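(* Any topologically free action of a unital inverse semigroup (by Hilbert bimodules) or of an étale groupoid with locally compact Hausdorff unit space (by a Fell bundle) on a $C^*$-algebra is aperiodic.
   Context: Ideals are closed and two-sided. A Hilbert $A$-bimodule is an $A$-bimodule $\mathcal E$ that is a right Hilbert $A$-module with inner product $\langle x\mid y\rangle$ and a left Hilbert $A$-module with inner product $\langle\!\langle x\mid y\rangle\!\rangle$ such that $\langle\!\langle x\mid y\rangle\!\rangle z=x\langle y\mid z\rangle$; its norm is $\|x\|=\|\langle x\mid x\rangle\|^{1/2}$; $s(\mathcal E)$, $r(\mathcal E)$ are the closed ideals of $A$ generated by the right and left inner products. Inverse semigroup actions. Let $S$ be an inverse semigroup with unit $1$ and natural partial order $\le$. An action of $S$ on $A$ by Hilbert bimodules consists of Hilbert $A$-bimodules $\mathcal E_t$ ($t\in S$) and Hilbert bimodule isomorphisms $\mu_{t,u}\colon\mathcal E_t\otimes_A\mathcal E_u\to\mathcal E_{tu}$ ($t,u\in S$) that are associative, with $\mathcal E_1=A$ and $\mu_{1,t},\mu_{t,1}$ the canonical maps $a\otimes x\mapsto ax$, $x\otimes a\mapsto xa$. Put $I_{1,t}=\overline{\sum_{v\le t,1}s(\mathcal E_v)}$ and $I_{1,t}^\perp=\{x\in A:x\cdot I_{1,t}=0\}$. The action is aperiodic if for each $t\in S$ the $A$-bimodule $X=\mathcal E_t\cdot I_{1,t}^\perp$ is aperiodic, that is, for every $x\in X$, every non-zero hereditary $C^*$-subalgebra $D\subseteq A$ and every $\varepsilon>0$ there is $a\in D$ with $a\ge0$,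 $\|a\|=1$, $\|axa\|<\varepsilon$. Dual groupoid. $\widehat A$ is the space of unitary equivalence classes of irreducible representations of $A$, with open subsets $\widehat J=\{[\varrho]:\varrho|_J\neq0\}$ for ideals $J$. A Hilbert $A$-bimodule $\mathcal E$ induces a homeomorphism $\widehat{\mathcal E}\colon\widehat{s(\mathcal E)}\to\widehat{r(\mathcal E)}$, $[\varrho]\mapsto[\mathcal E\otimes_\varrho\mathcal H]$. The dual groupoid $\widehat A\rtimes S$ is the étale transformation groupoid of the action of $S$ on $\widehat A$ by the partial homeomorphisms $\widehat{\mathcal E_t}$: its arrows are germs $[t,[\varrho]]$ with $t\in S$, $[\varrho]\in\widehat{s(\mathcal E_t)}$, where $[t,[\varrho]]=[u,[\varrho']]$ iff $[\varrho]=[\varrho']$ and there is $v\le t,u$ with $[\varrho]\in\widehat{s(\mathcal E_v)}$; source $[\varrho]$, range $\widehat{\mathcal E_t}[\varrho]$, product $[t,\widehat{\mathcal E_u}[\varrho]]\cdot[u,[\varrho]]=[tu,[\varrho]]$; the sets $\{[t,[\varrho]]:[\varrho]\in V\}$ for $t\in S$ and $V\subseteq\widehat{s(\mathcal E_t)}$ open form a basis of the topology; the unit space is $\widehat A$. An étale groupoid $G$ with unit space $X$ is topologically free if there is no non-empty open subset $U\subseteq G\setminus X$ with $r|_U=s|_U$. The inverse semigroup action is topologically free if its dual groupoid is topologically free. Groupoid actions. A topological groupoid is étale if its range and source maps $r,s$ are local homeomorphisms. A bisection is an open subset $U\subseteq G$ on which $r$ and $s$ are injective. A Fell bundle over $G$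 is an upper-semicontinuous bundle $\mathcal A=(A_\gamma)_{\gamma\in G}$ of Banach spaces with a continuous bilinear associative multiplication $A_\gamma\times A_\eta\to A_{\gamma\eta}$ for composable $(\gamma,\eta)$ and a continuous conjugate-linear involution $A_\gamma\to A_{\gamma^{-1}}$ with $(ab)^*=b^*a^*$, $\|ab\|\le\|a\|\|b\|$, $\|a^*a\|=\|a\|^2$ and $a^*a\ge0$ in the $C^*$-algebra $A_{s(\gamma)}$ for $a\in A_\gamma$ (not necessarily saturated). It is also called an action of $G$ on $A=C_0(X,\mathcal A|_X)$. For a bisection $U$, $C_0(U,\mathcal A|_U)$ is a Hilbert $A$-bimodule with the multiplication of $\mathcal A$ and $\langle x\mid y\rangle=x^*y$, $\langle\!\langle x\mid y\rangle\!\rangle=xy^*$. Let $S$ be the set of all Hilbert $A$-subbimodules of $C_0(U,\mathcal A|_U)$ for all bisections $U$ (viewed as spaces of sections of $\mathcal A$); it is a unital inverse semigroup with product the closed linear span of products, and $\mathcal E_t=t$ with the multiplication of $\mathcal A$ is an action of $S$ on $A$ by Hilbert bimodules. The groupoid action $\mathcal A$ is called aperiodic or topologically free if this corresponding inverse semigroup action is; its dual groupoid is $\widehat A\rtimes G\cong\widehat A\rtimes S$. *)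

(* Defs.v *)
From HB Require Import structures.
From mathcomp Require Import all_boot all_order all_algebra complex.
From mathcomp Require Import boolp classical_sets functions cardinality fsbigop.
From mathcomp Require Import reals topology normedtype.

Set Implicit Arguments.
Unset Strict Implicit.
Unset Printing Implicit Defensive.

Import Order.TTheory GRing.Theory Num.Theory numFieldNormedType.Exports.

Local Open Scope classical_set_scope.
Local Open Scope ring_scope.

Definition linear_subspace (K : pzRingType) (V : lmodType K) (M : set V) : Prop :=
  M 0 /\ forall (c : K) x y, M x -> M y -> M (c *: x + y).

(* Norms take their values in [R[i]], whose order only compares numbers with
   the same imaginary part; in particular [0 < e] forces [e] to be real. *)
Definition closed_wrt (R : realType) (V : lmodType R[i]) (N : V -> R[i])
    (M : set V) : Prop :=
  forall x, (forall e, 0 < e -> exists2 y, M y & N (x - y) < e) -> M x.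

Definition closed_span (R : realType) (V : lmodType R[i]) (N : V -> R[i])
    (X : set V) : set V :=
  smallest [set M | linear_subspace M /\ closed_wrt N M] X.

Record cstar_algebra (R : realType) := CStarAlgebra {
  cstar_sort :> completeNormedModType R[i];
  cmul : cstar_sort -> cstar_sort -> cstar_sort;
  cadj : cstar_sort -> cstar_sort;
  cmulA : forall a b c, cmul a (cmul b c) = cmul (cmul a b) c;
  cmulDl : forall a b c, cmul (a + b) c = cmul a c + cmul b c;
  cmulDr : forall a b c, cmul a (b + c) = cmul a b + cmul a c;
  cmulZl : forall z a b, cmul (z *: a) b = z *: cmul a b;
  cmulZr : forall z a b, cmul a (z *: b) = z *: cmul a b;
  cadjK : forall a, cadj (cadj a) = a;
  cadjD : forall a b, cadj (a + b) = cadj a + cadj b;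
  cadjZ : forall z a, cadj (z *: a) = z^* *: cadj a;
  cadjM : forall a b, cadj (cmul a b) = cmul (cadj b) (cadj a);
  cnormM : forall a b, `|cmul a b| <= `|a| * `|b|;
  cnorm_adj : forall a, `|cmul (cadj a) a| = `|a| ^+ 2 }.

Section CStar.
Variables (R : realType) (A : cstar_algebra R).

Definition cpositive (a : A) : Prop := exists b : A, a = cmul (cadj b) b.

Definition closed_ideal (J : set A) : Prop :=
  [/\ linear_subspace J, closed J
    & forall a x, J x -> J (cmul a x) /\ J (cmul x a)].

Definition ideal_gen (X : set A) : set A := smallest closed_ideal X.

Definition right_annihilator (J : set A) : set A :=
  [set x | forall y, J y -> cmul x y = 0].

Definition hereditary_subalgebra (D : set A) : Prop :=
  [/\ linear_subspace D, closed D,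
      forall a b, D a -> D b -> D (cmul a b),
      forall a, D a -> D (cadj a)
    & forall a d, cpositive a -> D d -> cpositive (d - a) -> D a].

End CStar.

Record hilbert_space (R : realType) := HilbertSpace {
  hilbert_sort :> completeNormedModType R[i];
  hip : hilbert_sort -> hilbert_sort -> R[i];
  hip_linear : forall c h k l, hip h (c *: k + l) = c * hip h k + hip h l;
  hip_conj : forall h k, hip k h = (hip h k)^*;
  hip_norm : forall h, hip h h = `|h| ^+ 2 }.

Record irrep (R : realType) (A : cstar_algebra R) := Irrep {
  irrep_space :> hilbert_space R;
  irrep_op : A -> irrep_space -> irrep_space;
  irrep_cont : forall a, continuous (irrep_op a);
  irrep_op_linear : forall a c h k,
    irrep_op a (c *: h + k) = c *: irrep_op a h + irrep_op a k;
  irrep_linear : forall c a b h,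
    irrep_op (c *: a + b) h = c *: irrep_op a h + irrep_op b h;
  irrep_mul : forall a b h, irrep_op (cmul a b) h = irrep_op a (irrep_op b h);
  irrep_adj : forall a h k, hip (irrep_op a h) k = hip h (irrep_op (cadj a) k);
  irrep_neq0 : exists a h, irrep_op a h != 0;
  irrep_irr : forall M : set irrep_space, linear_subspace M -> closed M ->
    (forall a h, M h -> M (irrep_op a h)) -> M = [set 0] \/ M = setT }.

Section Spectrum.
Variables (R : realType) (A : cstar_algebra R).

Definition unitarily_equivalent (rho sigma : irrep A) : Prop :=
  exists U : rho -> sigma,
    [/\ forall c h k, U (c *: h + k) = c *: U h + U k,
        forall h k, hip (U h) (U k) = hip h k,
        forall k, exists h, U h = k
      & forall a h, U (irrep_op a h) = irrep_op a (U h)].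

(* The hierarchy of normed modules sits above the universe of [set], so the
   points of the spectrum (equivalence classes of representations) and its
   subsets are given by predicates rather than by terms of type [set _]. *)
Record spectrum := Spectrum {
  spectrum_class : irrep A -> Prop;
  spectrum_classP : exists rho, spectrum_class = unitarily_equivalent rho }.

Definition spectrum_ideal (J : set A) (p : spectrum) : Prop :=
  exists2 rho, spectrum_class p rho
    & exists a (h : rho), J a /\ irrep_op a h != 0.

Definition spectrum_open (V : spectrum -> Prop) : Prop :=
  exists2 J, closed_ideal J & V = spectrum_ideal J.

End Spectrum.

(* Only the operations: the laws are in [hilbert_bimodule] below. [rip] and
   [lip] are the right and the left A-valued inner products. *)
Record bimodule_data (R : realType) (A : cstar_algebra R) := BimoduleData {
  bimodule_sort :> lmodType R[i];
  lact : A -> bimodule_sort -> bimodule_sort;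
  ract : bimodule_sort -> A -> bimodule_sort;
  rip : bimodule_sort -> bimodule_sort -> A;
  lip : bimodule_sort -> bimodule_sort -> A }.

Definition complete_wrt (R : realType) (V : lmodType R[i]) (N : V -> R[i]) :
    Prop :=
  forall u : nat -> V,
    (forall e, 0 < e -> exists n, forall i j,
      (n <= i)%N -> (n <= j)%N -> N (u i - u j) < e) ->
    exists x, forall e, 0 < e -> exists n, forall i,
      (n <= i)%N -> N (u i - x) < e.

Section Bimodule.
Variables (R : realType) (A : cstar_algebra R) (E : bimodule_data A).

Definition rnorm (x : E) : R[i] := sqrtC `|rip x x|.
Definition lnorm (x : E) : R[i] := sqrtC `|lip x x|.

Record right_hilbert_module : Prop := RightHilbertModule {
  ractDl : forall c (x y : E) a, ract (c *: x + y) a = c *: ract x a + ract y a;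
  ractDr : forall c (x : E) a b, ract x (c *: a + b) = c *: ract x a + ract x b;
  ractA : forall (x : E) a b, ract x (cmul a b) = ract (ract x a) b;
  rip_linear : forall c (x y z : E), rip x (c *: y + z) = c *: rip x y + rip x z;
  rip_ract : forall (x y : E) a, rip x (ract y a) = cmul (rip x y) a;
  rip_adj : forall x y : E, cadj (rip x y) = rip y x;
  rip_ge0 : forall x : E, cpositive (rip x x);
  rip_eq0 : forall x : E, rip x x = 0 -> x = 0;
  rnorm_complete : complete_wrt rnorm }.

Record left_hilbert_module : Prop := LeftHilbertModule {
  lactDr : forall c a (x y : E), lact a (c *: x + y) = c *: lact a x + lact a y;
  lactDl : forall c a b (x : E), lact (c *: a + b) x = c *: lact a x + lact b x;
  lactA : forall a b (x : E), lact (cmul a b) x = lact a (lact b x);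
  lip_linear : forall c (x y z : E), lip (c *: x + y) z = c *: lip x z + lip y z;
  lip_lact : forall a (x y : E), lip (lact a x) y = cmul a (lip x y);
  lip_adj : forall x y : E, cadj (lip x y) = lip y x;
  lip_ge0 : forall x : E, cpositive (lip x x);
  lip_eq0 : forall x : E, lip x x = 0 -> x = 0;
  lnorm_complete : complete_wrt lnorm }.

Definition hilbert_bimodule : Prop :=
  [/\ right_hilbert_module, left_hilbert_module,
      forall a (x : E) b, ract (lact a x) b = lact a (ract x b)
    & forall x y z : E, lact (lip x y) z = ract x (rip y z)].

Definition source_ideal : set A := ideal_gen [set a | exists x y : E, a = rip x y].

(* The closed linear span of the products [x a] with [a] in [J]. *)
Definition bimodule_mul_ideal (J : set A) : set E :=
  closed_span rnorm [set z | exists (x : E) a, J a /\ z = ract x a].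

Definition aperiodic_subbimodule (X : set E) : Prop :=
  forall x, X x ->
  forall D : set A, hereditary_subalgebra D -> D != [set 0] ->
  forall e : R[i], 0 < e ->
  exists a : A, [/\ D a, cpositive a, `|a| = 1 & rnorm (lact a (ract x a)) < e].

(* [sigma] is unitarily equivalent to the induced representation on the
   completed tensor product of [E] and [rho], where [T x h] is the image of the
   elementary tensor of [x] and [h]. *)
Definition is_induced (rho sigma : irrep A) : Prop :=
  exists T : E -> rho -> sigma,
    [/\ forall c x y h, T (c *: x + y) h = c *: T x h + T y h,
        forall c x h k, T x (c *: h + k) = c *: T x h + T x k,
        forall x h y k, hip (T x h) (T y k) = hip h (irrep_op (rip x y) k),
        closed_span Num.norm [set k | exists x h, k = T x h] = setT
      & forall a x h, irrep_op a (T x h) = T (lact a x) h].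

(* The graph of the partial homeomorphism of the spectrum given by [E]. *)
Definition dual_map (p q : spectrum A) : Prop :=
  spectrum_ideal source_ideal p /\
  exists rho sigma,
    [/\ spectrum_class p rho, spectrum_class q sigma & is_induced rho sigma].

End Bimodule.

(* Again only the operations; see [unital_inverse_semigroup]. *)
Record semigroup_data := SemigroupData {
  semigroup_sort :> Type;
  smul : semigroup_sort -> semigroup_sort -> semigroup_sort;
  sone : semigroup_sort }.
Arguments sone {_}.

Definition unital_inverse_semigroup (S : semigroup_data) : Prop :=
  [/\ forall t u v : S, smul t (smul u v) = smul (smul t u) v,
      forall t : S, smul sone t = t, forall t : S, smul t sone = t
    & forall t : S, exists! u, smul (smul t u) t = t /\ smul (smul u t) u = u].

Definition natural_le (S : semigroup_data) (t u : S) : Prop :=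
  exists e, smul e e = e /\ t = smul u e.

(* The data of an action; the laws are in [bimodule_action]. They are kept
   apart because the data determine aperiodicity and topological freeness. *)
Record action_data (R : realType) (A : cstar_algebra R) := ActionData {
  action_semigroup : semigroup_data;
  fibre :> action_semigroup -> bimodule_data A;
  mu : forall t u, fibre t -> fibre u -> fibre (smul t u);
  unit_fibre : A -> fibre sone }.

Section Action.
Variables (R : realType) (A : cstar_algebra R) (E : action_data A).
Local Notation S := (action_semigroup E).

(* [mu] induces an isomorphism of Hilbert bimodules from the completed tensor
   product of [E t] and [E u] over [A] onto [E (smul t u)]. *)
Record tensor_iso (t u : S) : Prop := TensorIso {
  mu_linear_l : forall c (x x' : E t) (y : E u),
    mu (c *: x + x') y = c *: mu x y + mu x' y;
  mu_linear_r : forall c (x : E t) (y y' : E u),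
    mu x (c *: y + y') = c *: mu x y + mu x y';
  mu_balanced : forall (x : E t) a (y : E u), mu (ract x a) y = mu x (lact a y);
  mu_lact : forall a (x : E t) (y : E u), mu (lact a x) y = lact a (mu x y);
  mu_ract : forall a (x : E t) (y : E u), mu x (ract y a) = ract (mu x y) a;
  mu_rip : forall (x x' : E t) (y y' : E u),
    rip (mu x y) (mu x' y') = rip y (lact (rip x x') y');
  mu_lip : forall (x x' : E t) (y y' : E u),
    lip (mu x y) (mu x' y') = lip (ract x (lip y y')) x';
  mu_dense : closed_span (@rnorm _ _ (E (smul t u)))
    [set z | exists (x : E t) (y : E u), z = mu x y] = setT }.

(* [unit_fibre] identifies [A], as a Hilbert bimodule over itself, with
   [E sone]. *)
Record unit_iso : Prop := UnitIso {
  unit_linear : forall c a b,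
    unit_fibre E (c *: a + b) = c *: unit_fibre E a + unit_fibre E b;
  unit_bij : bijective (unit_fibre E);
  unit_lact : forall a b, unit_fibre E (cmul a b) = lact a (unit_fibre E b);
  unit_ract : forall a b, unit_fibre E (cmul a b) = ract (unit_fibre E a) b;
  unit_rip : forall a b, rip (unit_fibre E a) (unit_fibre E b) = cmul (cadj a) b;
  unit_lip : forall a b, lip (unit_fibre E a) (unit_fibre E b) = cmul a (cadj b) }.

(* Equations between elements of [E t] and [E u] with [t] and [u] provably equal
   are stated in the disjoint union of all fibres. *)
Local Notation elt x := (existT (fun t : S => bimodule_sort (E t)) _ x).

Record bimodule_action : Prop := BimoduleAction {
  action_invsemigroup : unital_inverse_semigroup S;
  action_bimodule : forall t : S, hilbert_bimodule (E t);
  action_mu : forall t u : S, tensor_iso t u;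
  action_unit : unit_iso;
  mu_assoc : forall (t u v : S) (x : E t) (y : E u) (z : E v),
    elt (mu x (mu y z)) = elt (mu (mu x y) z);
  mu_unit_l : forall (t : S) a (x : E t), elt (mu (unit_fibre E a) x) = elt (lact a x);
  mu_unit_r : forall (t : S) (x : E t) a, elt (mu x (unit_fibre E a)) = elt (ract x a) }.

Definition unit_overlap_ideal (t : S) : set A :=
  closed_span Num.norm
    (\bigcup_(v in [set v | natural_le v t /\ natural_le v sone])
      source_ideal (E v)).

Definition aperiodic : Prop :=
  forall t : S, aperiodic_subbimodule
    (bimodule_mul_ideal (right_annihilator (unit_overlap_ideal t)) : set (E t)).

Definition germ_domain (t : S) : spectrum A -> Prop :=
  spectrum_ideal (source_ideal (E t)).

Definition germ_equiv (p : spectrum A) (t u : S) : Prop :=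
  [/\ germ_domain t p, germ_domain u p
    & exists v, [/\ natural_le v t, natural_le v u & germ_domain v p]].

(* The arrow [t,p] is represented by its source [p] and the set of all [u] with
   [u,p] = [t,p]. *)
Record dual_arrow := DualArrow {
  arrow_source : spectrum A;
  arrow_germ : S -> Prop;
  arrow_germP : exists2 t, germ_domain t arrow_source
    & arrow_germ = germ_equiv arrow_source t }.

(* The graph of the range map: [E t] induces [q] up to unitary equivalence, for
   one or equivalently any [t] in the germ. *)
Definition arrow_range (g : dual_arrow) (q : spectrum A) : Prop :=
  exists2 t, arrow_germ g t & dual_map (E t) (arrow_source g) q.

Definition arrow_unit (g : dual_arrow) : Prop := arrow_germ g sone.

Definition basic_open (t : S) (V : spectrum A -> Prop) (g : dual_arrow) : Prop :=
  arrow_germ g t /\ V (arrow_source g).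

Definition dual_groupoid_open (W : dual_arrow -> Prop) : Prop :=
  forall g, W g -> exists t V,
    [/\ spectrum_open V, forall p, V p -> germ_domain t p, basic_open t V g
      & forall g', basic_open t V g' -> W g'].

Definition topologically_free : Prop :=
  ~ exists W : dual_arrow -> Prop,
    [/\ exists g, W g, dual_groupoid_open W, forall g, W g -> ~ arrow_unit g
      & forall g, W g -> arrow_range g (arrow_source g)].

End Action.

(* [f] is a local homeomorphism onto open subsets of the subspace [X]. *)
Definition local_homeo (T : topologicalType) (X : set T) (f : T -> T) : Prop :=
  continuous f /\ forall g, exists U, [/\ open U, U g,
      forall h k, U h -> U k -> f h = f k -> h = k
    & forall V, open V -> V `<=` U -> exists2 O, open O & f @` V = X `&` O].

(* The unit space is identified with the subset [units] of the arrows, which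
   carries the subspace topology. Products of non-composable pairs are not
   constrained. *)
Record etale_groupoid := EtaleGroupoid {
  groupoid_sort :> topologicalType;
  gsrc : groupoid_sort -> groupoid_sort;
  grng : groupoid_sort -> groupoid_sort;
  ginv : groupoid_sort -> groupoid_sort;
  gmul : groupoid_sort -> groupoid_sort -> groupoid_sort;
  units : set groupoid_sort := [set x | gsrc x = x];
  composable : set (groupoid_sort * groupoid_sort) :=
    [set p | gsrc p.1 = grng p.2];
  gsrc_src : forall g, gsrc (gsrc g) = gsrc g;
  grng_src : forall g, grng (gsrc g) = gsrc g;
  gsrc_rng : forall g, gsrc (grng g) = grng g;
  grng_rng : forall g, grng (grng g) = grng g;
  gsrc_mul : forall g h, gsrc g = grng h -> gsrc (gmul g h) = gsrc h;
  grng_mul : forall g h, gsrc g = grng h -> grng (gmul g h) = grng g;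
  gmulA : forall g h k, gsrc g = grng h -> gsrc h = grng k ->
    gmul g (gmul h k) = gmul (gmul g h) k;
  gmul1g : forall g, gmul (grng g) g = g;
  gmulg1 : forall g, gmul g (gsrc g) = g;
  gsrc_inv : forall g, gsrc (ginv g) = grng g;
  grng_inv : forall g, grng (ginv g) = gsrc g;
  gmulgV : forall g, gmul g (ginv g) = grng g;
  gmulVg : forall g, gmul (ginv g) g = gsrc g;
  gmul_continuous : {within composable, continuous (fun p => gmul p.1 p.2)};
  ginv_continuous : continuous ginv;
  gsrc_homeo : local_homeo units gsrc;
  grng_homeo : local_homeo units grng;
  units_hausdorff : hausdorff_space (units : Type);
  units_locally_compact : locally_compact [set: (units : Type)] }.

Arguments gsrc {_} _.
Arguments grng {_} _.
Arguments ginv {_} _.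
Arguments units {_}.
Arguments composable {_}.

Definition bisection (G : etale_groupoid) (U : set G) : Prop :=
  [/\ open U, forall g h, U g -> U h -> gsrc g = gsrc h -> g = h
    & forall g h, U g -> U h -> grng g = grng h -> g = h].

(* An upper semicontinuous bundle of Banach spaces with multiplication and
   involution. The total space [ftot] is the disjoint union of the fibres, included
   by [felt]. Equations between elements of fibres over provably equal arrows are
   stated in [ftot]; continuity on the fibre products is spelled out with
   neighbourhoods. [fzero_nbhs] says that [felt v] tends to the zero of the fibre
   over [g] if the norm of [v] tends to 0 and its base point tends to [g]. *)
Record fell_bundle (R : realType) (G : etale_groupoid) := FellBundle {
  ffib : G -> completeNormedModType R[i];
  ftot : topologicalType;
  felt : forall g, ffib g -> ftot;
  fprj : ftot -> G;
  fmul : forall g h, ffib g -> ffib h -> ffib (gmul g h);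
  fadj : forall g, ffib g -> ffib (ginv g);
  fprj_elt : forall g (v : ffib g), fprj (felt v) = g;
  felt_inj : forall g, injective (@felt g);
  felt_surj : forall e, exists v : ffib (fprj e), felt v = e;
  fprj_continuous : continuous fprj;
  fprj_open : forall W : set ftot, open W -> open (fprj @` W);
  fnorm_usc : forall r, open [set e | exists g (v : ffib g), e = felt v /\ `|v| < r];
  fadd_continuous : forall g (v w : ffib g) W, nbhs (felt (v + w)) W ->
    exists V1 V2, [/\ nbhs (felt v) V1, nbhs (felt w) V2
      & forall h (v' w' : ffib h), V1 (felt v') -> V2 (felt w') ->
          W (felt (v' + w'))];
  fscale_continuous : forall (c : R[i]) g (v : ffib g) W,
    nbhs (felt (c *: v)) W -> exists2 V, nbhs (felt v) V
      & forall h (v' : ffib h), V (felt v') -> W (felt (c *: v'));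
  fzero_nbhs : forall g W, nbhs (felt (0 : ffib g)) W ->
    exists V e, [/\ nbhs g V, 0 < e
      & forall h (v : ffib h), V h -> `|v| < e -> W (felt v)];
  fmul_linear_l : forall g h c (v v' : ffib g) (w : ffib h), gsrc g = grng h ->
    fmul (c *: v + v') w = c *: fmul v w + fmul v' w;
  fmul_linear_r : forall g h c (v : ffib g) (w w' : ffib h), gsrc g = grng h ->
    fmul v (c *: w + w') = c *: fmul v w + fmul v w';
  fmulA : forall g h k (u : ffib g) (v : ffib h) (w : ffib k),
    gsrc g = grng h -> gsrc h = grng k ->
    felt (fmul u (fmul v w)) = felt (fmul (fmul u v) w);
  fmul_continuous : forall g h (v : ffib g) (w : ffib h) W, gsrc g = grng h ->
    nbhs (felt (fmul v w)) W ->
    exists V1 V2, [/\ nbhs (felt v) V1, nbhs (felt w) V2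
      & forall g' h' (v' : ffib g') (w' : ffib h'), gsrc g' = grng h' ->
          V1 (felt v') -> V2 (felt w') -> W (felt (fmul v' w'))];
  fadj_linear : forall g c (v w : ffib g),
    fadj (c *: v + w) = c^* *: fadj v + fadj w;
  fadj_continuous : forall g (v : ffib g) W, nbhs (felt (fadj v)) W ->
    exists2 V, nbhs (felt v) V
      & forall h (v' : ffib h), V (felt v') -> W (felt (fadj v'));
  fadjK : forall g (v : ffib g), felt (fadj (fadj v)) = felt v;
  fadjM : forall g h (v : ffib g) (w : ffib h), gsrc g = grng h ->
    felt (fadj (fmul v w)) = felt (fmul (fadj w) (fadj v));
  fnormM : forall g h (v : ffib g) (w : ffib h), gsrc g = grng h ->
    `|fmul v w| <= `|v| * `|w|;
  fnorm_adj : forall g (v : ffib g), `|fmul (fadj v) v| = `|v| ^+ 2;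
  fpositive : forall g (v : ffib g), exists w : ffib (gsrc g),
    felt (fmul (fadj v) v) = felt (fmul (fadj w) w) }.

Section GroupoidFacts.
Variable G : etale_groupoid.

Lemma units_src (g : G) : units (gsrc g). Proof. exact: gsrc_src. Qed.
Lemma units_rng (g : G) : units (grng g). Proof. exact: gsrc_rng. Qed.
Lemma rng_unit (x : G) : units x -> grng x = x.
Proof. by move=> xu; rewrite -{1}xu grng_src. Qed.

Lemma gmul_unit (x : G) : units x -> gmul x x = x.
Proof. by move=> xu; rewrite -{2}xu gmulg1. Qed.

Lemma gmulKg (g h : G) : grng g = grng h -> gmul g (gmul (ginv g) h) = h.
Proof.
move=> gh; have e : gsrc (ginv g) = grng h by rewrite gsrc_inv.
by rewrite gmulA ?grng_inv// gmulgV gh gmul1g.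
Qed.

Lemma gmulVKg (g h : G) : gsrc g = grng h -> gmul (ginv g) (gmul g h) = h.
Proof.
move=> gh; rewrite gmulA ?gsrc_inv//.
by rewrite gmulVg gh gmul1g.
Qed.

Lemma rng_mulV (g h : G) : grng g = grng h -> grng (gmul (ginv g) h) = gsrc g.
Proof. by move=> gh; rewrite grng_mul ?gsrc_inv ?grng_inv. Qed.

Lemma gmulgK (g h : G) : gsrc g = grng h -> gmul (gmul g h) (ginv h) = g.
Proof.
by move=> gh; rewrite -gmulA ?grng_inv// gmulgV -gh gmulg1.
Qed.

Lemma ginvK (g : G) : ginv (ginv g) = g.
Proof.
have := gmulVKg (g := ginv g) (h := g); rewrite gsrc_inv => /(_ erefl).
by rewrite gmulVg -grng_inv -gsrc_inv gmulg1.
Qed.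

Lemma ginv_unit (x : G) : units x -> ginv x = x.
Proof.
move=> xu; have := gmulVg x; rewrite xu => e.
have <- : gmul (ginv x) (gsrc (ginv x)) = ginv x by rewrite gmulg1.
by rewrite gsrc_inv rng_unit.
Qed.

Lemma gmulVK (g h : G) : gsrc g = gsrc h -> gmul (gmul g (ginv h)) h = g.
Proof.
by move=> gh; rewrite -gmulA ?grng_inv ?gsrc_inv// gmulVg -gh gmulg1.
Qed.

Lemma ginvM (g h : G) : gsrc g = grng h -> ginv (gmul g h) = gmul (ginv h) (ginv g).
Proof.
move=> gh; have e : gsrc (ginv h) = grng (ginv g) by rewrite gsrc_inv grng_inv.
have e1 : gsrc (gmul g h) = grng (ginv h) by rewrite gsrc_mul// grng_inv.
have := gmulVKg (g := gmul g h) (h := gmul (ginv h) (ginv g)).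
rewrite grng_mul// => /(_ e1) <-.
by rewrite [gmul (gmul g h) _]gmulA// gmulgK// gmulgV -(grng_mul gh) -gsrc_inv gmulg1.
Qed.

Lemma units_open : open (units : set G).
Proof.
rewrite openE => x xu; have [sc /(_ x)[U [Uo Ux Ui _]]] := gsrc_homeo G.
have : nbhs x (U `&` gsrc @^-1` U).
  apply: filterI; first exact: open_nbhs_nbhs.
  by apply: sc; rewrite xu; exact: open_nbhs_nbhs.
apply: filterS => g [Ug Usg].
by apply: Ui; rewrite ?gsrc_src.
Qed.

Lemma gmul_nbhs (g h : G) (W : set G) : gsrc g = grng h -> nbhs (gmul g h) W ->
  exists V1 V2, [/\ nbhs g V1, nbhs h V2
    & forall g' h', V1 g' -> V2 h' -> gsrc g' = grng h' -> W (gmul g' h')].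
Proof.
move=> gh nW; have /subspace_continuousP /(_ (g, h) gh W nW) := @gmul_continuous G.
move=> [[V1 V2] /= [nV1 nV2] sub]; exists V1, V2; split=> // g' h' v1 v2 c.
by have := sub (g', h') (conj v1 v2); apply.
Qed.

Lemma local_homeo_lift (f : G -> G) (U W : set G) (a : G) :
  local_homeo (units : set G) f -> (forall g, units (f g)) -> open U -> U a -> nbhs a W ->
  \forall x \near f a, units x -> exists b, [/\ U b, W b & f b = x].
Proof.
move=> [fc /(_ a)[U0 [U0o U0a U0i im]]] fu Uo Ua nW.
have [||O Oo e] := im (U0 `&` (U `&` W^°)).
- by do !apply: openI => //; exact: open_interior.
- by move=> ? [].
have : (f @` (U0 `&` (U `&` W^°))) (f a) by exists a.
rewrite e => -[_ Oa]; near=> x => xu.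
have : (units `&` O) x by split=> //; near: x; exact: open_nbhs_nbhs.
rewrite -e => -[b [_ [Ub Wb]] <-]; exists b; split=> //.
exact: interior_subset.
Unshelve. all: by end_near. Qed.

Lemma rng_lift (U W : set G) (a g : G) :
  open U -> U a -> nbhs a W -> grng a = grng g ->
  \forall g' \near g, exists b, [/\ U b, W b & grng b = grng g'].
Proof.
move=> Uo Ua nW ag.
have /(_ U W a) := local_homeo_lift (grng_homeo G) units_rng.
move=> /(_ Uo Ua nW); rewrite ag => nx.
have [rc _] := grng_homeo G.
have nx' : nbhs g (grng @^-1` _) := rc g _ nx.
by apply: filterS nx' => g' /=; apply; exact: units_rng.
Qed.

Definition set_gmul (U V : set G) : set G :=
  [set g | exists a b, [/\ U a, V b, gsrc a = grng b & g = gmul a b]].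

Lemma mulV_near (U W W' : set G) (a g : G) : open U -> U a -> nbhs a W' ->
  grng a = grng g -> nbhs (gmul (ginv a) g) W ->
  \forall g' \near g, exists b,
    [/\ U b, W' b, grng b = grng g' & W (gmul (ginv b) g')].
Proof.
move=> Uo Ua nW' ag nW.
have [|V1 [V2 [nV1 nV2 sub]]] := gmul_nbhs (g := ginv a) (h := g) _ nW.
  by rewrite gsrc_inv.
have nV1' : nbhs a (W' `&` ginv @^-1` V1).
  by apply: filterI => //; exact: ginv_continuous.
apply: filterS2 nV2 (rng_lift Uo Ua nV1' ag) => g' V2g [b [Ub [W'b V1b] bg]].
by exists b; split=> //; apply: sub => //; rewrite gsrc_inv.
Qed.

Lemma bisection_mul (U V : set G) :
  bisection U -> bisection V -> bisection (set_gmul U V).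
Proof.
move=> [Uo Us Ur] [Vo Vs Vr]; split.
- rewrite openE => _ [a [b [Ua Vb ab ->]]].
  have nV : nbhs (gmul (ginv a) (gmul a b)) V.
    by rewrite gmulVKg//; exact: open_nbhs_nbhs.
  have ag : grng a = grng (gmul a b) by rewrite grng_mul.
  have nT : nbhs a setT by exact: filterT.
  apply: filterS (mulV_near Uo Ua nT ag nV) => g' [c [Uc _ cg Vc]].
  exists c, (gmul (ginv c) g'); split=> //; first by rewrite rng_mulV.
  by rewrite gmulKg.
- move=> _ _ [a [b [Ua Vb ab ->]]] [c [d [Uc Vd cd ->]]].
  rewrite !gsrc_mul// => bd.
  have ? : b = d by apply: Vs.
  subst d; have -> // : a = c by apply: Us; rewrite ?ab.
- move=> _ _ [a [b [Ua Vb ab ->]]] [c [d [Uc Vd cd ->]]].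
  rewrite !grng_mul// => ac.
  have ? : a = c by apply: Ur.
  subst c; have -> // : b = d by apply: Vr; rewrite -?ab.
Qed.

Lemma bisection_inv (U : set G) : bisection U -> bisection (ginv @^-1` U).
Proof.
move=> [Uo Us Ur]; split.
- by apply: open_comp Uo => g _; exact: ginv_continuous.
- move=> g h  Ug  Uh; rewrite -!grng_inv => e.
  by rewrite -[g]ginvK -[h]ginvK; congr ginv; apply: Ur.
- move=> g h  Ug  Uh; rewrite -!gsrc_inv => e.
  by rewrite -[g]ginvK -[h]ginvK; congr ginv; apply: Us.
Qed.

Lemma bisection_units : bisection (units : set G).
Proof.
split; first exact: units_open.
- by move=> x y  xu  yu; rewrite xu yu.
- by move=> x y  xu  yu; rewrite !rng_unit.
Qed.

Lemma set_gmul1g (U : set G) : set_gmul units U `<=` U.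
Proof.
move=> _ [a [b [au Ub ab ->]]].
by rewrite -(_ : grng b = a) ?gmul1g// -ab.
Qed.

Lemma set_gmulg1 (U : set G) : set_gmul U units `<=` U.
Proof.
move=> _ [a [b [Ua bu ab ->]]].
by rewrite -(_ : gsrc a = b) ?gmulg1// ab rng_unit.
Qed.

Lemma set_gmulVg (U : set G) : bisection U ->
  set_gmul (ginv @^-1` U) U `<=` units.
Proof.
move=> [_ _ Ur] _ [a [b [Ua Ub ab ->]]].
have <- : ginv a = b.
  by apply: Ur; rewrite ?grng_inv.
by rewrite gmulgV; exact: units_rng.
Qed.

Lemma set_gmulgV (U : set G) : bisection U ->
  set_gmul U (ginv @^-1` U) `<=` units.
Proof.
move=> [_ Us _] _ [a [b [Ua Ub ab ->]]].
have -> : a = ginv b.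
  by apply: Us; rewrite ?gsrc_inv.
by rewrite gmulVg; exact: units_src.
Qed.

Lemma units_sep (x y : G) : units x -> units y -> x <> y ->
  exists P Q, [/\ nbhs x P, nbhs y Q & forall z, units z -> P z -> Q z -> False].
Proof.
move=> xu yu xy.
pose x' : ((units : set G) : Type) := exist _ x (mem_set xu).
pose y' : ((units : set G) : Type) := exist _ y (mem_set yu).
have x'y' : x' != y' by apply/eqP => /(congr1 val).
have := @units_hausdorff G; rewrite open_hausdorff => /(_ x' y' x'y').
move=> [[P Q] /= [/set_mem Px /set_mem Qy]].
move=> [[O Oo OP] [O' O'o O'Q] /eqP/seteqP[sub _]].
exists O, O'; split.
- by apply: open_nbhs_nbhs; split=> //; move: Px; rewrite -OP.
- by apply: open_nbhs_nbhs; split=> //; move: Qy; rewrite -O'Q.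
- move=> z zu Oz O'z; apply: (sub (exist _ z (mem_set zu))).
  by split; [rewrite -OP|rewrite -O'Q].
Qed.

Lemma composable_closed : closed (composable : set (G * G)).
Proof.
rewrite -openC openE => -[a b] /= ab.
have [P [Q [nP nQ PQ]]] := units_sep (units_src a) (units_rng b) ab.
have [sc _] := gsrc_homeo G; have [rc _] := grng_homeo G.
have : nbhs (a, b) ((gsrc @^-1` P) `*` (grng @^-1` Q)).
  by exists (gsrc @^-1` P, grng @^-1` Q) => //; split; [exact: sc|exact: rc].
apply: filterS => -[a' b'] /= [Pa Qb] e; apply: (PQ _ (units_src a')) => //.
by rewrite /composable/= in e; rewrite e.
Qed.

Lemma compact_gmul (K L : set G) :
  compact K -> compact L -> compact (set_gmul K L).
Proof.
move=> cK cL.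
have cKL := compact_closedI (compact_setX cK cL) composable_closed.
have : compact [set gmul p.1 p.2 | p in (K `*` L) `&` composable].
  apply: continuous_compact cKL.
  apply: continuous_subspaceW (@gmul_continuous G); exact: subIsetr.
congr compact; apply/seteqP; split.
- by move=> _ [[a b] /= [[Ka Lb] ab] <-]; exists a, b.
- by move=> _ [a [b [Ka Lb ab ->]]]; exists (a, b).
Qed.

Lemma compact_ginv (K : set G) : compact K -> compact (ginv @^-1` K).
Proof.
move=> cK; have : compact (ginv @` K).
  apply: continuous_compact cK; apply: continuous_subspaceT.
  exact: ginv_continuous.
congr compact; apply/seteqP; split; first by move=> _ [a Ka <-] /=; rewrite ginvK.
by move=> a Ka; exists (ginv a); rewrite ?ginvK.
Qed.

Lemma compact_far (U K : set G) (x : G) : bisection U -> compact K -> K `<=` U ->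
  U x -> ~ K x -> \forall y \near x, ~ K y.
Proof.
move=> [Uo Us Ur] cK KU Ux nKx.
have /compact_near_coveringP cov := cK.
have [sc _] := gsrc_homeo G.
have : \forall y \near x, K `<=` (fun k => k <> y).
  apply: cov => k Kk.
  have kx : gsrc k <> gsrc x by move=> /Us kx; apply: nKx; rewrite -kx//; exact: KU.
  have [P [Q [nP nQ PQ]]] := units_sep (units_src k) (units_src x) kx.
  exists (gsrc @^-1` P, gsrc @^-1` Q); first by split; exact: sc.
  move=> [k' y'] /= [Pk Qy] e; apply: (PQ _ (units_src k')) => //.
  by rewrite e.
by apply: filterS => y sub Ky; exact: (sub y).
Qed.

End GroupoidFacts.

Definition fsec (R : realType) (G : etale_groupoid) (B : fell_bundle R G) : Type :=
  forall g : G, ffib B g.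

Section SectionModule.
Variables (R : realType) (G : etale_groupoid) (B : fell_bundle R G).
Implicit Types f g h : fsec B.

Lemma fsecP f g : (forall x, f x = g x) -> f = g.
Proof. exact: functional_extensionality_dep. Qed.

HB.instance Definition _ := gen_eqMixin (fsec B).
HB.instance Definition _ := gen_choiceMixin (fsec B).

Let zero : fsec B := fun x => 0.
Let opp f : fsec B := fun x => - f x.
Let add f g : fsec B := fun x => f x + g x.
Let addA : associative add.
Proof. by move=> f g h; apply: fsecP => x; rewrite /add addrA. Qed.
Let addC : commutative add.
Proof. by move=> f g; apply: fsecP => x; rewrite /add addrC. Qed.
Let add0 : left_id zero add.
Proof. by move=> f; apply: fsecP => x; rewrite /add add0r. Qed.
Let addN : left_inverse zero opp add.
Proof. by move=> f; apply: fsecP => x; rewrite /add addNr. Qed.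
HB.instance Definition _ := GRing.isZmodule.Build (fsec B) addA addC add0 addN.

Let scale (c : R[i]) f : fsec B := fun x => c *: f x.
Let scaleA a b f : scale a (scale b f) = scale (a * b) f.
Proof. by apply: fsecP => x; rewrite /scale scalerA. Qed.
Let scale1 : left_id 1 scale.
Proof. by move=> f; apply: fsecP => x; rewrite /scale scale1r. Qed.
Let scaleDr : right_distributive scale +%R.
Proof. by move=> a f g; apply: fsecP => x; rewrite /scale scalerDr. Qed.
Let scaleDl f : {morph scale^~ f : a b / a + b}.
Proof. by move=> a b; apply: fsecP => x; rewrite /scale scalerDl. Qed.
HB.instance Definition _ :=
  GRing.Zmodule_isLmodule.Build R[i] (fsec B) scaleA scale1 scaleDr scaleDl.

Lemma fsecDE f g x : (f + g) x = f x + g x. Proof. by []. Qed.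
Lemma fsecNE f x : (- f) x = - f x. Proof. by []. Qed.
Lemma fsecZE c f x : (c *: f) x = c *: f x. Proof. by []. Qed.
Lemma fsec0E x : (0 : fsec B) x = 0. Proof. by []. Qed.
End SectionModule.

Section Sections.
Variables (R : realType) (G : etale_groupoid) (B : fell_bundle R G).
Implicit Types f g h : fsec B.

Definition supported (U : set G) f : Prop := forall x, ~ U x -> f x = 0.

(* Elements of C_0(U, B|_U), extended by zero to all of [G]. As [U] is open in
   all uses, continuity on [U] is continuity at the points of [U]. *)
Definition C0 (U : set G) : set (fsec B) := [set f | [/\ supported U f,
  forall x, U x -> (fun y => felt (f y)) @ x --> felt (f x)
  & forall e : R[i], 0 < e -> exists K,
      [/\ compact K, K `<=` U & forall x, ~ K x -> `|f x| < e]]].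

Definition transport (x y : G) (v : ffib B x) : ffib B y :=
  if pselect (x = y) is left e then ecast z (ffib B z) e v else 0.
Arguments transport {x} y v.

(* The convolution product: the sum over all factorisations x = a (a^-1 x). For
   sections supported in bisections at most one summand is non-zero, see
   [conv_comp], and this is the pointwise product of B. *)
Definition conv f g : fsec B := fun x =>
  \sum_(a \in [set a | grng a = grng x])
    transport x (fmul (f a) (g (gmul (ginv a) x))).

Definition adj f : fsec B := fun x => transport x (fadj (f (ginv x))).

Lemma felt_transport x y (v : ffib B x) : x = y -> felt (transport y v) = felt v.
Proof.
by move=> e; subst y; rewrite /transport; case: pselect => // e; rewrite eq_axiomK.
Qed.

Lemma transport_eq x y (v : ffib B x) (w : ffib B y) :
  felt v = felt w -> transport y v = w.
Proof.
move=> vw; have e : x = y by rewrite -(fprj_elt v) vw fprj_elt.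
by apply: (@felt_inj _ _ B); rewrite felt_transport.
Qed.

Lemma transport_linear x y c (v w : ffib B x) :
  transport y (c *: v + w) = c *: transport y v + transport y w.
Proof.
rewrite /transport; case: pselect => [e|_]; last by rewrite scaler0 addr0.
by subst y.
Qed.

Lemma transport0 x y : transport y (0 : ffib B x) = 0.
Proof. by rewrite /transport; case: pselect => // e; subst y. Qed.

Lemma norm_transport x y (v : ffib B x) : `|transport y v| <= `|v|.
Proof.
rewrite /transport; case: pselect => [e|_]; first by subst y.
by rewrite normr0.
Qed.

Lemma felt_norm x y (v : ffib B x) (w : ffib B y) : felt v = felt w -> `|v| = `|w|.
Proof.
move=> vw; have e : x = y by rewrite -(fprj_elt v) vw fprj_elt.
subst y; congr `|_|; exact: felt_inj vw.
Qed.

Lemma felt0 x y : x = y -> felt (0 : ffib B x) = felt (0 : ffib B y).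
Proof. by move=> e; subst y. Qed.

Lemma felt_eq0 x y (v : ffib B x) (w : ffib B y) :
  felt v = felt w -> v = 0 -> w = 0.
Proof.
by move=> /felt_norm vw v0; apply/normr0_eq0; rewrite -vw v0 normr0.
Qed.

Lemma fmul0l x y (w : ffib B y) : gsrc x = grng y -> fmul (0 : ffib B x) w = 0.
Proof.
move=> xy; have := fmul_linear_l (-1) (0 : ffib B x) 0 w xy.
by rewrite scaler0 addr0 scaleN1r addNr.
Qed.

Lemma fmul0r x y (w : ffib B x) : gsrc x = grng y -> fmul w (0 : ffib B y) = 0.
Proof.
move=> xy; have := fmul_linear_r (-1) w (0 : ffib B y) 0 xy.
by rewrite scaler0 addr0 scaleN1r addNr.
Qed.

Lemma fadj0 x : fadj (0 : ffib B x) = 0.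
Proof.
have := fadj_linear 0 (0 : ffib B x) 0.
have := fadj_linear (-1) (0 : ffib B x) 0.
by rewrite scaler0 addr0 rmorphN rmorph1 scaleN1r addNr.
Qed.

Lemma fmul_congr x x' y y' (v : ffib B x) (v' : ffib B x') (w : ffib B y)
    (w' : ffib B y') : felt v = felt v' -> felt w = felt w' ->
  felt (fmul v w) = felt (fmul v' w').
Proof.
move=> vv ww.
have e : x = x' by rewrite -(fprj_elt v) vv fprj_elt.
have e' : y = y' by rewrite -(fprj_elt w) ww fprj_elt.
by subst x' y'; rewrite (felt_inj vv) (felt_inj ww).
Qed.

Lemma fadj_congr x x' (v : ffib B x) (v' : ffib B x') : felt v = felt v' ->
  felt (fadj v) = felt (fadj v').
Proof.
move=> vv; have e : x = x' by rewrite -(fprj_elt v) vv fprj_elt.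
by subst x'; rewrite (felt_inj vv).
Qed.

Lemma conv_at (U : set G) f g a x : bisection U -> supported U f -> U a ->
  grng a = grng x -> conv f g x = transport x (fmul (f a) (g (gmul (ginv a) x))).
Proof.
move=> [_ _ Ur] sf Ua ax.
rewrite /conv -(fsbig_widen [set a]); [exact: fsbig_set1|by move=> _ ->|].
move=> b [/= bx ba]; rewrite sf ?fmul0l ?transport0//.
- by rewrite grng_mul ?gsrc_inv// grng_inv.
- by move=> Ub; apply: ba; apply: Ur; rewrite ?bx.
Qed.

Lemma conv_comp (U : set G) f g a b : bisection U -> supported U f -> U a ->
  gsrc a = grng b -> felt (conv f g (gmul a b)) = felt (fmul (f a) (g b)).
Proof.
move=> bU sf Ua ab; rewrite (conv_at g bU sf Ua) ?grng_mul//.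
rewrite felt_transport ?gmulKg ?grng_mul//.
by rewrite gmulVKg.
Qed.

Lemma conv_out (U : set G) f g x : supported U f ->
  (forall a, U a -> grng a <> grng x) -> conv f g x = 0.
Proof.
move=> sf no; apply: fsbig1 => a /= ax.
rewrite sf ?fmul0l ?transport0//; last by move=> /no.
by rewrite grng_mul ?gsrc_inv// grng_inv.
Qed.

Lemma conv_cases (U : set G) f x : bisection U -> supported U f ->
  (exists a b, [/\ U a, gsrc a = grng b & x = gmul a b]) \/
  (forall g, conv f g x = 0).
Proof.
move=> bU sf; have [[a [Ua ax]]|no] := pselect (exists a, U a /\ grng a = grng x).
  left; exists a, (gmul (ginv a) x); split=> //; last by rewrite gmulKg.
  by rewrite grng_mul ?gsrc_inv// grng_inv.
by right=> g; apply: (conv_out _ sf) => a Ua ax; apply: no; exists a.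
Qed.

Lemma conv_supported (U V : set G) f g : bisection U -> supported U f ->
  supported V g -> supported (set_gmul U V) (conv f g).
Proof.
move=> bU sf sg x nx; have [[a [b [Ua ab xab]]]|->//] := conv_cases x bU sf.
subst x; apply: (felt_eq0 (v := fmul (f a) (g b))).
  by rewrite (conv_comp _ bU).
rewrite sg ?fmul0r// => Vb; apply: nx; by exists a, b.
Qed.

Lemma conv_linear_l (U : set G) c f f' g : bisection U -> supported U f ->
  supported U f' -> conv (c *: f + f') g = c *: conv f g + conv f' g.
Proof.
move=> bU sf sf'; have sff' : supported U (c *: f + f').
  by move=> x nx; rewrite fsecDE fsecZE sf// sf'// scaler0 addr0.
apply: fsecP => x; rewrite fsecDE fsecZE.
have [[a [Ua ax]]|no] := pselect (exists a, U a /\ grng a = grng x).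
  rewrite !(conv_at _ bU _ Ua ax)// -transport_linear; congr transport.
  by rewrite fmul_linear_l// grng_mul ?gsrc_inv// grng_inv.
by rewrite !(@conv_out U) ?scaler0 ?addr0// => a Ua ax; apply: no; exists a.
Qed.

Lemma conv_linear_r (U : set G) c f g g' : bisection U -> supported U f ->
  conv f (c *: g + g') = c *: conv f g + conv f g'.
Proof.
move=> bU sf; apply: fsecP => x; rewrite fsecDE fsecZE.
have [[a [Ua ax]]|no] := pselect (exists a, U a /\ grng a = grng x).
  rewrite !(conv_at _ bU _ Ua ax)// -transport_linear; congr transport.
  by rewrite fmul_linear_r// grng_mul ?gsrc_inv// grng_inv.
by rewrite !(@conv_out U) ?scaler0 ?addr0// => a Ua ax; apply: no; exists a.
Qed.

Lemma convA (U V : set G) f g h : bisection U -> bisection V ->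
  supported U f -> supported V g -> conv f (conv g h) = conv (conv f g) h.
Proof.
move=> bU bV sf sg; have bUV := bisection_mul bU bV.
have sfg := conv_supported bU sf sg.
apply: fsecP => x.
have [[a [b [c [Ua Vb ab bc ->]]]]|no] := pselect (exists a b c,
    [/\ U a, V b, gsrc a = grng b, gsrc b = grng c & x = gmul a (gmul b c)]).
  apply: felt_inj; rewrite (conv_comp _ bU sf)//; last by rewrite grng_mul.
  rewrite (fmul_congr (erefl (felt (f a))) (conv_comp h bV sg Vb bc)).
  rewrite fmulA// gmulA// (conv_comp _ bUV sfg)//; last by rewrite gsrc_mul.
    exact: fmul_congr (esym (conv_comp g bU sf Ua ab)) erefl.
  by exists a, b.
transitivity (0 : ffib B x).
  have [[a [y [Ua ay xay]]]|-> //] := conv_cases x bU sf.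
  subst x; apply: (felt_eq0 (esym (conv_comp _ bU sf Ua ay))).
  have [[b [c [Vb bc ybc]]]|->] := conv_cases y bV sg; last by rewrite fmul0r.
  subst y; case: no; exists a, b, c; split=> //.
  by rewrite grng_mul in ay.
apply/esym; have [[p [c [[a [b [Ua Vb ab pab]]] pc xpc]]]|-> //] := conv_cases x bUV sfg.
subst p; rewrite gsrc_mul// in pc.
by case: no; exists a, b, c; rewrite gmulA.
Qed.

Lemma adj_supported (U : set G) f : supported U f -> supported (ginv @^-1` U) (adj f).
Proof. by move=> sf x nx; rewrite /adj sf// fadj0 transport0. Qed.

Lemma felt_adj f x : felt (adj f x) = felt (fadj (f (ginv x))).
Proof. by rewrite felt_transport// ginvK. Qed.

Lemma felt_sec f x y : x = y -> felt (f x) = felt (f y).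
Proof. by move=> ->. Qed.

Lemma adjK f : adj (adj f) = f.
Proof.
apply: fsecP => x; apply: felt_inj; rewrite felt_adj.
by rewrite (fadj_congr (felt_adj f (ginv x))) fadjK; apply: felt_sec; rewrite ginvK.
Qed.

Lemma adj_linear c f g : adj (c *: f + g) = c^* *: adj f + adj g.
Proof.
by apply: fsecP => x; rewrite fsecDE fsecZE /adj fsecDE fsecZE fadj_linear transport_linear.
Qed.

Lemma adj_conv (U V : set G) f g : bisection U -> bisection V ->
  supported U f -> supported V g -> adj (conv f g) = conv (adj g) (adj f).
Proof.
move=> bU bV sf sg; apply: fsecP => x.
have bV' := bisection_inv bV; have sg' := adj_supported sg.
have [[a [b [Ua Vb ab ->]]]|no] := pselect (exists a b,
    [/\ U a, V b, gsrc a = grng b & x = gmul (ginv b) (ginv a)]).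
  have ba : gsrc (ginv b) = grng (ginv a) by rewrite gsrc_inv grng_inv.
  apply: felt_inj; rewrite felt_adj (conv_comp _ bV' sg')//; last by rewrite /= ginvK.
  have e : ginv (gmul (ginv b) (ginv a)) = gmul a b by rewrite ginvM// !ginvK.
  rewrite (fadj_congr (felt_sec (conv f g) e)).
  rewrite (fadj_congr (conv_comp g bU sf Ua ab)) fadjM//.
  by apply: fmul_congr; rewrite felt_adj; apply: fadj_congr; apply: felt_sec; rewrite ginvK.
transitivity (0 : ffib B x).
  rewrite /adj; have [[a [b [Ua ab xab]]]|->] := conv_cases (ginv x) bU sf; last first.
    by rewrite fadj0 transport0.
  rewrite [X in fadj X](_ : _ = 0) ?fadj0 ?transport0//.
  apply: (felt_eq0 (v := fmul (f a) (g b))).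
    by rewrite -(conv_comp _ bU sf)//; apply: felt_sec.
  rewrite sg ?fmul0r// => Vb; apply: no; exists a, b; split=> //.
  by rewrite -ginvM// -xab ginvK.
apply/esym; have [[b [a [Vb ba xba]]]|-> //] := conv_cases x bV' sg'.
subst x; apply: (felt_eq0 (esym (conv_comp _ bV' sg' Vb ba))).
rewrite [adj f a](_ : _ = 0) ?fmul0r//.
rewrite /adj sf ?fadj0 ?transport0// => Ua; apply: no.
exists (ginv a), (ginv b); split; rewrite ?ginvK//.
by rewrite gsrc_inv grng_inv.
Qed.

Lemma norm_conv (U : set G) f g x M N : bisection U -> supported U f ->
  0 <= M -> 0 <= N ->
  (forall y, `|f y| <= M) -> (forall y, `|g y| <= N) -> `|conv f g x| <= M * N.
Proof.
move=> bU sf M0 N0 fM gN.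
have [[a [b [Ua ab ->]]]|->] := conv_cases x bU sf; last first.
  by rewrite normr0 mulr_ge0.
rewrite (felt_norm (conv_comp g bU sf Ua ab)).
by apply: (le_trans (fnormM _ _ ab)); rewrite ler_pM.
Qed.

Lemma norm_fadj x (v : ffib B x) : `|fadj v| = `|v|.
Proof.
have le y (w : ffib B y) : `|w| <= `|fadj w|.
  have [->|w0] := eqVneq w 0; first by rewrite normr0.
  have w0' : 0 < `|w| by rewrite normr_gt0.
  rewrite -(ler_pM2r w0') -expr2 -fnorm_adj; apply: fnormM.
  by rewrite gsrc_inv.
apply/eqP; rewrite eq_le le andbT.
by apply: le_trans (le _ _) _; rewrite (felt_norm (fadjK v)).
Qed.

Lemma norm_adj f x : `|adj f x| = `|f (ginv x)|.
Proof. by rewrite (felt_norm (felt_adj f x)) norm_fadj. Qed.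

Lemma felt_near x (v : ffib B x) (W : set (ftot B)) : nbhs (felt v) W ->
  exists W' e, [/\ nbhs (felt v) W', 0 < e
    & forall y (b c : ffib B y), W' (felt c) -> `|b - c| < e -> W (felt b)].
Proof.
rewrite -[v in nbhs (felt v)]addr0 => /fadd_continuous[W1 [N [nW1 nN sub]]].
have [V [e [nV e0 VN]]] := fzero_nbhs nN.
rewrite addr0; exists (W1 `&` @fprj _ _ B @^-1` V), e; split=> //.
  apply: filterI => //.
  by have := @fprj_continuous _ _ B (felt v) V; rewrite fprj_elt; apply.
move=> y b c [W1c Vc] bc; rewrite -(subrKC c b); apply: sub => //.
by apply: VN => //; rewrite -(fprj_elt c).
Qed.

Definition cont_at f x : Prop := forall W : set (ftot B),
  nbhs (felt (f x)) W -> nbhs x [set y | W (felt (f y))].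

Lemma cont_at_linear c f g x : cont_at f x -> cont_at g x -> cont_at (c *: f + g) x.
Proof.
move=> cf cg W; rewrite fsecDE fsecZE => /fadd_continuous[V1 [V2 [nV1 nV2 sub]]].
have [V nV sub'] := fscale_continuous nV1.
apply: filterS2 (cf _ nV) (cg _ nV2) => y /= Vy V2y.
by rewrite fsecDE fsecZE; apply: sub => //; exact: sub'.
Qed.

Lemma cont_at0 (x : G) : cont_at 0 x.
Proof.
move=> W /fzero_nbhs[V [e [nV e0 sub]]].
apply: filterS nV => y Vy /=; by apply: sub => //; rewrite normr0.
Qed.

Lemma C0_linear (U : set G) : linear_subspace (C0 U).
Proof.
split.
  split=> //; first by move=> x _; exact: cont_at0.
  by move=> e e0; exists set0; split; [exact: compact0| |move=> x _; rewrite normr0].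
move=> c f g [sf cf vf] [sg cg vg]; split.
- by move=> x nx; rewrite fsecDE fsecZE sf// sg// scaler0 addr0.
- by move=> x Ux; apply: cont_at_linear; [exact: cf|exact: cg].
move=> e e0; have c0 : 0 < `|c| + 1 by rewrite ltr_wpDl.
have [|K [cK KU Kf]] := vf (e / 2 / (`|c| + 1)); first by rewrite !divr_gt0.
have [|L [cL LU Lg]] := vg (e / 2); first by rewrite divr_gt0.
exists (K `|` L); split; first exact: compactU.
  by move=> x [/KU|/LU].
move=> x nKL; rewrite fsecDE fsecZE.
apply: le_lt_trans (ler_normD _ _) _; rewrite [e]splitr ltr_leD//; last first.
  by apply/ltW/Lg => Lx; apply: nKL; right.
rewrite normrZ; apply: (@le_lt_trans _ _ ((`|c| + 1) * `|f x|)).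
  by rewrite ler_wpM2r// lerDl.
by rewrite mulrC -ltr_pdivlMr//; apply: Kf => Kx; apply: nKL; left.
Qed.

Lemma C0_bounded (U : set G) f : C0 U f ->
  exists2 M : R[i], 0 <= M & forall x, `|f x| <= M.
Proof.
move=> [sf cf vf]; have [//|K [cK KU Kf]] := vf 1.
have /compact_near_coveringP cov := cK.
have : \forall M \near (@pinfty_nbhs R), K `<=` (fun x => `|f x| < M%:C%C).
  apply: cov => x Kx.
  have [r rE] : exists r : R, `|f x| = r%:C%C.
    by exists (complex.Re `|f x|); rewrite RRe_real// normr_real.
  have nx : nbhs x [set y | `|f y| < (r + 1)%:C%C].
    have nW : nbhs (felt (f x))
        [set e | exists z (v : ffib B z), e = felt v /\ `|v| < (r + 1)%:C%C].
      apply: open_nbhs_nbhs; split; first exact: fnorm_usc.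
      by exists x, (f x); rewrite rE ltcR ltrDl.
    have cfx : cont_at f x := cf x (KU _ Kx).
    apply: filterS (cfx _ nW) => y [z [v [e vr]]] /=.
    by rewrite (felt_norm e).
  exists ([set y | `|f y| < (r + 1)%:C%C], [set M | r + 1 < M]).
    split=> //=; apply: nbhs_pinfty_gt; exact: num_real.
  by move=> [y M] /= [fy rM]; apply: lt_trans fy _; rewrite ltcR.
move=> nM.
have : \forall M \near (@pinfty_nbhs R), 0 <= M by apply: nbhs_pinfty_ge; exact: num_real.
move=> n0; have [M [KM M0]] := filter_ex (filterI nM n0).
have M0' : 0 <= M%:C%C by rewrite lecR.
exists (M%:C%C + 1); first by rewrite addr_ge0.
move=> x; have [Kx|nKx] := pselect (K x).
  by apply: (le_trans (ltW (KM x Kx))); rewrite lerDl.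
by apply: (le_trans (ltW (Kf x nKx))); rewrite lerDr.
Qed.

Definition uniformly_closed (M : set (fsec B)) : Prop :=
  forall f, (forall e : R[i], 0 < e ->
    exists2 g, M g & forall x, `|f x - g x| < e) -> M f.

Lemma C0_closed (U : set G) : uniformly_closed (C0 U).
Proof.
move=> f app; split.
- move=> x nx; apply/normr0_eq0/eqP; apply: contraT => fx.
  have fx0 : 0 < `|f x| by rewrite normr_gt0 -normr_eq0.
  have [g [sg _ _] fg] := app _ fx0.
  by have := fg x; rewrite sg// subr0 ltxx.
- move=> x Ux; suff : cont_at f x by [].
  move=> W nW.
  have [W1 [e1 [nW1 e10 sub1]]] := felt_near nW.
  have [W2 [e2 [nW2 e20 sub2]]] := felt_near (nbhs_interior nW1).
  have [e [e0 ee1 ee2]] : exists e : R[i], [/\ 0 < e, e <= e1 & e <= e2].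
    have [|/ltW] := real_leP (gtr0_real e10) (gtr0_real e20); first by exists e1.
    by exists e2.
  have [g [_ cg _] fg] := app _ e0.
  have W1g : nbhs (felt (g x)) W1.
    apply: sub2 (nbhs_singleton nW2) _.
    by rewrite distrC; exact: lt_le_trans (fg x) ee2.
  have cgx : cont_at g x := cg x Ux.
  apply: filterS (cgx _ W1g) => y /= W1y.
  by apply: sub1 W1y _; exact: lt_le_trans (fg y) ee1.
- move=> e e0; have e20 : 0 < e / 2 by rewrite divr_gt0.
  have [g [_ _ vg] fg] := app _ e20; have [K [cK KU Kg]] := vg _ e20.
  exists K; split=> // x nK; rewrite -(subrK (g x) (f x)).
  by apply: le_lt_trans (ler_normD _ _) _; rewrite [e]splitr ltrD// Kg.
Qed.

Lemma C0_ext (U V : set G) f : U `<=` V -> open U -> bisection V -> C0 U f -> C0 V f.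
Proof.
move=> UV Uo bV [sf cf vf]; split.
- by move=> x nx; apply: sf => /UV.
- move=> x Vx; have [Ux|nUx] := pselect (U x); first exact: cf.
  suff : cont_at f x by [].
  move=> W; rewrite sf// => /fzero_nbhs[N [e [nN e0 sub]]].
  have [K [cK KU Kf]] := vf _ e0.
  have := compact_far bV cK (subset_trans KU UV) Vx (fun Kx => nUx (KU _ Kx)).
  by apply: filterS2 nN => y Ny nKy /=; apply: sub => //; exact: Kf.
- move=> e /vf[K [cK KU Kf]]; exists K; split=> //; exact: subset_trans UV.
Qed.

Lemma C0_adj (U : set G) f : C0 U f -> C0 (ginv @^-1` U) (adj f).
Proof.
move=> [sf cf vf]; split; first exact: adj_supported.
- move=> x Ux; suff : cont_at (adj f) x by [].
  move=> W; rewrite felt_adj => /fadj_continuous[V nV sub].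
  have cfx : cont_at f (ginv x) := cf _ Ux.
  have nx : nbhs x [set y | V (felt (f (ginv y)))] :=
    @ginv_continuous G x _ (cfx _ nV).
  apply: filterS nx => y /= Vy.
  by rewrite felt_adj; exact: sub.
- move=> e /vf[K [cK KU Kf]]; exists (ginv @^-1` K); split.
  + exact: compact_ginv.
  + by move=> x /KU.
  + by move=> x /= nK; rewrite norm_adj; exact: Kf.
Qed.

Lemma C0_conv (U V : set G) f g : bisection U -> bisection V ->
  C0 U f -> C0 V g -> C0 (set_gmul U V) (conv f g).
Proof.
move=> bU bV C0f C0g; have [sf cf vf] := C0f; have [sg cg vg] := C0g.
have [Uo _ _] := bU.
split; first exact: conv_supported.
- move=> _ [a [b [Ua Vb ab ->]]].
  suff : cont_at (conv f g) (gmul a b) by [].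
  move=> W; rewrite (conv_comp g bU sf Ua ab) => nW.
  have [W1 [W2 [nW1 nW2 sub]]] := fmul_continuous ab nW.
  have cfa : cont_at f a := cf a Ua; have cgb : cont_at g b := cg b Vb.
  have nb : nbhs (gmul (ginv a) (gmul a b)) [set y | W2 (felt (g y))].
    by rewrite gmulVKg//; exact: cgb.
  have ag : grng a = grng (gmul a b) by rewrite grng_mul.
  apply: filterS (mulV_near Uo Ua (cfa _ nW1) ag nb) => x [c [Uc W1c cx W2c]] /=.
  have cc : gsrc c = grng (gmul (ginv c) x) by rewrite rng_mulV.
  rewrite -(felt_sec (conv f g) (gmulKg cx)) (conv_comp g bU sf Uc cc).
  exact: sub.
- have [M M0 fM] := C0_bounded C0f; have [N N0 gN] := C0_bounded C0g.
  move=> e e0.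
  have M1 : 0 < M + 1 by rewrite ltr_wpDl.
  have N1 : 0 < N + 1 by rewrite ltr_wpDl.
  have [|K [cK KU Kf]] := vf (e / (N + 1)); first by rewrite divr_gt0.
  have [|L [cL LV Lg]] := vg (e / (M + 1)); first by rewrite divr_gt0.
  exists (set_gmul K L); split; first exact: compact_gmul.
    by move=> _ [a [b [/KU Ua /LV Vb ab ->]]]; exists a, b.
  move=> x nKL; have [[a [b [Ua ab xab]]]|->] := conv_cases x bU sf; last first.
    by rewrite normr0.
  subst x; rewrite (felt_norm (conv_comp g bU sf Ua ab)).
  apply: le_lt_trans (fnormM _ _ ab) _.
  have [Ka|nKa] := pselect (K a).
    have nLb : ~ L b by move=> Lb; apply: nKL; exists a, b.
    apply: (@le_lt_trans _ _ ((M + 1) * `|g b|)).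
      by rewrite ler_wpM2r// (le_trans (fM a))// lerDl.
    by rewrite mulrC -ltr_pdivlMr//; exact: Lg.
  apply: (@le_lt_trans _ _ (`|f a| * (N + 1))).
    by rewrite ler_wpM2l// (le_trans (gN b))// lerDl.
  by rewrite -ltr_pdivlMr//; exact: Kf.
Qed.

End Sections.

Record linsub (K : pzRingType) (V : lmodType K) := LinSub {
  linsub_set : set V;
  linsubP : linear_subspace linsub_set }.

Record linsub_elt (K : pzRingType) (V : lmodType K) (M : linsub V) := LinSubElt {
  lval :> V;
  lvalP : linsub_set M lval }.

Section LinearSubspace.
Variables (K : pzRingType) (V : lmodType K) (M : linsub V).
Implicit Types x y z : linsub_elt M.

Lemma lval_inj : injective (@lval _ _ M).
Proof. by move=> [x xM] [y yM] /= xy; subst y; congr LinSubElt. Qed.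

HB.instance Definition _ := gen_eqMixin (linsub_elt M).
HB.instance Definition _ := gen_choiceMixin (linsub_elt M).

Lemma linsub_add (x y : V) : linsub_set M x -> linsub_set M y -> linsub_set M (x + y).
Proof. by move=> Mx My; rewrite -[x]scale1r; apply: (linsubP M).2. Qed.
Lemma linsub_scale c (x : V) : linsub_set M x -> linsub_set M (c *: x).
Proof. by move=> Mx; rewrite -[_ *: _]addr0; apply: (linsubP M).2 => //; exact: (linsubP M).1. Qed.
Lemma linsub_opp (x : V) : linsub_set M x -> linsub_set M (- x).
Proof. by rewrite -scaleN1r; exact: linsub_scale. Qed.

Let zero := LinSubElt (linsubP M).1.
Let opp x := LinSubElt (linsub_opp (lvalP x)).
Let add x y := LinSubElt (linsub_add (lvalP x) (lvalP y)).
Let addA : associative add.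
Proof. by move=> x y z; apply: lval_inj; rewrite /= addrA. Qed.
Let addC : commutative add.
Proof. by move=> x y; apply: lval_inj; rewrite /= addrC. Qed.
Let add0 : left_id zero add.
Proof. by move=> x; apply: lval_inj; rewrite /= add0r. Qed.
Let addN : left_inverse zero opp add.
Proof. by move=> x; apply: lval_inj; rewrite /= addNr. Qed.
HB.instance Definition _ :=
  GRing.isZmodule.Build (linsub_elt M) addA addC add0 addN.

Let scale c x := LinSubElt (linsub_scale c (lvalP x)).
Let scaleA a b x : scale a (scale b x) = scale (a * b) x.
Proof. by apply: lval_inj; rewrite /= scalerA. Qed.
Let scale1 : left_id 1 scale.
Proof. by move=> x; apply: lval_inj; rewrite /= scale1r. Qed.
Let scaleDr : right_distributive scale +%R.
Proof. by move=> a x y; apply: lval_inj; rewrite /= scalerDr. Qed.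
Let scaleDl x : {morph scale^~ x : a b / a + b}.
Proof. by move=> a b; apply: lval_inj; rewrite /= scalerDl. Qed.
HB.instance Definition _ :=
  GRing.Zmodule_isLmodule.Build K (linsub_elt M) scaleA scale1 scaleDr scaleDl.

Lemma lvalD x y : lval (x + y) = lval x + lval y. Proof. by []. Qed.
Lemma lvalZ c x : lval (c *: x) = c *: lval x. Proof. by []. Qed.
Lemma lvalN x : lval (- x) = - lval x. Proof. by []. Qed.
Lemma lval0 : lval (0 : linsub_elt M) = 0. Proof. by []. Qed.
End LinearSubspace.

Section C0Algebra.
Variables (R : realType) (G : etale_groupoid) (B : fell_bundle R G).

Definition C0_units : Type := linsub_elt (LinSub (C0_linear B (units : set G))).
Implicit Types a b c : C0_units.

HB.instance Definition _ := GRing.Lmodule.on C0_units.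

Definition C0_elt (f : fsec B) (C0f : C0 units f) : C0_units :=
  @LinSubElt _ _ (LinSub (C0_linear B units)) f C0f.

Lemma C0_eltP a : C0 units (lval a). Proof. exact: (lvalP a). Qed.

Definition supnorm (a : C0_units) : R[i] :=
  (sup [set complex.Re `|lval a x| | x in setT])%:C%C.

Lemma supnorm_le a x : `|lval a x| <= supnorm a.
Proof.
have [M M0 aM] := C0_bounded (lvalP a).
rewrite -[leLHS]RRe_real ?normr_real// lecR; apply: ub_le_sup; last by exists x.
exists (complex.Re M) => _ [y _ <-].
by have := aM y; rewrite lecE => /andP[].
Qed.

Lemma supnorm_ge0 a : 0 <= supnorm a.
Proof.
rewrite lecR; have [[x _]|] := pselect (exists x : G, True).
  have [M M0 aM] := C0_bounded (lvalP a).
  have : complex.Re `|lval a x| <= sup [set complex.Re `|lval a x| | x in setT].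
    apply: ub_le_sup; last by exists x.
    exists (complex.Re M) => _ [y _ <-].
    by have := aM y; rewrite lecE => /andP[].
  apply: le_trans; have := normr_ge0 (lval a x); by rewrite lecE => /andP[].
move=> no; rewrite (_ : [set _ | _ in _] = set0) ?sup0//.
by apply/seteqP; split=> // y [x]; case: no; exists x.
Qed.

Lemma supnorm_lub a M : 0 <= M -> (forall x, `|lval a x| <= M) -> supnorm a <= M.
Proof.
move=> M0 aM.
have ME : M = (complex.Re M)%:C%C by rewrite RRe_real// ger0_real.
have [[x _]|no] := pselect (exists x : G, True); last first.
  rewrite /supnorm (_ : [set _ | _ in _] = set0) ?sup0//.
  by apply/seteqP; split=> // y [x]; case: no; exists x.
rewrite ME lecR; apply: ge_sup; first by exists (complex.Re `|lval a x|); exists x.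
by move=> _ [y _ <-]; have := aM y; rewrite lecE => /andP[].
Qed.

Let supnormD a b : supnorm (a + b) <= supnorm a + supnorm b.
Proof.
apply: supnorm_lub => [|x]; first by rewrite addr_ge0 ?supnorm_ge0.
by apply: le_trans (ler_normD _ _) _; rewrite lerD ?supnorm_le.
Qed.

Let supnormZ z a : supnorm (z *: a) = `|z| * supnorm a.
Proof.
have le w c : supnorm (w *: c) <= `|w| * supnorm c.
  apply: supnorm_lub => [|x]; first by rewrite mulr_ge0 ?supnorm_ge0.
  by rewrite lvalZ fsecZE normrZ ler_wpM2l ?supnorm_le.
apply/eqP; rewrite eq_le le/=.
have [->|z0] := eqVneq z 0; first by rewrite normr0 mul0r supnorm_ge0.
rewrite -{1}[a](scalerK z0) -ler_pdivlMl ?normr_gt0//.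
by rewrite -normfV; exact: le.
Qed.

Let supnorm_eq0 a : supnorm a = 0 -> a = 0.
Proof.
move=> a0; apply: lval_inj; apply: fsecP => x; apply: normr0_eq0.
by apply/eqP; rewrite eq_le normr_ge0 -a0 supnorm_le.
Qed.

HB.instance Definition _ :=
  @Lmodule_isNormed.Build R[i] C0_units supnorm supnormD supnormZ supnorm_eq0.

Let C0_units_complete (F : set_system C0_units) : ProperFilter F -> cauchy F -> cvg F.
Proof.
move=> FF cF.
have F_near e : 0 < e -> \forall a \near F, \forall b \near F, `|a - b| < e.
  move=> e0; have /cauchy_ballP/(_ e e0) := cF.
  by move/nearP_dep; apply: filterS => a; apply: filterS => b; rewrite -ball_normE.
have cFx x : cvg ((fun a : C0_units => lval a x) @ F).
  apply/cauchy_cvgP; apply/cauchy_exP => e e0.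
  have [a Fa] := filter_ex (F_near e e0).
  exists (lval a x); apply: filterS Fa => b ab.
  rewrite /= -ball_normE /=; apply: le_lt_trans ab.
  exact: (supnorm_le (a - b) x).
pose f : fsec B := fun x => lim ((fun a : C0_units => lval a x) @ F).
have Ff e : 0 < e -> \forall a \near F, forall x, `|f x - lval (a : C0_units) x| < e.
  move=> e0; have e20 : 0 < e / 2 by rewrite divr_gt0.
  apply: filterS (F_near _ e20) => a Fa x.
  have /cvgrPdist_lt/(_ _ e20) Fx := cFx x.
  have [b [ab bx]] := filter_ex (filterI Fa Fx).
  rewrite -(subrKA (lval b x)) [e]splitr.
  apply: le_lt_trans (ler_normD _ _) _; apply: ltrD => //.
  rewrite distrC; apply: le_lt_trans ab; exact: (supnorm_le (a - b) x).
have C0f : C0 units f.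
  apply: C0_closed => e /Ff Fe; have [a ae] := filter_ex Fe.
  exists (lval (a : C0_units)) => //; exact: C0_eltP.
apply/cvg_ex; exists (C0_elt C0f).
apply/cvgrPdist_le => e e0; apply: filterS (Ff _ e0) => a ae.
by apply: supnorm_lub => [|x]; apply: ltW => //; exact: ae.
Qed.

HB.instance Definition _ := Uniform_isComplete.Build C0_units C0_units_complete.


Local Notation X := (units : set G).

Let bX : bisection X := bisection_units G.

Let suppX a : supported X (lval a).
Proof. by have [] := C0_eltP a. Qed.

Lemma C0_units_conv (f g : fsec B) : C0 X f -> C0 X g -> C0 X (conv f g).
Proof.
move=> C0f C0g; have bXX := bisection_mul bX bX.
apply: C0_ext (C0_conv bX bX C0f C0g) => //; last by case: bXX.
exact: set_gmul1g.
Qed.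

Lemma C0_units_adj (f : fsec B) : C0 X f -> C0 X (adj f).
Proof.
move=> C0f; have bX' := bisection_inv bX.
apply: C0_ext (C0_adj C0f) => //; last by case: bX'.
by move=> x /= xX; rewrite -[x]ginvK ginv_unit.
Qed.

Definition C0_mul a b : C0_units :=
  C0_elt (C0_units_conv (C0_eltP a) (C0_eltP b)).

Definition C0_star a : C0_units := C0_elt (C0_units_adj (C0_eltP a)).

Let mulA a b c : C0_mul a (C0_mul b c) = C0_mul (C0_mul a b) c.
Proof. by apply: lval_inj; apply: (convA (U := X) (V := X)). Qed.

Let mul_linear_l z a b c : C0_mul (z *: a + b) c = z *: C0_mul a c + C0_mul b c.
Proof. by apply: lval_inj; apply: (conv_linear_l (U := X)). Qed.

Let mul_linear_r z a b c : C0_mul a (z *: b + c) = z *: C0_mul a b + C0_mul a c.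
Proof. by apply: lval_inj; apply: (conv_linear_r (U := X)). Qed.

Let mulDl a b c : C0_mul (a + b) c = C0_mul a c + C0_mul b c.
Proof. by have := mul_linear_l 1 a b c; rewrite !scale1r. Qed.

Let mulDr a b c : C0_mul a (b + c) = C0_mul a b + C0_mul a c.
Proof. by have := mul_linear_r 1 a b c; rewrite !scale1r. Qed.

Let mul0l a : C0_mul 0 a = 0.
Proof. by apply: (addrI (C0_mul 0 a)); rewrite -mulDl !addr0. Qed.

Let mul0r a : C0_mul a 0 = 0.
Proof. by apply: (addrI (C0_mul a 0)); rewrite -mulDr !addr0. Qed.

Let mulZl z a b : C0_mul (z *: a) b = z *: C0_mul a b.
Proof. by have := mul_linear_l z a 0 b; rewrite mul0l !addr0. Qed.

Let mulZr z a b : C0_mul a (z *: b) = z *: C0_mul a b.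
Proof. by have := mul_linear_r z a b 0; rewrite mul0r !addr0. Qed.

Let starK a : C0_star (C0_star a) = a.
Proof. by apply: lval_inj; exact: adjK. Qed.

Let star_linear z a b : C0_star (z *: a + b) = z^* *: C0_star a + C0_star b.
Proof. by apply: lval_inj; exact: adj_linear. Qed.

Let starD a b : C0_star (a + b) = C0_star a + C0_star b.
Proof. by have := star_linear 1 a b; rewrite rmorph1 !scale1r. Qed.

Let star0 : C0_star 0 = 0.
Proof. by apply: (addrI (C0_star 0)); rewrite -starD !addr0. Qed.

Let starZ z a : C0_star (z *: a) = z^* *: C0_star a.
Proof. by have := star_linear z a 0; rewrite star0 !addr0. Qed.

Let starM a b : C0_star (C0_mul a b) = C0_mul (C0_star b) (C0_star a).
Proof. by apply: lval_inj; apply: (adj_conv (U := X) (V := X)). Qed.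

Let normM a b : `|C0_mul a b| <= `|a| * `|b|.
Proof.
apply: supnorm_lub => [|x]; first by rewrite mulr_ge0.
by apply: (norm_conv (U := X)) => // y; exact: supnorm_le.
Qed.

Let norm_star a : `|C0_mul (C0_star a) a| = `|a| ^+ 2.
Proof.
apply/eqP; rewrite eq_le; apply/andP; split.
  apply: le_trans (normM _ _) _; rewrite expr2 ler_wpM2r//.
  apply: supnorm_lub => // x; rewrite /= norm_adj; exact: supnorm_le.
rewrite -[leRHS]sqrtCK ler_sqr ?nnegrE ?sqrtC_ge0//.
apply: supnorm_lub => [|x]; first by rewrite sqrtC_ge0.
have [xX|nX] := pselect (X x); last by rewrite suppX// normr0 sqrtC_ge0.
rewrite -ler_sqr ?nnegrE ?sqrtC_ge0// sqrtCK.
have C0s : supported X (adj (lval a)) by have [] := C0_units_adj (C0_eltP a).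
have xx : gsrc x = grng x by rewrite rng_unit.
have e : felt (conv (adj (lval a)) (lval a) x) = felt (fmul (fadj (lval a x)) (lval a x)).
  rewrite (felt_sec _ (esym (gmul_unit xX))) (conv_comp _ bX C0s xX xx).
  apply: fmul_congr => //; rewrite felt_adj; apply: fadj_congr; apply: felt_sec.
  exact: ginv_unit.
by rewrite -fnorm_adj -(felt_norm e); exact: (supnorm_le (C0_mul (C0_star a) a)).
Qed.

Definition C0_cstar : cstar_algebra R :=
  @CStarAlgebra R C0_units C0_mul C0_star mulA mulDl mulDr mulZl mulZr starK
    starD starZ starM normM norm_star.

End C0Algebra.

Section BisectionAction.
Variables (R : realType) (G : etale_groupoid) (B : fell_bundle R G).
Local Notation X := (units : set G).

(* The Hilbert subbimodules of C_0(U, B|_U) for bisections [U]. The norm of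
   C_0(U, B|_U) as a Hilbert bimodule is the supremum norm. *)
Record bisection_bimodule := BisectionBimodule {
  bbset : linsub (fsec B);
  bb_bisection : exists2 U : set G, bisection U & linsub_set bbset `<=` C0 U;
  bb_closed : uniformly_closed (linsub_set bbset);
  bb_lact : forall a f, C0 X a -> linsub_set bbset f -> linsub_set bbset (conv a f);
  bb_ract : forall f a, linsub_set bbset f -> C0 X a -> linsub_set bbset (conv f a) }.
Implicit Types s t u : bisection_bimodule.

Definition uniform_span (Y : set (fsec B)) : set (fsec B) :=
  smallest [set M | linear_subspace M /\ uniformly_closed M] Y.

Lemma uniform_span_linear Y : linear_subspace (uniform_span Y).
Proof.
split=> [M [[[M0 _] _] _] //|c x y sx sy M MY].
by have [[[_ lin] _] _] := MY; apply: lin; [exact: sx|exact: sy].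
Qed.

Lemma uniform_span_closed Y : uniformly_closed (uniform_span Y).
Proof.
move=> f app M MY; have [[_ cl] _] := MY; apply: cl => e /app[g sg fg].
by exists g => //; exact: sg.
Qed.

Lemma sub_uniform_span Y : Y `<=` uniform_span Y.
Proof. by move=> f Yf M [_]; exact. Qed.

Definition bb_products t u : set (fsec B) :=
  [set h | exists f g, [/\ linsub_set (bbset t) f, linsub_set (bbset u) g
    & h = conv f g]].

Definition bb_mul_set t u := uniform_span (bb_products t u).

Let bX : bisection X := bisection_units G.

Lemma bb_mul_C0 t u (U V : set G) : bisection U -> bisection V ->
  linsub_set (bbset t) `<=` C0 U -> linsub_set (bbset u) `<=` C0 V ->
  bb_mul_set t u `<=` C0 (set_gmul U V).
Proof.
move=> bU bV tU uV f; apply; split.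
  by split; [exact: C0_linear|exact: C0_closed].
by move=> _ [g [h [tg uh ->]]]; apply: C0_conv => //; [exact: tU|exact: uV].
Qed.

Lemma bb_mul_bisection t u :
  exists2 W : set G, bisection W & bb_mul_set t u `<=` C0 W.
Proof.
have [U bU tU] := bb_bisection t; have [V bV uV] := bb_bisection u.
by exists (set_gmul U V); [exact: bisection_mul|exact: bb_mul_C0].
Qed.

Let conv0r (f : fsec B) (U : set G) : bisection U -> supported U f -> conv f 0 = 0.
Proof.
move=> bU sf; apply: (addrI (conv f 0)).
by have := conv_linear_r 1 0 0 bU sf; rewrite scaler0 scale1r !addr0 => <-.
Qed.

Let convBr (f g h : fsec B) (U : set G) : bisection U -> supported U f ->
  conv f (g - h) = conv f g - conv f h.
Proof.
move=> bU sf; rewrite addrC -scaleN1r (conv_linear_r _ _ _ bU sf).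
by rewrite scaleN1r addrC.
Qed.

Let conv0l (f : fsec B) : conv 0 f = 0.
Proof.
have s0 : supported X (0 : fsec B) by [].
apply: (addrI (conv 0 f)).
by have := conv_linear_l 1 f bX s0 s0; rewrite scaler0 scale1r !addr0 => <-.
Qed.

Let convBl (f g h : fsec B) (U : set G) : bisection U -> supported U f ->
  supported U g -> conv (f - g) h = conv f h - conv g h.
Proof.
move=> bU sf sg; rewrite addrC -scaleN1r (conv_linear_l _ _ bU sg sf).
by rewrite scaleN1r addrC.
Qed.

Let small (M e : R[i]) : 0 <= M -> 0 < e -> M * (e / (M + 1)) < e.
Proof.
move=> M0 e0; have M1 : 0 < M + 1 by rewrite ltr_wpDl.
by rewrite mulrCA gtr_pMr// ltr_pdivrMr// mul1r ltrDl.
Qed.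

Lemma bb_mul_lact t u a f : C0 X a -> bb_mul_set t u f -> bb_mul_set t u (conv a f).
Proof.
move=> C0a; have [M M0 aM] := C0_bounded C0a; have [sa _ _] := C0a.
have [U bU tU] := bb_bisection t.
move=> /(_ [set f | bb_mul_set t u (conv a f)]); apply; split; first split; first split.
- by rewrite /= (conv0r bX sa); exact: (uniform_span_linear _).1.
- move=> c g h ag ah; rewrite /= (conv_linear_r _ _ _ bX sa).
  exact: (uniform_span_linear _).2.
- move=> g app; apply: uniform_span_closed => e e0.
  have M1 : 0 < M + 1 by rewrite ltr_wpDl.
  have [|h ah gh] := app (e / (M + 1)); first by rewrite divr_gt0.
  exists (conv a h) => // x.
  rewrite -fsecNE -fsecDE -(convBr _ _ bX sa).
  apply: le_lt_trans (small M0 e0).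
  apply: (norm_conv x bX sa) => //; first by rewrite divr_ge0// ltW.
  by move=> y; apply: ltW; exact: gh.
- move=> _ [g [h [tg uh ->]]]; have [sg _ _] := tU _ tg.
  rewrite /= (convA h bX bU sa sg).
  by apply: sub_uniform_span; exists (conv a g), h; split=> //; exact: bb_lact.
Qed.

Lemma bb_mul_ract t u f a : bb_mul_set t u f -> C0 X a -> bb_mul_set t u (conv f a).
Proof.
move=> tuf C0a; have [M M0 aM] := C0_bounded C0a.
have [U bU tU] := bb_bisection t; have [V bV uV] := bb_bisection u.
have bUV := bisection_mul bU bV; have tuUV := bb_mul_C0 bU bV tU uV.
suff : [set f | bb_mul_set t u f /\ bb_mul_set t u (conv f a)] f by case.
have supp g : bb_mul_set t u g -> supported (set_gmul U V) g by move=> /tuUV[].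
apply: tuf; split; first split; first split.
- rewrite /= conv0l; split; exact: (uniform_span_linear _).1.
- move=> c g h [tug ag] [tuh ah]; split; first exact: (uniform_span_linear _).2.
  rewrite (conv_linear_l _ _ bUV (supp _ tug) (supp _ tuh)).
  exact: (uniform_span_linear _).2.
- move=> g app.
  have tug : bb_mul_set t u g.
    by apply: uniform_span_closed => e /app[h [tuh _] gh]; exists h.
  split=> //; apply: uniform_span_closed => e e0.
  have M1 : 0 < M + 1 by rewrite ltr_wpDl.
  have [|h [tuh ah] gh] := app (e / (M + 1)); first by rewrite divr_gt0.
  exists (conv h a) => // x.
  rewrite -fsecNE -fsecDE -(convBl _ bUV (supp _ tug) (supp _ tuh)).
  apply: le_lt_trans (small M0 e0); rewrite mulrC.
  have sgh : supported (set_gmul U V) (g - h).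
    by move=> y ny; rewrite fsecDE fsecNE !supp// subrr.
  apply: (norm_conv x bUV sgh) => //; first by rewrite divr_ge0// ltW.
  by move=> y; apply: ltW; exact: gh.
- move=> _ [g [h [tg uh ->]]]; split; first by apply: sub_uniform_span; exists g, h.
  have [sg _ _] := tU _ tg; have [sh _ _] := uV _ uh.
  rewrite -(convA a bU bV sg sh).
  by apply: sub_uniform_span; exists g, (conv h a); split=> //; exact: bb_ract.
Qed.

Definition bb_mul t u : bisection_bimodule :=
  @BisectionBimodule (LinSub (uniform_span_linear (bb_products t u)))
    (bb_mul_bisection t u) (@uniform_span_closed _)
    (@bb_mul_lact t u) (@bb_mul_ract t u).

Lemma bb_one_bisection :
  exists2 U : set G, bisection U & C0 X `<=` (C0 U : set (fsec B)).
Proof. by exists X. Qed.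

Definition bb_one : bisection_bimodule :=
  @BisectionBimodule (LinSub (C0_linear B X)) bb_one_bisection
    (@C0_closed _ _ B X) (@C0_units_conv _ _ B) (@C0_units_conv _ _ B).

Local Notation A := (C0_cstar B).

Section Fibre.
Variable t : bisection_bimodule.
Local Notation E := (linsub_elt (bbset t)).

Lemma bb_rip_C0 (x y : E) : C0 X (conv (adj (lval x)) (lval y)).
Proof.
have [U bU tU] := bb_bisection t.
have bU' := bisection_inv bU; have [UUo _ _] := bisection_mul bU' bU.
apply: (C0_ext (set_gmulVg bU) UUo bX).
by apply: C0_conv => //; [apply: C0_adj|]; apply: tU; exact: lvalP.
Qed.

Lemma bb_lip_C0 (x y : E) : C0 X (conv (lval x) (adj (lval y))).
Proof.
have [U bU tU] := bb_bisection t.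
have bU' := bisection_inv bU; have [UUo _ _] := bisection_mul bU bU'.
apply: (C0_ext (set_gmulgV bU) UUo bX).
by apply: C0_conv => //; [|apply: C0_adj]; apply: tU; exact: lvalP.
Qed.

Definition bb_bimodule : bimodule_data A :=
  @BimoduleData R A E
    (fun a x => LinSubElt (bb_lact (C0_eltP a) (lvalP x)))
    (fun x a => LinSubElt (bb_ract (lvalP x) (C0_eltP a)))
    (fun x y => C0_elt (bb_rip_C0 x y))
    (fun x y => C0_elt (bb_lip_C0 x y)).

End Fibre.

Lemma bb_mu_subproof t u (x : bb_bimodule t) (y : bb_bimodule u) :
  linsub_set (bbset (bb_mul t u)) (conv (lval x) (lval y)).
Proof.
by apply: sub_uniform_span; exists (lval x), (lval y); split=> //; exact: lvalP.
Qed.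

Definition fell_action : action_data A :=
  @ActionData R A (SemigroupData bb_mul bb_one) bb_bimodule
    (fun t u x y => LinSubElt (bb_mu_subproof x y)) (fun a => a).

End BisectionAction.

(* Main.v *)
(* Suppose that some [x] in [E_t I^perp] satisfies [|axa| >= e] for all positive
   norm one elements [a] of a hereditary subalgebra [D]. Then every irreducible
   representation [rho] that does not kill [D] is equivalent to the representation
   [E_t (x) rho] that it induces. If [xd <> 0] with [d] in [D], the germs of [t] at
   the [rho] not killing [<xd|xd>] therefore form a non-empty open set of arrows
   with equal source and range. It contains no unit because [xd] is killed by the
   source ideals of all [v <= t, 1] and kernels of irreducible representations are
   prime. This contradicts topological freeness.

   To see that [rho] induces itself, let [xi] be a unit vector in the range of
   [rho(D)]. There is no [a'] in [D] with [0 <= a' <= 1] that almost fixes [xi] and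
   almost kills [x (x) xi], since it would give rise to a peak element [a] with
   [axa] small. A minimax argument turns this into a single vector [zeta <> 0] and
   [y = d'x] such that [|rho(a) zeta|^2 <= C |ay (x) xi|^2] for all [a]. So
   [ay (x) xi |-> rho(a) zeta] defines a non-zero intertwiner, and Schur's lemma
   for bounded invariant forms makes it a multiple of a unitary. *)

From HB Require Import structures.
From mathcomp Require Import all_boot all_order all_algebra complex ring lra.
From mathcomp Require Import boolp classical_sets functions.
From mathcomp Require Import reals topology normedtype.
Require Import Defs.

Set Implicit Arguments.
Unset Strict Implicit.
Unset Printing Implicit Defensive.

Import Order.TTheory GRing.Theory Num.Theory numFieldNormedType.Exports.

Local Open Scope classical_set_scope.
Local Open Scope ring_scope.

(** * Seminorms and positive semidefinite forms *)

(** Spectral theory is replaced by explicit constructions. Square roots come from Visser's iteration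
    for [1 - sqrt (1 - y)], peak elements are high powers and cut-offs are [1 - (1 - u)^n]. The last
    two are controlled by the moments [<v, q^j v>] of an operator [0 <= q <= 1], which form a
    decreasing convex sequence. The estimates must hold at once for an irreducible representation
    and for the left action on [E_t] with the form [<x (x) xi, y (x) xi>]; hence they are stated for
    arbitrary semi-inner product spaces with an involution-preserving action.

    A minimax argument enters because non-flatness provides, for each [k] in [D], a vector depending
    on [k], whereas an intertwiner requires one vector for all [k]. The penalty
    [2 <xi, z> - |z|^2 - <z, k z>] is concave in [z] and affine in [k], so the quantifiers can be
    exchanged.

    Fell bundles are covered by the same theorem: its hypotheses are pre-bimodules, reflexivity of
    the order and transitivity of germs, and these are checked directly on spaces of sections. *)

Local Notation re := complex.Re.
Local Notation im := complex.Im.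

Section ComplexFacts.
Variable R : realType.
Implicit Types (z w : R[i]) (r : R).

Lemma reD z w : re (z + w) = re z + re w.
Proof. by case: z w => [a b] [c d]. Qed.

Lemma reN z : re (- z) = - re z.
Proof. by case: z. Qed.

Lemma reZ r z : re (r%:C%C * z) = r * re z.
Proof. by case: z => a b /=; rewrite mul0r subr0. Qed.

Lemma reJ z : re z^* = re z.
Proof. by case: z. Qed.

Lemma conjCr r : (r%:C%C : R[i])^* = r%:C%C.
Proof. by rewrite conj_Creal// complex_real. Qed.

Lemma re_iM z : re ('i%C * z) = - im z.
Proof. by case: z => a b /=; rewrite mul0r mul1r sub0r. Qed.

Lemma re_imP z w : re z = re w -> im z = im w -> z = w.
Proof. by case: z w => [a b] [c d] /= -> ->. Qed.

Lemma normC_re z : `|z| = (re `|z|)%:C%C.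
Proof. by rewrite RRe_real// normr_real. Qed.

Lemma le_re z w : z <= w -> re z <= re w.
Proof. by rewrite lecE => /andP[]. Qed.

Lemma gt0_re z : 0 < z -> exists2 r, 0 < r & z = r%:C%C.
Proof.
move=> z0; have zE : z = (re z)%:C%C by rewrite RRe_real// gtr0_real.
by exists (re z) => //; rewrite -(@ltcR R) -zE.
Qed.

Definition cabs z : R := re `|z|.

Lemma cabs_ge0 z : 0 <= cabs z.
Proof. by rewrite /cabs -(@lecR R) -normC_re; exact: normr_ge0. Qed.

Lemma cabs_real r : cabs r%:C%C = `|r|.
Proof. by rewrite /cabs normc_def/= expr0n/= addr0 sqrtr_sqr. Qed.

Lemma cabsM z w : cabs (z * w) = cabs z * cabs w.
Proof. by rewrite /cabs normrM normC_re [`|w|]normC_re -rmorphM. Qed.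

Lemma cabsJ z : cabs z^* = cabs z.
Proof. by rewrite /cabs norm_conjC. Qed.

Lemma cabs_sqr z : (cabs z ^+ 2)%:C%C = z^* * z.
Proof. by rewrite /cabs rmorphXn/= -normC_re normCK mulrC. Qed.

End ComplexFacts.

Section RealNorm.
Variable R : realType.

(** Norms take complex values; the real-valued copy gives access to linear arithmetic, suprema and
    square roots over [R]. *)
Definition nr (V : normedModType R[i]) (x : V) : R := re `|x|.

Section Facts.
Variable V : normedModType R[i].
Implicit Types (x y : V).

Lemma normE x : `|x| = (nr x)%:C%C.
Proof. by rewrite /nr RRe_real// normr_real. Qed.

Lemma nr_ge0 x : 0 <= nr x.
Proof. by rewrite -(@lecR R) -normE; exact: normr_ge0. Qed.

Lemma nrD x y : nr (x + y) <= nr x + nr y.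
Proof. by rewrite -(@lecR R) rmorphD/= -!normE ler_normD. Qed.

Lemma nrZ c x : nr (c *: x) = cabs c * nr x.
Proof. by apply: (@complexI R); rewrite rmorphM/= -!normE normrZ -normC_re. Qed.

Lemma nr0 : nr (0 : V) = 0.
Proof. by rewrite /nr normr0. Qed.

Lemma nr0_eq0 x : nr x = 0 -> x = 0.
Proof. by move=> x0; apply: normr0_eq0; rewrite normE x0. Qed.

Lemma nrN x : nr (- x) = nr x.
Proof. by rewrite /nr normrN. Qed.

Lemma nrB x y : nr (x - y) <= nr x + nr y.
Proof. by rewrite -[nr y]nrN nrD. Qed.

Lemma nr_distrC x y : nr (x - y) = nr (y - x).
Proof. by rewrite -nrN opprB. Qed.

End Facts.

(** Limits with respect to a bare function [n], which may be a norm that is not attached to a normed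
    module type, such as the norm of the unitization. *)
Definition slim (V : zmodType) (n : V -> R) (u : nat -> V) (l : V) : Prop :=
  forall e, 0 < e -> exists N, forall i, (N <= i)%N -> n (u i - l) < e.

Definition seq_complete (V : zmodType) (n : V -> R) : Prop :=
  forall u : nat -> V,
    (forall e, 0 < e -> exists N, forall i j,
      (N <= i)%N -> (N <= j)%N -> n (u i - u j) < e) ->
    exists l, slim n u l.

Lemma nr_complete (V : completeNormedModType R[i]) : seq_complete (@nr V).
Proof.
move=> u cu; have /cauchy_cvgP cvgu : cauchy (u @ \oo).
  apply/cauchy_ballP => e e0; rewrite !near_map2/=.
  have [r r0 eE] := gt0_re e0; have [N uN] := cu _ r0.
  exists (([set i | (N <= i)%N]), ([set i | (N <= i)%N])) => /=.
    by split; exists N.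
  by move=> [i j] /= [iN jN]; rewrite -ball_normE/= eE normE ltcR uN.
exists (lim (u @ \oo)) => e e0.
have e0' : 0 < e%:C%C :> R[i] by rewrite ltcR.
have /cvgrPdist_lt/(_ _ e0')[N _ uN] := cvgu.
by exists N => i /uN /=; rewrite normE ltcR nr_distrC.
Qed.

Lemma closed_slim (V : normedModType R[i]) (M : set V) (u : nat -> V) l :
  closed M -> (forall i, M (u i)) -> slim (@nr V) u l -> M l.
Proof.
move=> cM Mu ul; apply: (closed_cvg M cM (u_ := u) (F := \oo)) => //.
  by apply: nearW.
apply/cvgrPdist_lt => e e0; have [r r0 ->] := gt0_re e0.
have [N uN] := ul _ r0; exists N => // i /= iN.
by rewrite normE ltcR nr_distrC uN.
Qed.

Definition harm (n : nat) : R := n.+1%:R^-1.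

Lemma harm_gt0 n : 0 < harm n.
Proof. by rewrite invr_gt0. Qed.

Lemma harm_le i j : (i <= j)%N -> harm j <= harm i.
Proof. by move=> ij; rewrite lef_pV2 ?posrE// ler_nat. Qed.

Lemma harm_lt (e : R) : 0 < e -> exists N, forall i, (N <= i)%N -> harm i < e.
Proof.
move=> e0; exists (Num.bound e^-1) => i iN.
have e1 : 0 <= e^-1 by rewrite invr_ge0 ltW.
rewrite invf_plt ?posrE//; apply: lt_le_trans (archi_boundP e1) _.
by rewrite ler_nat; exact: leq_trans iN _.
Qed.

Lemma closed_nr (V : normedModType R[i]) (M : set V) x :
  closed M -> (forall e : R, 0 < e -> exists2 y, M y & nr (x - y) < e) -> M x.
Proof.
move=> cM Mx.
have Mn n : exists y, M y /\ nr (x - y) < harm n.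
  by have [|y My xy] := Mx (harm n); [exact: harm_gt0|exists y].
have [u uM] := choice Mn; apply: (closed_slim (u := u)) => //.
  by move=> i; have [] := uM i.
move=> e /harm_lt[N Ne]; exists N => i iN; rewrite nr_distrC.
by have [_ /lt_trans] := uM i; apply; exact: Ne.
Qed.

Lemma nr_closed (V : normedModType R[i]) (M : set V) :
  (forall x, (forall e : R, 0 < e -> exists2 y, M y & nr (x - y) < e) -> M x) ->
  closed M.
Proof.
move=> cl x xM; apply: cl => e e0.
have e0' : 0 < e%:C%C :> R[i] by rewrite ltcR.
have [y [My]] := xM _ (nbhsx_ballx x e%:C%C e0').
by rewrite -ball_normE/= normE ltcR; exists y.
Qed.

End RealNorm.

Section RealForm.
Variables (R : realType) (V : lmodType R[i]) (B : V -> V -> R).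

(** The real part of a possibly degenerate complex inner product. By [rfJ], multiplication by [c]
    has adjoint [c^*], and the complex form can be recovered as [B u v - i B u (i v)]. *)
Record real_form : Prop := RealForm {
  rfC : forall u v, B u v = B v u;
  rfD : forall u v w, B u (v + w) = B u v + B u w;
  rfZ : forall (r : R) u v, B u (r%:C%C *: v) = r * B u v;
  rf_ge0 : forall u, 0 <= B u u;
  rfJ : forall c u v, B u (c *: v) = B (c^* *: u) v }.

Definition qn (u : V) : R := Num.sqrt (B u u).

Hypothesis rB : real_form.

Lemma rfDl u v w : B (u + v) w = B u w + B v w.
Proof. by rewrite (rfC rB) (rfD rB) !(rfC rB w). Qed.

Lemma rfZl (r : R) u v : B (r%:C%C *: u) v = r * B u v.
Proof. by rewrite (rfC rB) (rfZ rB) (rfC rB v). Qed.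

Lemma rfN u v : B u (- v) = - B u v.
Proof. by rewrite -scaleN1r -(rmorphN1 (real_complex R)) (rfZ rB) mulN1r. Qed.

Lemma rfNl u v : B (- u) v = - B u v.
Proof. by rewrite (rfC rB) rfN (rfC rB). Qed.

Lemma rfB u v w : B u (v - w) = B u v - B u w.
Proof. by rewrite (rfD rB) rfN. Qed.

Lemma rfBl u v w : B (u - v) w = B u w - B v w.
Proof. by rewrite rfDl rfNl. Qed.

Lemma rf0 u : B u 0 = 0.
Proof. by rewrite -(subrr 0) rfB subrr. Qed.

Lemma rf_sqrB u v : B (u - v) (u - v) = B u u - 2 * B u v + B v v.
Proof. by rewrite rfB !rfBl (rfC rB v u); ring. Qed.

Lemma rf_sqrD u v : B (u + v) (u + v) = B u u + 2 * B u v + B v v.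
Proof. by rewrite (rfD rB) !rfDl (rfC rB v u); ring. Qed.

Lemma rf_CS u v : B u v ^+ 2 <= B u u * B v v.
Proof.
have key t : 0 <= B u u - 2 * t * B u v + t ^+ 2 * B v v.
  have := rf_ge0 rB (u - t%:C%C *: v).
  by rewrite rf_sqrB !rfZl !(rfZ rB); congr (_ <= _); ring.
have [v0|v0] := eqVneq (B v v) 0.
  rewrite v0 mulr0; have [->|uv0] := eqVneq (B u v) 0; first by rewrite expr0n.
  (* For this [t] the quadratic would take the value [-1]. *)
  have := key ((B u u + 1) / (2 * B u v)).
  rewrite v0 mulr0 addr0 (_ : 2 * _ * _ = B u u + 1); last by field.
  by lra.
have vv : 0 < B v v by rewrite lt_neqAle eq_sym v0 (rf_ge0 rB).
have := key (B u v / B v v).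
rewrite (_ : _ + _ = (B u u * B v v - B u v ^+ 2) / B v v); last by field.
by rewrite pmulr_lge0 ?invr_gt0// subr_ge0.
Qed.

Lemma qn_ge0 u : 0 <= qn u. Proof. exact: sqrtr_ge0. Qed.

Lemma qn_sqr u : qn u ^+ 2 = B u u.
Proof. by rewrite sqr_sqrtr// (rf_ge0 rB). Qed.

Lemma rf_abs u v : `|B u v| <= qn u * qn v.
Proof.
rewrite -ler_sqr ?nnegrE ?mulr_ge0 ?qn_ge0// exprMn !qn_sqr.
by rewrite real_normK ?num_real// rf_CS.
Qed.

Lemma rf_le u v : B u v <= qn u * qn v.
Proof. exact: le_trans (ler_norm _) (rf_abs u v). Qed.

Lemma qnD u v : qn (u + v) <= qn u + qn v.
Proof.
rewrite -ler_sqr ?nnegrE ?addr_ge0 ?qn_ge0// qn_sqr rf_sqrD sqrrD !qn_sqr.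
by rewrite -mulr_natl; have := rf_le u v; lra.
Qed.

Lemma qnZ c u : qn (c *: u) = cabs c * qn u.
Proof.
apply/eqP; rewrite -(@eqrXn2 _ 2)// ?mulr_ge0 ?qn_ge0 ?cabs_ge0//.
by rewrite exprMn !qn_sqr (rfJ rB) scalerA -cabs_sqr rfZl.
Qed.

Lemma qn_le u (b : R) : 0 <= b -> B u u <= b ^+ 2 -> qn u <= b.
Proof. by move=> b0 ub; rewrite -ler_sqr ?nnegrE ?qn_ge0// qn_sqr. Qed.

Lemma rf_parallelogram u v :
  B (u + v) (u + v) + B (u - v) (u - v) = 2 * B u u + 2 * B v v.
Proof. by rewrite rf_sqrD rf_sqrB; ring. Qed.

End RealForm.

(** * Convex sequences and moments of operators between 0 and 1 *)

Section ConvexSequence.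
Variables (R : realType) (m : nat -> R).
Hypothesis m_ge0 : forall j, 0 <= m j.
Hypothesis m_dec : forall j, m j.+1 <= m j.
Hypothesis m_cvx : forall j, m j.+1 - m j.+2 <= m j - m j.+1.

Lemma convex_steps i j : (i <= j)%N -> m j - m j.+1 <= m i - m i.+1.
Proof.
move=> /subnK <-; elim: (j - i)%N => [//|k ih].
exact: le_trans (m_cvx _) ih.
Qed.

(** The drops decrease, so each of the [n] drops from [j] to [j + n] is at least the next one. *)
Lemma convex_late j n : n%:R * (m (j + n) - m (j + n).+1) <= m j - m (j + n).
Proof.
elim: n => [|n ih]; first by rewrite mul0r addn0 subrr.
have := m_cvx (j + n); rewrite addnS -natr1 mulrDl mul1r.
have : n%:R * (m (j + n).+1 - m (j + n).+2) <= n%:R * (m (j + n) - m (j + n).+1).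
  by rewrite ler_wpM2l.
by move: ih; lra.
Qed.

Lemma convex_early n : m 0%N - m n <= n%:R * (m 0%N - m 1%N).
Proof.
elim: n => [|n ih]; first by rewrite mul0r subrr.
have := convex_steps (leq0n n); rewrite -natr1 mulrDl mul1r.
by move: ih; lra.
Qed.

(** The [n + 1] drops from [0] to [n + 1] add up to at most [m 0], and the last one is the
    smallest. *)
Lemma convex_decay n : m n - m n.+1 <= m 0%N / n.+1%:R.
Proof.
rewrite ler_pdivlMr// mulrC; have := convex_late 0 n; rewrite !add0n.
by have := m_ge0 n.+1; rewrite -natr1 mulrDl mul1r; lra.
Qed.

Lemma convex_le n : m n <= m 0%N.
Proof. by elim: n => [//|n ih]; exact: le_trans (m_dec n) ih. Qed.

End ConvexSequence.

Section Moments.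
Variables (R : realType) (V : lmodType R[i]) (B : V -> V -> R) (q : V -> V).
Hypothesis rB : real_form B.

(* The operator inequality [0 <= q <= 1], in the form [q^2 <= q]. *)
Record unit_interval_op : Prop := UnitIntervalOp {
  uioD : {morph q : u v / u + v};
  uioC : forall u v, B (q u) v = B u (q v);
  uio_le : forall u, B (q u) (q u) <= B u (q u) }.

Hypothesis hq : unit_interval_op.

Lemma uio_iterC j u v : B (iter j q u) v = B u (iter j q v).
Proof. by elim: j v => [//|j ih] v; rewrite [in RHS]iterSr -ih iterS (uioC hq). Qed.

Lemma uio0 : q 0 = 0.
Proof. by apply: (addrI (q 0)); rewrite -(uioD hq) !addr0. Qed.

Lemma uioN u : q (- u) = - q u.
Proof. by apply/eqP; rewrite -addr_eq0 -(uioD hq) addNr uio0. Qed.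

Lemma uioB u v : q (u - v) = q u - q v.
Proof. by rewrite (uioD hq) uioN. Qed.

Lemma uio_iterB j u v : iter j q (u - v) = iter j q u - iter j q v.
Proof. by elim: j => [//|j ih]; rewrite iterS ih uioB. Qed.

Lemma uio_ge0 u : 0 <= B u (q u).
Proof. exact: le_trans (rf_ge0 rB _) (uio_le hq u). Qed.

(** Cauchy-Schwarz and [q^2 <= q] give [<u, qu>^2 <= <u, u> <qu, qu> <= <u, u> <u, qu>]; divide by
    [<u, qu>]. *)
Lemma uio_le1 u : B u (q u) <= B u u.
Proof.
have [q0|q0] := eqVneq (B u (q u)) 0; first by rewrite q0 (rf_ge0 rB).
have q0' : 0 < B u (q u) by rewrite lt_neqAle eq_sym q0 uio_ge0.
rewrite -(ler_pM2r q0') -expr2; apply: le_trans (rf_CS rB _ _) _.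
by rewrite ler_wpM2l ?(rf_ge0 rB)// (uio_le hq).
Qed.

Definition moment (v : V) (j : nat) : R := B v (iter j q v).

Lemma momentD v i j : B (iter i q v) (iter j q v) = moment v (i + j).
Proof. by rewrite uio_iterC -iterD. Qed.

(** Half of the factors [q] are moved to the left; what remains is a square or, for odd [j], a value
    of the form of [q]. *)
Lemma moment_ge0 v j : 0 <= moment v j.
Proof.
have jE : j = (j./2 + (odd j + j./2))%N by rewrite addnCA addnn odd_double_half.
rewrite jE -momentD iterD; case: (odd j) => /=; first exact: uio_ge0.
exact: rf_ge0.
Qed.

(** The second difference at [j] is the [j]-th moment of [v - q v]. *)
Lemma moment_cvx v j : moment v j.+1 - moment v j.+2 <= moment v j - moment v j.+1.
Proof.
have := moment_ge0 (v - q v) j; rewrite /moment uio_iterB (rfB rB) !(rfBl rB).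
by rewrite -!iterSr !(uioC hq) -!iterS; lra.
Qed.

Lemma moment_dec v j : moment v j.+1 <= moment v j.
Proof.
have jE : j = (j./2 + (odd j + j./2))%N by rewrite addnCA addnn odd_double_half.
rewrite jE -addnS -!momentD; case: (odd j) => /=.
  by rewrite -(uioC hq) (uio_le hq).
exact: uio_le1.
Qed.

End Moments.

Lemma uio_compl (R : realType) (V : lmodType R[i]) (B : V -> V -> R) (q : V -> V) :
  real_form B -> unit_interval_op B q -> unit_interval_op B (fun u => u - q u).
Proof.
move=> rB hq; split=> [u v|u v|u].
- by rewrite (uioD hq) opprD addrACA.
- by rewrite (rfBl rB) (rfB rB) (uioC hq).
- rewrite (rf_sqrB rB) (rfB rB).
  by have := uio_le hq u; lra.
Qed.

(** * Hilbert spaces and a minimax theorem *)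

Section SmallNumbers.
Variable R : realType.

Lemma eps_le (x y : R) (K : R) : 0 <= K ->
  (forall e, 0 < e -> x <= y + e * K) -> x <= y.
Proof.
move=> K0 h; apply/ler_addgt0Pr => e e0.
have K1 : 0 < K + 1 by rewrite ltr_wpDl.
apply: le_trans (h (e / (K + 1)) (divr_gt0 e0 K1)) _.
by rewrite lerD2l mulrAC ler_pdivrMr// ler_pM2l// lerDl.
Qed.

Lemma eps_eq0 (x K : R) : 0 <= K -> (forall e, 0 < e -> `|x| <= e * K) -> x = 0.
Proof.
move=> K0 h; apply/eqP; rewrite -normr_eq0 eq_le normr_ge0 andbT.
by apply: (eps_le K0) => e /h; rewrite add0r.
Qed.

(** Serves to read off the first-order condition at the maximum in [riesz_on]. *)
Lemma quad_le0 (b c : R) : 0 <= c -> (forall t, 2 * t * b <= t ^+ 2 * c) -> b = 0.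
Proof.
move=> c0 h; have [//|b0] := eqVneq b 0; have := h (b / (c + 1)).
have c1 : 0 < c + 1 by rewrite ltr_wpDl.
have c1' : c + 1 != 0 by rewrite gt_eqF.
rewrite (_ : 2 * _ * b = (2 * (c + 1)) * (b / (c + 1)) ^+ 2); last by field.
have t0 : 0 < (b / (c + 1)) ^+ 2.
  by rewrite lt_neqAle sqr_ge0 eq_sym sqrf_eq0 mulf_neq0 ?invr_eq0.
by rewrite mulrC ler_pM2l//; lra.
Qed.

Lemma real_seq_complete : seq_complete (fun x : R => `|x|).
Proof.
move=> u cu; have /cauchy_cvgP cvgu : cauchy (u @ \oo).
  apply/cauchy_ballP => e e0; rewrite !near_map2/=.
  have [N uN] := cu _ e0.
  exists (([set i | (N <= i)%N]), ([set i | (N <= i)%N])) => /=.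
    by split; exists N.
  by move=> [i j] /= [iN jN]; rewrite -ball_normE/= uN.
exists (lim (u @ \oo)) => e e0; have /cvgrPdist_lt/(_ _ e0)[N _ uN] := cvgu.
by exists N => i /uN /=; rewrite distrC.
Qed.

End SmallNumbers.

Section HilbertForm.
Variables (R : realType) (H : hilbert_space R).
Implicit Types (h k l : H) (c : R[i]).

Definition hr h k : R := re (hip h k).

Lemma hipZ c h k : hip h (c *: k) = c * hip h k.
Proof.
have h0 : hip h 0 = 0.
  by apply: (addrI (1 * hip h 0)); rewrite -hip_linear scaler0 !addr0 mul1r.
by rewrite -[c *: k]addr0 hip_linear h0 addr0.
Qed.

Lemma hr_form : real_form hr.
Proof.
split=> [u v|u v w|r u v|u|c u v]; rewrite /hr.
- by rewrite hip_conj reJ.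
- by rewrite -[v]scale1r hip_linear mul1r scale1r reD.
- by rewrite hipZ reZ.
- by rewrite hip_norm normE -rmorphXn/= sqr_ge0.
- by rewrite (hip_conj v) !hipZ rmorphM/= conjCK -hip_conj.
Qed.

Lemma hr_norm h : hr h h = nr h ^+ 2.
Proof. by rewrite /hr hip_norm normE -rmorphXn. Qed.

Lemma nr_qn h : nr h = qn hr h.
Proof. by rewrite /qn hr_norm sqrtr_sqr ger0_norm ?nr_ge0. Qed.

Lemma hip_im h k : im (hip h k) = - hr h ('i%C *: k).
Proof. by rewrite /hr hipZ re_iM opprK. Qed.

Lemma hr_ext h k : (forall l, hr l h = hr l k) -> h = k.
Proof.
move=> e; apply/eqP; rewrite -subr_eq0; apply/eqP/nr0_eq0/eqP.
by rewrite -sqrf_eq0 -hr_norm (rfB hr_form) e subrr.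
Qed.

Lemma hr_le h k : `|hr h k| <= nr h * nr k.
Proof. by rewrite !nr_qn; apply: rf_abs; exact: hr_form. Qed.

(* Applied to [M = setT] this is the Riesz representation theorem, and applied
   to [F = hr xi] it is the orthogonal projection of [xi] to [M]. *)
Lemma riesz_on (M : set H) (F : H -> R) (K : R) :
  linear_subspace M -> closed M ->
  {morph F : h k / h + k} -> (forall (r : R) h, F (r%:C%C *: h) = r * F h) ->
  (forall h, M h -> F h <= K * nr h) ->
  exists2 u, M u & forall h, M h -> F h = hr h u.
Proof.
move=> [M0 Ml] cM FD FZ FK.
have MD h k : M h -> M k -> M (h + k) by move=> Mh Mk; rewrite -[h]scale1r; exact: Ml.
have MZ c h : M h -> M (c *: h) by move=> Mh; rewrite -[_ *: _]addr0; exact: Ml.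
have FN h : F (- h) = - F h.
  by rewrite -scaleN1r -(rmorphN1 (real_complex R)) FZ mulN1r.
(* For a representing vector [u] this is [|u|^2 - |u - h|^2], so [u] is sought as the maximiser on
   [M]. *)
pose g h := 2 * F h - nr h ^+ 2.
pose S : set R := [set g h | h in M].
have Sub : has_sup S.
  split; first by exists (g 0); exists 0.
  exists (K ^+ 2) => _ [h Mh <-]; rewrite /g; have := FK _ Mh.
  by have := sqr_ge0 (K - nr h); rewrite sqrrB; lra.
pose m := sup S.
have gm h : M h -> g h <= m by move=> Mh; apply: ub_le_sup; [exact: Sub.2|exists h].
(* Parallelogram law: two near-maximisers are close, because their midpoint cannot exceed the
   supremum. *)
have mid h k (s : R) : M h -> M k -> m - s <= g h -> m - s <= g k ->
    nr (h - k) ^+ 2 <= 4 * s.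
  move=> Mh Mk gh gk; have := gm _ (MZ (2^-1)%:C%C _ (MD _ _ Mh Mk)).
  have := rf_parallelogram hr_form h k; rewrite -!hr_norm.
  rewrite /g in gh gk *; rewrite -!hr_norm in gh gk *.
  rewrite FZ FD (rfZ hr_form) (rfZl hr_form); move: gh gk.
  set a := F h; set b := F k; set c := hr h h; set d := hr k k.
  by set x := hr (h + k) _; set y := hr (h - k) _; lra.
have near n : exists h, M h /\ m - harm R n < g h.
  have n0 := @harm_gt0 R n.
  by have [_ [h Mh <-] gh] := sup_adherent n0 Sub; exists h.
have [z zP] := choice near.
have cz : exists l, slim (@nr _ H) z l.
  apply: nr_complete => e e0.
  have e4 : 0 < e ^+ 2 / 4 by rewrite divr_gt0// exprn_gt0.
  have [N Ne] := harm_lt e4; exists N => i j iN jN.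
  rewrite -ltr_sqr ?nnegrE ?nr_ge0 ?ltW//.
  have [Mi gi] := zP i; have [Mj gj] := zP j.
  have lei := @harm_le R _ _ iN; have lej := @harm_le R _ _ jN.
  have := Ne N (leqnn _).
  have gi' : m - harm R N <= g (z i) by lra.
  have gj' : m - harm R N <= g (z j) by lra.
  by have := mid _ _ _ Mi Mj gi' gj'; lra.
have [u zu] := cz; have Mu : M u.
  by apply: closed_slim zu => // i; have [] := zP i.
exists u => // h Mh.
have gcont (k : H) : M k -> forall s : R, 0 < s ->
    exists2 z', M z' & m - s <= g z' /\ nr (z' - u) * nr k <= s.
  move=> Mk s s0; have k1 : 0 < nr k + 1 by rewrite ltr_wpDl ?nr_ge0.
  have [N1 N1P] := zu _ (divr_gt0 s0 k1); have [N2 N2P] := harm_lt s0.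
  have [Mz gz] := zP (maxn N1 N2); exists (z (maxn N1 N2)) => //; split.
    by have := N2P _ (leq_maxr N1 N2); lra.
  have := N1P _ (leq_maxl N1 N2); rewrite ltr_pdivlMr// => lt.
  by apply: le_trans (ltW lt); rewrite ler_wpM2l ?nr_ge0// lerDl.
suff : F h - hr h u = 0 by move/eqP; rewrite subr_eq0 => /eqP.
apply: (@quad_le0 _ _ (nr h ^+ 2)) => [|t]; first exact: sqr_ge0.
apply: (@eps_le _ _ _ (1 + 2 * `|t|)); first by rewrite addr_ge0// mulr_ge0.
move=> s s0; have [z' Mz' [gz' uz']] := gcont h Mh s s0.
have := gm _ (MD _ _ Mz' (MZ t%:C%C _ Mh)).
rewrite /g in gz' *; rewrite -!hr_norm in gz' *.
rewrite FD FZ (rf_sqrD hr_form) !(rfZ hr_form) (rfZl hr_form).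
have := hr_le (z' - u) h; rewrite (rfBl hr_form) (rfC hr_form u h) => le1.
have : `|t| * `|hr z' h - hr h u| <= `|t| * s.
  by rewrite ler_wpM2l//; apply: le_trans le1 _.
rewrite -normrM => /(le_trans (ler_norm _)).
by move: gz'; rewrite mulrBr mulrDr; lra.
Qed.

Lemma riesz (F : H -> R) (K : R) :
  {morph F : h k / h + k} -> (forall (r : R) h, F (r%:C%C *: h) = r * F h) ->
  (forall h, F h <= K * nr h) -> exists u, forall h, F h = hr h u.
Proof.
move=> FD FZ FK.
have lT : linear_subspace [set: H] by [].
have [|u _ uP] := riesz_on (K := K) lT closedT FD FZ; first by move=> h _.
by exists u => h; rewrite uP.
Qed.

End HilbertForm.

Lemma hip_eq (R : realType) (H H' : hilbert_space R) (h k : H) (h' k' : H') :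
  hr h k = re (hip h' k') -> hr h ('i%C *: k) = re (hip h' ('i%C *: k')) ->
  hip h k = hip h' k'.
Proof.
move=> e e'; apply: re_imP; first exact: e.
by rewrite hip_im e' hipZ re_iM opprK.
Qed.

(* For a positive operator [k], the supremum over [z] of [penalty z k] is
   <xi, (1 + k)^-1 xi>. Minimising it over the convex set [L] gives a sequence of
   near-maximisers that is Cauchy by strict concavity, and its limit works for
   all [k] in [L] simultaneously. *)
Section Minimax.
Variables (R : realType) (H : hilbert_space R) (xi : H).
Variables (T : Type) (L : T -> Prop) (k : T -> H -> H).
Variable mix : R -> T -> T -> T.

Definition penalty (z : H) (t : T) : R :=
  2 * hr xi z - nr z ^+ 2 - hr z (k t z).

Hypothesis kD : forall t, {morph k t : u v / u + v}.
Hypothesis kC : forall t, L t -> forall u v, hr (k t u) v = hr u (k t v).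
Hypothesis kge0 : forall t, L t -> forall u, 0 <= hr u (k t u).
Hypothesis kK : forall t, L t -> exists2 K, 0 <= K & forall u, nr (k t u) <= K * nr u.
Hypothesis mixL : forall r s t, 0 <= r <= 1 -> L s -> L t -> L (mix r s t).
Hypothesis mixE : forall r s t u, 0 <= r <= 1 -> L s -> L t ->
  k (mix r s t) u = (1 - r)%:C%C *: k s u + r%:C%C *: k t u.

Let rB := @hr_form R H.

Let penalty_le z t : L t -> penalty z t <= nr xi ^+ 2.
Proof.
move=> Lt; rewrite /penalty -!hr_norm.
have := rf_ge0 rB (xi - z); rewrite (rf_sqrB rB).
by have := kge0 Lt z; lra.
Qed.

Let phi t : R := sup (range (penalty^~ t)).

Let has_sup_phi t : L t -> has_sup (range (penalty^~ t)).
Proof.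
move=> Lt; split; first by exists (penalty 0 t); exists 0.
by exists (nr xi ^+ 2) => _ [z _ <-]; exact: penalty_le.
Qed.

Let phi_ub z t : L t -> penalty z t <= phi t.
Proof. by move=> Lt; apply: ub_le_sup; [exact: (has_sup_phi Lt).2|exists z]. Qed.

Let phi_adh t s : L t -> 0 < s -> exists z, phi t - s < penalty z t.
Proof. by move=> Lt s0; have [_ [z _ <-]] := sup_adherent s0 (has_sup_phi Lt); exists z. Qed.

Let penalty_mix z r s t : 0 <= r <= 1 -> L s -> L t ->
  penalty z (mix r s t) = (1 - r) * penalty z s + r * penalty z t.
Proof.
by move=> r01 Ls Lt; rewrite /penalty mixE// (rfD rB) !(rfZ rB); ring.
Qed.

(* strict concavity of [penalty] in the first argument *)
Let near_max z z' t (s : R) : L t ->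
  phi t - s <= penalty z t -> phi t - s <= penalty z' t -> nr (z - z') ^+ 2 <= 4 * s.
Proof.
move=> Lt; have kDt := kD t; have kCt := kC Lt.
have kZ u : k t ((2^-1)%:C%C *: u) = (2^-1)%:C%C *: k t u.
  have e : u = (2^-1)%:C%C *: u + (2^-1)%:C%C *: u.
    by rewrite -scalerDl -rmorphD/= (_ : 2^-1 + 2^-1 = 1) ?scale1r//; lra.
  rewrite {2}e kDt scalerDr -scalerDl -rmorphD/=.
  by rewrite (_ : 2^-1 + 2^-1 = 1) ?scale1r//; lra.
have kN u : k t (- u) = - k t u.
  have k0 : k t 0 = 0 by apply: (addrI (k t 0)); rewrite -kDt !addr0.
  by apply/eqP; rewrite -addr_eq0 -kDt addNr k0.
have := phi_ub ((2^-1)%:C%C *: (z + z')) Lt; rewrite /penalty -!hr_norm.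
rewrite kZ kDt !(rfZ rB) !(rfZl rB) !(rfD rB) !(rfDl rB).
have := kge0 Lt (z - z'); rewrite kDt kN !(rfB rB) !(rfBl rB).
rewrite ?(rfN rB) ?(rfNl rB) ?(rfN rB) (rfC rB z' z) -(kCt z' z) (rfC rB (k t z') z).
by lra.
Qed.

Lemma minimax (d : R) (t0 : T) : L t0 -> 0 < d ->
  (forall t, L t -> exists z, d <= penalty z t) ->
  exists z, forall t, L t -> d <= penalty z t.
Proof.
move=> Lt0 d0 hd; pose S : set R := [set phi t | t in L].
have dphi t : L t -> d <= phi t.
  by move=> Lt; have [z /le_trans] := hd _ Lt; apply; exact: phi_ub.
have infS : has_inf S.
  by split; [exists (phi t0); exists t0|exists d => _ [t Lt <-]; exact: dphi].
pose m := inf S.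
have mphi t : L t -> m <= phi t by move=> Lt; apply: ge_inf; [exact: infS.2|exists t].
have dm : d <= m by apply: lb_le_inf; [exact: infS.1|move=> _ [t Lt <-]; exact: dphi].
(* Approximate saddle points: a parameter that nearly minimises [phi], with a vector that nearly
   maximises the penalty for it. *)
pose good s (p : T * H) := [/\ L p.1, phi p.1 <= m + s & m - s <= penalty p.2 p.1].
have good_ex s : 0 < s -> exists p, good s p.
  move=> s0; have [_ [t Lt <-] pt] := inf_adherent s0 infS.
  have [z pz] := phi_adh Lt s0; exists (t, z); split=> //=; first exact: ltW.
  by have := mphi _ Lt; lra.
(* Both vectors are compared with a near-maximiser [z] for the midpoint of the two parameters; the
   penalty being affine in the parameter, [z] is nearly maximal for each of them. *)
have good_close s p q : 0 < s -> good s p -> good s q ->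
    nr (p.2 - q.2) <= 8 * Num.sqrt s.
  move=> s0 [Lp pp gp] [Lq pq gq].
  have h01 : 0 <= (2^-1 : R) <= 1 by rewrite invr_ge0 ler0n invf_le1// ler1n.
  have Lm := mixL h01 Lp Lq; have [z pz] := phi_adh Lm s0.
  have := mphi _ Lm; move: pz; rewrite (penalty_mix z h01 Lp Lq).
  set f := phi _ => pz mf; have up := phi_ub z Lp; have uq := phi_ub z Lq.
  have close r : good s r -> m - 3 * s <= penalty z r.1 ->
      nr (z - r.2) <= 4 * Num.sqrt s.
    move=> [Lr pr gr] zr; have : nr (z - r.2) ^+ 2 <= 4 * (4 * s).
      by apply: near_max Lr _ _; lra.
    move=> le; rewrite -ler_sqr ?nnegrE ?nr_ge0 ?mulr_ge0 ?sqrtr_ge0//.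
    have ss : Num.sqrt s ^+ 2 = s by rewrite sqr_sqrtr ?ltW.
    by rewrite exprMn ss expr2 -mulrA.
  have zp : nr (z - p.2) <= 4 * Num.sqrt s by apply: (close p); [split|lra].
  have zq : nr (z - q.2) <= 4 * Num.sqrt s by apply: (close q); [split|lra].
  have -> : p.2 - q.2 = (z - q.2) - (z - p.2) by rewrite opprB [RHS]addrC addrA subrK.
  by apply: le_trans (nrB _ _) _; lra.
have hn n : 0 < (harm R n) ^+ 2 by rewrite exprn_gt0// harm_gt0.
have [g gP] := choice (fun n => good_ex _ (hn n)).
have good_le s s' p : s <= s' -> good s p -> good s' p.
  by move=> ss' [Lp pp gp]; split=> //; lra.
have g_close i j : (i <= j)%N -> nr ((g i).2 - (g j).2) <= 8 * harm R i.
  move=> ij; have := @good_close (harm R i ^+ 2) (g i) (g j) (hn i) (gP i).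
  rewrite sqrtr_sqr ger0_norm ?(ltW (harm_gt0 _ _))//; apply.
  apply: good_le (gP j).
  by rewrite lerXn2r ?nnegrE ?(ltW (harm_gt0 _ _)) ?harm_le.
have [zeta zetaP] : exists l, slim (@nr _ H) (fun n => (g n).2) l.
  apply: nr_complete => e e0; have e8 : 0 < e / 16 by rewrite divr_gt0.
  have [N NP] := harm_lt e8; exists N => i j iN jN.
  have := g_close _ _ iN; have := g_close _ _ jN; have := NP _ (leqnn N).
  have -> : (g i).2 - (g j).2 = ((g N).2 - (g j).2) - ((g N).2 - (g i).2).
    by rewrite opprB [RHS]addrC addrA subrK.
  have := nrB ((g N).2 - (g j).2) ((g N).2 - (g i).2); lra.
have zeta_close n : nr ((g n).2 - zeta) <= 9 * harm R n.
  have n0 := @harm_gt0 R n.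
  have [N NP] := zetaP _ n0; have := NP _ (leq_maxl N n).
  have := g_close _ _ (leq_maxr N n); set j := maxn N n => c1 c2.
  by have := nrD ((g n).2 - (g j).2) ((g j).2 - zeta); rewrite addrA subrK; lra.
exists zeta => t Lt; apply: (le_trans dm).
have [K K0 kKt] := kK Lt; have kCt := kC Lt.
(* Passing from [z] to [zeta] costs terms of order [e]: the quadratic terms of the difference have
   the favourable sign. *)
suff close e : 0 < e -> exists2 z, nr (z - zeta) <= e & m - e <= penalty z t.
  apply: (@eps_le _ _ _ (1 + 2 * nr xi + 2 * nr zeta + 2 * (K * nr zeta))).
    by rewrite !addr_ge0// !mulr_ge0// nr_ge0.
  move=> e /close[z zw mz].
  have [w zE we] : exists2 w, z = zeta + w & nr w <= e.
    by exists (z - zeta) => //; rewrite addrC subrK.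
  have bnd u : `|hr u w| <= nr u * e.
    by apply: le_trans (hr_le _ _) _; rewrite ler_wpM2l ?nr_ge0.
  have b1 := le_trans (ler_norm _) (bnd xi).
  have b2 : - hr zeta w <= nr zeta * e.
    by apply: le_trans (bnd zeta); rewrite -normrN ler_norm.
  have b3 : - hr w (k t zeta) <= K * nr zeta * e.
    rewrite (rfC rB); apply: le_trans (_ : nr (k t zeta) * e <= _).
      by apply: le_trans (bnd _); rewrite -normrN ler_norm.
    by rewrite ler_wpM2r ?kKt// (le_trans _ we)// nr_ge0.
  have b4 := kge0 Lt w; have b5 := sqr_ge0 (nr w).
  move: mz; rewrite /penalty zE kD -!hr_norm (rf_sqrD rB) !(rfD rB) !(rfDl rB).
  by rewrite -(kCt zeta w) (rfC rB (k t zeta)) !hr_norm; lra.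
(* [z] nearly maximises the penalty of a small perturbation of a near-minimiser
   in the direction of [t] *)
move=> e0; pose X := nr xi ^+ 2; have X0 : 0 <= X by exact: sqr_ge0.
have e1 : 0 < e / 20 by rewrite divr_gt0.
have e2 : 0 < e ^+ 2 / (16 * (3 + 2 * X)).
  by rewrite divr_gt0 ?exprn_gt0// mulr_gt0// ltr_wpDr// mulr_ge0.
have e3 : 0 < (2^-1 : R) by rewrite invr_gt0.
have [N1 N1P] := harm_lt e1; have [N2 N2P] := harm_lt e2.
have [N3 N3P] := harm_lt e3; pose n := maxn N1 (maxn N2 N3).
have := N1P n (leq_maxl _ _); have := N2P n _; have := N3P n _.
rewrite !leq_max !leqnn !orbT => /(_ isT) s3 /(_ isT) s2 s1.
have s0 := @harm_gt0 R n.
have := gP n; have := zeta_close n; move: s0 s1 s2 s3.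
set s := harm R n; case: (g n) => [t' z'] s0 s1 s2 s3 /= zz [/= Lt' p' g'].
have s01 : 0 <= s <= 1 by lra.
have Lm := mixL s01 Lt' Lt; have [z pz] := phi_adh Lm (hn n).
have := mphi _ Lm; have eP := penalty_mix z s01 Lt' Lt; move: pz; rewrite -/s.
rewrite {}eP => pz mp; have up := phi_ub z Lt'; have uq : penalty z t <= X := penalty_le z Lt.
(* The defect [s ^+ 2] of near-optimality is divided by the weight [s] of [t] in the mixture, which
   leaves an error of order [s]. *)
have Q : m - 2 * s <= penalty z t.
  rewrite -(ler_pM2l s0); have : (1 - s) * penalty z t' <= (1 - s) * (m + s ^+ 2).
    by rewrite ler_wpM2l//; lra.
  have : 0 <= s ^+ 3 by rewrite exprn_ge0// ltW.
  by lra.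
(* On the other hand [z] is nearly maximal for [t'], hence close to [z'] by strict concavity, and so
   to [zeta]. *)
have P : m - 2 * s * (1 + X) <= penalty z t'.
  have ss : s ^+ 2 <= s by rewrite expr2 ler_piMl//; lra.
  have : s * penalty z t <= s * X by rewrite ler_wpM2l// ltW.
  have : m - s - s * X <= (1 - s) * penalty z t' -> m - 2 * s * (1 + X) <= penalty z t'.
    move=> h; have [p0|p0] := leP 0 (penalty z t').
      have : s * penalty z t' >= 0 by rewrite mulr_ge0// ltW.
      have : 0 <= s * X by rewrite mulr_ge0// ltW.
      by lra.
    have : (1 - 2 * s) * penalty z t' <= 0 by rewrite mulr_ge0_le0 ?ltW//; lra.
    by lra.
  by move=> imp le; apply: imp; lra.
exists z; last by lra.
have zz' : nr (z - z') <= e / 2.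
  rewrite -ler_sqr ?nnegrE ?nr_ge0 ?divr_ge0 ?(ltW e0)//.
  have ss : s ^+ 2 <= s by rewrite expr2 ler_piMl//; lra.
  have sX : 0 <= s * X by rewrite mulr_ge0// ltW.
  apply: le_trans (near_max (s := s * (3 + 2 * X)) Lt' _ _) _; [lra|lra|].
  move: s2; rewrite ltr_pdivlMr; last by rewrite mulr_gt0// ltr_wpDr// mulr_ge0.
  by rewrite exprMn exprVn; lra.
have := nrD (z - z') (z' - zeta); rewrite addrA subrK.
by lra.
Qed.

End Minimax.

(** * Completion of a semi-inner product space *)

(* The Hilbert space completion of a semi-inner product space [V], realised as the
   space of those real-linear functionals on [V] that are limits of the
   functionals [B _ u]. *)
Section Completion.
Variables (R : realType) (V : lmodType R[i]) (B : V -> V -> R).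
Hypothesis rB : real_form B.

(** Closeness of [F] and [B _ u] in the dual norm, multiplied out so as to cover vectors of seminorm
    zero. *)
Definition appx (d : R) (F : V -> R) (u : V) : Prop :=
  forall w, `|F w - B w u| <= d * qn B w.

(* The vacuous [let] makes the type depend on [rB]. *)
Record completion := Completion {
  cfun :> V -> R;
  cappx : let _ := rB in forall d, 0 < d -> exists u, appx d cfun u }.
Implicit Types F G : completion.

Lemma cext F G : (forall w, F w = G w) -> F = G.
Proof.
case: F G => [f pf] [g pg] /= /funext fg; subst g; congr Completion.
exact: Prop_irrelevance.
Qed.

Lemma cfunD F u v : F (u + v) = F u + F v.
Proof.
apply/eqP; rewrite -subr_eq0; apply/eqP.
apply: (@eps_eq0 _ _ (qn B (u + v) + qn B u + qn B v)).
  by rewrite !addr_ge0 ?qn_ge0.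
move=> d /(cappx F)[w Fw]; have a := Fw (u + v); have b := Fw u; have c := Fw v.
have -> : F (u + v) - (F u + F v) =
    (F (u + v) - B (u + v) w) - (F u - B u w) - (F v - B v w).
  by rewrite (rfDl rB); ring.
apply: le_trans (ler_normB _ _) _; rewrite !mulrDr lerD//.
by apply: le_trans (ler_normB _ _) _; rewrite lerD.
Qed.

Lemma cfunZ F (r : R) u : F (r%:C%C *: u) = r * F u.
Proof.
apply/eqP; rewrite -subr_eq0; apply/eqP.
apply: (@eps_eq0 _ _ (qn B (r%:C%C *: u) + `|r| * qn B u)).
  by rewrite !addr_ge0 ?mulr_ge0 ?qn_ge0.
move=> d /(cappx F)[w Fw]; have a := Fw (r%:C%C *: u); have b := Fw u.
have -> : F (r%:C%C *: u) - r * F u =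
    (F (r%:C%C *: u) - B (r%:C%C *: u) w) - r * (F u - B u w).
  by rewrite (rfZl rB); ring.
apply: le_trans (ler_normB _ _) _; rewrite [leRHS]mulrDr lerD// normrM mulrCA.
by rewrite ler_wpM2l.
Qed.

Lemma cfun_bounded F : exists2 K, 0 <= K & forall w, `|F w| <= K * qn B w.
Proof.
have [u Fu] := cappx F ltr01; exists (1 + qn B u).
  by rewrite addr_ge0 ?qn_ge0.
move=> w; rewrite -(subrK (B w u) (F w)); apply: le_trans (ler_normD _ _) _.
by rewrite mulrDl lerD// mulrC rf_abs.
Qed.

Lemma appx_sub d d' F u v : 0 <= d -> 0 <= d' -> appx d F u -> appx d' F v ->
  qn B (u - v) <= d + d'.
Proof.
move=> d0 d0' Fu Fv; set w := u - v.
have [->|w0] := eqVneq (qn B w) 0; first by rewrite addr_ge0.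
have w0' : 0 < qn B w by rewrite lt_neqAle eq_sym w0 qn_ge0.
rewrite -(ler_pM2r w0') -expr2 (qn_sqr rB) {2}/w (rfB rB).
have := Fu w; have := Fv w; rewrite !ler_norml => /andP[_ a] /andP[b _].
by rewrite mulrDl; lra.
Qed.

Lemma appx_cfun_app F G d (K : R) u v : (forall w, `|G w| <= K * qn B w) ->
  0 <= d -> 0 <= K -> appx d F u -> appx d F v -> `|G u - G v| <= 2 * K * d.
Proof.
move=> GK d0 K0 Fu Fv.
have -> : G u - G v = G (u - v).
  by rewrite cfunD -scaleN1r -(rmorphN1 (real_complex R)) cfunZ mulN1r.
apply: le_trans (GK _) _; have -> : 2 * K * d = K * (d + d) by ring.
by rewrite ler_wpM2l// (appx_sub d0 d0 Fu Fv).
Qed.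

Definition capprox F (n : nat) : V :=
  projT1 (cid (cappx F (harm_gt0 R n))).

Lemma capproxP F n : appx (harm R n) F (capprox F n).
Proof. by rewrite /capprox; case: cid. Qed.

Lemma appx_le d d' F u : d <= d' -> appx d F u -> appx d' F u.
Proof. by move=> dd Fu w; apply: le_trans (Fu w) _; rewrite ler_wpM2r ?qn_ge0. Qed.

Lemma cip_ex F G : exists l, slim (fun x : R => `|x|) (fun n => G (capprox F n)) l.
Proof.
apply: real_seq_complete => e e0; have [K K0 GK] := cfun_bounded G.
have K1 : 0 < 2 * K + 1 by rewrite ltr_wpDl// mulr_ge0.
have [N NP] := harm_lt (divr_gt0 e0 K1); exists N => i j iN jN.
have h := @harm_gt0 R N.
apply: (@le_lt_trans _ _ (2 * K * harm R N)).
  apply: (appx_cfun_app GK (ltW h) K0).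
    exact: appx_le (harm_le R iN) (capproxP F i).
  exact: appx_le (harm_le R jN) (capproxP F j).
have := NP N (leqnn N); rewrite ltr_pdivlMr// => lt.
by apply: le_lt_trans lt; rewrite mulrC ler_pM2l// lerDl.
Qed.

(** The inner product of [F] and [G] is the limit of the values of [G] at approximants of [F]; for
    [F = cemb v] it is [G v]. *)
Definition cip F G : R := projT1 (cid (cip_ex F G)).

Lemma cip_appx F G d (K : R) u : 0 <= d -> 0 <= K -> appx d F u ->
  (forall w, `|G w| <= K * qn B w) -> `|cip F G - G u| <= K * d.
Proof.
move=> d0 K0 Fu GK; rewrite /cip; case: cid => /= l lP.
apply: (@eps_le _ _ _ (1 + K)) => [|e e0]; first by rewrite addr_ge0.
have [N1 N1P] := lP _ e0; have [N2 N2P] := harm_lt e0; pose n := maxn N1 N2.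
have a := N1P n (leq_maxl _ _); have b := N2P n (leq_maxr _ _).
have c := appx_sub (ltW (harm_gt0 R n)) d0 (capproxP F n) Fu.
have -> : l - G u = (G (capprox F n) - G u) - (G (capprox F n) - l) by ring.
apply: le_trans (ler_normB _ _) _.
have -> : G (capprox F n) - G u = G (capprox F n - u).
  by rewrite cfunD -scaleN1r -(rmorphN1 (real_complex R)) cfunZ mulN1r.
have := GK (capprox F n - u); have := ler_wpM2l K0 c.
have := ler_wpM2l K0 (ltW b); rewrite mulrDr mulrDr mulr1 [e * K]mulrC.
by lra.
Qed.

Lemma cip_unique F G (l : R) :
  (forall e, 0 < e -> exists d u K, [/\ 0 <= d, 0 <= K, appx d F u,
    forall w, `|G w| <= K * qn B w & K * d + `|G u - l| <= e]) -> cip F G = l.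
Proof.
move=> h; apply/eqP; rewrite -subr_eq0; apply/eqP.
apply: (@eps_eq0 _ _ 1) => // e /h[d [u [K [d0 K0 Fu GK le]]]]; rewrite mulr1.
apply: le_trans le; have := cip_appx d0 K0 Fu GK.
have -> : cip F G - l = (cip F G - G u) + (G u - l) by ring.
by move=> a; apply: le_trans (ler_normD _ _) _; rewrite lerD2r.
Qed.

(* It suffices to identify [cip F G] along approximants of [F]. *)
Lemma cip_lim F G (l C : R) : 0 <= C ->
  (forall d u, 0 < d -> d <= 1 -> appx d F u -> `|G u - l| <= C * d) -> cip F G = l.
Proof.
move=> C0 h; have [K K0 GK] := cfun_bounded G; apply: cip_unique => e e0.
have D : 0 < K + C + 1 + e by lra.
have d0 : 0 < e / (K + C + 1 + e) by rewrite divr_gt0.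
have [u Fu] := cappx F d0; exists (e / (K + C + 1 + e)), u, K; split=> //.
  exact: ltW.
have d1 : e / (K + C + 1 + e) <= 1 by rewrite ler_pdivrMr//; lra.
have := h _ _ d0 d1 Fu.
have : (K + C) * (e / (K + C + 1 + e)) <= e.
  by rewrite mulrA ler_pdivrMr// mulrC ler_pM2l//; lra.
by rewrite mulrDl; lra.
Qed.

Lemma cipC F G : cip F G = cip G F.
Proof.
have [K K0 GK] := cfun_bounded G; have [K' K0' FK] := cfun_bounded F.
have [v1 Gv1] := cappx G ltr01.
have [u1 Fu1] := cappx F ltr01.
apply: (@cip_lim _ _ _ (K' + qn B u1 + qn B v1 + 4)).
  by rewrite !addr_ge0 ?qn_ge0.
move=> d u d0 d1 Fu; have [v Gv] := cappx G d0.
have e1 := Gv u; have e2 := Fu v.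
have e3 := cip_appx (ltW d0) K0' Gv FK.
have qu : qn B u <= qn B u1 + 2.
  have := appx_sub (ltW d0) ler01 Fu Fu1; have := qnD rB (u - u1) u1.
  by rewrite subrK; lra.
have qv : qn B v <= qn B v1 + 2.
  have := appx_sub (ltW d0) ler01 Gv Gv1; have := qnD rB (v - v1) v1.
  by rewrite subrK; lra.
have -> : G u - cip G F = (G u - B u v) - (F v - B v u) - (cip G F - F v).
  by rewrite (rfC rB v u); ring.
apply: le_trans (ler_normB _ _) _.
apply: le_trans (lerD (ler_normB _ _) (lexx _)) _.
have := ler_wpM2l (ltW d0) qu; have := ler_wpM2l (ltW d0) qv.
by rewrite !mulrDr !mulrDl; lra.
Qed.

Definition cemb_subproof v d (d0 : 0 < d) : exists u, appx d (B^~ v) u.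
Proof. by exists v => w; rewrite subrr normr0 mulr_ge0 ?qn_ge0 ?ltW. Qed.

Definition cemb v : completion := Completion (cemb_subproof v).

Lemma appx_cemb v : appx 0 (cemb v) v.
Proof. by move=> w; rewrite subrr normr0 mul0r. Qed.

Lemma cip_emb v G : cip (cemb v) G = G v.
Proof.
have [K K0 GK] := cfun_bounded G; apply: cip_unique => e e0.
exists 0, v, K; split=> //; first exact: appx_cemb.
by rewrite mulr0 subrr normr0 addr0 ltW.
Qed.

HB.instance Definition _ := gen_eqMixin completion.
HB.instance Definition _ := gen_choiceMixin completion.

Let zero := cemb 0.

Lemma cadd_subproof F G d : 0 < d -> exists u, appx d (fun w => F w + G w) u.
Proof.
move=> d0; have d2 : 0 < d / 2 by rewrite divr_gt0.
have [u Fu] := cappx F d2; have [v Gv] := cappx G d2; exists (u + v) => w.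
have -> : F w + G w - B w (u + v) = (F w - B w u) + (G w - B w v).
  by rewrite (rfD rB); ring.
apply: le_trans (ler_normD _ _) _; rewrite [d]splitr mulrDl lerD//.
Qed.

Let add F G := Completion (@cadd_subproof F G).

(** If [F] is [B _ u], then [c *: u] corresponds to [w |-> B (c^* w) u]. *)
Lemma cscale_subproof (c : R[i]) F d : 0 < d ->
  exists u, appx d (fun w => F (c^* *: w)) u.
Proof.
move=> d0; have c1 : 0 < cabs c + 1 by rewrite ltr_wpDl ?cabs_ge0.
have [u Fu] := cappx F (divr_gt0 d0 c1); exists (c *: u) => w.
rewrite (rfJ rB); apply: le_trans (Fu _) _; rewrite (qnZ rB) cabsJ.
rewrite mulrA ler_wpM2r ?qn_ge0// mulrAC ler_pdivrMr// ler_wpM2l ?ltW//.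
by rewrite ltrDl.
Qed.

Let scale c F := Completion (@cscale_subproof c F).

Let cfun0 F : F 0 = 0.
Proof. by have := cfunZ F 0 0; rewrite mul0r scaler0. Qed.

Let cfunN F w : F (- w) = - F w.
Proof. by rewrite -scaleN1r -(rmorphN1 (real_complex R)) cfunZ mulN1r. Qed.

Let opp F := scale (- 1) F.
Let addA : associative add.
Proof. by move=> F G H; apply: cext => w /=; rewrite addrA. Qed.
Let addC : commutative add.
Proof. by move=> F G; apply: cext => w /=; rewrite addrC. Qed.
Let add0 : left_id zero add.
Proof. by move=> F; apply: cext => w /=; rewrite (rf0 rB) add0r. Qed.
Let addN : left_inverse zero opp add.
Proof.
move=> F; apply: cext => w /=.
by rewrite rmorphN rmorph1 scaleN1r cfunN addNr (rf0 rB).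
Qed.
HB.instance Definition _ := GRing.isZmodule.Build completion addA addC add0 addN.

Let scaleA a b F : scale a (scale b F) = scale (a * b) F.
Proof. by apply: cext => w /=; rewrite scalerA rmorphM mulrC. Qed.
Let scale1 : left_id 1 scale.
Proof. by move=> F; apply: cext => w /=; rewrite rmorph1 scale1r. Qed.
Let scaleDr : right_distributive scale +%R.
Proof. by move=> a F G; apply: cext. Qed.
Let scaleDl F : {morph scale^~ F : a b / a + b}.
Proof. by move=> a b; apply: cext => w /=; rewrite rmorphD scalerDl cfunD. Qed.
HB.instance Definition _ :=
  GRing.Zmodule_isLmodule.Build R[i] completion scaleA scale1 scaleDr scaleDl.

Lemma caddE F G w : (F + G) w = F w + G w. Proof. by []. Qed.
Lemma cscaleE c F w : (c *: F) w = F (c^* *: w). Proof. by []. Qed.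
Lemma coppE F w : (- F) w = - F w.
Proof. by rewrite -scaleN1r cscaleE rmorphN rmorph1 scaleN1r cfunN. Qed.

Lemma cip_form : real_form cip.
Proof.
split.
- exact: cipC.
- move=> F G H; have [K K0 GK] := cfun_bounded G; have [K' K0' HK] := cfun_bounded H.
  apply: (@cip_lim _ _ _ (K + K')); first by rewrite addr_ge0.
  move=> d u d0 _ Fu; have := cip_appx (ltW d0) K0 Fu GK.
  have := cip_appx (ltW d0) K0' Fu HK; rewrite caddE mulrDl => b a.
  have -> : G u + H u - (cip F G + cip F H) =
    - (cip F G - G u) - (cip F H - H u) by ring.
  by apply: le_trans (ler_normB _ _) _; rewrite normrN lerD.
- move=> r F G; have [K K0 GK] := cfun_bounded G.
  apply: (@cip_lim _ _ _ (`|r| * K)); first by rewrite mulr_ge0.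
  move=> d u d0 _ Fu; have := cip_appx (ltW d0) K0 Fu GK.
  rewrite cscaleE conjCr cfunZ -mulrBr normrM distrC -mulrA => a.
  by rewrite ler_wpM2l.
- move=> F; have [K K0 FK] := cfun_bounded F.
  have [u1 Fu1] := cappx F ltr01.
  apply: (@eps_le _ _ _ (qn B u1 + 2 + K)) => [|d d0].
    by rewrite !addr_ge0 ?qn_ge0.
  have [u Fu] : exists u, appx (Num.min d 1) F u.
    by apply: cappx; rewrite lt_min d0 ltr01.
  have m0 : 0 <= Num.min d 1 by rewrite le_min ltW//=.
  have dm : Num.min d 1 <= d by rewrite ge_min lexx.
  have d1 : Num.min d 1 <= 1 by rewrite ge_min lexx orbT.
  have a := cip_appx m0 K0 Fu FK; have b := Fu u; have c := rf_ge0 rB u.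
  have qu : qn B u <= qn B u1 + 2.
    have := appx_sub m0 ler01 Fu Fu1; have := qnD rB (u - u1) u1.
    by rewrite subrK; lra.
  have e1 := ler_pM m0 (qn_ge0 B u) dm qu; have e2 := ler_wpM2l K0 dm.
  move: a b; rewrite !ler_norml => /andP[a _] /andP[b _].
  by rewrite !mulrDr in e1 *; lra.
- move=> c F G; have [K K0 GK] := cfun_bounded (c *: G).
  have [K' K0' GK'] := cfun_bounded G.
  apply: (@cip_lim _ _ _ (cabs c * K')); first by rewrite mulr_ge0 ?cabs_ge0.
  move=> d u d0 _ Fu.
  have Fu' : appx (cabs c * d) (c^* *: F) (c^* *: u).
    move=> w; rewrite cscaleE (rfJ rB); apply: le_trans (Fu _) _.
    by rewrite (qnZ rB) conjCK [cabs c * d]mulrC mulrA.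
  have := cip_appx (mulr_ge0 (cabs_ge0 c) (ltW d0)) K0' Fu' GK'.
  by rewrite cscaleE distrC mulrA [K' * _]mulrC.
Qed.

Let cB := cip_form.

Lemma cfun_le F w : `|F w| <= qn cip F * qn B w.
Proof.
have e : qn cip (cemb w) = qn B w by rewrite /qn cip_emb.
by rewrite -cip_emb -e mulrC; exact: rf_abs.
Qed.

Lemma qn_cfun_le F d : 0 <= d -> (forall w, `|F w| <= d * qn B w) -> qn cip F <= d.
Proof.
move=> d0 Fd; apply: qn_le => //.
have F0 : appx d F 0 by move=> w; rewrite (rf0 rB) subr0.
have := cip_appx d0 d0 F0 Fd; rewrite cfun0 subr0 -expr2.
exact: le_trans (ler_norm _).
Qed.

Lemma qn_appx F u d : 0 <= d -> appx d F u -> qn cip (F - cemb u) <= d.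
Proof. by move=> d0 Fu; apply: qn_cfun_le => // w; rewrite caddE coppE. Qed.

Let cnorm F : R[i] := (qn cip F)%:C%C.

Let cnormD F G : cnorm (F + G) <= cnorm F + cnorm G.
Proof. by rewrite /cnorm -rmorphD/= lecR qnD. Qed.

Let cnormZ c F : cnorm (c *: F) = `|c| * cnorm F.
Proof. by rewrite /cnorm (qnZ cB) rmorphM/= -normC_re. Qed.

Let cnorm_eq0 F : cnorm F = 0 -> F = 0.
Proof.
move=> /complexI F0; apply: cext => w; have := cfun_le F w.
by rewrite F0 mul0r normr_le0 => /eqP ->; rewrite /= (rf0 rB).
Qed.

HB.instance Definition _ :=
  @Lmodule_isNormed.Build R[i] completion cnorm cnormD cnormZ cnorm_eq0.

Lemma nr_completion F : nr F = qn cip F. Proof. by []. Qed.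

Let ccomplete (X : set_system completion) : ProperFilter X -> cauchy X -> cvg X.
Proof.
move=> XF cX.
have X_near e : 0 < e -> exists F, \forall G \near X, nr (F - G) < e.
  move=> e0; have e0' : 0 < e%:C%C :> R[i] by rewrite ltcR.
  have /cauchy_ballP/(_ _ e0')/nearP_dep/filter_ex[F XP] := cX.
  exists F; apply: filterS XP => G; rewrite -ball_normE/= normE ltcR.
  by apply: le_lt_trans.
have [F FP] := choice (fun n => X_near _ (harm_gt0 R n)).
have Fc i j : nr (F i - F j) <= harm R i + harm R j.
  have [G [Fi Fj]] := filter_ex (filterI (FP i) (FP j)).
  rewrite -(subrKA G); apply: le_trans (nrD _ _) _.
  by rewrite lerD ?ltW// nr_distrC.
have f_ex w : exists l, slim (fun x : R => `|x|) (fun n => F n w) l.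
  apply: real_seq_complete => e e0.
  have q1 : 0 < 2 * (qn B w + 1) by rewrite mulr_gt0// ltr_wpDl ?qn_ge0.
  have [N NP] := harm_lt (divr_gt0 e0 q1); exists N => i j iN jN.
  have := Fc i j; rewrite nr_completion => c.
  have := cfun_le (F i - F j) w; rewrite caddE coppE => le.
  have q0 := qn_ge0 B w; have := ler_wpM2r q0 c.
  have := NP _ (leqnn N); rewrite ltr_pdivlMr// => lt.
  have h1 := harm_le R iN; have h2 := harm_le R jN.
  have := ler_wpM2r q0 h1; have := ler_wpM2r q0 h2.
  have := harm_gt0 R N; rewrite mulrDl.
  by move: lt le; rewrite mulrCA mulrDr mulr1; lra.
have [f fP] := choice f_ex.
have fF n w : `|f w - F n w| <= 2 * harm R n * qn B w.
  apply: (@eps_le _ _ _ (1 + qn B w)); first by rewrite addr_ge0 ?qn_ge0.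
  move=> e e0; have [N1 N1P] := fP w _ e0.
  have [N2 N2P] := harm_lt (harm_gt0 R n); have [N3 N3P] := harm_lt e0.
  pose m := maxn N1 (maxn N2 N3).
  have a := N1P m (leq_maxl _ _).
  have b : harm R m < harm R n by apply: N2P; rewrite !leq_max leqnn !orbT.
  have -> : f w - F n w = (F m - F n) w - (F m w - f w).
    by rewrite caddE coppE; ring.
  apply: le_trans (ler_normB _ _) _.
  have := cfun_le (F m - F n) w; have := Fc m n; rewrite nr_completion => c.
  have q0 := qn_ge0 B w; have := ler_wpM2r q0 c; have := ler_wpM2r q0 (ltW b).
  have := mulr_ge0 (ltW e0) q0; rewrite !mulrDl mulrDr mulr1.
  by lra.
have fx d : 0 < d -> exists u, appx d f u.
  move=> d0; have d3 : 0 < d / 3 by rewrite divr_gt0.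
  have [N NP] := harm_lt d3; have := NP N (leqnn N) => lt.
  have [u Fu] := cappx (F N) d3; exists u => w.
  have -> : f w - B w u = (f w - F N w) + (F N w - B w u) by ring.
  apply: le_trans (ler_normD _ _) _; have := fF N w; have := Fu w.
  have := ler_wpM2r (qn_ge0 B w) (ltW lt); lra.
pose L := Completion fx; apply/cvg_ex; exists L.
apply/cvgrPdist_le => e e0; have [r r0 ->] := gt0_re e0.
have r3 : 0 < r / 3 by rewrite divr_gt0.
have [N NP] := harm_lt r3; have lt := NP N (leqnn N).
have LF : nr (L - F N) <= 2 * harm R N.
  rewrite nr_completion; apply: qn_cfun_le => [|w].
    by rewrite mulr_ge0// ltW ?harm_gt0.
  by rewrite caddE coppE.
apply: filterS (FP N) => G FG; rewrite normE lecR.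
rewrite -(subrKA (F N)); apply: le_trans (nrD _ _) _; lra.
Qed.

HB.instance Definition _ := Uniform_isComplete.Build completion ccomplete.

(** The form [cip] carries the real part; the imaginary part is forced by linearity in the second
    argument. *)
Definition chip F G : R[i] := Complex (cip F G) (- cip F ('i%C *: G)).

Let cipZ F (c : R[i]) G :
  cip F (c *: G) = re c * cip F G + im c * cip F ('i%C *: G).
Proof.
have {1}-> : c = (re c)%:C%C + (im c)%:C%C * 'i%C by rewrite mulrC -complexE.
by rewrite scalerDl (rfD cB) -scalerA !(rfZ cB).
Qed.

Let cip_ii F G : cip F ('i%C *: ('i%C *: G)) = - cip F G.
Proof. by rewrite scalerA -expr2 sqr_i scaleN1r (rfN cB). Qed.

Let chip_linear c F G H : chip F (c *: G + H) = c * chip F G + chip F H.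
Proof.
rewrite /chip; have -> : 'i%C *: (c *: G + H) = c *: ('i%C *: G) + 'i%C *: H.
  by rewrite scalerDr !scalerA mulrC.
rewrite !(rfD cB) !(cipZ _ c).
rewrite cip_ii; case: c => a b; apply: re_imP => /=; ring.
Qed.

Let chip_conj F G : chip G F = (chip F G)^*.
Proof.
apply: re_imP; rewrite /chip /=; first by rewrite cipC.
rewrite opprK (rfJ cB) cipC -(rfN cB) -scaleNr; congr (cip F (_ *: G)).
by apply: re_imP => /=; rewrite ?oppr0 ?opprK.
Qed.

Let chip_norm F : chip F F = `|F| ^+ 2.
Proof.
rewrite normE nr_completion -rmorphXn/= (qn_sqr cB); apply: re_imP => //=.
suff e : cip F ('i%C *: F) = - cip F ('i%C *: F) by move: e; lra.
rewrite {1}(rfJ cB) cipC -(rfN cB) -scaleNr; congr (cip F (_ *: F)).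
by apply: re_imP => /=; rewrite ?oppr0.
Qed.

Definition hcompletion : hilbert_space R :=
  @HilbertSpace R completion chip chip_linear chip_conj chip_norm.

End Completion.

Section CompletionFacts.
Variables (R : realType) (V : lmodType R[i]) (B : V -> V -> R).
Variable rB : real_form B.
Local Notation H := (hcompletion rB).

Lemma hr_emb u (F : H) : hr (cemb rB u : H) F = F u.
Proof. exact: cip_emb. Qed.

Lemma cemb_dense (F : H) (e : R) : 0 < e -> exists u, nr (F - cemb rB u : H) <= e.
Proof.
by move=> e0; have [u Fu] := cappx F e0; exists u; apply: qn_appx => //; exact: ltW.
Qed.

(** Near-maximisers [u] of [2 f u - B u u] satisfy [|f w - B w u| <= d |w|], so [f] is itself a
    limit of functionals [B _ u], that is, a point of the completion. *)
Lemma completion_riesz (f : V -> R) (K : R) :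
  (forall u v, f (u + v) = f u + f v) -> (forall (r : R) u, f (r%:C%C *: u) = r * f u) ->
  (forall u, f u <= K * qn B u) -> exists F : H, forall u, F u = f u.
Proof.
move=> fD fZ fK; pose g u := 2 * f u - B u u.
have Sg : has_sup (range g).
  split; first by exists (g 0); exists 0.
  exists (K ^+ 2) => _ [u _ <-]; rewrite /g -(qn_sqr rB); have := fK u.
  by have := sqr_ge0 (K - qn B u); rewrite sqrrB; lra.
have fx d : 0 < d -> exists u, appx B d f u.
  move=> d0; have d2 : 0 < d ^+ 2 by rewrite exprn_gt0.
  have [_ [u _ <-] gu] := sup_adherent d2 Sg; exists u => w.
  have key t : 2 * t * (f w - B w u) - t ^+ 2 * B w w <= d ^+ 2.
    have : g (u + t%:C%C *: w) <= sup (range g).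
      by apply: ub_le_sup; [exact: Sg.2|exists (u + t%:C%C *: w)].
    rewrite /g in gu *; rewrite fD fZ (rf_sqrD rB) !(rfZ rB) (rfZl rB) (rfC rB u w).
    by lra.
  rewrite -ler_sqr ?nnegrE ?mulr_ge0 ?qn_ge0 ?(ltW d0)// exprMn (qn_sqr rB).
  rewrite real_normK ?num_real//; set x := f w - B w u in key *.
  have [w0|w0] := eqVneq (B w w) 0.
    have [->|x0] := eqVneq x 0; first by rewrite w0 mulr0 expr0n.
    have := key ((d ^+ 2 + 1) / x); rewrite w0 mulr0 subr0 -mulrA divfK//.
    by have := sqr_ge0 d; lra.
  have w0' : 0 < B w w by rewrite lt_neqAle eq_sym w0 (rf_ge0 rB).
  have := key (x / B w w); have -> : 2 * (x / B w w) * x - (x / B w w) ^+ 2 * B w w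
    = x ^+ 2 / B w w by field.
  by rewrite ler_pdivrMr.
by exists (Completion (rB := rB) fx).
Qed.

End CompletionFacts.

(** * Positive elements of unital C*-algebras *)

(* The scalar majorant of Visser's iteration for [1 - sqrt (1 - y)]. *)
Section VisserScalars.
Variable R : realType.

Fixpoint vis (n : nat) : R := if n is m.+1 then (1 + vis m ^+ 2) / 2 else 0.

Lemma vis01 n : 0 <= vis n <= 1.
Proof.
elim: n => [|n /andP[v0 v1]] /=; first by rewrite lexx ler01.
have : vis n ^+ 2 <= 1 by rewrite expr_le1.
by have := sqr_ge0 (vis n); lra.
Qed.

Lemma vis_mono n : vis n <= vis n.+1.
Proof. by rewrite /=; have := sqr_ge0 (vis n - 1); rewrite sqrrB; lra. Qed.

Lemma vis_le i j : (i <= j)%N -> vis i <= vis j.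
Proof.
move=> /subnK <-; elim: (j - i)%N => [//|k ih].
by apply: le_trans ih _; rewrite addSn vis_mono.
Qed.

Lemma vis_cauchy (e : R) : 0 < e ->
  exists N, forall i j, (N <= i)%N -> (i <= j)%N -> vis j - vis i < e.
Proof.
move=> e0; have sv : has_sup (range vis).
  split; first by exists (vis 0); exists 0%N.
  by exists 1 => _ [n _ <-]; have /andP[] := vis01 n.
have [_ [N _ <-] NP] := sup_adherent e0 sv; exists N => i j iN ij.
have := vis_le iN; have : vis j <= sup (range vis).
  by apply: ub_le_sup; [exact: sv.2|exists j].
by lra.
Qed.

(** The increments are majorised by those of the bounded increasing sequence [vis], so telescoping
    makes [u] Cauchy. The estimate serves both elements of an algebra and operators applied to a
    vector. *)
Lemma vis_seq (V : zmodType) (n : V -> R) (u : nat -> V) (K : R) :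
  (forall x y, n (x + y) <= n x + n y) -> (forall x, n (- x) = n x) -> n 0 = 0 ->
  seq_complete n -> 0 <= K ->
  (forall i, n (u i.+1 - u i) <= K * (vis i.+1 - vis i)) ->
  exists l, slim n u l.
Proof.
move=> nD nN n0 cn K0 uK.
have step i k : n (u (i + k.+1)%N - u i) <= K * (vis (i + k.+1)%N - vis i).
  elim: k => [|k ih]; first by rewrite addn1.
  rewrite -(subrKA (u (i + k.+1)%N)); apply: le_trans (nD _ _) _.
  by have := uK (i + k.+1)%N; rewrite -addnS; move: ih; lra.
apply: cn => e e0; have K1 : 0 < K + 1 by rewrite ltr_wpDl.
have [N NP] := vis_cauchy (divr_gt0 e0 K1); exists N.+1.
have lt i j : (N < i)%N -> (i < j)%N -> n (u j - u i) < e.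
  move=> iN ij; have jE : j = (i + (j - i).-1.+1)%N.
    by rewrite prednK ?subn_gt0// subnKC// ltnW.
  have := step i (j - i).-1; rewrite -jE => le.
  have := NP i j (ltnW iN) (ltnW ij); rewrite ltr_pdivlMr// => lt.
  have /andP[_ v] : 0 <= K <= K + 1 by rewrite K0 lerDl ler01.
  have vv : 0 <= vis j - vis i by rewrite subr_ge0 vis_le// ltnW.
  have := ler_wpM2r vv v; rewrite mulrC in lt; lra.
move=> i j iN jN; case: (ltngtP i j) => [ij|ij|->]; last by rewrite subrr n0.
  by rewrite -nN opprB lt.
exact: lt.
Qed.

End VisserScalars.

Section UnitalCStar.
Variables (R : realType) (B : algType R[i]) (star : B -> B) (n : B -> R).

Record unital_cstar : Prop := UnitalCStar {
  ucK : involutive star;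
  ucD : {morph star : a b / a + b};
  ucZ : forall c a, star (c *: a) = c^* *: star a;
  ucM : forall a b, star (a * b) = star b * star a;
  uc_ge0 : forall a, 0 <= n a;
  uc_normD : forall a b, n (a + b) <= n a + n b;
  uc_normZ : forall c a, n (c *: a) = cabs c * n a;
  uc_normM : forall a b, n (a * b) <= n a * n b;
  uc_norm_star : forall a, n (star a * a) = n a ^+ 2;
  uc_eq0 : forall a, n a = 0 -> a = 0;
  uc_complete : seq_complete n }.

Hypothesis uc : unital_cstar.
Local Notation "r %:B" := ((r%:C%C : R[i])%:A : B) (at level 2, format "r %:B").
Local Notation sa a := (star a = a).

Let star0 : star 0 = 0.
Proof. by apply: (addrI (star 0)); rewrite -(ucD uc) !addr0. Qed.

Let starN a : star (- a) = - star a.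
Proof. by apply/eqP; rewrite -addr_eq0 -(ucD uc) addNr star0. Qed.

Let starB a b : star (a - b) = star a - star b.
Proof. by rewrite (ucD uc) starN. Qed.

Let star1 : star 1 = 1.
Proof. by rewrite -[LHS]mulr1 -{2}(ucK uc 1) -(ucM uc) mulr1 (ucK uc). Qed.

Let starZ (r : R) a : star (r%:C%C *: a) = r%:C%C *: star a.
Proof. by rewrite (ucZ uc) conjCr. Qed.

Let n0 : n 0 = 0.
Proof. by rewrite -(scale0r 0) (uc_normZ uc) /cabs normr0 mul0r. Qed.

Let nN a : n (- a) = n a.
Proof. by rewrite -scaleN1r (uc_normZ uc) /cabs normrN normr1 mul1r. Qed.

Let nZ (r : R) a : n (r%:C%C *: a) = `|r| * n a.
Proof. by rewrite (uc_normZ uc) cabs_real. Qed.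

Let nZp (r : R) a : 0 <= r -> n (r%:C%C *: a) = r * n a.
Proof. by move=> r0; rewrite nZ ger0_norm. Qed.

Let n_star a : n (star a) = n a.
Proof.
have le b : n b <= n (star b).
  have [->|b0] := eqVneq (n b) 0; first exact: uc_ge0.
  have b0' : 0 < n b by rewrite lt_neqAle eq_sym b0 (uc_ge0 uc).
  by rewrite -(ler_pM2r b0') -expr2 -(uc_norm_star uc) (uc_normM uc).
by apply/eqP; rewrite eq_le le andbT -{2}(ucK uc a) le.
Qed.

Let n1 : n 1 = 1.
Proof.
have := uc_norm_star uc 1; rewrite star1 mulr1 expr2 => e.
have n10 : n 1 != 0 by apply/eqP => /(uc_eq0 uc)/eqP; rewrite oner_eq0.
by apply: (mulfI n10); rewrite mulr1.
Qed.

Let n_sa a : sa a -> n (a * a) = n a ^+ 2.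
Proof. by move=> sa_a; rewrite -(uc_norm_star uc) sa_a. Qed.

Let half (a : B) : (2^-1)%:C%C *: a + (2^-1)%:C%C *: a = a.
Proof. by rewrite -scalerDl -rmorphD/= (_ : 2^-1 + 2^-1 = 1) ?scale1r//; lra. Qed.

Let slim_unique u a b : slim n u a -> slim n u b -> a = b.
Proof.
move=> ua ub; apply/eqP; rewrite -subr_eq0; apply/eqP/(uc_eq0 uc).
apply/eqP; rewrite eq_le (uc_ge0 uc) andbT; apply: (@eps_le _ _ _ 2) => // e e0.
have [N1 N1P] := ua _ e0; have [N2 N2P] := ub _ e0; pose m := maxn N1 N2.
have := N1P m (leq_maxl _ _); have := N2P m (leq_maxr _ _).
have -> : a - b = (u m - b) - (u m - a) by rewrite opprB [RHS]addrC addrA subrK.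
by have := uc_normD uc (u m - b) (- (u m - a)); rewrite nN; lra.
Qed.

Let slimD u v a b : slim n u a -> slim n v b -> slim n (fun i => u i + v i) (a + b).
Proof.
move=> ua vb e e0; have e2 : 0 < e / 2 by rewrite divr_gt0.
have [N1 N1P] := ua _ e2; have [N2 N2P] := vb _ e2; exists (maxn N1 N2) => i.
rewrite geq_max => /andP[/N1P h1 /N2P h2]; rewrite opprD addrACA.
by have := uc_normD uc (u i - a) (v i - b); lra.
Qed.

Let slim_const a : slim n (fun=> a) a.
Proof. by move=> e e0; exists 0%N => i _; rewrite subrr n0. Qed.

Let slimZ c u a : slim n u a -> slim n (fun i => c *: u i) (c *: a).
Proof.
move=> ua e e0; have c1 : 0 < cabs c + 1 by rewrite ltr_wpDl ?cabs_ge0.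
have [N NP] := ua _ (divr_gt0 e0 c1); exists N => i /NP.
rewrite ltr_pdivlMr// -scalerBr (uc_normZ uc); apply: le_lt_trans.
by rewrite mulrC ler_wpM2l ?uc_ge0// lerDl.
Qed.

Let slim_mul b u a : slim n u a -> slim n (fun i => b * u i) (b * a).
Proof.
move=> ua e e0; have c1 : 0 < n b + 1 by rewrite ltr_wpDl ?uc_ge0.
have [N NP] := ua _ (divr_gt0 e0 c1); exists N => i /NP.
rewrite ltr_pdivlMr// -mulrBr; apply: le_lt_trans.
apply: le_trans (uc_normM uc _ _) _.
by rewrite mulrC ler_wpM2l ?uc_ge0// lerDl.
Qed.

Let slim_star u a : slim n u a -> slim n (fun i => star (u i)) (star a).
Proof. by move=> ua e /ua[N NP]; exists N => i /NP; rewrite -starB n_star. Qed.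

Let slim_ext u v a : u =1 v -> slim n u a -> slim n v a.
Proof. by move=> /funext ->. Qed.

Let slim_mulr b u a : slim n u a -> slim n (fun i => u i * b) (a * b).
Proof.
move=> /slim_star/(slim_mul (star b))/slim_star.
by rewrite -(ucM uc) (ucK uc); apply: slim_ext => i; rewrite -(ucM uc) (ucK uc).
Qed.

Let slim_shift u a : slim n u a -> slim n (fun i => u i.+1) a.
Proof. by move=> ua e /ua[N NP]; exists N => i iN; apply: NP; exact: leqW. Qed.

Let slim_sqr u a (K : R) : (forall i, n (u i) <= K) -> slim n u a ->
  slim n (fun i => u i * u i) (a * a).
Proof.
move=> uK ua e e0; have K0 : 0 <= K := le_trans (uc_ge0 uc _) (uK 0%N).
have c1 : 0 < K + n a + 1 by rewrite ltr_wpDl// addr_ge0 ?uc_ge0.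
have [N NP] := ua _ (divr_gt0 e0 c1); exists N => i /NP.
rewrite ltr_pdivlMr//; apply: le_lt_trans.
have -> : u i * u i - a * a = u i * (u i - a) + (u i - a) * a.
  by rewrite mulrBr mulrBl addrA subrK.
apply: le_trans (uc_normD uc _ _) _.
apply: le_trans (lerD (uc_normM uc _ _) (uc_normM uc _ _)) _.
rewrite mulrDr mulr1 mulrDr -[leLHS]addr0 lerD ?uc_ge0// lerD//.
by rewrite mulrC ler_wpM2l ?uc_ge0.
Qed.

(** The iterates [u_(i+1) = (y + u_i^2) / 2] converge to some [r] with [2 r = y + r^2], and
    [w = 1 - r] squares to [1 - y]. Being polynomials in [y], they are self-adjoint and commute with
    whatever commutes with [y]; their norms are at most [vis i], hence [|r| <= 1]. *)
Lemma visser_sqrt y : sa y -> n y <= 1 -> exists w, [/\ sa w, w * w = 1 - y,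
  n (1 - w) <= 1 & forall z, y * z = z * y -> w * z = z * w].
Proof.
move=> sy y1.
pose u := fix u i := if i is j.+1 then (2^-1)%:C%C *: (y + u j * u j) else 0.
have uS i : u i.+1 = (2^-1)%:C%C *: (y + u i * u i) by [].
have h0 : 0 <= (2^-1 : R) by rewrite invr_ge0.
have un i : n (u i) <= vis R i.
  elim: i => [|i ih]; first by rewrite /= n0.
  rewrite uS nZp//= mulrC ler_wpM2r//; apply: le_trans (uc_normD uc _ _) _.
  rewrite lerD//; apply: le_trans (uc_normM uc _ _) _.
  by rewrite expr2 ler_pM ?uc_ge0.
have us i : sa (u i).
  elim: i => [|i ih]; first exact: star0.
  by rewrite uS starZ (ucD uc) (ucM uc) sy ih.
have uc' i z : y * z = z * y -> u i * z = z * u i.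
  move=> yz; elim: i => [|i ih]; first by rewrite /= mul0r mulr0.
  by rewrite uS -scalerAl -scalerAr mulrDl mulrDr yz -mulrA ih !mulrA ih.
have ud i : n (u i.+1 - u i) <= 1 * (vis R i.+1 - vis R i).
  rewrite mul1r; elim: i => [|i ih].
    rewrite subr0 uS mulr0 addr0 nZp//= expr0n/= addr0 subr0 mulrC ler_wpM2r//.
  rewrite uS [in X in _ - X]uS -scalerBr opprD addrACA subrr add0r nZp//.
  have -> : u i.+1 * u i.+1 - u i * u i =
      u i.+1 * (u i.+1 - u i) + (u i.+1 - u i) * u i.
    by rewrite mulrBr mulrBl addrA subrK.
  have -> : vis R i.+2 - vis R i.+1 = 2^-1 *
    (vis R i.+1 * (vis R i.+1 - vis R i) + (vis R i.+1 - vis R i) * vis R i).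
    have e2 : vis R i.+2 = (1 + vis R i.+1 ^+ 2) / 2 by [].
    have e1 : vis R i.+1 = (1 + vis R i ^+ 2) / 2 by [].
    by rewrite e2 [X in _ - X = _]e1; move: (vis R i.+1) (vis R i) => a b; field.
  rewrite ler_wpM2l//; apply: le_trans (uc_normD uc _ _) _.
  by rewrite lerD//; apply: le_trans (uc_normM uc _ _) _; rewrite ler_pM ?uc_ge0.
have [r ur] := vis_seq (uc_normD uc) nN n0 (uc_complete uc) ler01 ud.
have un1 i : n (u i) <= 1 by apply: le_trans (un i) _; have /andP[] := vis01 R i.
have rE : r = (2^-1)%:C%C *: (y + r * r).
  apply: slim_unique (slim_shift ur) _.
  by apply: slimZ; apply: slimD; [exact: slim_const|exact: slim_sqr un1 ur].
exists (1 - r); split.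
- rewrite starB star1; congr (_ - _); apply: slim_unique (slim_star ur) _.
  by apply: slim_ext ur => i; rewrite us.
- have e : r + r = y + r * r by rewrite {1 2}rE half.
  have -> : y = r + r - r * r by rewrite e addrK.
  by rewrite mulrBr mulr1 mulrBl mul1r -addrA -opprD addrA.
- rewrite opprB addrC subrK; apply: (@eps_le _ _ _ 1) => // e e0; rewrite mulr1.
  have [N NP] := ur _ e0; have := NP N (leqnn _); have := un1 N.
  have := uc_normD uc (u N) (- (u N - r)); rewrite nN opprB addrCA subrr addr0.
  by lra.
- move=> z yz; rewrite mulrBl mulrBr mul1r mulr1; congr (_ - _).
  apply: slim_unique (slim_mulr z ur) _.
  by apply: slim_ext (slim_mul z ur) => i; rewrite uc'.
Qed.


(** [z = h + i k] is normal with [z^* z = h^2 + k^2], and [h] is the mean of [z] and [z^*]. *)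
Lemma norm_sqr_comm h k : sa h -> sa k -> h * k = k * h ->
  n (h * h) <= n (h * h + k * k).
Proof.
move=> sh sk hk; pose z := h + 'i%C *: k.
have sz : star z = h - 'i%C *: k.
  rewrite (ucD uc) (ucZ uc) sh sk -scaleNr; congr (_ + _ *: _).
  by apply: re_imP => /=; rewrite ?oppr0.
have zz : star z * z = h * h + k * k.
  have ii : 'i%C * 'i%C = -1 :> R[i] by rewrite -expr2 sqr_i.
  rewrite sz /z mulrBl !mulrDr -!scalerAl -!scalerAr hk scalerA ii scaleN1r.
  by rewrite opprD opprK addrA addrK.
have hz : h = (2^-1)%:C%C *: (star z + z).
  by rewrite sz addrACA addNr addr0 scalerDr half.
rewrite -zz (uc_norm_star uc) n_sa// ler_sqr ?nnegrE ?uc_ge0//.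
rewrite {1}hz nZp ?invr_ge0//; have := uc_normD uc (star z) z; rewrite n_star.
by lra.
Qed.

(** For self-adjoint [a] the bound says that the spectrum lies in [[0, 2t]]. In this form the
    positive elements visibly form a convex cone, before it is known that [b^* b] belongs to it. *)
Definition uc_pos (a : B) : Prop :=
  sa a /\ exists2 t : R, 0 <= t & n (t%:B - a) <= t.

Let nB (r : R) : 0 <= r -> n (r%:B) = r.
Proof. by move=> r0; rewrite nZp// n1 mulr1. Qed.

Let starBr (r : R) : star (r%:B) = r%:B.
Proof. by rewrite starZ star1. Qed.

Let BC (r : R) a : r%:B * a = a * r%:B.
Proof. by rewrite -scalerAl -scalerAr mul1r mulr1. Qed.

Let scaleV (r : R) (a : B) : r != 0 -> r%:C%C *: ((r^-1)%:C%C *: a) = a.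
Proof. by move=> r0; rewrite scalerA -rmorphM/= divff// scale1r. Qed.

Lemma uc_pos_sqrt a : uc_pos a -> exists w, [/\ sa w, w * w = a
  & forall z, a * z = z * a -> w * z = z * w].
Proof.
move=> [saa [t t0 ta]]; have [tE|tn0] := eqVneq t 0.
  exists 0; split; rewrite ?star0// ?mul0r//; last by move=> z _; rewrite mul0r mulr0.
  apply/esym/(uc_eq0 uc)/eqP; rewrite eq_le (uc_ge0 uc) andbT.
  by move: ta; rewrite tE scale0r sub0r nN.
have t0' : 0 < t by rewrite lt_neqAle eq_sym tn0.
pose y : B := 1 - (t^-1)%:C%C *: a.
have sy : sa y by rewrite starB star1 starZ saa.
have ny : n y <= 1.
  have -> : y = (t^-1)%:C%C *: (t%:B - a).
    by rewrite scalerBr scalerA -rmorphM/= mulVf// scale1r.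
  by rewrite nZp ?invr_ge0// mulrC ler_pdivrMr// mul1r.
have [w [sw ww _ wc]] := visser_sqrt sy ny; pose s := Num.sqrt t.
have ss : s * s = t by rewrite -expr2 sqr_sqrtr.
exists (s%:C%C *: w); split.
- by rewrite starZ sw.
- rewrite -scalerAl -scalerAr scalerA -rmorphM/= ss ww /y opprB addrC subrK.
  exact: scaleV.
- move=> z az; rewrite -scalerAl -scalerAr wc// /y mulrBl mulrBr mul1r mulr1.
  by rewrite -scalerAl -scalerAr az.
Qed.

(** After scaling to [t = 1], a square root [w] of [1 - h^2] commutes with [h] and [w^2 + h^2 = 1],
    so [norm_sqr_comm] bounds [w^2]. *)
Lemma norm_compl_sqr h (t : R) : sa h -> n h ^+ 2 <= t -> n (t%:B - h * h) <= t.
Proof.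
move=> sh ht; have [tE|tn0] := eqVneq t 0.
  have h0 : h = 0.
    apply: (uc_eq0 uc); apply/eqP; rewrite -sqrf_eq0 eq_le sqr_ge0 andbT.
    by rewrite -tE.
  by rewrite h0 mulr0 subr0 tE scale0r n0.
have t0' : 0 < t.
  by rewrite lt_neqAle eq_sym tn0 (le_trans _ ht)// sqr_ge0.
have ti : 0 <= t^-1 by rewrite invr_ge0 ltW.
pose s := Num.sqrt (t^-1); have s0 : 0 <= s by exact: sqrtr_ge0.
have ss : s * s = t^-1 by rewrite -expr2 sqr_sqrtr.
pose g := s%:C%C *: h; have sg : sa g by rewrite starZ sh.
have gg : g * g = (t^-1)%:C%C *: (h * h).
  by rewrite -scalerAl -scalerAr scalerA -rmorphM/= ss.
have ng : n (g * g) <= 1.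
  by rewrite gg nZp// n_sa// mulrC ler_pdivrMr// mul1r.
have sgg : sa (g * g) by rewrite (ucM uc) sg.
have [w [sw ww _ wc]] := visser_sqrt sgg ng.
have wg : w * g = g * w by apply: wc; rewrite mulrA.
have : n (w * w) <= 1.
  apply: le_trans (norm_sqr_comm sw sg wg) _.
  by rewrite ww subrK n1.
rewrite ww gg => le; have -> : t%:B - h * h = t%:C%C *: (1 - (t^-1)%:C%C *: (h * h)).
  by rewrite scalerBr scaleV.
by rewrite nZp ?(ltW t0')// ler_piMr ?(ltW t0').
Qed.

Lemma uc_pos_sqr h : sa h -> uc_pos (h * h).
Proof.
move=> sh; split; first by rewrite (ucM uc) sh.
by exists (n h ^+ 2); [exact: sqr_ge0|exact: norm_compl_sqr].
Qed.

Lemma uc_posD a b : uc_pos a -> uc_pos b -> uc_pos (a + b).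
Proof.
move=> [saa [t t0 ta]] [sbb [u u0 ub]]; split; first by rewrite (ucD uc) saa sbb.
exists (t + u); first exact: addr_ge0.
rewrite rmorphD/= scalerDl opprD addrACA.
by apply: le_trans (uc_normD uc _ _) _; rewrite lerD.
Qed.

Lemma uc_posZ (r : R) a : 0 <= r -> uc_pos a -> uc_pos (r%:C%C *: a).
Proof.
move=> r0 [saa [t t0 ta]]; split; first by rewrite starZ saa.
exists (r * t); first exact: mulr_ge0.
by rewrite rmorphM/= -scalerA -scalerBr nZp// ler_wpM2l.
Qed.

(** With [t] the norm of the sum, [t - h^2] is positive and has a square root commuting with [h],
    which reduces the claim to [norm_sqr_comm]. *)
Lemma norm_sqr_mono h k : sa h -> sa k -> n (h * h) <= n (h * h + k * k).
Proof.
move=> sh sk; pose x := h * h + k * k; pose t := n x.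
have px : uc_pos x by apply: uc_posD; exact: uc_pos_sqr.
have [g [sg gg _]] := uc_pos_sqrt px.
have tg : n g ^+ 2 <= t by rewrite /t -gg n_sa.
have pt : uc_pos (t%:B - x).
  split; first by rewrite starB starBr px.1.
  exists t; first exact: uc_ge0.
  by rewrite opprB addrC subrK.
have pth : uc_pos (t%:B - h * h).
  have -> : t%:B - h * h = (t%:B - x) + k * k.
    by rewrite /x opprD addrA subrK.
  by apply: uc_posD => //; exact: uc_pos_sqr.
have [w [sw ww wc]] := uc_pos_sqrt pth.
have wh : w * h = h * w by apply: wc; rewrite mulrBl mulrBr BC mulrA.
have := norm_sqr_comm sh sw (esym wh).
by rewrite ww addrC subrK nB// uc_ge0.
Qed.

(** The classical proof compares the spectra of [d^* d] and [d d^*]. Here [f = d d^*] is positive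
    because [d^* d + d d^*] is a sum of squares; [p = 1 - f / t] is then a contraction with
    [d^* p^N = (1 + v)^N d^*] for [v = e^2 / t], so [(1 + v)^N e^2] stays bounded in [N], which
    forces [e = 0]. *)
Lemma star_mul_neg_sqr d e : sa e -> star d * d = - (e * e) -> d = 0.
Proof.
move=> se dd; pose h := (2^-1)%:C%C *: (star d + d).
pose k := ((2^-1)%:C%C * 'i%C) *: (star d - d).
have sh : sa h by rewrite starZ (ucD uc) (ucK uc) addrC.
have sk : sa k.
  rewrite (ucZ uc) starB (ucK uc) -[d - _]opprB scalerN -scaleNr; congr (_ *: _).
  by apply: re_imP => /=; ring.
have hk : h * h + k * k = (2^-1)%:C%C *: (star d * d + d * star d).
  rewrite /h /k -!scalerAl -!scalerAr !scalerA.
  have -> : (2^-1)%:C%C * 'i%C * ((2^-1)%:C%C * 'i%C) = - ((2^-1)%:C%C * (2^-1)%:C%C) :> R[i].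
    by rewrite mulrACA (_ : 'i%C * 'i%C = -1) ?mulrN1// -expr2 sqr_i.
  rewrite scaleNr -scalerBr -scalerA; congr (_ *: _).
  rewrite !mulrDl !mulrDr !mulNr !mulrN !opprK.
  set a := star d * star d; set b := star d * d; set c := d * star d; set f := d * d.
  have -> : a + b + (c + f) - (a - b + (- c + f)) = (b + c) + (b + c).
    rewrite opprD opprB opprD opprK addrACA [a + b]addrC [b - a]addrC [c - f]addrC.
    by rewrite !addrA !addrK -!addrA [c + (b + c)]addrCA.
  by rewrite scalerDr half.
pose f := d * star d.
have fE : f = (h * h + h * h) + (k * k + k * k) + e * e.
  have -> : (h * h + h * h) + (k * k + k * k) = (h * h + k * k) + (h * h + k * k).
    by rewrite addrACA.
  by rewrite hk half dd [RHS]addrC addrA subrr add0r.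
have pf : uc_pos f.
  by rewrite fE; do !(apply: uc_posD || exact: uc_pos_sqr).
have [g [sg gg _]] := uc_pos_sqrt pf.
pose t := n g ^+ 2 + 1; have t0 : 0 < t by rewrite ltr_wpDl ?sqr_ge0.
have tV : 0 <= t^-1 by rewrite invr_ge0 ltW.
pose v := (t^-1)%:C%C *: (e * e); pose p := 1 - (t^-1)%:C%C *: f.
have np : n p <= 1.
  have -> : p = (t^-1)%:C%C *: (t%:B - g * g).
    by rewrite gg scalerBr scalerA -rmorphM/= mulVf ?gt_eqF// scale1r.
  rewrite nZp// mulrC ler_pdivrMr// mul1r; apply: norm_compl_sqr => //.
  by rewrite lerDl.
have dp : star d * p = (1 + v) * star d.
  rewrite /p /v mulrBr mulrDl mulr1 mul1r -scalerAr -scalerAl /f mulrA dd.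
  by rewrite mulNr scalerN opprK.
have dpN N : star d * p ^+ N = (1 + v) ^+ N * star d.
  elim: N => [|N ih]; first by rewrite !expr0 mulr1 mul1r.
  by rewrite exprSr mulrA ih -mulrA dp mulrA -exprSr.
have npN N : n (p ^+ N) <= 1.
  elim: N => [|N ih]; first by rewrite expr0 n1.
  rewrite exprS; apply: le_trans (uc_normM uc _ _) _.
  by rewrite -[leRHS]mulr1 ler_pM ?uc_ge0.
have bound N : n ((1 + v) ^+ N * (e * e)) <= n d ^+ 2.
  rewrite -nN -mulrN -dd mulrA -dpN; apply: le_trans (uc_normM uc _ _) _.
  rewrite expr2 ler_wpM2r ?uc_ge0//; apply: le_trans (uc_normM uc _ _) _.
  by rewrite n_star ler_piMr ?uc_ge0.
have ee_sqr q : uc_pos q -> q * e = e * q ->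
    uc_pos (e * e * q) /\ (e * e * q) * e = e * (e * e * q).
  move=> /uc_pos_sqrt[w [sw ww wc]] qe; have we := wc _ qe; split.
    have -> : e * e * q = (e * w) * (e * w).
      by rewrite -ww mulrA -[e * w * _]mulrA [w * (e * w)]mulrA we !mulrA.
    by apply: uc_pos_sqr; rewrite (ucM uc) sw se.
  by rewrite -!mulrA qe.
(* Bernoulli's inequality, with a positive remainder that commutes with [e]. *)
have expand N : exists P, [/\ uc_pos P, P * e = e * P
    & (1 + v) ^+ N = 1 + N%:R%:C%C *: v + P].
  elim: N => [|N [P [pP cP eP]]].
    exists 0; split; rewrite ?mul0r ?mulr0 ?expr0 ?scale0r ?addr0//.
    by split; [exact: star0|exists 0; rewrite // scale0r subr0 n0].
  have pv : uc_pos (N%:R%:C%C *: (v * v)).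
    apply: uc_posZ => //; rewrite /v -scalerAl -scalerAr scalerA -rmorphM/=.
    by apply: uc_posZ; [exact: mulr_ge0|apply: uc_pos_sqr; rewrite (ucM uc) se].
  have [pe ce] := ee_sqr _ pP cP.
  exists (N%:R%:C%C *: (v * v) + P + v * P); split.
  - apply: uc_posD; first exact: uc_posD.
    by rewrite /v -scalerAl; exact: uc_posZ.
  - have vv : v * v * e = e * (v * v).
      have ve : v * e = e * v by rewrite /v -scalerAl -scalerAr mulrA.
      by rewrite -mulrA ve !mulrA ve.
    have vvN : N%:R%:C%C *: (v * v) * e = e * (N%:R%:C%C *: (v * v)).
      by rewrite -(scalerAl _ (v * v) e) vv (scalerAr _ e (v * v)).
    have vPe : v * P * e = e * (v * P) by rewrite /v -!scalerAl ce -scalerAr.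
    by rewrite !mulrDl !mulrDr vvN cP vPe.
  - rewrite exprS eP mulrDl mul1r mulrDr mulrDr mulr1 -(scalerAr _ v v).
    rewrite -[in RHS]natr1 rmorphD/= scalerDl scale1r.
    set a := N%:R%:C%C *: v; set b := N%:R%:C%C *: (v * v); set c := v * P.
    rewrite -!addrA; congr (1 + (a + _)).
    by rewrite addrCA [P + (b + c)]addrCA.
have grow N : N%:R / t * (n e ^+ 2) ^+ 2 <= n d ^+ 2.
  apply: le_trans (bound N); have [P [pP cP ->]] := expand N.
  pose s := Num.sqrt (N%:R / t).
  have s0 : 0 <= N%:R / t by rewrite divr_ge0 ?(ltW t0).
  have ss : s * s = N%:R / t by rewrite -expr2 sqr_sqrtr.
  pose x := s%:C%C *: (e * e).
  have sx : sa x by rewrite starZ (ucM uc) se.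
  have xx : x * x = (N%:R%:C%C *: v) * (e * e).
    by rewrite /x /v -!scalerAl -!scalerAr !scalerA -!rmorphM/= ss.
  have pq : uc_pos (e * e + P * (e * e)).
    have [pe _] := ee_sqr _ pP cP; apply: uc_posD; first exact: uc_pos_sqr.
    by rewrite mulrA cP -mulrA cP mulrA.
  have [q [sq qq _]] := uc_pos_sqrt pq.
  have := norm_sqr_mono sx sq; rewrite n_sa// {1}/x nZp ?sqrtr_ge0// n_sa//.
  rewrite exprMn expr2 ss => /le_trans; apply.
  by rewrite xx qq !mulrDl mul1r addrCA addrA.
have e0 : n e = 0.
  apply/eqP; apply: contraT => ne0.
  have c0 : 0 < (n e ^+ 2) ^+ 2 / t.
    by rewrite divr_gt0// exprn_gt0// exprn_gt0// lt_neqAle eq_sym ne0 (uc_ge0 uc).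
  have := grow (Num.bound (n d ^+ 2 / ((n e ^+ 2) ^+ 2 / t))).
  set N := Num.bound _ => le.
  have : n d ^+ 2 / ((n e ^+ 2) ^+ 2 / t) < N%:R.
    by apply: archi_boundP; rewrite divr_ge0 ?sqr_ge0 ?(ltW c0).
  by rewrite ltr_pdivrMr// mulrCA mulrC => /lt_le_trans/(_ le); rewrite ltxx.
apply: (uc_eq0 uc); apply/eqP; rewrite -sqrf_eq0 -(uc_norm_star uc) dd nN.
by rewrite n_sa// e0 expr0n.
Qed.

(** Let [c] be the absolute value of [a = b^* b], [m = c - a] and [q^2 = c]. Then [a m = - c m], so
    [m b^* b m = - (q m)^2] and [star_mul_neg_sqr] gives [b m = 0]. It follows that [c m = a m = 0],
    hence [m = 0], and [a = c] is positive. *)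
Theorem star_mul_sqr b : exists q, [/\ sa q, star b * b = q * q
  & forall z, star b * b * z = z * (star b * b) -> q * z = z * q].
Proof.
have [a aE] : exists a, a = star b * b by exists (star b * b).
rewrite -aE; have saa : sa a by rewrite aE (ucM uc) (ucK uc).
suff : uc_pos a.
  by move=> /uc_pos_sqrt[q [sq qq qc]]; exists q; split.
have paa : uc_pos (a * a) by exact: uc_pos_sqr.
have [s s0 sP] : exists2 s : R, 0 < s & n a ^+ 2 <= s.
  by exists (n a ^+ 2 + 1); [rewrite ltr_wpDl ?sqr_ge0|rewrite lerDl].
pose y := (s^-1)%:C%C *: (s%:B - a * a).
have sV : 0 <= s^-1 by rewrite invr_ge0 ltW.
have sy : sa y by rewrite starZ starB starBr (ucM uc) saa.
have ny : n y <= 1.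
  by rewrite nZp// mulrC ler_pdivrMr// mul1r norm_compl_sqr.
have [w [sw ww nw wc]] := visser_sqrt sy ny.
have wa : w * a = a * w.
  by apply: wc; rewrite /y -(scalerAl _ _ a) -(scalerAr _ a) mulrBl mulrBr BC mulrA.
pose c := (Num.sqrt s)%:C%C *: w.
have sc : sa c by rewrite starZ sw.
have cc : c * c = a * a.
  rewrite -scalerAl -scalerAr scalerA -rmorphM/= -expr2 sqr_sqrtr ?ltW// ww.
  have -> : 1 - y = (s^-1)%:C%C *: (a * a).
    rewrite /y scalerBr scalerA -rmorphM/= mulVf ?gt_eqF// scale1r.
    by rewrite opprB addrC subrK.
  by rewrite scaleV ?gt_eqF.
have ca : c * a = a * c by rewrite -scalerAl -scalerAr wa.
have pc : uc_pos c.
  by apply: uc_posZ; [exact: sqrtr_ge0|split=> //; exists 1; rewrite ?scale1r].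
have [q [sq qq qc]] := uc_pos_sqrt pc.
pose m := c - a; have sm : sa m by rewrite starB sc saa.
have qm : q * m = m * q by rewrite mulrBl mulrBr (qc a ca) (qc c).
have am : a * m = - (c * m).
  by rewrite !mulrBr cc ca opprB.
have ma : m * a = a * m by rewrite mulrBl mulrBr ca.
have qqmm : q * q * m * m = q * m * (q * m).
  by rewrite -(mulrA q q m) {1}qm (mulrA q m q) -(mulrA (q * m)).
have d0 : b * m = 0.
  apply: (@star_mul_neg_sqr _ (q * m)); first by rewrite (ucM uc) sq sm qm.
  rewrite (ucM uc) sm mulrA -[m * star b * b]mulrA -aE ma am mulNr; congr (- _).
  by rewrite -qq qqmm.
have qm0 : q * m = 0.
  apply: (uc_eq0 uc); apply/eqP; rewrite -sqrf_eq0 -n_sa; last first.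
    by rewrite (ucM uc) sq sm qm.
  have -> : (q * m) * (q * m) = - (m * a * m).
    by rewrite ma am mulNr opprK -qq qqmm.
  have -> : m * a * m = star (b * m) * (b * m) by rewrite (ucM uc) sm aE !mulrA.
  by rewrite d0 mulr0 oppr0 n0.
have cm0 : c * m = 0 by rewrite -qq -mulrA qm0 mulr0.
have am0 : a * m = 0 by rewrite am cm0 oppr0.
have m0 : m = 0.
  apply: (uc_eq0 uc); apply/eqP; rewrite -sqrf_eq0 -n_sa//.
  by rewrite {1}/m mulrBl cm0 am0 subrr n0.
by have -> : a = c by apply/esym/eqP; rewrite -subr_eq0 -/m m0.
Qed.

End UnitalCStar.

(** * Extreme linear functionals *)

(* Extreme linear functionals below a sublinear one, by Zorn's lemma applied to
   sublinear functionals ordered by being a face: this yields the Hahn-Banach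
   and the Krein-Milman theorem at once and without a topology. *)
Section ExtremeFunctional.
Variables (R : realType) (V : lmodType R[i]).
Implicit Types (p q f g h : V -> R) (x y : V).
Local Notation "r *r x" := ((r%:C%C : R[i]) *: x) (at level 40).

Definition sublinear p : Prop :=
  (forall x y, p (x + y) <= p x + p y) /\
  (forall (r : R) x, 0 <= r -> p (r *r x) = r * p x).

Definition rlinear f : Prop :=
  (forall x y, f (x + y) = f x + f y) /\ (forall (r : R) x, f (r *r x) = r * f x).

(** For the support functions of two convex sets of functionals: the smaller set is a face of the
    larger one if it contains the midpoint of two points of the larger set only when it contains
    both points. *)
Definition face q p : Prop := (forall x, q x <= p x) /\
  forall f g, rlinear f -> rlinear g -> (forall x, f x <= p x) ->
    (forall x, g x <= p x) -> (forall x, f x + g x <= 2 * q x) ->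
  (forall x, f x <= q x) /\ (forall x, g x <= q x).

Lemma face_refl p : face p p. Proof. by split. Qed.

Lemma face_trans q p s : face q p -> face p s -> face q s.
Proof.
move=> [qp fq] [ps fp]; split=> [x|f g lf lg fs gs fg].
  exact: le_trans (qp x) (ps x).
have [fp' gp'] : (forall x, f x <= p x) /\ (forall x, g x <= p x).
  by apply: fp => // x; apply: le_trans (fg x) _; rewrite ler_pM2l.
exact: fq.
Qed.

Lemma rlinearN f x : rlinear f -> f (- x) = - f x.
Proof.
by move=> [_ fZ]; rewrite -scaleN1r -(rmorphN1 (real_complex R)) fZ mulN1r.
Qed.

Lemma sublinear0 p : sublinear p -> p 0 = 0.
Proof. by move=> [_ pZ]; have := pZ 0 0 (lexx _); rewrite scaler0 mul0r. Qed.

Lemma sublinear_opp p x : sublinear p -> - p (- x) <= p x.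
Proof. by move=> sp; have := sp.1 x (- x); rewrite subrr (sublinear0 sp); lra. Qed.

Section Direction.
Variables (p : V -> R) (a : V).
Hypothesis sp : sublinear p.

(* the support function of the face of the functionals below [p] that are
   maximal at [a] *)
Definition dirf x : R :=
  inf [set p (x + t *r a) - t * p a | t in [set t : R | 0 <= t]].

Let dirf_lb x t : 0 <= t -> - p (- x) <= p (x + t *r a) - t * p a.
Proof.
move=> t0; rewrite -(sp.2 _ a t0); have := sp.1 (x + t *r a) (- x).
by rewrite addrAC subrr add0r; lra.
Qed.

Let dirf_has_inf x :
  has_inf [set p (x + t *r a) - t * p a | t in [set t : R | 0 <= t]].
Proof.
split; first by exists (p (x + 0 *r a) - 0 * p a); exists 0 => //=.
by exists (- p (- x)) => _ [t t0 <-]; exact: dirf_lb.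
Qed.

Lemma dirf_le x t : 0 <= t -> dirf x <= p (x + t *r a) - t * p a.
Proof. by move=> t0; apply: ge_inf; [exact: (dirf_has_inf x).2|exists t]. Qed.

Lemma dirf_ge x l :
  (forall t, 0 <= t -> l <= p (x + t *r a) - t * p a) -> l <= dirf x.
Proof.
move=> h; apply: lb_le_inf; first exact: (dirf_has_inf x).1.
by move=> _ [t t0 <-]; exact: h.
Qed.

Lemma dirf_sublinear : sublinear dirf.
Proof.
split=> [x y|r x r0].
  have h t : 0 <= t -> dirf (x + y) - (p (y + t *r a) - t * p a) <= dirf x.
    move=> t0; apply: dirf_ge => s s0.
    have := @dirf_le (x + y) (s + t) (addr_ge0 s0 t0).
    have := sp.1 (x + s *r a) (y + t *r a).
    by rewrite addrACA -scalerDl -rmorphD; lra.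
  suff : dirf (x + y) - dirf x <= dirf y by lra.
  by apply: dirf_ge => t /h; lra.
have [->|rn0] := eqVneq r 0.
  rewrite scale0r mul0r; apply/eqP; rewrite eq_le; apply/andP; split.
    by have := @dirf_le 0 0 (lexx _); rewrite scale0r addr0 (sublinear0 sp); lra.
  by apply: dirf_ge => t t0; rewrite add0r (sp.2 _ _ t0) subrr.
have r0' : 0 < r by rewrite lt_neqAle eq_sym rn0.
apply/eqP; rewrite eq_le; apply/andP; split.
  rewrite mulrC -ler_pdivrMr//; apply: dirf_ge => t t0.
  rewrite ler_pdivrMr//; have := @dirf_le (r *r x) (r * t) (mulr_ge0 r0 t0).
  rewrite rmorphM/= -scalerA -scalerDr (sp.2 _ _ r0) => /le_trans; apply.
  by rewrite le_eqVlt; apply/orP; left; apply/eqP; ring.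
apply: dirf_ge => t t0; rewrite mulrC -ler_pdivlMr//.
have tr : 0 <= t / r by rewrite divr_ge0.
apply: le_trans (dirf_le x tr) _; rewrite ler_pdivlMr// mulrC mulrBr.
rewrite -(sp.2 _ _ r0) scalerDr scalerA -rmorphM/= mulrCA divff// mulr1.
by rewrite mulrA mulrCA divff// mulr1.
Qed.

(** At [- a] the bound on [f + g] says [f a + g a >= 2 p a], which forces both to attain the maximum
    [p a]. *)
Lemma dirf_face : face dirf p.
Proof.
have opp : dirf (- a) <= - p a.
  have := @dirf_le (- a) 1 ler01.
  by rewrite scale1r addNr (sublinear0 sp) mul1r sub0r.
split=> [x|f g lf lg fp gp fg].
  by have := @dirf_le x 0 (lexx _); rewrite scale0r addr0 mul0r subr0.
have := fg (- a); rewrite (rlinearN a lf) (rlinearN a lg) => s.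
have ef : f a = p a by have := fp a; have := gp a; lra.
have eg : g a = p a by have := fp a; have := gp a; lra.
split=> x; apply: dirf_ge => t t0.
  by have := fp (x + t *r a); rewrite lf.1 lf.2 ef; lra.
by have := gp (x + t *r a); rewrite lg.1 lg.2 eg; lra.
Qed.

Lemma dirf_opp : dirf (- a) <= - p a.
Proof.
have := @dirf_le (- a) 1 ler01.
by rewrite scale1r addNr (sublinear0 sp) mul1r sub0r.
Qed.

End Direction.

Lemma minimal_face p : sublinear p -> exists2 q, sublinear q /\ face q p &
  forall s, sublinear s -> face s q -> forall x, q x <= s x.
Proof.
move=> sp; pose T := {q : V -> R | sublinear q /\ face q p}.
pose r (s t : T) := `[< face (sval t) (sval s) >].
pose t0 : T := exist _ p (conj sp (face_refl p)).
have [||A tot|t tP] := @ZL_preorder T t0 r.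
- by move=> t; apply/asboolP; exact: face_refl.
- move=> s t u /asboolP st /asboolP tu; apply/asboolP; exact: face_trans tu st.
- have [[a0 Aa0]|A0] := pselect (exists a, A a); last first.
    by exists t0 => s As; case: A0; exists s.
  pose E x := [set sval a x | a in A].
  have Ei x : has_inf (E x).
    split; first by exists (sval a0 x); exists a0.
    exists (- p (- x)) => _ [a Aa <-]; have [sa fa] := svalP a.
    by apply: le_trans (sublinear_opp x sa); rewrite lerN2; exact: fa.1.
  pose m x := inf (E x).
  have m_le a x : A a -> m x <= sval a x.
    by move=> Aa; apply: ge_inf; [exact: (Ei x).2|exists a].
  have m_ge x l : (forall a, A a -> l <= sval a x) -> l <= m x.
    by move=> h; apply: lb_le_inf; [exact: (Ei x).1|move=> _ [a Aa <-]; exact: h].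
  have sm : sublinear m.
    split=> [x y|c x c0].
      suff : m (x + y) - m y <= m x by lra.
      apply: (m_ge) => a Aa; suff : m (x + y) - sval a x <= m y by lra.
      apply: (m_ge) => b Ab.
      (* In a chain some member lies below both given ones, so the pointwise infimum is
         subadditive. *)
      suff [d [Ad da db]] : exists d, [/\ A d, sval d x <= sval a x
          & sval d y <= sval b y].
        by have := m_le d (x + y) Ad; have := (svalP d).1.1 x y; lra.
      have [/asboolP[ba _]|/asboolP[ab _]] := tot _ _ Aa Ab.
        by exists b; split.
      by exists a; split.
    have [->|cn0] := eqVneq c 0.
      rewrite scale0r mul0r; apply/eqP; rewrite eq_le; apply/andP; split.
        by have := m_le a0 0 Aa0; rewrite (sublinear0 (svalP a0).1).
      by apply: (m_ge) => a _; rewrite (sublinear0 (svalP a).1).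
    have c0' : 0 < c by rewrite lt_neqAle eq_sym cn0.
    apply/eqP; rewrite eq_le; apply/andP; split.
      rewrite mulrC -ler_pdivrMr//; apply: (m_ge) => a Aa; rewrite ler_pdivrMr//.
      by rewrite mulrC -((svalP a).1.2 _ _ c0) m_le.
    apply: (m_ge) => a Aa; rewrite ((svalP a).1.2 _ _ c0) ler_pM2l//.
    exact: m_le.
  have fm a : A a -> face m (sval a).
    move=> Aa; split=> [x|f g lf lg fa ga fg]; first exact: m_le.
    have h b : A b -> (forall x, f x <= sval b x) /\ (forall x, g x <= sval b x).
      move=> Ab; have [/asboolP[_ fb]|/asboolP[ab _]] := tot _ _ Aa Ab.
        by apply: fb => // x; have := fg x; have := m_le b x Ab; lra.
      by split=> x; [exact: le_trans (fa x) (ab x)|exact: le_trans (ga x) (ab x)].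
    by split=> x; apply: (m_ge) => b /h[].
  exists (exist _ m (conj sm (face_trans (fm _ Aa0) (svalP a0).2))).
  by move=> s As; apply/asboolP; exact: (fm s As).
exists (sval t) => [|s ss st]; first exact: (svalP t).
have := tP (exist _ s (conj ss (face_trans st (svalP t).2))).
by move=> /(_ (introT (asboolP _) st))/asboolP[].
Qed.

(** A minimal face is a single point: minimality against [dirf x] gives [q (- x) <= - q x], and a
    sublinear functional with this property is linear. Starting from the face where [c] is maximal
    ensures [f c = p c]. *)
Theorem extreme_functional p c : sublinear p -> exists f,
  [/\ rlinear f, forall x, f x <= p x, f c = p c
    & forall (l : R) g h, 0 < l < 1 -> rlinear g -> rlinear h ->
        (forall x, g x <= p x) -> (forall x, h x <= p x) ->
        (forall x, f x = l * g x + (1 - l) * h x) -> forall x, g x = f x].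
Proof.
move=> sp; have [q [sq fq] qm] := minimal_face (dirf_sublinear c sp).
have fqp := face_trans fq (dirf_face c sp).
have qo x : q (- x) <= - q x.
  have := qm _ (dirf_sublinear x sq) (dirf_face x sq) (- x).
  by have := dirf_opp x sq; lra.
have qN x : q (- x) = - q x.
  by apply/eqP; rewrite eq_le qo/= ; have := sublinear_opp x sq; lra.
have lq : rlinear q.
  split=> [x y|r x].
    apply/eqP; rewrite eq_le sq.1/=; have := sq.1 (- x) (- y).
    by rewrite -opprD !qN; lra.
  have [r0|r0] := leP 0 r; first exact: sq.2.
  have := sq.2 (- r) x; rewrite oppr_ge0 ltW// => /(_ isT).
  by rewrite rmorphN scaleNr qN; lra.
have qc : q c = p c.
  apply/eqP; rewrite eq_le fqp.1/=.
  have := fq.1 (- c); rewrite qN; have := dirf_opp c sp; lra.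
exists q; split=> //; first exact: fqp.1.
have mid g h : rlinear g -> rlinear h -> (forall x, g x <= p x) ->
    (forall x, h x <= p x) -> (forall x, g x + h x = 2 * q x) ->
    forall x, g x = q x /\ h x = q x.
  move=> lg lh gp hp gh x.
  have [gq hq] : (forall x, g x <= q x) /\ (forall x, h x <= q x).
    by apply: fqp.2 => // y; rewrite gh.
  have := gq (- x); have := hq (- x); rewrite (rlinearN x lg) (rlinearN x lh) !qN.
  by move=> h1 h2; have h3 := gq x; have h4 := hq x; split; lra.
move=> l g h /andP[l0 l1] lg lh gp hp e x.
have comb k g1 h1 : 0 <= k <= 1 -> rlinear g1 -> rlinear h1 ->
    (forall x, g1 x <= p x) -> (forall x, h1 x <= p x) ->
    rlinear (fun x => k * g1 x + (1 - k) * h1 x) /\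
    forall x, k * g1 x + (1 - k) * h1 x <= p x.
  move=> /andP[k0 k1] lg1 lh1 gp1 hp1; split.
    by split=> *; rewrite ?lg1.1 ?lh1.1 ?lg1.2 ?lh1.2; ring.
  move=> y; have := ler_wpM2l k0 (gp1 y).
  have k1' : 0 <= 1 - k by rewrite subr_ge0.
  by have := ler_wpM2l k1' (hp1 y); lra.
(* Unequal weights are reduced to a midpoint: for [l <= 1/2] the two functionals are
   [2 l g + (1 - 2 l) h] and [h]. *)
have [lh2|lh2] := leP l 2^-1.
  have k : 0 <= 2 * l <= 1 by lra.
  have [l1' p1'] := comb _ _ _ k lg lh gp hp.
  have [|_ hq] := mid _ _ l1' lh p1' hp _ x; first by move=> y; rewrite e; lra.
  have := e x; rewrite hq => e2; apply: (mulfI (lt0r_neq0 l0)); lra.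
have k : 0 <= 2 * (1 - l) <= 1 by lra.
have [l1' p1'] := comb _ _ _ k lh lg hp gp.
by have [|-> //] := mid _ _ lg l1' gp p1' _ x => y; rewrite e; lra.
Qed.

End ExtremeFunctional.

(** * Pure states and the GNS construction *)

Section GNS.
Variables (R : realType) (B : algType R[i]) (star : B -> B) (n : B -> R).
Hypothesis uc : unital_cstar star n.
Local Notation "r %:B" := ((r%:C%C : R[i])%:A : B) (at level 2, format "r %:B").

Lemma uc_star0 : star 0 = 0.
Proof. by apply: (addrI (star 0)); rewrite -(ucD uc) !addr0. Qed.

Lemma uc_starN a : star (- a) = - star a.
Proof. by apply/eqP; rewrite -addr_eq0 -(ucD uc) addNr uc_star0. Qed.

Lemma uc_star1 : star 1 = 1.
Proof. by rewrite -[LHS]mulr1 -{2}(ucK uc 1) -(ucM uc) mulr1 (ucK uc). Qed.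

Lemma uc_starZ (r : R) a : star (r%:C%C *: a) = r%:C%C *: star a.
Proof. by rewrite (ucZ uc) conjCr. Qed.

Lemma uc_norm0 : n 0 = 0.
Proof. by rewrite -(scale0r 0) (uc_normZ uc) /cabs normr0 mul0r. Qed.

Lemma uc_normZr (r : R) a : 0 <= r -> n (r%:C%C *: a) = r * n a.
Proof. by move=> r0; rewrite (uc_normZ uc) cabs_real ger0_norm. Qed.

Lemma uc_norm_starE a : n (star a) = n a.
Proof.
have le b : n b <= n (star b).
  have [->|b0] := eqVneq (n b) 0; first exact: (uc_ge0 uc).
  have b0' : 0 < n b by rewrite lt_neqAle eq_sym b0 (uc_ge0 uc).
  by rewrite -(ler_pM2r b0') -expr2 -(uc_norm_star uc) (uc_normM uc).
by apply/eqP; rewrite eq_le le andbT -{2}(ucK uc a) le.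
Qed.

Lemma uc_cone b c : exists q, star b * b + star c * c = star q * q.
Proof.
have [p [sp -> _]] := star_mul_sqr uc b; have [q [sq -> _]] := star_mul_sqr uc c.
have [w [sw ww _]] := uc_pos_sqrt uc (uc_posD uc (uc_pos_sqr uc sp) (uc_pos_sqr uc sq)).
by exists w; rewrite sw ww.
Qed.

Lemma uc_norm_mono b c : n (star b * b) <= n (star b * b + star c * c).
Proof.
have [p [sp -> _]] := star_mul_sqr uc b; have [q [sq -> _]] := star_mul_sqr uc c.
exact: (norm_sqr_mono uc).
Qed.

Lemma uc_norm_sqr_compl a : exists w, (n a ^+ 2)%:B - star a * a = star w * w.
Proof.
have [a0|a0] := eqVneq (n a) 0.
  by exists 0; rewrite a0 (uc_eq0 uc a0) mulr0 expr0n scale0r subr0.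
have a0' : 0 < n a ^+ 2 by rewrite exprn_gt0// lt_neqAle eq_sym a0 (uc_ge0 uc).
pose y := ((n a ^+ 2)^-1)%:C%C *: (star a * a).
have sy : star y = y by rewrite uc_starZ (ucM uc) (ucK uc).
have ny : n y <= 1.
  by rewrite uc_normZr ?invr_ge0 ?(ltW a0')// (uc_norm_star uc) mulVf ?gt_eqF.
have [w [sw ww _ _]] := visser_sqrt uc sy ny.
exists ((n a)%:C%C *: w); rewrite uc_starZ sw -scalerAl -scalerAr scalerA -rmorphM/=.
by rewrite -expr2 ww /y scalerBr scalerA -rmorphM/= divff ?gt_eqF// rmorph1 scale1r.
Qed.

Section State.
Variable f : B -> R.

(** The real part of a positive functional, which determines the functional. *)
Record uc_state : Prop := UcState {
  usL : rlinear f;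
  usJ : forall a, f (star a) = f a;
  us_ge0 : forall a, 0 <= f (star a * a) }.

Hypothesis sf : uc_state.
Definition gform (a b : B) : R := f (star a * b).

Lemma gform_form : real_form gform.
Proof.
split=> [u v|u v w|r u v|u|c u v]; rewrite /gform.
- by rewrite -(usJ sf) (ucM uc) (ucK uc).
- by rewrite mulrDr (usL sf).1.
- by rewrite -scalerAr (usL sf).2.
- exact: (us_ge0 sf).
- by rewrite (ucZ uc) conjCK -scalerAr -scalerAl.
Qed.

Local Notation H := (hcompletion gform_form).
Let gB := gform_form.

Let fB a b : f (a - b) = f a - f b.
Proof. by rewrite (usL sf).1 (rlinearN _ (usL sf)). Qed.

Lemma gform_mul a w : qn gform (a * w) <= n a * qn gform w.
Proof.
apply: qn_le => //; first by rewrite mulr_ge0 ?(uc_ge0 uc) ?qn_ge0.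
rewrite exprMn (qn_sqr gB); have [x ax] := uc_norm_sqr_compl a.
have := us_ge0 sf (x * w); rewrite (ucM uc) !mulrA -[star w * star x * x]mulrA -ax.
rewrite mulrBr mulrBl -scalerAr mulr1 -scalerAl fB (usL sf).2 subr_ge0.
by rewrite /gform (ucM uc) !mulrA.
Qed.

Lemma gns_subproof a (F : H) d : 0 < d ->
  exists u, appx gform d (fun w => F (star a * w)) u.
Proof.
move=> d0; have a1 : 0 < n a + 1 by rewrite ltr_wpDl ?(uc_ge0 uc).
have [u Fu] := cappx F (divr_gt0 d0 a1); exists (a * u) => w.
have -> : gform w (a * u) = gform (star a * w) u.
  by rewrite /gform (ucM uc) (ucK uc) mulrA.
apply: le_trans (Fu _) _.
have := gform_mul (star a) w; rewrite uc_norm_starE => le.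
have q0 := qn_ge0 gform w; have dn := divr_ge0 (ltW d0) (ltW a1).
apply: le_trans (ler_wpM2l dn le) _; rewrite mulrA ler_wpM2r//.
by rewrite mulrAC ler_pdivrMr// ler_wpM2l ?(ltW d0)// lerDl.
Qed.

(** A vector is a functional [w |-> <w, u>], so [a] acts by composition with left multiplication by
    [star a]. *)
Definition gns (a : B) (F : H) : H := Completion (@gns_subproof a F).

Lemma gnsE a F w : gns a F w = F (star a * w). Proof. by []. Qed.

Lemma gns_linear_r a c F G : gns a (c *: F + G) = c *: gns a F + gns a G.
Proof.
by apply: cext => w; rewrite gnsE !caddE !cscaleE !gnsE -scalerAr.
Qed.

Lemma gns_linear_l c a b F : gns (c *: a + b) F = c *: gns a F + gns b F.
Proof.
apply: cext => w; rewrite gnsE !caddE cscaleE !gnsE (ucD uc) (ucZ uc).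
by rewrite mulrDl -scalerAl cfunD -scalerAr.
Qed.

Lemma gnsZ c a F : gns (c *: a) F = c *: gns a F.
Proof. by apply: cext => w; rewrite cscaleE !gnsE (ucZ uc) -scalerAl -scalerAr. Qed.

Lemma gnsM a b F : gns (a * b) F = gns a (gns b F).
Proof. by apply: cext => w; rewrite !gnsE (ucM uc) mulrA. Qed.

Lemma gns1 F : gns 1 F = F.
Proof. by apply: cext => w; rewrite gnsE uc_star1 mul1r. Qed.

Lemma gns_emb a u : gns a (cemb gB u) = cemb gB (a * u).
Proof.
by apply: cext => w; rewrite gnsE /= /gform (ucM uc) (ucK uc) mulrA.
Qed.

Lemma gns_norm a (F : H) : nr (gns a F) <= n a * nr F.
Proof.
apply: qn_cfun_le => [|w]; first by rewrite mulr_ge0 ?(uc_ge0 uc) ?nr_ge0.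
rewrite gnsE; apply: le_trans (cfun_le _ _) _; rewrite [n a * _]mulrC -mulrA.
rewrite ler_wpM2l ?qn_ge0//; have := gform_mul (star a) w.
by rewrite uc_norm_starE.
Qed.

Lemma gns_adj a (F G : H) : hr (gns a F) G = hr F (gns (star a) G).
Proof.
apply/eqP; rewrite -subr_eq0; apply/eqP.
apply: (@eps_eq0 _ _ (2 * n a * nr G)); first by rewrite !mulr_ge0 ?(uc_ge0 uc) ?nr_ge0.
move=> e e0; have [u Fu] := cemb_dense F e0.
have -> : hr (gns a F) G - hr F (gns (star a) G) =
    hr (gns a (F - cemb gB u)) G - hr (F - cemb gB u) (gns (star a) G).
  have -> : gns a (F - cemb gB u) = gns a F - gns a (cemb gB u).
    by rewrite -scaleN1r addrC gns_linear_r scaleN1r addrC.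
  rewrite !(rfBl (hr_form H)) gns_emb !hr_emb gnsE (ucK uc).
  by ring.
apply: le_trans (ler_normB _ _) _.
have h1 := hr_le (gns a (F - cemb gB u)) G.
have h2 := hr_le (F - cemb gB u : H) (gns (star a) G).
have h3 := gns_norm a (F - cemb gB u); have h4 := gns_norm (star a) G.
rewrite uc_norm_starE in h4.
have h5 := ler_wpM2r (nr_ge0 (G : H)) h3.
have h6 := ler_wpM2l (nr_ge0 (F - cemb gB u : H)) h4.
have h7 := ler_wpM2r (mulr_ge0 (uc_ge0 uc a) (nr_ge0 (G : H))) Fu.
by lra.
Qed.

Definition gcyc : H := cemb gB 1.

Lemma hr_gcyc a (F : H) : hr (gns a gcyc) F = F a.
Proof. by rewrite gns_emb hr_emb mulr1. Qed.

End State.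

(* the support function of the set of positive functionals of norm at most 1 *)
Definition rep (a : B) : B := (2^-1)%:C%C *: (a + star a).
Definition psup (a : B) : R := inf [set n (rep a + star b * b) | b in [set: B]].

Let psup_hi a : has_inf [set n (rep a + star b * b) | b in [set: B]].
Proof.
split; first by exists (n (rep a + star 0 * 0)); exists 0.
by exists 0 => _ [b _ <-]; exact: (uc_ge0 uc).
Qed.

Lemma psup_le a b : psup a <= n (rep a + star b * b).
Proof. by apply: ge_inf; [exact: (psup_hi a).2|exists b]. Qed.

Lemma psup_ge a l : (forall b, l <= n (rep a + star b * b)) -> l <= psup a.
Proof.
by move=> h; apply: lb_le_inf; [exact: (psup_hi a).1|move=> _ [b _ <-]; exact: h].
Qed.

Lemma repD a b : rep (a + b) = rep a + rep b.
Proof. by rewrite /rep (ucD uc) addrACA scalerDr. Qed.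

Lemma repZ (r : R) a : rep (r%:C%C *: a) = r%:C%C *: rep a.
Proof. by rewrite /rep uc_starZ -scalerDr !scalerA mulrC. Qed.

Lemma rep_sa a : star a = a -> rep a = a.
Proof.
move=> sa_a; rewrite /rep sa_a scalerDr -scalerDl -rmorphD/= (_ : 2^-1 + 2^-1 = 1).
  by rewrite scale1r.
by lra.
Qed.

Lemma norm_rep a : n (rep a) <= n a.
Proof.
rewrite /rep uc_normZr ?invr_ge0//; have := uc_normD uc a (star a).
by rewrite uc_norm_starE; lra.
Qed.

Lemma psup_sublinear : sublinear psup.
Proof.
split=> [x y|r x r0].
  suff : psup (x + y) - psup y <= psup x by lra.
  apply: psup_ge => b; suff : psup (x + y) - n (rep x + star b * b) <= psup y by lra.
  apply: psup_ge => c; have [q bc] := uc_cone b c; have := psup_le (x + y) q.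
  rewrite -bc repD addrACA; have := uc_normD uc (rep x + star b * b) (rep y + star c * c).
  by lra.
have le s z : 0 <= s -> psup (s%:C%C *: z) <= s * psup z.
  move=> s0; have [->|sn0] := eqVneq s 0.
    rewrite mul0r scale0r; have := psup_le 0 0.
    by rewrite mulr0 /rep uc_star0 !addr0 scaler0 uc_norm0.
  have s0' : 0 < s by rewrite lt_neqAle eq_sym sn0.
  rewrite mulrC -ler_pdivrMr//; apply: psup_ge => b; rewrite ler_pdivrMr//.
  apply: le_trans (psup_le _ ((Num.sqrt s)%:C%C *: b)) _.
  rewrite repZ uc_starZ -scalerAl -scalerAr (scalerA _ _ (star b * b)).
  rewrite -rmorphM/= -expr2 sqr_sqrtr//.
  by rewrite -scalerDr uc_normZr// mulrC.
apply/eqP; rewrite eq_le le//=; have [->|rn0] := eqVneq r 0.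
  rewrite mul0r scale0r; apply: psup_ge => b; exact: (uc_ge0 uc).
have r0' : 0 < r by rewrite lt_neqAle eq_sym rn0.
have := le r^-1 (r%:C%C *: x); rewrite invr_ge0 => /(_ r0).
by rewrite scalerA -rmorphM/= mulVf// scale1r mulrC ler_pdivlMr// mulrC.
Qed.

Lemma psup_le_norm a : psup a <= n a.
Proof. by have := psup_le a 0; rewrite mulr0 addr0 => /le_trans; apply; exact: norm_rep. Qed.

(** The infimum in [psup] is tested where the norm vanishes: [b - b^*] has real part zero, and
    [- a^* a] is cancelled by the summand [a^* a]. *)
Lemma psup_state f : rlinear f -> (forall a, f a <= psup a) -> uc_state f.
Proof.
move=> lf fp; split=> // a.
  have h b : f (b - star b) <= 0.
    apply: le_trans (fp _) _; have := psup_le (b - star b) 0.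
    by rewrite mulr0 addr0 /rep (ucD uc) uc_starN (ucK uc) addrA subrK subrr scaler0
      uc_norm0.
  have := h a; have := h (star a); rewrite (ucK uc) !lf.1 !(rlinearN _ lf).
  by move=> h1 h2; apply/eqP; rewrite eq_le; apply/andP; split; lra.
have := fp (- (star a * a)); rewrite (rlinearN _ lf).
have := psup_le (- (star a * a)) a.
rewrite rep_sa ?uc_starN ?(ucM uc) ?(ucK uc)// addNr uc_norm0; lra.
Qed.


(* the norm and the extreme point are combined in the cyclic vector: an invariant
   subspace splits the state into two, and extremality makes them proportional *)
Theorem pure_state c : n c != 0 -> exists f (sf : uc_state f),
  [/\ nr (gcyc sf : hcompletion (gform_form sf)) = 1,
      nr (gns c (gcyc sf) : hcompletion (gform_form sf)) = n c
    & forall M : set (hcompletion (gform_form sf)), linear_subspace M -> closed M ->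
        (forall a h, M h -> M (gns a h)) -> M = [set 0] \/ M = setT].
Proof.
move=> c0; have c0' : 0 < n c ^+ 2.
  by rewrite exprn_gt0// lt_neqAle eq_sym c0 (uc_ge0 uc).
have [f [lf fp fc ext]] := extreme_functional (star c * c) psup_sublinear.
have sf := psup_state lf fp; exists f, sf.
pose H := hcompletion (gform_form sf).
have f_norm a : f a <= n a := le_trans (fp a) (psup_le_norm a).
have fcc : f (star c * c) = n c ^+ 2.
  apply/eqP; rewrite eq_le -(uc_norm_star uc) f_norm/= fc; apply: psup_ge => b.
  rewrite rep_sa ?(ucM uc) ?(ucK uc)//; exact: uc_norm_mono.
have f1 : f 1 = 1.
  apply/eqP; rewrite eq_le; apply/andP; split.
    apply: le_trans (f_norm 1) _; have := uc_norm_star uc 1.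
    rewrite uc_star1 mulr1 expr2 => e.
    have [->|n1] := eqVneq (n 1) 0; first exact: ler01.
    by rewrite -(mulfI n1 (_ : n 1 * 1 = n 1 * n 1)) ?mulr1.
  (* Since [f] takes the value [|c|^2] at [c^* c], positivity at [|c|^2 - c^* c] gives
     [f 1 >= 1]. *)
  have [w ew] := uc_norm_sqr_compl c; have := us_ge0 sf w.
  rewrite -ew lf.1 (rlinearN _ lf) lf.2 fcc.
  by rewrite -[X in _ - X]mulr1 -mulrBr pmulr_rge0// subr_ge0.
have cyc a b : hr (gns a (gcyc sf) : H) (gns b (gcyc sf)) = f (star a * b).
  by rewrite hr_gcyc gns_emb/= /gform mulr1.
have nrc a : nr (gns a (gcyc sf) : H) ^+ 2 = f (star a * a).
  by rewrite -hr_norm cyc.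
split.
- apply/eqP; rewrite -(@eqrXn2 _ 2)// ?nr_ge0//; apply/eqP.
  by have := nrc 1; rewrite gns1 uc_star1 mulr1 f1 expr1n.
- apply/eqP; rewrite -(@eqrXn2 _ 2)// ?nr_ge0// ?(uc_ge0 uc)//; apply/eqP.
  by rewrite nrc fcc.
move=> M [M0 Ml] cM Mi; pose xi : H := gcyc sf.
have hB := @hr_form R H.
have MZ (r : R[i]) (h : H) : M h -> M (r *: h).
  by move=> Mh; rewrite -[_ *: _]addr0; exact: Ml.
(* [u] is the projection of the cyclic vector [xi] to [M]. If both [u] and [v = xi - u] are
   non-zero, [f] is a proper convex combination of their normalised vector states. *)
have [| |h _|u Mu uP] := @riesz_on R H M (hr xi) (nr xi) (conj M0 Ml) cM.
- by move=> h k; exact: (rfD hB).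
- by move=> r h; exact: (rfZ hB).
- exact: le_trans (ler_norm _) (hr_le _ _).
pose v := xi - u; have vP h : M h -> hr v h = 0.
  by move=> Mh; rewrite (rfBl hB) uP// (rfC hB h) subrr.
have nu : hr u u = hr xi u by rewrite uP.
have nv : hr v v = 1 - hr u u.
  rewrite {2}/v (rfB hB) (vP _ Mu) subr0 (rfBl hB) nu (rfC hB u).
  by rewrite hr_norm; have := nrc 1; rewrite gns1 uc_star1 mulr1 f1 => ->.
have vM a h : M h -> hr (gns a v : H) h = 0.
  by move=> Mh; rewrite gns_adj vP//; exact: Mi.
have gB a (h k : H) : gns a (h - k) = gns a h - gns a k.
  by rewrite addrC -scaleN1r gns_linear_r scaleN1r addrC.
have zeroP (h : H) : (forall a, h a = 0) -> h = 0.
  by move=> h0; apply: cext => w; rewrite h0 /= (rf0 (gform_form sf)).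
have [u0|u0] := eqVneq (hr u u) 0.
  left; apply/seteqP; split=> [h Mh|_ ->//]; apply: zeroP => a.
  have uz : u = 0 by apply: nr0_eq0; apply/eqP; rewrite -sqrf_eq0 -hr_norm u0.
  rewrite -(hr_gcyc a h); have := vM a h Mh; rewrite /v uz subr0; exact.
have [v0|v0] := eqVneq (hr v v) 0.
  right; apply/seteqP; split=> // h _.
  have vz : v = 0 by apply: nr0_eq0; apply/eqP; rewrite -sqrf_eq0 -hr_norm v0.
  have Mxi : M xi by rewrite (_ : xi = u)//; apply/eqP; rewrite -subr_eq0 -/v vz.
  apply: (closed_nr cM) => e e0; have e2 : 0 < e / 2 by rewrite divr_gt0.
  have [w hw] := cemb_dense h e2; exists (cemb (gform_form sf) w).
    by rewrite -[w]mulr1 -gns_emb; exact: Mi.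
  by lra.
exfalso; pose l := hr u u.
have l0 : 0 < l by rewrite lt_neqAle eq_sym u0 (rf_ge0 hB).
have l1 : l < 1.
  by rewrite -subr_gt0 -nv lt_neqAle eq_sym v0 (rf_ge0 hB).
pose g (e : H) (a : B) := (hr e e)^-1 * hr e (gns a e).
have g_lin e : rlinear (g e).
  split=> [x y|r x]; rewrite /g.
    by rewrite -[x]scale1r gns_linear_l scale1r (rfD hB) scale1r mulrDr.
  by rewrite gnsZ (rfZ hB) mulrCA.
have g_le (e : H) : hr e e != 0 -> forall a, g e a <= psup a.
  move=> e0 a; have e0' : 0 < hr e e by rewrite lt_neqAle eq_sym e0 (rf_ge0 hB).
  apply: psup_ge => b; rewrite /g mulrC ler_pdivrMr//.
  have ea : hr e (gns a e) = hr e (gns (rep a) e).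
    rewrite /rep gnsZ (rfZ hB) -[a in a + _]scale1r gns_linear_l scale1r (rfD hB).
    by rewrite -gns_adj (rfC hB (gns a e)); lra.
  have eb : 0 <= hr e (gns (star b * b) e) by rewrite gnsM -gns_adj (rf_ge0 hB).
  have : hr e (gns (rep a + star b * b) e) <= n (rep a + star b * b) * hr e e.
    apply: le_trans (ler_norm _) _; apply: le_trans (hr_le _ _) _.
    have := gns_norm (rep a + star b * b) e; rewrite hr_norm.
    by move=> /(ler_wpM2l (nr_ge0 e)); rewrite mulrCA expr2.
  apply: le_trans; rewrite -[rep a in leRHS]scale1r gns_linear_l scale1r (rfD hB) ea.
  by rewrite lerDl.
have xiE : xi = u + v by rewrite addrC subrK.
clearbody v.
have split_f a : f a = l * g u a + (1 - l) * g v a.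
  rewrite /g -nv -/l !mulrA !divff ?mul1r//.
  have := cyc 1 a; rewrite gns1 uc_star1 mul1r => <-; rewrite -/xi xiE.
  have -> : gns a (u + v) = gns a u + gns a v by rewrite -[u]scale1r gns_linear_r !scale1r.
  rewrite (rfD hB) !(rfDl hB) (vP (gns a u)) ?addr0; last exact: Mi.
  have -> : hr u (gns a v) = 0.
    by rewrite (rfC hB) vM.
  by rewrite add0r.
have l01 : 0 < l < 1 by rewrite l0 l1.
have gf := ext l (g u) (g v) l01 (g_lin u) (g_lin v) (g_le _ u0) (g_le _ v0) split_f.
(* Extremality makes [u] proportional to [xi]; as [u] is a projection of [xi], the factor satisfies
   [l^2 = l], against [0 < l < 1]. *)
have ul : u = l%:C%C *: xi.
  apply/eqP; rewrite -subr_eq0; apply/eqP; apply: zeroP => a.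
  rewrite -hr_gcyc gns_adj gB.
  have -> : gns (star a) (l%:C%C *: xi) = l%:C%C *: gns (star a) xi.
    by apply: cext => w; rewrite cscaleE !gnsE cscaleE scalerAr.
  rewrite (rfB hB) (rfZ hB); have := cyc 1 (star a); rewrite gns1 uc_star1 mul1r => ->.
  rewrite -gf /g mulrA -/l divff// mul1r -/xi xiE (rfDl hB).
  by rewrite (vP (gns _ u)) ?addr0 ?subrr//; exact: Mi.
have xi1 : hr xi xi = 1 by have := cyc 1 1; rewrite gns1 uc_star1 mulr1 f1.
have := nu; rewrite ul !(rfZ hB) (rfZl hB) xi1 mulr1 => /eqP.
rewrite -subr_eq0 -[X in _ - X]mulr1 -mulrBr mulf_eq0 subr_eq0.
by rewrite (gt_eqF l0) (lt_eqF l1).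
Qed.

End GNS.

(** * The unitization *)

Section CStarFacts.
Variables (R : realType) (A : cstar_algebra R).
Implicit Types a b c : A.

Lemma cmul0l b : cmul (0 : A) b = 0.
Proof. by apply: (addrI (cmul 0 b)); rewrite -cmulDl !addr0. Qed.

Lemma cmul0r b : cmul b (0 : A) = 0.
Proof. by apply: (addrI (cmul b 0)); rewrite -cmulDr !addr0. Qed.

Lemma cmulNl a b : cmul (- a) b = - cmul a b.
Proof. by rewrite -scaleN1r cmulZl scaleN1r. Qed.

Lemma cmulNr a b : cmul a (- b) = - cmul a b.
Proof. by rewrite -scaleN1r cmulZr scaleN1r. Qed.

Lemma cmulBl a b c : cmul (a - b) c = cmul a c - cmul b c.
Proof. by rewrite cmulDl cmulNl. Qed.

Lemma cmulBr a b c : cmul c (a - b) = cmul c a - cmul c b.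
Proof. by rewrite cmulDr cmulNr. Qed.

Lemma cadj0 : cadj (0 : A) = 0.
Proof. by apply: (addrI (cadj 0)); rewrite -cadjD !addr0. Qed.

Lemma cadjN a : cadj (- a) = - cadj a.
Proof. by apply/eqP; rewrite -addr_eq0 -cadjD addNr cadj0. Qed.

Lemma cadjB a b : cadj (a - b) = cadj a - cadj b.
Proof. by rewrite cadjD cadjN. Qed.

Lemma cadjZr (r : R) a : cadj (r%:C%C *: a) = r%:C%C *: cadj a.
Proof. by rewrite cadjZ conjCr. Qed.

Lemma nrM a b : nr (cmul a b) <= nr a * nr b.
Proof. by rewrite -(@lecR R) rmorphM/= -!normE cnormM. Qed.

Lemma nr_cstar a : nr (cmul (cadj a) a) = nr a ^+ 2.
Proof. by apply: (@complexI R); rewrite rmorphXn/= -!normE cnorm_adj. Qed.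

Lemma nr_cadj a : nr (cadj a) = nr a.
Proof.
have le b : nr b <= nr (cadj b).
  have [->|b0] := eqVneq (nr b) 0; first exact: nr_ge0.
  have b0' : 0 < nr b by rewrite lt_neqAle eq_sym b0 nr_ge0.
  by rewrite -(ler_pM2r b0') -expr2 -nr_cstar nrM.
by apply/eqP; rewrite eq_le le andbT -{2}(cadjK a) le.
Qed.

Lemma nr_sa a : cadj a = a -> nr (cmul a a) = nr a ^+ 2.
Proof. by move=> sa; rewrite -{1}sa nr_cstar. Qed.

End CStarFacts.

Section ComplexComplete.
Variable R : realType.

Lemma cabs_re_le (z : R[i]) : `|re z| <= cabs z.
Proof. by rewrite -(@lecR R) /cabs -normC_re normc_ge_Re. Qed.

Lemma cabs_im_le (z : R[i]) : `|im z| <= cabs z.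
Proof.
have := cabs_re_le ('i%C * z); rewrite re_iM normrN cabsM.
by rewrite /cabs [in X in _ <= X * _]normc_def /= !expr0n/= expr1n add0r sqrtr1 mul1r.
Qed.

Lemma cabs_le_sum (z : R[i]) : cabs z <= `|re z| + `|im z|.
Proof.
rewrite {1}[z]complexE; have := ler_normD (re z)%:C%C ('i%C * (im z)%:C%C).
move=> /le_re; rewrite reD -/(cabs _) -/(cabs _) -/(cabs _) cabsM !cabs_real.
by rewrite [cabs 'i%C]/cabs normc_def /= !expr0n/= expr1n add0r sqrtr1 mul1r.
Qed.

Lemma cabsD (z w : R[i]) : cabs (z + w) <= cabs z + cabs w.
Proof. by have := le_re (ler_normD z w); rewrite reD. Qed.

Lemma cabs_eq0 (z : R[i]) : cabs z = 0 -> z = 0.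
Proof. by move=> z0; apply: normr0_eq0; rewrite normC_re -/(cabs z) z0. Qed.

Lemma cabs_complete : seq_complete (@cabs R).
Proof.
move=> u cu.
have [a ua] : exists a, slim (fun x : R => `|x|) (fun i => re (u i)) a.
  apply: real_seq_complete => e /cu[N NP]; exists N => i j iN jN.
  by apply: le_lt_trans (NP i j iN jN); rewrite -reN -reD cabs_re_le.
have [b ub] : exists b, slim (fun x : R => `|x|) (fun i => im (u i)) b.
  apply: real_seq_complete => e /cu[N NP]; exists N => i j iN jN.
  apply: le_lt_trans (NP i j iN jN); have := cabs_im_le (u i - u j).
  by case: (u i) (u j) => [? ?] [? ?].
exists (Complex a b) => e e0; have e2 : 0 < e / 2 by rewrite divr_gt0.
have [N1 N1P] := ua _ e2; have [N2 N2P] := ub _ e2; exists (maxn N1 N2) => i.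
rewrite geq_max => /andP[/N1P h1 /N2P h2].
apply: le_lt_trans (cabs_le_sum _) _; rewrite [e]splitr.
by case: (u i) h1 h2 => ? ? /= h1 h2; rewrite ltrD.
Qed.

End ComplexComplete.

Section Unitization.
Variables (R : realType) (A : cstar_algebra R).

Record unitization := Unitization { upart : A; uscal : R[i] }.
Implicit Types x y z : unitization.

Lemma unitization_ext x y : upart x = upart y -> uscal x = uscal y -> x = y.
Proof. by case: x y => [a u] [b v] /= -> ->. Qed.

HB.instance Definition _ := gen_eqMixin unitization.
HB.instance Definition _ := gen_choiceMixin unitization.

Let zero := Unitization 0 0.
Let opp x := Unitization (- upart x) (- uscal x).
Let add x y := Unitization (upart x + upart y) (uscal x + uscal y).
Let addA : associative add.
Proof. by move=> x y z; apply: unitization_ext; rewrite /= addrA. Qed.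
Let addC : commutative add.
Proof. by move=> x y; apply: unitization_ext; rewrite /= addrC. Qed.
Let add0 : left_id zero add.
Proof. by move=> x; apply: unitization_ext; rewrite /= add0r. Qed.
Let addN : left_inverse zero opp add.
Proof. by move=> x; apply: unitization_ext; rewrite /= addNr. Qed.
HB.instance Definition _ := GRing.isZmodule.Build unitization addA addC add0 addN.

Let one := Unitization 0 1.
Let mul x y := Unitization
  (cmul (upart x) (upart y) + uscal y *: upart x + uscal x *: upart y)
  (uscal x * uscal y).

Let mulA : associative mul.
Proof.
move=> x y z; apply: unitization_ext; rewrite /= ?mulrA//.
case: x y z => [a u] [b v] [c w] /=.
rewrite !cmulDl !cmulDr !scalerDr !cmulZl !cmulZr !scalerA cmulA.
rewrite -!addrA; congr (_ + _); rewrite [w * v]mulrC [w * u]mulrC.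
rewrite addrCA; congr (_ + _); rewrite [RHS]addrCA; congr (_ + _).
exact: addrCA.
Qed.
Let mul1l : left_id one mul.
Proof.
by move=> x; apply: unitization_ext; rewrite /= ?mul1r// cmul0l scaler0 !add0r scale1r.
Qed.
Let mul1r' : right_id one mul.
Proof.
by move=> x; apply: unitization_ext; rewrite /= ?mulr1// cmul0r scaler0 addr0 add0r scale1r.
Qed.
Let mulDl' : left_distributive mul add.
Proof.
move=> x y z; apply: unitization_ext; rewrite /= ?mulrDl//.
rewrite cmulDl scalerDr scalerDl (addrACA (cmul _ _)).
exact: addrACA.
Qed.
Let mulDr' : right_distributive mul add.
Proof.
move=> x y z; apply: unitization_ext; rewrite /= ?mulrDr//.
rewrite cmulDr scalerDr scalerDl (addrACA (cmul _ _)).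
exact: addrACA.
Qed.
Let one_neq0 : one != zero.
Proof. by apply/eqP => /(congr1 uscal)/eqP /=; rewrite oner_eq0. Qed.
HB.instance Definition _ := GRing.Zmodule_isNzRing.Build unitization
  mulA mul1l mul1r' mulDl' mulDr' one_neq0.

Let scale c x := Unitization (c *: upart x) (c * uscal x).
Let scaleA a b x : scale a (scale b x) = scale (a * b) x.
Proof. by apply: unitization_ext; rewrite /= ?scalerA ?mulrA. Qed.
Let scale1 : left_id 1 scale.
Proof. by move=> x; apply: unitization_ext; rewrite /= ?scale1r ?mul1r. Qed.
Let scaleDr : right_distributive scale +%R.
Proof. by move=> a x y; apply: unitization_ext; rewrite /= ?scalerDr ?mulrDr. Qed.
Let scaleDl x : {morph scale^~ x : a b / a + b}.
Proof. by move=> a b; apply: unitization_ext; rewrite /= ?scalerDl ?mulrDl. Qed.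
HB.instance Definition _ :=
  GRing.Zmodule_isLmodule.Build R[i] unitization scaleA scale1 scaleDr scaleDl.

Let scaleAl (c : R[i]) x y : c *: (x * y) = (c *: x) * y.
Proof.
apply: unitization_ext; rewrite /= ?mulrA// !scalerDr cmulZl !scalerA.
by rewrite [_ * c]mulrC.
Qed.
HB.instance Definition _ := GRing.Lmodule_isLalgebra.Build R[i] unitization scaleAl.

Let scaleAr (c : R[i]) x y : c *: (x * y) = x * (c *: y).
Proof.
apply: unitization_ext => /=; last exact: mulrCA.
by rewrite !scalerDr cmulZr !scalerA [_ * c]mulrC.
Qed.
HB.instance Definition _ := GRing.Lalgebra_isAlgebra.Build R[i] unitization scaleAr.

Definition ustar x := Unitization (cadj (upart x)) (uscal x)^*.

Definition uact x (b : A) : A := cmul (upart x) b + uscal x *: b.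

Definition uopn x : R := sup [set nr (uact x b) | b in [set b : A | nr b <= 1]].

(** The operator norm alone is degenerate if [A] already has a unit; the modulus of the scalar part
    separates that unit from the adjoined one. *)
Definition unorm x : R := Num.max (uopn x) (cabs (uscal x)).

Lemma uactD x y b : uact (x + y) b = uact x b + uact y b.
Proof. by rewrite /uact /= cmulDl scalerDl addrACA. Qed.

Lemma uactZ c x b : uact (c *: x) b = c *: uact x b.
Proof. by rewrite /uact /= cmulZl scalerDr scalerA. Qed.

Lemma uactZr x c b : uact x (c *: b) = c *: uact x b.
Proof. by rewrite /uact cmulZr scalerA mulrC -scalerA -scalerDr. Qed.

Lemma uactM x y b : uact (x * y) b = uact x (uact y b).
Proof.
rewrite /uact /= !cmulDl !cmulDr !scalerDr !cmulZl !cmulZr cmulA !scalerA.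
by rewrite -!addrA.
Qed.

Let nr_uact_le x b : nr (uact x b) <= (nr (upart x) + cabs (uscal x)) * nr b.
Proof.
apply: le_trans (nrD _ _) _; rewrite mulrDl nrZ lerD2r; exact: nrM.
Qed.

Let uopn_sup x : has_sup [set nr (uact x b) | b in [set b : A | nr b <= 1]].
Proof.
split; first by exists (nr (uact x 0)); exists 0 => //=; rewrite nr0.
exists (nr (upart x) + cabs (uscal x)) => _ [b /= b1 <-].
apply: le_trans (nr_uact_le x b) _.
by rewrite ler_piMr// addr_ge0 ?nr_ge0 ?cabs_ge0.
Qed.

Lemma uopn_ge0 x : 0 <= uopn x.
Proof.
have h : nr (uact x 0) <= uopn x.
  by apply: ub_le_sup; [exact: (uopn_sup x).2|exists 0 => //=; rewrite nr0].
exact: le_trans (nr_ge0 _) h.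
Qed.

Lemma uact_norm x b : nr (uact x b) <= uopn x * nr b.
Proof.
have [b0|b0] := eqVneq (nr b) 0.
  rewrite (nr0_eq0 b0) nr0 mulr0 /uact cmul0r scaler0 addr0 nr0; exact: lexx.
have b0' : 0 < nr b by rewrite lt_neqAle eq_sym b0 nr_ge0.
rewrite -ler_pdivrMr//; have c0 : 0 <= (nr b)^-1 by rewrite invr_ge0 ltW.
have -> : nr (uact x b) / nr b = nr (uact x ((nr b)^-1%:C%C *: b)).
  by rewrite uactZr nrZ cabs_real ger0_norm// mulrC.
apply: ub_le_sup; first exact: (uopn_sup x).2.
by exists ((nr b)^-1%:C%C *: b) => //=; rewrite nrZ cabs_real ger0_norm// mulVf.
Qed.

Lemma uopn_le x (K : R) : 0 <= K -> (forall b, nr (uact x b) <= K * nr b) -> uopn x <= K.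
Proof.
move=> K0 h; apply: ge_sup; first exact: (uopn_sup x).1.
by move=> _ [b /= b1 <-]; apply: le_trans (h b) _; rewrite ler_piMr.
Qed.

Let uact_star x b : cmul (cadj (uact x b)) (uact x b) =
  cmul (cadj b) (uact (ustar x * x) b).
Proof.
have -> : cadj (uact x b) =
    cmul (cadj b) (cadj (upart x)) + (uscal x)^* *: cadj b.
  by rewrite /uact cadjD cadjM cadjZ.
rewrite uactM; move: (uact x b) => w.
by rewrite cmulDl -cmulA cmulZl /uact /= cmulDr cmulZr.
Qed.

Let uopn_sqr x : uopn x ^+ 2 <= uopn (ustar x * x).
Proof.
have h : uopn x <= Num.sqrt (uopn (ustar x * x)).
  apply: uopn_le => [|b]; first exact: sqrtr_ge0.
  rewrite -ler_sqr ?nnegrE ?mulr_ge0 ?nr_ge0 ?sqrtr_ge0//.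
  rewrite exprMn sqr_sqrtr ?uopn_ge0// -nr_cstar uact_star.
  apply: le_trans (nrM _ _) _; rewrite nr_cadj expr2 mulrCA.
  rewrite ler_wpM2l ?nr_ge0//; exact: uact_norm.
rewrite -[leRHS]sqr_sqrtr ?uopn_ge0//.
by rewrite ler_sqr ?nnegrE ?uopn_ge0 ?sqrtr_ge0.
Qed.

Let uopnM x y : uopn (x * y) <= uopn x * uopn y.
Proof.
apply: uopn_le => [|b]; first by rewrite mulr_ge0 ?uopn_ge0.
rewrite uactM; apply: le_trans (uact_norm _ _) _.
by rewrite -mulrA ler_wpM2l ?uopn_ge0// uact_norm.
Qed.

Let ustarK : involutive ustar.
Proof. by move=> x; apply: unitization_ext; rewrite /= ?cadjK ?conjCK. Qed.

Let uopn_star x : uopn (ustar x) = uopn x.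
Proof.
have le y : uopn y <= uopn (ustar y).
  have [->|y0] := eqVneq (uopn y) 0; first exact: uopn_ge0.
  have y0' : 0 < uopn y by rewrite lt_neqAle eq_sym y0 uopn_ge0.
  by rewrite -(ler_pM2r y0') -expr2; apply: le_trans (uopn_sqr y) (uopnM _ _).
by apply/eqP; rewrite eq_le le andbT -{2}(ustarK x) le.
Qed.

Definition uemb (a : A) : unitization := Unitization a 0.

Lemma uopn_emb a : uopn (uemb a) = nr a.
Proof.
apply/eqP; rewrite eq_le; apply/andP; split.
  apply: uopn_le => [|b]; first exact: nr_ge0.
  by rewrite /uact /= scale0r addr0 nrM.
have [->|a0] := eqVneq (nr a) 0; first exact: uopn_ge0.
have a0' : 0 < nr a by rewrite lt_neqAle eq_sym a0 nr_ge0.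
have := uact_norm (uemb a) (cadj a); rewrite /uact /= scale0r addr0.
by rewrite -{1}(cadjK a) nr_cstar nr_cadj expr2 ler_pM2r.
Qed.

Lemma unorm_emb a : unorm (uemb a) = nr a.
Proof.
by rewrite /unorm uopn_emb /= (_ : cabs 0 = 0) ?max_l ?nr_ge0// /cabs normr0.
Qed.

Lemma unorm_le x : unorm x <= nr (upart x) + cabs (uscal x).
Proof.
rewrite /unorm ge_max; apply/andP; split; last by rewrite lerDr nr_ge0.
by apply: uopn_le => [|b]; [rewrite addr_ge0 ?nr_ge0 ?cabs_ge0|exact: nr_uact_le].
Qed.

Let upart_le x : nr (upart x) <= unorm x + cabs (uscal x).
Proof.
rewrite -uopn_emb; apply: uopn_le => [|b].
  by rewrite addr_ge0 ?cabs_ge0// le_max uopn_ge0.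
have -> : uact (uemb (upart x)) b = uact x b - uscal x *: b.
  by rewrite /uact /= scale0r addr0 addrK.
apply: le_trans (nrB _ _) _; rewrite nrZ mulrDl lerD2r.
apply: le_trans (uact_norm _ _) _.
by rewrite ler_wpM2r ?nr_ge0// le_max lexx.
Qed.

Theorem unitization_cstar : unital_cstar ustar unorm.
Proof.
split.
- exact: ustarK.
- by move=> x y; apply: unitization_ext => /=; [exact: cadjD|exact: rmorphD].
- by move=> c x; apply: unitization_ext => /=; [exact: cadjZ|exact: rmorphM].
- move=> x y; apply: unitization_ext => /=; last by rewrite rmorphM mulrC.
  by rewrite !cadjD cadjM !cadjZ addrAC.
- by move=> x; rewrite le_max uopn_ge0.
- move=> x y; rewrite /unorm ge_max; apply/andP; split.
    apply: (@le_trans _ _ (uopn x + uopn y)).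
      apply: uopn_le => [|b]; first by rewrite addr_ge0 ?uopn_ge0.
      by rewrite uactD mulrDl; apply: le_trans (nrD _ _) _; rewrite lerD ?uact_norm.
    by rewrite lerD// le_max lexx.
  apply: le_trans (cabsD _ _) _; by rewrite lerD// le_max lexx orbT.
- move=> c x.
  have le d y : unorm (d *: y) <= cabs d * unorm y.
    rewrite /unorm ge_max; apply/andP; split.
      apply: uopn_le => [|b].
        by rewrite mulr_ge0 ?cabs_ge0// le_max uopn_ge0.
      rewrite uactZ nrZ -mulrA ler_wpM2l ?cabs_ge0//.
      apply: le_trans (uact_norm _ _) _.
      by rewrite ler_wpM2r ?nr_ge0// le_max lexx.
    by rewrite /= cabsM ler_wpM2l ?cabs_ge0// le_max lexx orbT.
  apply/eqP; rewrite eq_le le/=; have [->|c0] := eqVneq c 0.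
    by rewrite /cabs normr0 mul0r le_max uopn_ge0.
  have c0' : 0 < cabs c.
    by rewrite lt_neqAle cabs_ge0 andbT eq_sym; apply: contra c0 => /eqP/cabs_eq0 ->.
  have := le c^-1 (c *: x); rewrite scalerA mulVf// scale1r.
  have -> : cabs c^-1 = (cabs c)^-1.
    apply: (mulfI (lt0r_neq0 c0')); rewrite divff ?gt_eqF// -cabsM divff//.
    by rewrite -(rmorph1 (real_complex R)) cabs_real normr1.
  by rewrite mulrC ler_pdivlMr// mulrC.
- move=> x y; rewrite /unorm ge_max; apply/andP; split.
    apply: le_trans (uopnM x y) _.
    by rewrite ler_pM ?uopn_ge0// le_max lexx.
  by rewrite /= cabsM ler_pM ?cabs_ge0// le_max lexx orbT.
- move=> x; have e : cabs (uscal (ustar x * x)) = cabs (uscal x) ^+ 2.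
    by rewrite /= cabsM cabsJ expr2.
  have eo : uopn (ustar x * x) = uopn x ^+ 2.
    apply/eqP; rewrite eq_le uopn_sqr andbT.
    by apply: le_trans (uopnM _ _) _; rewrite uopn_star expr2.
  rewrite /unorm e eo; case: (leP (uopn x) (cabs (uscal x))) => h.
    by rewrite max_r// ler_sqr ?nnegrE ?uopn_ge0 ?cabs_ge0.
  by rewrite max_l// ler_sqr ?nnegrE ?uopn_ge0 ?cabs_ge0// ltW.
- move=> x x0; have s0 : uscal x = 0.
    apply: cabs_eq0; apply/eqP; rewrite eq_le cabs_ge0 andbT -x0.
    by rewrite le_max lexx orbT.
  apply: unitization_ext => //=; apply: nr0_eq0; apply/eqP.
  by rewrite eq_le nr_ge0 andbT; have := upart_le x; rewrite x0 s0 /cabs normr0 addr0.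
- move=> u cu.
  have cs i j : cabs (uscal (u i) - uscal (u j)) <= unorm (u i - u j).
    by rewrite le_max lexx orbT.
  have [z uz] : exists z : R[i], slim (@cabs R) (fun i => uscal (u i)) z.
    apply: cabs_complete => e /cu[N NP]; exists N => i j iN jN.
    exact: le_lt_trans (cs i j) (NP i j iN jN).
  have [a ua] : exists a, slim (@nr R A) (fun i => upart (u i)) a.
    apply: nr_complete => e e0; have e2 : 0 < e / 2 by rewrite divr_gt0.
    have [N NP] := cu _ e2; exists N => i j iN jN.
    have := upart_le (u i - u j); have := cs i j; have := NP i j iN jN.
    by rewrite /=; lra.
  exists (Unitization a z) => e e0; have e2 : 0 < e / 2 by rewrite divr_gt0.
  have [N1 N1P] := ua _ e2; have [N2 N2P] := uz _ e2; exists (maxn N1 N2) => i.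
  rewrite geq_max => /andP[/N1P h1 /N2P h2].
  apply: le_lt_trans (unorm_le _) _; rewrite [e]splitr ltrD//.
Qed.

Lemma uemb_linear c a b : uemb (c *: a + b) = c *: uemb a + uemb b.
Proof. by apply: unitization_ext; rewrite /= ?mulr0 ?addr0. Qed.

Lemma uembM a b : uemb (cmul a b) = uemb a * uemb b.
Proof. by apply: unitization_ext; rewrite /= ?mulr0// !scale0r !addr0. Qed.

Lemma uemb_star a : ustar (uemb a) = uemb (cadj a).
Proof. by apply: unitization_ext; rewrite /= ?rmorph0. Qed.

Lemma unitizationE x : x = uemb (upart x) + (uscal x)%:A.
Proof.
by apply: unitization_ext; rewrite /= ?scaler0 ?addr0 ?add0r ?mulr1.
Qed.

End Unitization.

(** * Irreducible representations attaining the norm *)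

Section Irreps.
Variable R : realType.

Lemma bounded_continuous (V W : normedModType R[i]) (f : V -> W) (K : R) :
  (forall x y, f (x - y) = f x - f y) -> (forall x, nr (f x) <= K * nr x) ->
  continuous f.
Proof.
move=> fB fK x; apply/cvgrPdist_lt => e /gt0_re[r r0 ->].
have K1 : 0 < `|K| + 1 by rewrite ltr_wpDl.
have d0 : 0 < (r / (`|K| + 1))%:C%C :> R[i] by rewrite ltcR divr_gt0.
apply: filterS (nbhsx_ballx x _ d0) => y; rewrite -ball_normE/= !normE !ltcR -fB.
rewrite ltr_pdivlMr// => lt; apply: le_lt_trans (fK _) (le_lt_trans _ lt).
rewrite mulrC ler_wpM2l ?nr_ge0//; apply: le_trans (ler_norm K) _.
by rewrite lerDl.
Qed.

Variable A : cstar_algebra R.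
Local Notation At := (unitization A).
Let uc := unitization_cstar A.

(** A pure state of the unitization is restricted to [A]: a subspace invariant under [A] is
    invariant under the adjoined scalars too, so irreducibility survives. *)
Theorem irrep_norm (b : A) : b != 0 ->
  exists (pi : irrep A) (v : pi), nr v = 1 /\ nr (irrep_op b v) = nr b.
Proof.
move=> b0; have nb0 : nr b != 0 by apply: contra b0 => /eqP/nr0_eq0 ->.
have [|f [sf [xi1 xib irr]]] := @pure_state R At _ _ uc (uemb b).
  by rewrite unorm_emb.
pose H := hcompletion (gform_form uc sf).
pose op (a : A) (F : H) : H := gns (uemb a) F.
have opB a (F G : H) : op a (F - G) = op a F - op a G.
  by rewrite /op addrC -scaleN1r gns_linear_r scaleN1r addrC.
have cont a : continuous (op a).
  by apply: (bounded_continuous (opB a)); exact: gns_norm.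
have lin a c (h k : H) : op a (c *: h + k) = c *: op a h + op a k.
  exact: gns_linear_r.
have lin' c a a' (h : H) : op (c *: a + a') h = c *: op a h + op a' h.
  by rewrite /op uemb_linear gns_linear_l.
have mul a a' (h : H) : op (cmul a a') h = op a (op a' h) by rewrite /op uembM gnsM.
have adj a (h k : H) : hip (op a h) k = hip h (op (cadj a) k).
  have adj' (h' k' : H) : hr (op a h') k' = hr h' (op (cadj a) k').
    by rewrite /op gns_adj uemb_star.
  apply: hip_eq; first exact: adj'.
  rewrite adj'; congr (re (hip h _)).
  by apply: cext => w; rewrite cscaleE !gnsE cscaleE scalerAr.
have neq0 : exists a (h : H), op a h != 0.
  exists b, (gcyc uc sf); apply/negP => /eqP e; move: xib; rewrite -/(op _ _) e nr0.
  by rewrite unorm_emb => /esym/eqP; rewrite (negPf nb0).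
have irr' (M : set H) : linear_subspace M -> closed M ->
    (forall a h, M h -> M (op a h)) -> M = [set 0] \/ M = setT.
  move=> [M0 Ml] cM Mi; apply: (irr M (conj M0 Ml) cM) => a h Mh.
  rewrite (unitizationE a) addrC gns_linear_l gns1.
  by apply: Ml => //; exact: Mi.
exists (@Irrep R A H op cont lin lin' mul adj neq0 irr'), (gcyc uc sf).
by split=> //; rewrite -unorm_emb -xib.
Qed.

(** [r] is [1 - sqrt (1 - y)], which lies in [A] even if [1] does not, because the square root has
    scalar part [1]. *)
Lemma visser_calg (y : A) : cadj y = y -> nr y <= 1 -> exists r, [/\ cadj r = r,
  r + r - cmul r r = y & forall z, cmul y z = cmul z y -> cmul r z = cmul z r].
Proof.
move=> sy y1; have [||w [sw ww nw wc]] := @visser_sqrt R At _ _ uc (uemb y).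
- by rewrite uemb_star sy.
- by rewrite unorm_emb.
(* The scalar part squares to [1], and [-1] is excluded by [|1 - w| <= 1]. *)
have s1 : uscal w = 1.
  have : uscal w * uscal w = 1 by have := congr1 (@uscal R A) ww; rewrite /= subr0.
  have : cabs (1 - uscal w) <= 1 by apply: le_trans nw; rewrite le_max lexx orbT.
  move=> le /eqP; rewrite -expr2 sqrf_eq1 => /orP[/eqP//|/eqP s].
  have : 1 + 1 <= (1 : R).
    apply: le_trans le; rewrite s opprK.
    have -> : 1 + 1 = (1 + 1 : R)%:C%C :> R[i] by rewrite rmorphD rmorph1.
    by rewrite cabs_real ler_norm.
  by rewrite gerDl ler10.
exists (- upart w); split.
- by rewrite cadjN; congr (- _); exact: (congr1 (@upart R A) sw).
- have := congr1 (@upart R A) ww; rewrite /= s1 !scale1r sub0r => e.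
  rewrite cmulNl cmulNr opprK -[y]opprK -e !opprD -!addrA.
  by rewrite [RHS]addrC -!addrA [_ - cmul _ _]addrC.
- move=> z yz; rewrite cmulNl cmulNr; congr (- _).
  have := wc (uemb z); rewrite -!uembM yz => /(_ erefl)/(congr1 (@upart R A)).
  by rewrite /= s1 !scale0r !addr0 ?add0r scale1r => /addIr.
Qed.

Lemma cpositive_sqrt (a : A) : cpositive a -> exists q, [/\ cadj q = q, cmul q q = a
  & forall z, cmul a z = cmul z a -> cmul q z = cmul z q].
Proof.
move=> [b ->]; have [q [sq qq qc]] := star_mul_sqr uc (uemb b).
rewrite uemb_star -uembM in qq qc.
have s0 : uscal q = 0.
  have := congr1 (@uscal R A) qq; rewrite /= => /esym/eqP.
  by rewrite mulf_eq0 orbb => /eqP.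
exists (upart q); split.
- exact: (congr1 (@upart R A) sq).
- by have := congr1 (@upart R A) qq; rewrite /= s0 !scale0r !addr0.
- move=> z az; have := qc (uemb z); rewrite -!uembM az => /(_ erefl).
  by move=> /(congr1 (@upart R A)); rewrite /= s0 !scale0r !addr0.
Qed.

Lemma cpositiveD (a b : A) : cpositive a -> cpositive b -> cpositive (a + b).
Proof.
move=> [c ->] [d ->]; have [q] := uc_cone uc (uemb c) (uemb d).
rewrite !uemb_star -!uembM => e; have s0 : uscal q = 0.
  have := congr1 (@uscal R A) e; rewrite /= addr0 => /esym/eqP.
  by rewrite mulf_eq0 conjC_eq0 orbb => /eqP.
exists (upart q); have := congr1 (@upart R A) e.
by rewrite /= s0 rmorph0 !scale0r !addr0.
Qed.

Lemma cpositiveZ (r : R) (a : A) : 0 <= r -> cpositive a -> cpositive (r%:C%C *: a).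
Proof.
move=> r0 [b ->]; exists ((Num.sqrt r)%:C%C *: b).
by rewrite cadjZr cmulZl cmulZr scalerA -rmorphM/= -expr2 sqr_sqrtr.
Qed.

Lemma cpositive_sa (a : A) : cpositive a -> cadj a = a.
Proof. by move=> [b ->]; rewrite cadjM cadjK. Qed.

(** The bound [|t - a| <= t], expressed by left multiplication to avoid the unit. With the converse
    [norm_cpositive] it allows positivity to be tested without exhibiting a square root. *)
Lemma cpositive_norm (a b : A) (t : R) : cpositive a -> nr a <= t ->
  nr (t%:C%C *: b - cmul a b) <= t * nr b.
Proof.
move=> /cpositive_sqrt[q [sq qq _]] at_.
have sq' : ustar (uemb q) = uemb q by rewrite uemb_star sq.
have qt : unorm (uemb q) ^+ 2 <= t by rewrite unorm_emb -nr_sa// qq.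
have := norm_compl_sqr uc sq' qt; rewrite -uembM qq => le.
apply: le_trans (_ : unorm ((t%:C%C : R[i])%:A - uemb a) * unorm (uemb b) <= _); last first.
  by rewrite unorm_emb ler_wpM2r ?nr_ge0.
rewrite -unorm_emb; apply: le_trans (uc_normM uc _ _).
rewrite le_eqVlt; apply/orP; left; apply/eqP; congr unorm.
apply: unitization_ext; rewrite /= ?mulr0// !scale0r addr0 mulr1 subr0.
by rewrite scaler0 add0r cmulNl addrC.
Qed.

Lemma norm_cpositive (a : A) (t : R) : cadj a = a -> 0 <= t ->
  (forall b, nr (t%:C%C *: b - cmul a b) <= t * nr b) -> cpositive a.
Proof.
move=> sa t0 h; have : uc_pos (@ustar _ A) (@unorm _ A) (uemb a).
  split; first by rewrite uemb_star sa.
  exists t => //; rewrite ge_max; apply/andP; split.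
    apply: uopn_le => // b; have := h b; congr (nr _ <= _).
    by rewrite /uact /= scaler0 sub0r mulr1 subr0 cmulNl addrC.
  by rewrite /= mulr1 subr0 cabs_real ger0_norm.
move=> /(uc_pos_sqrt uc)[q [sq qq _]].
have s0 : uscal q = 0.
  by have := congr1 (@uscal R A) qq => /= /eqP; rewrite mulf_eq0 orbb => /eqP.
exists (upart q); have := congr1 (@upart R A) qq.
by rewrite /= s0 !scale0r !addr0 (congr1 (@upart R A) sq : cadj _ = _).
Qed.

End Irreps.

Section RepFacts.
Variables (R : realType) (A : cstar_algebra R) (pi : irrep A).
Implicit Types (a b : A) (h k : pi).
Local Notation op := (@irrep_op R A pi).

Lemma opD a h k : op a (h + k) = op a h + op a k.
Proof. by rewrite -[h]scale1r irrep_op_linear !scale1r. Qed.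

Lemma op0 a : op a 0 = 0.
Proof. by apply: (addrI (op a 0)); rewrite -opD !addr0. Qed.

Lemma opZ a c h : op a (c *: h) = c *: op a h.
Proof. by rewrite -[c *: h]addr0 irrep_op_linear op0 addr0. Qed.

Lemma opB a h k : op a (h - k) = op a h - op a k.
Proof. by rewrite opD -scaleN1r opZ scaleN1r. Qed.

Lemma opDl a b h : op (a + b) h = op a h + op b h.
Proof. by rewrite -[a]scale1r irrep_linear !scale1r. Qed.

Lemma op0l h : op 0 h = 0.
Proof. by apply: (addrI (op 0 h)); rewrite -opDl !addr0. Qed.

Lemma opZl c a h : op (c *: a) h = c *: op a h.
Proof. by rewrite -[c *: a]addr0 irrep_linear op0l addr0. Qed.

Lemma opBl a b h : op (a - b) h = op a h - op b h.
Proof. by rewrite opDl -scaleN1r opZl scaleN1r. Qed.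

Lemma opM a b h : op (cmul a b) h = op a (op b h).
Proof. exact: irrep_mul. Qed.

Lemma hr_op a h k : hr (op a h) k = hr h (op (cadj a) k).
Proof. by rewrite /hr irrep_adj. Qed.

(** For [y = a^* a / |a|^2] one has [1 - y = (1 - r)^2], so [|(1 - r) h|^2 >= 0] reads
    [|a h|^2 <= |a|^2 |h|^2]. *)
Lemma op_norm a h : nr (op a h) <= nr a * nr h.
Proof.
have [a0|a0] := eqVneq (nr a) 0; first by rewrite (nr0_eq0 a0) op0l !nr0 mul0r.
have a0' : 0 < nr a ^+ 2 by rewrite exprn_gt0// lt_neqAle eq_sym a0 nr_ge0.
pose y := ((nr a ^+ 2)^-1)%:C%C *: cmul (cadj a) a.
have sy : cadj y = y by rewrite cadjZr cadjM cadjK.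
have ny : nr y <= 1.
  by rewrite nrZ cabs_real ger0_norm ?invr_ge0 ?(ltW a0')// nr_cstar mulVf ?gt_eqF.
have [r [sr rr _]] := visser_calg sy ny; have hB := @hr_form R pi.
have := rf_ge0 hB (h - op r h); rewrite (rf_sqrB hB) hr_op sr -opM.
have -> : hr h h - 2 * hr h (op r h) + hr h (op (cmul r r) h) = hr h h - hr h (op y h).
  by rewrite -rr opBl opDl (rfB hB) (rfD hB); ring.
rewrite opZl (rfZ hB) opM -hr_op !hr_norm subr_ge0.
rewrite mulrC ler_pdivrMr// -exprMn ler_sqr ?nnegrE ?mulr_ge0 ?nr_ge0//.
by rewrite mulrC.
Qed.

Lemma hr_op_star a h : hr h (op (cmul (cadj a) a) h) = nr (op a h) ^+ 2.
Proof. by rewrite opM -hr_op hr_norm. Qed.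

Lemma op_cpositive a h : cpositive a -> 0 <= hr h (op a h).
Proof. by move=> [b ->]; rewrite hr_op_star sqr_ge0. Qed.

Lemma op_nondegenerate h : (forall a, op a h = 0) -> h = 0.
Proof.
move=> h0; pose M : set pi := [set k | forall a, op a k = 0].
have [|||M0|MT] := @irrep_irr _ _ pi M.
- by split=> [a|c x y Mx My a]; rewrite ?op0// irrep_op_linear Mx My scaler0 addr0.
- apply: nr_closed => x ap a; apply: nr0_eq0; apply/eqP.
  rewrite eq_le nr_ge0 andbT; apply: (@eps_le _ _ _ (nr a)) => [|e /ap[y My xy]].
    exact: nr_ge0.
  rewrite add0r -[op a x]subr0 -(My a) -opB; apply: le_trans (op_norm _ _) _.
  by rewrite mulrC ler_wpM2r ?nr_ge0// ltW.
- by move=> a k Mk b; rewrite -opM.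
- by have : M h by []; rewrite M0.
- have [a [k /eqP]] := irrep_neq0 pi; have : M k by rewrite MT.
  by move=> ->.
Qed.

Lemma irrep_invariant (M : set pi) h : linear_subspace M -> closed M ->
  (forall a k, M k -> M (op a k)) -> M h -> h <> 0 -> M = setT.
Proof.
move=> lM cM iM Mh h0; have [M0|//] := irrep_irr lM cM iM.
by case: h0; move: Mh; rewrite M0.
Qed.

Lemma op_cyclic k : k <> 0 -> forall h (e : R), 0 < e -> exists a, nr (h - op a k) < e.
Proof.
move=> k0; have [b bk] : exists b, op b k <> 0.
  apply: contrapT => no; apply: k0; apply: op_nondegenerate => a.
  by apply: contrapT => ak; apply: no; exists a.
pose M : set pi := [set h | forall e : R, 0 < e -> exists a, nr (h - op a k) < e].
suff : M = setT by move=> MT h; have : M h by rewrite MT.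
apply: (@irrep_invariant M (op b k)) => //.
- split=> [e e0|c x y Mx My e e0]; first by exists 0; rewrite op0l subr0 nr0.
  have c1 : 0 < cabs c + 1 by rewrite ltr_wpDl ?cabs_ge0.
  have e2 : 0 < e / 2 by rewrite divr_gt0.
  have [a xa] := Mx _ (divr_gt0 e2 c1); have [a' ya] := My _ e2.
  exists (c *: a + a'); rewrite irrep_linear opprD addrACA -scalerBr.
  apply: le_lt_trans (nrD _ _) _; rewrite nrZ [e]splitr ltr_leD ?(ltW ya)//.
  move: xa; rewrite ltr_pdivlMr//; apply: le_lt_trans.
  by rewrite mulrC ler_wpM2l ?nr_ge0// lerDl.
- apply: nr_closed => x ap e e0; have e2 : 0 < e / 2 by rewrite divr_gt0.
  have [y My xy] := ap _ e2; have [a ya] := My _ e2; exists a.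
  by have := nrD (x - y) (y - op a k); rewrite addrA subrK; lra.
- move=> a h Mh e e0; have a1 : 0 < nr a + 1 by rewrite ltr_wpDl ?nr_ge0.
  have [c hc] := Mh _ (divr_gt0 e0 a1); exists (cmul a c).
  rewrite opM -opB; apply: le_lt_trans (op_norm _ _) _.
  move: hc; rewrite ltr_pdivlMr//; apply: le_lt_trans.
  by rewrite mulrC ler_wpM2l ?nr_ge0// lerDl.
- by move=> e e0; exists b; rewrite subrr nr0.
Qed.

End RepFacts.

Section NormByIrreps.
Variables (R : realType) (A : cstar_algebra R).

Lemma norm_by_irreps (a : A) (K : R) : 0 <= K ->
  (forall (pi : irrep A) (v : pi), nr v = 1 -> nr (irrep_op a v) <= K) -> nr a <= K.
Proof.
move=> K0 h; have [->|a0] := eqVneq a 0; first by rewrite nr0.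
by have [pi [v [v1 <-]]] := irrep_norm a0; exact: h.
Qed.

(** The element is dominated by [|a|^2 d^* d]: after scaling, the difference is [e^* e] for
    [e = (1 - r) d], where [1 - y = (1 - r)^2]. *)
Lemma hereditary_conj (D : set A) (a d : A) : hereditary_subalgebra D -> D d ->
  D (cmul (cadj d) (cmul (cmul (cadj a) a) d)).
Proof.
move=> [[D0 Dl] _ DM Ds Dh] Dd; have [a0|a0] := eqVneq (nr a) 0.
  by rewrite (nr0_eq0 a0) !cmul0r !cmul0l cmul0r.
have a0' : 0 < nr a ^+ 2 by rewrite exprn_gt0// lt_neqAle eq_sym a0 nr_ge0.
have DZ c x : D x -> D (c *: x) by move=> Dx; rewrite -[_ *: _]addr0; exact: Dl.
pose y := ((nr a ^+ 2)^-1)%:C%C *: cmul (cadj a) a.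
have sy : cadj y = y by rewrite cadjZr cadjM cadjK.
have ny : nr y <= 1.
  by rewrite nrZ cabs_real ger0_norm ?invr_ge0 ?(ltW a0')// nr_cstar mulVf ?gt_eqF.
have [r [sr rr _]] := visser_calg sy ny.
have [e ee] : exists e, cmul (cadj e) e = cmul (cadj d) d - cmul (cadj d) (cmul y d).
  exists (d - cmul r d).
  rewrite cadjB cadjM sr cmulBl !cmulBr -!cmulA -rr cmulBl cmulDl.
  rewrite !cmulBr !cmulDr !cmulA.
  by rewrite -addrA -opprD [in LHS]addrA.
have yE : cmul (cadj d) (cmul y d) =
    ((nr a ^+ 2)^-1)%:C%C *: cmul (cadj d) (cmul (cmul (cadj a) a) d).
  by rewrite /y cmulZl cmulZr.
suff Dy : D (cmul (cadj d) (cmul y d)).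
  have -> : cmul (cadj d) (cmul (cmul (cadj a) a) d) =
      (nr a ^+ 2)%:C%C *: cmul (cadj d) (cmul y d).
    by rewrite yE scalerA -rmorphM/= divff ?gt_eqF// rmorph1 scale1r.
  exact: DZ.
apply: (Dh _ (cmul (cadj d) d)).
- rewrite yE; apply: cpositiveZ; first by rewrite invr_ge0 ltW.
  by exists (cmul a d); rewrite cadjM !cmulA.
- by apply: DM => //; exact: Ds.
- by rewrite -ee; exists e.
Qed.

End NormByIrreps.

(** * Schur's lemma for invariant forms *)

Section VisserOperator.
Variables (R : realType) (H : hilbert_space R).

Let slimN_unique (u : nat -> H) a b : slim (@nr R H) u a -> slim (@nr R H) u b -> a = b.
Proof.
move=> ua ub; apply/eqP; rewrite -subr_eq0; apply/eqP/nr0_eq0/eqP.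
rewrite eq_le nr_ge0 andbT; apply: (@eps_le _ _ _ 2) => // e e0.
have [N1 N1P] := ua _ e0; have [N2 N2P] := ub _ e0; pose m := maxn N1 N2.
have := N1P m (leq_maxl _ _); have := N2P m (leq_maxr _ _).
have -> : a - b = (u m - b) - (u m - a) by rewrite opprB [RHS]addrC addrA subrK.
by have := nrB (u m - b) (u m - a); lra.
Qed.

Let slim_map (Z : H -> H) (K : R) u a :
  (forall x y, Z (x - y) = Z x - Z y) -> (forall x, nr (Z x) <= K * nr x) ->
  slim (@nr R H) u a -> slim (@nr R H) (fun i => Z (u i)) (Z a).
Proof.
move=> ZB ZK ua e e0; have K1 : 0 < `|K| + 1 by rewrite ltr_wpDl.
have [N NP] := ua _ (divr_gt0 e0 K1); exists N => i /NP.
rewrite ltr_pdivlMr// -ZB; apply: le_lt_trans; apply: le_trans (ZK _) _.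
by rewrite mulrC ler_wpM2l ?nr_ge0//; apply: le_trans (ler_norm K) _; rewrite lerDl.
Qed.

Definition clinear (Z : H -> H) : Prop := forall c x y, Z (c *: x + y) = c *: Z x + Z y.

Lemma clinearB Z x y : clinear Z -> Z (x - y) = Z x - Z y.
Proof. by move=> lZ; rewrite addrC -scaleN1r lZ scaleN1r addrC. Qed.

Lemma clinear0 Z : clinear Z -> Z 0 = 0.
Proof. by move=> lZ; have := clinearB 0 0 lZ; rewrite !subrr. Qed.

Lemma clinearD Z x y : clinear Z -> Z (x + y) = Z x + Z y.
Proof. by move=> lZ; rewrite -[x]scale1r lZ !scale1r. Qed.

Lemma clinearZ Z c x : clinear Z -> Z (c *: x) = c *: Z x.
Proof. by move=> lZ; rewrite -[c *: x]addr0 lZ clinear0// addr0. Qed.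

(* [1 - r] is a square root of [1 - Y] in the double commutant of [Y]. *)
Lemma visser_operator (Y : H -> H) : clinear Y -> (forall h, nr (Y h) <= nr h) ->
  exists r : H -> H, [/\ clinear r, forall h, nr (r h) <= nr h,
    forall h, r h + r h - r (r h) = Y h
  & forall (Z : H -> H) K, clinear Z -> (forall h, nr (Z h) <= K * nr h) ->
      (forall h, Z (Y h) = Y (Z h)) -> forall h, Z (r h) = r (Z h)].
Proof.
move=> lY Y1.
pose u := fix u i (h : H) : H :=
  if i is j.+1 then (2^-1)%:C%C *: (Y h + u j (u j h)) else 0.
have uS i h : u i.+1 h = (2^-1)%:C%C *: (Y h + u i (u i h)) by [].
have h0 : 0 <= (2^-1 : R) by rewrite invr_ge0.
have nZ (h : H) : nr ((2^-1)%:C%C *: h) = 2^-1 * nr h.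
  by rewrite nrZ cabs_real ger0_norm.
have lu i : clinear (u i).
  elim: i => [|i ih] c x y; first by rewrite /= scaler0 addr0.
  have -> : u i.+1 (c *: x + y) = (2^-1)%:C%C *: (c *: (Y x + u i (u i x)) + (Y y + u i (u i y))).
    by rewrite uS lY !ih [c *: (_ + _)]scalerDr addrACA.
  by rewrite scalerDr scalerA mulrC -scalerA !uS.
have un i h : nr (u i h) <= vis R i * nr h.
  elim: i h => [|i ih] h; first by rewrite /= nr0 mul0r.
  have v0 : 0 <= vis R i by have /andP[] := vis01 R i.
  rewrite uS nZ /= mulrAC [2^-1 * _]mulrC ler_wpM2r//.
  apply: le_trans (nrD _ _) _; rewrite mulrDl mul1r lerD//.
  apply: le_trans (ih _) _; rewrite expr2 -mulrA ler_wpM2l//.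
have un1 i h : nr (u i h) <= nr h.
  apply: le_trans (un i h) _; have /andP[v0 v1] := vis01 R i.
  by rewrite ler_piMl ?nr_ge0.
have ud i h : nr (u i.+1 h - u i h) <= nr h * (vis R i.+1 - vis R i).
  elim: i h => [|i ih] h.
    rewrite subr0 uS /= addr0 nZ expr0n/= addr0 subr0 mulrC mul1r ler_wpM2r//.
  rewrite uS [in X in _ - X]uS -scalerBr opprD addrACA subrr add0r nZ.
  have -> : u i.+1 (u i.+1 h) - u i (u i h) =
      u i.+1 (u i.+1 h - u i h) + (u i.+1 (u i h) - u i (u i h)).
    by rewrite (clinearB _ _ (lu _)) addrA subrK.
  have -> : vis R i.+2 - vis R i.+1 = 2^-1 *
    (vis R i.+1 * (vis R i.+1 - vis R i) + (vis R i.+1 - vis R i) * vis R i).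
    have e2 : vis R i.+2 = (1 + vis R i.+1 ^+ 2) / 2 by [].
    have e1 : vis R i.+1 = (1 + vis R i ^+ 2) / 2 by [].
    by rewrite e2 [X in _ - X = _]e1; move: (vis R i.+1) (vis R i) => a b; field.
  rewrite mulrCA ler_wpM2l// mulrDr; apply: le_trans (nrD _ _) _.
  have d0 : 0 <= vis R i.+1 - vis R i by rewrite subr_ge0 vis_mono.
  have v0 : 0 <= vis R i.+1 by have /andP[] := vis01 R i.+1.
  rewrite lerD//.
    apply: le_trans (un _ _) _; rewrite mulrCA ler_wpM2l//.
  apply: le_trans (ih _) _; rewrite mulrA mulrAC ler_wpM2r// mulrC; exact: un.
have lim_ex h : exists l, slim (@nr R H) (fun i => u i h) l.
  apply: vis_seq (ud^~ h) => //; [exact: nrD|exact: nrN|exact: nr0|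
    exact: nr_complete|exact: nr_ge0].
have [r rP] := choice lim_ex.
have r1 h : nr (r h) <= nr h.
  apply: (@eps_le _ _ _ 1) => // e e0; rewrite mulr1.
  have [N NP] := rP h _ e0; have := NP N (leqnn N); have := un1 N h.
  have := nrB (u N h) (u N h - r h); rewrite opprB addrCA subrr addr0; lra.
have lr : clinear r.
  move=> c x y; apply: slimN_unique (rP _) _ => e e0.
  have c1 : 0 < cabs c + 1 by rewrite ltr_wpDl ?cabs_ge0.
  have e2 : 0 < e / 2 by rewrite divr_gt0.
  have [N1 N1P] := rP x _ (divr_gt0 e2 c1); have [N2 N2P] := rP y _ e2.
  exists (maxn N1 N2) => i; rewrite geq_max => /andP[/N1P a /N2P b].
  rewrite lu opprD addrACA -scalerBr; apply: le_lt_trans (nrD _ _) _.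
  rewrite nrZ [e]splitr ler_ltD//; move: a; rewrite ltr_pdivlMr// => /ltW.
  by apply: le_trans; rewrite mulrC ler_wpM2l ?nr_ge0// lerDl.
have shift h : slim (@nr R H) (fun i => u i.+1 h) (r h).
  by move=> e /(rP h)[N NP]; exists N => i iN; apply: NP; exact: leqW.
exists r; split=> //.
  move=> h; have : r h = (2^-1)%:C%C *: (Y h + r (r h)).
    apply: slimN_unique (shift h) _ => e e0.
    have [N1 N1P] := rP h _ e0; have [N2 N2P] := rP (r h) _ e0.
    exists (maxn N1 N2) => i; rewrite geq_max => /andP[/N1P a /N2P b].
    rewrite uS -scalerBr opprD addrACA subrr add0r nZ.
    have -> : u i (u i h) - r (r h) = u i (u i h - r h) + (u i (r h) - r (r h)).
      by rewrite (clinearB _ _ (lu _)) addrA subrK.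
    have := nrD (u i (u i h - r h)) (u i (r h) - r (r h)).
    by have := un1 i (u i h - r h); lra.
  move=> e; have -> : r h + r h = Y h + r (r h); last by rewrite addrK.
  rewrite {1 2}e -scalerDl -rmorphD/= (_ : 2^-1 + 2^-1 = 1) ?rmorph1 ?scale1r//.
  by lra.
move=> Z K lZ ZK ZY h; apply: slimN_unique (rP (Z h)).
have eq i k : Z (u i k) = u i (Z k).
  elim: i k => [|i ih] k; first by rewrite /= clinear0.
  by rewrite !uS (clinearZ _ _ lZ) (clinearD _ _ lZ) ZY !ih.
have -> : (fun i => u i (Z h)) = fun i => Z (u i h) by apply/funext => i; rewrite eq.
by apply: slim_map ZK _ => // x y; exact: clinearB.
Qed.

End VisserOperator.

Section Schur.
Variables (R : realType) (A : cstar_algebra R) (pi : irrep A).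
Local Notation op := (@irrep_op R A pi).
Variables (B : pi -> pi -> R) (C : R).
Hypothesis rB : real_form B.
Hypothesis C0 : 0 <= C.
Hypothesis BC : forall h k, B h k <= C * (nr h * nr k).
Hypothesis Binv : forall a h k, B (op a h) k = B h (op (cadj a) k).

Let hB := @hr_form R pi.

(** Let [Q] be the absolute value of [T]. The kernel of [Q - T] is invariant. If it is everything,
    [T = Q] is positive; if it is zero, [(Q - T) (Q + T) = 0] yields [T = - Q]. *)
Let symmetric_dichotomy (T : pi -> pi) (K : R) : clinear T ->
  (forall h, nr (T h) <= K * nr h) -> (forall h k, hr (T h) k = hr h (T k)) ->
  (forall a h, T (op a h) = op a (T h)) ->
  (forall h, 0 <= hr h (T h)) \/ (forall h, hr h (T h) <= 0).
Proof.
move=> lT TK Ts Ti.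
pose t := K ^+ 2 + 1; have t0 : 0 < t by rewrite ltr_wpDl ?sqr_ge0.
have tV : 0 <= t^-1 by rewrite invr_ge0 ltW.
have TT h : nr (T h) ^+ 2 <= t * nr h ^+ 2.
  apply: (@le_trans _ _ ((K * nr h) ^+ 2)).
    rewrite -[(K * nr h) ^+ 2]real_normK ?num_real// ler_sqr ?nnegrE ?nr_ge0//.
    by apply: le_trans (TK h) _; rewrite ler_norm.
  by rewrite exprMn ler_wpM2r ?sqr_ge0// lerDl.
pose q h := (t^-1)%:C%C *: T (T h).
have lq : clinear q.
  by move=> c x y; rewrite /q !lT scalerDr !scalerA [_ * c]mulrC -!scalerA.
have uq : unit_interval_op (@hr R pi) q.
  split=> [u v|u v|u].
  - exact: (clinearD _ _ lq).
  - by rewrite /q (rfZ hB) (rfZl hB) !Ts.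
  - have -> : hr (q u) (q u) = t^-1 * (t^-1 * hr (T (T u)) (T (T u))).
      by rewrite /q (rfZ hB) (rfZl hB).
    have -> : hr u (q u) = t^-1 * hr (T u) (T u) by rewrite /q (rfZ hB) Ts.
    by rewrite ler_wpM2l// !hr_norm mulrC ler_pdivrMr// mulrC.
pose Y h := h - q h.
have lY : clinear Y.
  by move=> c x y; rewrite /Y lq scalerBr opprD addrACA.
have Y1 h : nr (Y h) <= nr h.
  rewrite -ler_sqr ?nnegrE ?nr_ge0// -!hr_norm (rf_sqrB hB).
  by have := uio_le uq h; have := uio_ge0 hB uq h; lra.
have [r [lr r1 rE rc]] := visser_operator lY Y1.
pose s := Num.sqrt t; have ss : s * s = t by rewrite -expr2 sqr_sqrtr// ltW.
have s0 : 0 <= s by exact: sqrtr_ge0.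
pose Q h := s%:C%C *: (h - r h).
have QQ h : Q (Q h) = T (T h).
  rewrite /Q (clinearZ _ _ lr) -scalerBr scalerA -rmorphM/= ss.
  have -> : h - r h - r (h - r h) = h - (r h + r h - r (r h)).
    by rewrite (clinearB _ _ lr) -addrA -opprD addrA.
  rewrite rE /Y opprB addrC subrK /q scalerA -rmorphM/= divff ?gt_eqF//.
  by rewrite rmorph1 scale1r.
have TY h : T (Y h) = Y (T h).
  by rewrite /Y (clinearB _ _ lT) /q (clinearZ _ _ lT).
have Tr h : T (r h) = r (T h) by apply: rc TY _.
have iY a h : op a (Y h) = Y (op a h) by rewrite /Y opB /q opZ !Ti.
have ir a h : op a (r h) = r (op a h).
  apply: (rc (op a) (nr a)) => //; first exact: irrep_op_linear.
  exact: op_norm.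
have QT h : Q (T h) = T (Q h).
  by rewrite /Q (clinearZ _ _ lT) (clinearB _ _ lT) Tr.
have Qge0 h : 0 <= hr h (Q h).
  rewrite /Q (rfZ hB) mulr_ge0// (rfB hB) subr_ge0 hr_norm expr2.
  apply: le_trans (ler_norm _) _; apply: le_trans (hr_le _ _) _.
  by rewrite ler_wpM2l ?nr_ge0.
have lQ : clinear Q.
  move=> c x y; rewrite /Q lr opprD addrACA -scalerBr scalerDr !scalerA.
  by rewrite [s%:C%C * c]mulrC.
pose M : set pi := [set h | Q h = T h].
have [|||M0|MT] := @irrep_irr _ _ pi M.
- split; first by rewrite /M/= (clinear0 lQ) (clinear0 lT).
  by move=> c x y Mx My; rewrite /M/= lQ lT Mx My.
- apply: nr_closed => x ap; apply/eqP; rewrite -subr_eq0; apply/eqP/nr0_eq0/eqP.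
  rewrite eq_le nr_ge0 andbT.
  apply: (@eps_le _ _ _ (s * 2 + `|K|)) => [|e /ap[y My xy]].
    by rewrite addr_ge0// mulr_ge0.
  have -> : Q x - T x = Q (x - y) - T (x - y).
    by rewrite (clinearB _ _ lQ) (clinearB _ _ lT) My opprB addrA subrK.
  apply: le_trans (nrB _ _) _; rewrite add0r mulrDr; apply: lerD.
    rewrite /Q nrZ cabs_real ger0_norm// mulrCA ler_wpM2l//.
    by have := nrB (x - y) (r (x - y)); have := r1 (x - y); lra.
  apply: le_trans (TK _) _; apply: le_trans (ler_norm _) _.
  by rewrite normrM [`|nr _|]ger0_norm ?nr_ge0// mulrC ler_wpM2r// ltW.
- by move=> a h Mh; rewrite /M/= Ti -Mh /Q opZ opB ir.
- right => h; have : M (Q h + T h).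
    by rewrite /M/= (clinearD _ _ lQ) (clinearD _ _ lT) QQ QT addrC.
  rewrite M0 /= => /eqP; rewrite addr_eq0 => /eqP e.
  by have := Qge0 h; rewrite e (rfN hB); lra.
- left => h; have : M h by rewrite MT.
  by rewrite /M/= => <-.
Qed.

(** The form is [<h, S k>] with [S] in the commutant. By the dichotomy for [S - m], every real [m]
    is a lower or an upper bound of the quadratic form on unit vectors, so the form is constant
    there. *)
Theorem schur_form : exists2 l : R, 0 <= l & forall h k, B h k = l * hr h k.
Proof.
have Sex k : exists u, forall h, B h k = hr h u.
  apply: (@riesz R pi (B^~ k) (C * nr k)).
  - by move=> h h'; rewrite (rfDl rB).
  - by move=> x h; rewrite (rfZl rB).
  - by move=> h; apply: le_trans (BC h k) _; rewrite [nr h * _]mulrC mulrA.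
have [S SP] := choice Sex.
have lS : clinear S.
  move=> c x y; apply: hr_ext => h.
  by rewrite -SP (rfD rB) (rfD hB) (rfJ rB) (rfJ hB) !SP.
have SK h : nr (S h) <= C * nr h.
  have [->|Sh0] := eqVneq (nr (S h)) 0; first by rewrite mulr_ge0 ?nr_ge0.
  have Sh0' : 0 < nr (S h) by rewrite lt_neqAle eq_sym Sh0 nr_ge0.
  rewrite -(ler_pM2l Sh0') -expr2 -hr_norm -SP; apply: le_trans (BC _ _) _.
  by rewrite mulrCA.
have Ss h k : hr (S h) k = hr h (S k) by rewrite (rfC hB) -SP (rfC rB) SP.
have Si a h : S (op a h) = op a (S h).
  by apply: hr_ext => k; rewrite -SP -{1}[a]cadjK -Binv SP hr_op cadjK.
have dich (m : R) : (forall h, m * nr h ^+ 2 <= B h h) \/ (forall h, B h h <= m * nr h ^+ 2).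
  pose T h := S h - m%:C%C *: h.
  have [| | | |p|p] := @symmetric_dichotomy T (C + `|m|).
  - by move=> c x y; rewrite /T lS scalerDr opprD addrACA !scalerA [_ * c]mulrC
      scalerBr scalerA.
  - move=> h; rewrite mulrDl; apply: le_trans (nrB _ _) _.
    by rewrite nrZ cabs_real lerD2r.
  - by move=> h k; rewrite /T (rfBl hB) (rfB hB) Ss (rfZ hB) (rfZl hB).
  - by move=> a h; rewrite /T Si opB opZ.
  - left => h; have := p h; rewrite /T (rfB hB) (rfZ hB) hr_norm -SP.
    by rewrite subr_ge0.
  - right => h; have := p h; rewrite /T (rfB hB) (rfZ hB) hr_norm -SP.
    by rewrite subr_le0.
have [a [h0 ah0]] := irrep_neq0 pi; pose x := op a h0.
have x0 : 0 < nr x ^+ 2.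
  rewrite exprn_gt0// lt_neqAle nr_ge0 andbT eq_sym; apply: contra ah0.
  by move=> /eqP/nr0_eq0/eqP.
pose E : set R := [set m | forall h, m * nr h ^+ 2 <= B h h].
have E0 : E 0 by move=> h; rewrite mul0r (rf_ge0 rB).
have supE : has_sup E.
  split; first by exists 0.
  exists C => m /(_ x) mx; rewrite -(ler_pM2r x0); apply: le_trans mx _.
  by apply: le_trans (BC _ _) _; rewrite expr2.
pose l := sup E.
have l_ge h : l * nr h ^+ 2 <= B h h.
  apply: (@eps_le _ _ _ (nr h ^+ 2)) => [|e e0]; first exact: sqr_ge0.
  have [m Em lm] := sup_adherent e0 supE; have := Em h.
  have := ler_wpM2r (sqr_ge0 (nr h)) (ltW lm); rewrite mulrBl -/l; lra.
have l_le h : B h h <= l * nr h ^+ 2.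
  apply: (@eps_le _ _ _ (nr h ^+ 2)) => [|e e0]; first exact: sqr_ge0.
  have [le|le] := dich (l + e); last by have := le h; rewrite mulrDl.
  have : l + e <= l by apply: ub_le_sup; [exact: supE.2|exact: le].
  lra.
have lE h : B h h = l * nr h ^+ 2 by apply/eqP; rewrite eq_le l_le l_ge.
exists l; first by apply: ub_le_sup; [exact: supE.2|exact: E0].
move=> h k; have := lE (h + k); rewrite -!hr_norm (rf_sqrD rB) (rf_sqrD hB) !lE.
by rewrite !hr_norm; lra.
Qed.

End Schur.

(** * Vector states on Hilbert bimodules *)

Section FormRep.
Variables (R : realType) (A : cstar_algebra R) (V : lmodType R[i]) (B : V -> V -> R).
Variable f : A -> V -> V.

(** A common frame for irreducible representations and for [E] with the form [<x (x) h, y (x) h>],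
    so that one estimate on an element of [A] applies both to [xi] and to [x (x) xi]. *)
Record form_rep : Prop := FormRep {
  frep_form : real_form B;
  frepD : forall a, {morph f a : u v / u + v};
  frepDl : forall a b u, f (a + b) u = f a u + f b u;
  frepZl : forall (r : R) a u, f (r%:C%C *: a) u = r%:C%C *: f a u;
  frepM : forall a b u, f (cmul a b) u = f a (f b u);
  frepC : forall a u v, B (f a u) v = B u (f (cadj a) v) }.

Hypothesis rf : form_rep.
Let rB := frep_form rf.

Lemma frepBl a b u : f (a - b) u = f a u - f b u.
Proof.
have -> : a - b = a + (-1)%:C%C *: b by rewrite rmorphN rmorph1 scaleN1r.
by rewrite (frepDl rf) (frepZl rf) rmorphN rmorph1 scaleN1r.
Qed.

Lemma frep_norm a u : B (f a u) (f a u) <= nr a ^+ 2 * B u u.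
Proof.
have [a0|a0] := eqVneq (nr a) 0.
  have -> : f a u = 0 by rewrite (nr0_eq0 a0) -(subrr 0) frepBl subrr.
  by rewrite (rf0 rB) mulr_ge0// ?sqr_ge0// (rf_ge0 rB).
have a0' : 0 < nr a ^+ 2 by rewrite exprn_gt0// lt_neqAle eq_sym a0 nr_ge0.
pose y := ((nr a ^+ 2)^-1)%:C%C *: cmul (cadj a) a.
have sy : cadj y = y by rewrite cadjZr cadjM cadjK.
have ny : nr y <= 1.
  by rewrite nrZ cabs_real ger0_norm ?invr_ge0 ?(ltW a0')// nr_cstar mulVf ?gt_eqF.
have [r [sr rr _]] := visser_calg sy ny.
have := rf_ge0 rB (u - f r u); rewrite (rf_sqrB rB) (frepC rf) sr -(frepM rf).
have -> : B u u - 2 * B u (f r u) + B u (f (cmul r r) u) = B u u - B u (f y u).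
  by rewrite -rr frepBl (frepDl rf) (rfB rB) (rfD rB); ring.
rewrite (frepZl rf) (rfZ rB) (frepM rf).
have -> : B u (f (cadj a) (f a u)) = B (f a u) (f a u) by rewrite (frepC rf).
by rewrite subr_ge0 mulrC ler_pdivrMr// mulrC.
Qed.

Lemma frep_uio a : cpositive a -> nr a <= 1 -> unit_interval_op B (f a).
Proof.
move=> pa a1; have [q [sq qq _]] := cpositive_sqrt pa; have sa := cpositive_sa pa.
have q1 : nr q ^+ 2 <= 1 by rewrite -(nr_sa sq) qq.
split=> [u v|u v|u]; first exact: (frepD rf).
  by rewrite (frepC rf) sa.
have e u' : f a u' = f q (f q u') by rewrite -qq (frepM rf).
have -> : B u (f a u) = B (f q u) (f q u) by rewrite e [in RHS](frepC rf) sq.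
rewrite e; apply: le_trans (frep_norm _ _) _.
by rewrite ler_piMl// (rf_ge0 rB).
Qed.

End FormRep.

Section Cutoff.
Variables (R : realType) (A : cstar_algebra R) (u : A).

(* [cutoff n = 1 - (1 - u)^n], computed in [A]. *)
Fixpoint cutoff (n : nat) : A := if n is m.+1 then cutoff m + u - cmul (cutoff m) u else 0.

Lemma frep_cutoff (V : lmodType R[i]) (B : V -> V -> R) (f : A -> V -> V) n x :
  form_rep B f -> x - f (cutoff n) x = iter n (fun y => y - f u y) x.
Proof.
move=> rf; elim: n x => [|n ih] x.
  by rewrite /= -(subrr 0) (frepBl rf) subrr subr0.
rewrite iterSr -ih /= (frepBl rf) (frepDl rf) (frepM rf).
have -> : f (cutoff n) (x - f u x) = f (cutoff n) x - f (cutoff n) (f u x).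
  apply/eqP; rewrite eq_sym subr_eq -(frepD rf); apply/eqP; congr (f _ _).
  by rewrite subrK.
by rewrite !opprD !opprK !addrA; congr (_ + _); rewrite addrAC.
Qed.

End Cutoff.

Section FormRepIrrep.
Variables (R : realType) (A : cstar_algebra R).

Lemma irrep_form_rep (pi : irrep A) : form_rep (@hr R pi) (@irrep_op R A pi).
Proof.
split; [exact: hr_form|exact: opD|exact: opDl| |exact: opM|exact: hr_op].
by move=> r a u; exact: opZl.
Qed.

Lemma irreps_faithful (a b : A) :
  (forall (pi : irrep A) (v : pi), irrep_op a v = irrep_op b v) -> a = b.
Proof.
move=> h; apply/eqP; rewrite -subr_eq0; apply/eqP/nr0_eq0/eqP.
rewrite eq_le nr_ge0 andbT; apply: norm_by_irreps => // pi v _.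
by rewrite opBl h subrr nr0.
Qed.

(** The recursion multiplies by [u] on one side, so the claim is read off in irreducible
    representations, where [1 - cutoff u n] acts as a power of the self-adjoint [1 - u]. *)
Lemma cutoff_sa (u : A) n : cadj u = u -> cadj (cutoff u n) = cutoff u n.
Proof.
move=> su; apply: irreps_faithful => pi v; apply: hr_ext => w.
have rp := irrep_form_rep pi; have hB := hr_form pi.
rewrite -hr_op; apply/eqP; rewrite -subr_eq0; apply/eqP.
pose q := fun y : pi => y - irrep_op u y.
have E k : irrep_op (cutoff u n) k = k - iter n q k.
  by rewrite -(frep_cutoff _ _ _ rp) opprB addrC subrK.
have qC j k l : hr (iter j q k) l = hr k (iter j q l).
  elim: j k l => [//|j ih] k l; rewrite iterS iterSr -ih.
  by rewrite /q (rfBl hB) (rfB hB) hr_op su.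
by rewrite !E (rfBl hB) (rfB hB) qC subrr.
Qed.

End FormRepIrrep.

(* The part of the axioms of a Hilbert bimodule that the argument uses; it also
   holds for incomplete bimodules and without positivity of the left inner
   product. *)
Record pre_bimodule (R : realType) (A : cstar_algebra R) (E : bimodule_data A) : Prop :=
  PreBimodule {
  pb_rip_linear : forall c (x y z : E), rip x (c *: y + z) = c *: rip x y + rip x z;
  pb_rip_ract : forall (x y : E) a, rip x (ract y a) = cmul (rip x y) a;
  pb_rip_adj : forall x y : E, cadj (rip x y) = rip y x;
  pb_rip_ge0 : forall x : E, cpositive (rip x x);
  pb_rip_eq0 : forall x : E, rip x x = 0 -> x = 0;
  pb_lactDl : forall c a b (x : E), lact (c *: a + b) x = c *: lact a x + lact b x;
  pb_lactA : forall a b (x : E), lact (cmul a b) x = lact a (lact b x);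
  pb_lip_linear : forall c (x y z : E), lip (c *: x + y) z = c *: lip x z + lip y z;
  pb_lip_lact : forall a (x y : E), lip (lact a x) y = cmul a (lip x y);
  pb_lip_adj : forall x y : E, cadj (lip x y) = lip y x;
  pb_imprim : forall x y z : E, lact (lip x y) z = ract x (rip y z) }.

Lemma hilbert_pre_bimodule (R : realType) (A : cstar_algebra R) (E : bimodule_data A) :
  hilbert_bimodule E -> pre_bimodule E.
Proof. by move=> [[? ? ? ? ? ? ? ? ?] [? ? ? ? ? ? ? ? ?] ? ?]; split. Qed.

Section PreBimodule.
Variables (R : realType) (A : cstar_algebra R) (E : bimodule_data A).
Hypothesis pE : pre_bimodule E.
Implicit Types (x y z w : E) (a b : A).

Lemma ripD x y z : rip x (y + z) = rip x y + rip x z.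
Proof. by have := pb_rip_linear pE 1 x y z; rewrite !scale1r. Qed.

Lemma rip0 x : rip x 0 = 0.
Proof. by apply: (addIr (rip x 0)); rewrite -ripD !add0r. Qed.

Lemma ripZ c x y : rip x (c *: y) = c *: rip x y.
Proof. by have := pb_rip_linear pE c x y 0; rewrite rip0 !addr0. Qed.

Lemma ripN x y : rip x (- y) = - rip x y.
Proof. by rewrite -scaleN1r ripZ scaleN1r. Qed.

Lemma ripB x y z : rip x (y - z) = rip x y - rip x z.
Proof. by rewrite ripD ripN. Qed.

Lemma ripDl x y z : rip (x + y) z = rip x z + rip y z.
Proof. by rewrite -(pb_rip_adj pE) ripD cadjD !(pb_rip_adj pE). Qed.

Lemma ripZl c x y : rip (c *: x) y = c^* *: rip x y.
Proof. by rewrite -(pb_rip_adj pE) ripZ cadjZ (pb_rip_adj pE). Qed.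

Lemma ripBl x y z : rip (x - y) z = rip x z - rip y z.
Proof. by rewrite -(pb_rip_adj pE) ripB cadjB !(pb_rip_adj pE). Qed.

Lemma rip0l x : rip 0 x = 0.
Proof. by rewrite -(pb_rip_adj pE) rip0 cadj0. Qed.

Lemma rip_ractl x y a : rip (ract x a) y = cmul (cadj a) (rip x y).
Proof. by rewrite -(pb_rip_adj pE) (pb_rip_ract pE) cadjM (pb_rip_adj pE). Qed.

Lemma lactDl1 a b x : lact (a + b) x = lact a x + lact b x.
Proof. by have := pb_lactDl pE 1 a b x; rewrite !scale1r. Qed.

Lemma lact0l x : lact 0 x = 0.
Proof. by apply: (addIr (lact 0 x)); rewrite -lactDl1 !add0r. Qed.

Lemma lactZl c a x : lact (c *: a) x = c *: lact a x.
Proof. by have := pb_lactDl pE c a 0 x; rewrite lact0l !addr0. Qed.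

Lemma rip_ext x y : (forall z, rip z x = rip z y) -> x = y.
Proof.
move=> h; apply/eqP; rewrite -subr_eq0; apply/eqP/(pb_rip_eq0 pE).
by rewrite ripB h subrr.
Qed.

Lemma ractZr c x a : ract x (c *: a) = c *: ract x a.
Proof. by apply: rip_ext => z; rewrite ripZ !(pb_rip_ract pE) cmulZr. Qed.

Lemma ractD x y a : ract (x + y) a = ract x a + ract y a.
Proof. by apply: rip_ext => z; rewrite ripD !(pb_rip_ract pE) ripD cmulDl. Qed.

Lemma ractZ c x a : ract (c *: x) a = c *: ract x a.
Proof. by apply: rip_ext => z; rewrite ripZ !(pb_rip_ract pE) ripZ cmulZl. Qed.

Lemma ractM x a b : ract x (cmul a b) = ract (ract x a) b.
Proof. by apply: rip_ext => z; rewrite !(pb_rip_ract pE) cmulA. Qed.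

Lemma ract0l a : ract (0 : E) a = 0.
Proof. by apply: rip_ext => z; rewrite (pb_rip_ract pE) !rip0 cmul0l. Qed.

Lemma ractBl x y a : ract (x - y) a = ract x a - ract y a.
Proof. by rewrite ractD -scaleN1r ractZ scaleN1r. Qed.

Lemma lip_lactr a x y : lip x (lact a y) = cmul (lip x y) (cadj a).
Proof. by rewrite -(pb_lip_adj pE) (pb_lip_lact pE) cadjM (pb_lip_adj pE). Qed.

(* [c = <ax|y> - <x|a^* y>] satisfies [zc = 0] for all [z], by imprimitivity. *)
Lemma rip_lact a x y : rip (lact a x) y = rip x (lact (cadj a) y).
Proof.
pose c := rip (lact a x) y - rip x (lact (cadj a) y).
have rz z w : cmul (rip w z) c = 0.
  apply/eqP; rewrite cmulBr subr_eq0; apply/eqP.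
  by rewrite -!(pb_rip_ract pE) -!(pb_imprim pE) lip_lactr (pb_lactA pE).
apply/eqP; rewrite -subr_eq0; apply/eqP/nr0_eq0/eqP; rewrite -/c -sqrf_eq0 -nr_cstar.
by rewrite [cadj c]cadjB !(pb_rip_adj pE) cmulBl !rz subrr nr0.
Qed.

Lemma lactD a x y : lact a (x + y) = lact a x + lact a y.
Proof. by apply: rip_ext => z; rewrite ripD -[a]cadjK -!rip_lact ripD. Qed.

Lemma lact_ract a x b : lact a (ract x b) = ract (lact a x) b.
Proof.
by apply: rip_ext => z; rewrite (pb_rip_ract pE) -[a]cadjK -!rip_lact (pb_rip_ract pE).
Qed.

Section Vector.
Variables (pi : irrep A).
Local Notation op := (@irrep_op R A pi).
Implicit Types h k : pi.

(** The real part of [<x (x) h, y (x) h>] in the tensor product of [E] and [pi]. *)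
Definition vform h x y : R := hr h (op (rip x y) h).

Lemma vform_form h : real_form (vform h).
Proof.
have hB := @hr_form R pi; rewrite /vform; split=> [x y|x y z|r x y|x|c x y].
- by rewrite (rfC hB) hr_op (pb_rip_adj pE).
- by rewrite ripD opDl (rfD hB).
- by rewrite ripZ opZl (rfZ hB).
- exact: op_cpositive (pb_rip_ge0 pE x).
- by rewrite ripZl ripZ conjCK.
Qed.

Lemma vform_rep h : form_rep (vform h) (@lact R A E).
Proof.
split; [exact: vform_form|by move=> a x y; exact: lactD| | | |].
- by move=> a b x; exact: lactDl1.
- by move=> r a x; exact: lactZl.
- by move=> a b x; exact: (pb_lactA pE).
- by move=> a x y; rewrite /vform rip_lact.
Qed.

Lemma vform_ract h x y a : vform h (ract x a) (ract y a) = vform (op a h) x y.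
Proof. by rewrite /vform rip_ractl (pb_rip_ract pE) !opM -hr_op. Qed.

Lemma vform_sum x h k : vform (h + k) x x <= 2 * vform h x x + 2 * vform k x x.
Proof.
have hB := @hr_form R pi.
have p v : 0 <= vform v x x by exact: (rf_ge0 (vform_form v)).
have e : vform (h + k) x x + vform (h - k) x x = 2 * vform h x x + 2 * vform k x x.
  rewrite /vform opD opB !(rfD hB, rfDl hB, rfN hB, rfNl hB); ring.
by have := p (h - k); lra.
Qed.

End Vector.

Definition rnr x : R := Num.sqrt (nr (rip x x)).

Lemma rnr_ge0 x : 0 <= rnr x. Proof. exact: sqrtr_ge0. Qed.

Lemma rnr_sqr x : rnr x ^+ 2 = nr (rip x x).
Proof. by rewrite sqr_sqrtr// nr_ge0. Qed.

Lemma rnormE x : rnorm x = (rnr x)%:C%C.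
Proof.
apply/eqP; rewrite -(@eqrXn2 _ 2) ?sqrtC_ge0 ?normr_ge0//; last first.
  by rewrite lecR rnr_ge0.
by rewrite sqrtCK -rmorphXn/= rnr_sqr normE.
Qed.

Lemma rnr0_eq0 x : rnr x = 0 -> x = 0.
Proof.
move=> x0; apply: (pb_rip_eq0 pE); apply: nr0_eq0.
by rewrite -rnr_sqr x0 expr0n.
Qed.

Lemma vform_le (pi : irrep A) (h : pi) x : vform h x x <= rnr x ^+ 2 * nr h ^+ 2.
Proof.
apply: le_trans (ler_norm _) _; apply: le_trans (hr_le _ _) _.
by rewrite rnr_sqr expr2 mulrCA ler_wpM2l ?nr_ge0// op_norm.
Qed.

(** [<x|x>] is the square of a self-adjoint [q], whose norm is tested in irreducible
    representations. *)
Lemma rnr_le x (K : R) : 0 <= K ->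
  (forall (pi : irrep A) (v : pi), nr v = 1 -> vform v x x <= K ^+ 2) -> rnr x <= K.
Proof.
move=> K0 h; have [q [sq qq _]] := cpositive_sqrt (pb_rip_ge0 pE x).
have -> : rnr x = nr q by rewrite /rnr -qq nr_sa// sqrtr_sqr ger0_norm ?nr_ge0.
apply: norm_by_irreps => // pi v v1.
rewrite -ler_sqr ?nnegrE ?nr_ge0//; apply: le_trans (h pi v v1).
by rewrite /vform -qq -{2}sq hr_op_star.
Qed.

Lemma vform_unit (pi : irrep A) (h : pi) x : nr h = 1 -> vform h x x <= rnr x ^+ 2.
Proof. by move=> h1; apply: le_trans (vform_le h x) _; rewrite h1 expr1n mulr1. Qed.

Lemma rnr_lact a x : rnr (lact a x) <= nr a * rnr x.
Proof.
apply: rnr_le => [|pi v v1]; first by rewrite mulr_ge0 ?nr_ge0 ?rnr_ge0.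
apply: le_trans (frep_norm (vform_rep v) a x) _.
by rewrite exprMn ler_wpM2l ?sqr_ge0// vform_unit.
Qed.

Lemma rnr_ract x a : rnr (ract x a) <= rnr x * nr a.
Proof.
apply: rnr_le => [|pi v v1]; first by rewrite mulr_ge0 ?nr_ge0 ?rnr_ge0.
rewrite vform_ract; apply: le_trans (vform_le _ x) _.
rewrite exprMn ler_wpM2l ?sqr_ge0// ler_sqr ?nnegrE ?nr_ge0//.
by have := op_norm a v; rewrite v1 mulr1.
Qed.

(* [y - z <y|y> = y (1 - u)^n] with [u] a multiple of [<y|y>]; in every vector
   state its norm is a difference of consecutive moments of [1 - u]. *)
Lemma approx_unit y (e : R) : 0 < e -> exists z, rnr (y - ract z (rip y y)) < e.
Proof.
move=> e0; set c := rip y y; pose b := nr c + 1.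
have b0 : 0 < b by rewrite ltr_wpDl ?nr_ge0.
pose u := (b^-1)%:C%C *: c.
have pu : cpositive u by apply: cpositiveZ; [rewrite invr_ge0 ltW|exact: (pb_rip_ge0 pE)].
have u1 : nr u <= 1.
  rewrite nrZ cabs_real ger0_norm ?invr_ge0 ?(ltW b0)// mulrC ler_pdivrMr// mul1r.
  by rewrite lerDl.
pose Y := fix Y n := if n is m.+1 then Y m - ract (Y m) u else y.
have YE n : exists z, Y n = y - ract z c.
  elim: n => [|n [z zE]]; first by exists 0; rewrite ract0l subr0.
  by exists (z + (b^-1)%:C%C *: Y n); rewrite ractD ractZ opprD addrA -zE /= ractZr.
pose Q (pi : irrep A) (h : pi) := h - irrep_op u h.
have YQ n (pi : irrep A) (v : pi) : vform v (Y n) (Y n) = vform (iter n (@Q pi) v) y y.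
  elim: n v => [//|n ih] v; rewrite iterSr -ih.
  have hB := hr_form pi; have su := cpositive_sa pu.
  rewrite /vform /= ripB !ripBl rip_ractl !(pb_rip_ract pE) su rip_ractl su /Q.
  by rewrite !(opBl, opM, opB) !(rfB hB, rfBl hB) !hr_op su.
(* The squared norm will be at most [b / (2 N + 1)], which is to be below [(e / 2)^2]. *)
have [N NP] := @harm_lt R (e ^+ 2 / (4 * b)) ltac:(by rewrite divr_gt0 ?exprn_gt0 ?mulr_gt0).
have [z zE] := YE N; exists z; rewrite -zE.
suff : rnr (Y N) <= e / 2 by move=> /le_lt_trans -> //; lra.
apply: rnr_le => [|pi v v1]; first by rewrite divr_ge0 ?ltW.
have rp := irrep_form_rep pi; have hB := hr_form pi.
have uq := uio_compl hB (frep_uio rp pu u1).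
have cE : c = b%:C%C *: u by rewrite scalerA -rmorphM/= divff ?gt_eqF// rmorph1 scale1r.
rewrite YQ /vform -/c cE opZl (rfZ hB).
pose m := moment (@hr R pi) (@Q pi) v.
have m0 : m 0%N = 1 by rewrite /m /moment /= hr_norm v1 expr1n.
have -> : hr (iter N (@Q pi) v) (irrep_op u (iter N (@Q pi) v)) = m (N + N)%N - m (N + N).+1.
  by rewrite /m -addnS -!momentD// /Q /= (rfB hB) opprB addrC subrK.
have le := convex_decay (moment_ge0 hB uq v) (moment_cvx hB uq v) (N + N).
have := NP (N + N)%N (leq_addr _ _); rewrite ltr_pdivlMr ?mulr_gt0// => lt.
have : m (N + N)%N - m (N + N).+1 <= harm R (N + N) by move: le; rewrite -/m m0 mul1r.
move=> /(ler_wpM2l (ltW b0))/le_trans -> //.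
rewrite expr_div_n; move: lt; move: (harm _ _) b {b0 u pu u1 Y YE Q YQ NP zE uq cE m m0 le z} => t b; lra.
Qed.

End PreBimodule.

(** * Peak elements *)

Section Peak.
Variables (R : realType) (A : cstar_algebra R).
Local Notation sq := (fun b : A => cmul b b).

Lemma frep_sq (V : lmodType R[i]) (B : V -> V -> R) (f : A -> V -> V) (a : A) j u :
  form_rep B f -> f (iter j sq a) u = iter (2 ^ j) (f a) u.
Proof.
move=> rf; elim: j u => [//|j ih] u.
by rewrite iterS (frepM rf) !ih -iterD addnn expnS mul2n.
Qed.

Lemma sq_sa (a : A) j : cadj a = a -> cadj (iter j sq a) = iter j sq a.
Proof. by move=> sa; elim: j => [//|j ih]; rewrite iterS cadjM ih. Qed.

Lemma sq_norm1 (a : A) j : cadj a = a -> nr a = 1 -> nr (iter j sq a) = 1.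
Proof.
by move=> sa a1; elim: j => [//|j ih]; rewrite iterS nr_sa ?sq_sa// ih expr1n.
Qed.

(* [a] is a high power of [k / |k|], on whose range [k] is almost [|k|]. *)
Lemma power_peak (D : set A) (k : A) (s : R) : hereditary_subalgebra D -> D k ->
  cpositive k -> nr k <= 1 -> 0 < nr k -> 1 - nr k < s ->
  exists a, [/\ D a, cpositive a, nr a = 1 &
    forall (V : lmodType R[i]) (B : V -> V -> R) (f : A -> V -> V) u, form_rep B f ->
      B (f a u) (f a u - f k (f a u)) <= s * B u u].
Proof.
move=> [[D0 Dlin] _ DM _ _] Dk pk k1 k0 ks.
pose g := ((nr k)^-1)%:C%C *: k; have kV : 0 <= (nr k)^-1 by rewrite invr_ge0 ltW.
have pg : cpositive g by exact: cpositiveZ.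
have sg := cpositive_sa pg.
have g1 : nr g = 1 by rewrite nrZ cabs_real ger0_norm// mulVf ?gt_eqF.
have kE : k = (nr k)%:C%C *: g.
  by rewrite scalerA -rmorphM/= divff ?gt_eqF// rmorph1 scale1r.
have Dg : D g by rewrite /g -[_ *: k]addr0; exact: Dlin.
have Dsq j : D (iter j sq g) by elim: j => [//|j ih]; exact: DM.
have [j jP] := @harm_lt R (s - (1 - nr k)) ltac:(by rewrite subr_gt0).
pose n := (2 ^ j.+1)%N.
(* Repeated squaring keeps the norm at [1] by the C*-identity, and the last squaring exhibits the
   power as positive. *)
exists (iter j.+1 sq g); split=> //.
- by exists (iter j sq g); rewrite sq_sa.
- exact: sq_norm1.
move=> V B f u rf; have rB := frep_form rf.
have uq : unit_interval_op B (f g) by apply: frep_uio => //; rewrite g1.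
rewrite (frep_sq g j.+1 u rf) -/n; set w := iter n (f g) u.
have Bu := rf_ge0 rB u.
have wE : B w w = moment B (f g) u (n + n) by rewrite -momentD.
have wE' : B w (f g w) = moment B (f g) u (n + n).+1 by rewrite -addnS -momentD.
have w1 : B w w <= B u u by rewrite wE; apply: (convex_le (moment_dec rB uq u)).
have wd : B w w - B w (f g w) <= harm R j * B u u.
  rewrite wE wE'; apply: le_trans (convex_decay (moment_ge0 rB uq u) (moment_cvx rB uq u) _) _.
  rewrite [moment _ _ _ 0]/moment/= mulrC ler_wpM2r// -/(harm R _).
  apply: harm_le; apply: leq_trans (leq_addr n n).
  by rewrite /n; apply: leq_trans (leqnSn j) (ltnW (ltn_expl _ _)).
have -> : B w (w - f k w) = (1 - nr k) * B w w + nr k * (B w w - B w (f g w)).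
  by rewrite {1}kE (frepZl rf) (rfB rB) (rfZ rB); ring.
have h1 := jP j (leqnn j).
have e1 : (1 - nr k) * B w w <= (1 - nr k) * B u u by rewrite ler_wpM2l// subr_ge0.
have e2 : nr k * (B w w - B w (f g w)) <= harm R j * B u u.
  apply: le_trans wd; rewrite ler_piMl// subr_ge0.
  by rewrite wE wE' (moment_dec rB uq).
apply: le_trans (lerD e1 e2) _; rewrite -mulrDl ler_wpM2r//; lra.
Qed.

End Peak.

Section Flat.
Variables (R : realType) (A : cstar_algebra R) (E : bimodule_data A).
Hypothesis pE : pre_bimodule E.
Variables (x : E) (D : set A) (e : R).
Hypothesis hD : hereditary_subalgebra D.
Hypothesis e0 : 0 < e.
Hypothesis big : forall a, D a -> cpositive a -> nr a = 1 -> e <= rnr (lact a (ract x a)).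

(* If [a'] almost fixed [xi] and almost killed [x (x) xi], then so would the
   peak element [a] built from [a' (1 - y) a'], [y = <a'x|a'x> / b], for its
   range in every irreducible representation, whence [axa] would be small. *)
Lemma not_flat : exists2 d : R, 0 < d & forall a' : A, D a' -> cadj a' = a' ->
  (forall (V : lmodType R[i]) (B : V -> V -> R) (f : A -> V -> V), form_rep B f ->
    unit_interval_op B (f a')) ->
  forall (pi : irrep A) (xi : pi), nr xi = 1 -> hr xi (xi - irrep_op a' xi) < d ->
    vform xi (lact a' x) (lact a' x) < d -> False.
Proof.
pose b := rnr x ^+ 2 + 1; have b1 : 1 <= b by rewrite lerDr sqr_ge0.
have b0 : 0 < b by exact: lt_le_trans b1.
have e20 : 0 < e ^+ 2 by rewrite exprn_gt0.
(* Chosen so that [s <= 1] and [10 b s < e^2]; the final estimate is [|axa|^2 <= 10 b s]. *)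
pose s := e ^+ 2 / (20 * b + e ^+ 2).
have den : 0 < 20 * b + e ^+ 2 by rewrite addr_gt0 ?mulr_gt0.
have s0 : 0 < s by rewrite divr_gt0.
have s1 : s <= 1 by rewrite ler_pdivrMr// mul1r lerDr mulr_ge0// ltW.
have sb : 10 * b * s < e ^+ 2.
  rewrite mulrA ltr_pdivrMr// mulrC ltr_pM2l//; lra.
exists (s / 12) => [|a' Da' sa' ua' pi xi xi1 flat1 flat2]; first by rewrite divr_gt0.
have bV : 0 <= b^-1 by rewrite invr_ge0 ltW.
pose y := (b^-1)%:C%C *: rip (lact a' x) (lact a' x).
have py : cpositive y by apply: cpositiveZ => //; exact: (pb_rip_ge0 pE).
have sy := cpositive_sa py.
have a'1 : nr a' <= 1.
  apply: norm_by_irreps => // rho v v1; have rp := irrep_form_rep rho.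
  have := uio_le (ua' _ _ _ rp) v; have := uio_le1 (hr_form rho) (ua' _ _ _ rp) v.
  rewrite !hr_norm v1 => h1 h2; have := le_trans h2 h1.
  by rewrite ler_sqr ?nnegrE ?nr_ge0.
have a'x : rnr (lact a' x) ^+ 2 <= b.
  apply: (@le_trans _ _ (rnr x ^+ 2)); last by rewrite lerDl.
  rewrite ler_sqr ?nnegrE ?rnr_ge0//; apply: le_trans (rnr_lact pE _ _) _.
  by rewrite ler_piMl ?rnr_ge0.
have y1 : nr y <= 1.
  by rewrite nrZ cabs_real ger0_norm// -rnr_sqr mulrC ler_pdivrMr// mul1r.
(* [1 - r] is a square root of [1 - y], so [k = c^* c] becomes [a' (1 - y) a'], which belongs to [D]
   by heredity. *)
have [r [sr rr _]] := visser_calg sy y1.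
pose c := a' - cmul r a'.
pose k := cmul (cadj c) c.
have sc : cadj c = a' - cmul a' r by rewrite /c cadjB cadjM sr sa'.
have kE : k = cmul a' a' - cmul (cmul a' y) a'.
  rewrite /k sc /c -rr !(cmulBl, cmulBr, cmulDl, cmulDr) !cmulA.
  by rewrite !opprD !opprK !addrA; congr (_ + _); rewrite -!addrA; congr (_ + _); rewrite addrC.
have Dk : D k.
  have [[D0 Dlin] _ DM _ _] := hD.
  have [q yq] := py.
  have Dy : D (cmul (cmul a' y) a').
    by have := hereditary_conj q hD Da'; rewrite sa' -yq cmulA.
  rewrite kE addrC -scaleN1r; apply: Dlin => //; exact: DM.
have pk : cpositive k by exists c.
have kB (V : lmodType R[i]) (B : V -> V -> R) (f : A -> V -> V) w : form_rep B f ->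
    B w (w - f k w) = (B w w - B (f a' w) (f a' w)) + B (f a' w) (f y (f a' w)).
  move=> rf; have rB := frep_form rf.
  rewrite kE (frepBl rf) !(frepM rf) !(rfB rB) -{1 3}sa'.
  rewrite -![B w (f (cadj a') _)](frepC rf); ring.
have aB (V : lmodType R[i]) (B : V -> V -> R) (f : A -> V -> V) w : form_rep B f ->
    B (w - f a' w) (w - f a' w) <= B w w - B (f a' w) (f a' w).
  move=> rf; have rB := frep_form rf; rewrite (rf_sqrB rB).
  by have := uio_le (ua' _ _ _ rf) w; lra.
have yE (rho : irrep A) (v : rho) :
    vform v (lact a' x) (lact a' x) = b * hr v (irrep_op y v).
  by rewrite /y opZl (rfZ (hr_form rho)) mulrA divff ?gt_eqF// mul1r.
have y_ge0 (rho : irrep A) (v : rho) : 0 <= hr v (irrep_op y v) by exact: op_cpositive.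
have y_le (rho : irrep A) (v : rho) : hr v (irrep_op y v) <= nr v ^+ 2.
  rewrite -(ler_pM2l b0) -yE; apply: le_trans (vform_le _ _) _.
  by rewrite ler_wpM2r ?sqr_ge0.
have y_sum (rho : irrep A) (v w : rho) : hr v (irrep_op y v) <=
    2 * hr w (irrep_op y w) + 2 * hr (v - w) (irrep_op y (v - w)).
  rewrite -(ler_pM2l b0) mulrDr !(mulrCA b) -!yE.
  by have := vform_sum pE (lact a' x) w (v - w); rewrite addrC subrK.
have k1 : nr k <= 1.
  rewrite nr_cstar expr_le1 ?nr_ge0//; apply: norm_by_irreps => // rho v v1.
  have rp := irrep_form_rep rho.
  have := kB _ _ _ v rp; rewrite (rfB (hr_form rho)) hr_op_star !hr_norm v1 expr1n => h.
  have := y_ge0 rho (irrep_op a' v); have := aB _ _ _ v rp.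
  rewrite !hr_norm v1 expr1n => h1 h2.
  have : nr (irrep_op c v) ^+ 2 <= 1.
    have := nr_ge0 (v - irrep_op a' v); have := op_norm a' v.
    by move: h h1 h2; have := sqr_ge0 (nr (v - irrep_op a' v)); lra.
  by rewrite -{1}(expr1n _ 2) ler_sqr ?nnegrE ?nr_ge0.
(* Flatness makes [<xi, p>], [|p|^2] and [<xi, y xi>] at most [s / 12], and [1 - <xi, k xi>] is
   bounded by a combination of them of total weight at most six. *)
have kge : 1 - nr k <= s / 2.
  have rp := irrep_form_rep pi; have hB := hr_form pi.
  have le1 : hr xi (irrep_op k xi) <= nr k.
    apply: le_trans (ler_norm _) _; apply: le_trans (hr_le _ _) _.
    by rewrite xi1 mul1r; have := op_norm k xi; rewrite xi1 mulr1.
  have := kB _ _ _ xi rp; rewrite (rfB hB) !hr_norm xi1 expr1n => h.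
  pose p := xi - irrep_op a' xi.
  have p1 : nr p ^+ 2 <= hr xi p.
    by rewrite -hr_norm; apply: uio_le (uio_compl hB (ua' _ _ _ rp)) xi.
  have a'xi : nr (irrep_op a' xi) ^+ 2 = 1 - 2 * hr xi p + nr p ^+ 2.
    have -> : irrep_op a' xi = xi - p by rewrite /p opprB addrC subrK.
    by rewrite -!hr_norm (rf_sqrB hB) hr_norm xi1 expr1n.
  have := y_sum pi (irrep_op a' xi) xi.
  have -> : irrep_op a' xi - xi = - p by rewrite opprB.
  have -> : irrep_op y (- p) = - irrep_op y p by rewrite -scaleN1r opZ scaleN1r.
  rewrite (rfN hB) (rfNl hB) opprK => ys.
  have := y_le pi p; have := sqr_ge0 (nr p) => p0 yp.
  have yx : hr xi (irrep_op y xi) <= s / 12.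
    have := y_ge0 pi xi => y0; apply: (@le_trans _ _ (b * hr xi (irrep_op y xi))).
      by rewrite ler_peMl.
    by rewrite -yE ltW.
  move: flat1; rewrite -/p; lra.
have k0 : 0 < nr k by lra.
have [a [Da pa a1 aP]] := power_peak hD Dk pk k1 k0 (s := s) ltac:(lra).
have sa := cpositive_sa pa.
have small (rho : irrep A) (v : rho) (w := irrep_op a v) : nr v = 1 ->
    nr (w - irrep_op a' w) ^+ 2 <= s /\ hr (irrep_op a' w) (irrep_op y (irrep_op a' w)) <= s.
  move=> v1; have rp := irrep_form_rep rho.
  have := aP _ _ _ v rp; rewrite -/w (kB _ _ _ w rp) (hr_norm v) v1 expr1n mulr1.
  have := aB _ _ _ w rp; have := y_ge0 rho (irrep_op a' w).
  have := rf_ge0 (hr_form rho) (w - irrep_op a' w).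
  rewrite -!hr_norm; set u1 := hr (w - _) _; set u2 := hr _ (irrep_op y _).
  by move: (hr w w) (hr (irrep_op a' w) _) => t1 t2; lra.
(* The adjoint is estimated, since it acts as [1 - a'] on the range of [a]. *)
have aa' : nr (a - cmul a a') ^+ 2 <= s.
  rewrite -nr_cadj cadjB cadjM sa sa' -[s]sqr_sqrtr ?(ltW s0)//.
  rewrite ler_sqr ?nnegrE ?nr_ge0 ?sqrtr_ge0//.
  apply: norm_by_irreps => [|rho v v1]; first exact: sqrtr_ge0.
  rewrite -ler_sqr ?nnegrE ?nr_ge0 ?sqrtr_ge0// sqr_sqrtr ?(ltW s0)//.
  by rewrite opBl opM; case: (small rho v v1).
have : rnr (lact a (ract x a)) <= Num.sqrt (10 * b * s).
  have bs : 0 <= 10 * b * s by apply: ltW (mulr_gt0 (mulr_gt0 _ b0) s0).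
  apply: (rnr_le pE) => [|rho v v1]; first exact: sqrtr_ge0.
  rewrite (lact_ract pE) (vform_ract pE) sqr_sqrtr//; set w := irrep_op a v.
  have w1 : nr w <= 1 by have := op_norm a v; rewrite a1 v1 mulr1.
  have w2 : nr w ^+ 2 <= 1 by rewrite expr_le1 ?nr_ge0.
  have rf := vform_rep pE w; have fB := frep_form rf.
  (* The summands contribute at most [4 b s] and [b s], and squaring the sum costs a factor two. *)
  have -> : lact a x = lact a (lact a' x) + lact (a - cmul a a') x.
    by rewrite (frepBl rf) (pb_lactA pE) addrC subrK.
  have h1 : vform w (lact a (lact a' x)) (lact a (lact a' x)) <= 4 * (b * s).
    apply: le_trans (frep_norm rf _ _) _; rewrite a1 expr1n mul1r yE mulrCA ler_pM2l//.
    have [q1 q2] := small rho v v1; have := y_sum rho w (irrep_op a' w).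
    have := y_le rho (w - irrep_op a' w); rewrite -/w in q1 q2; lra.
  have h2 : vform w (lact (a - cmul a a') x) (lact (a - cmul a a') x) <= b * s.
    apply: le_trans (frep_norm rf _ _) _; rewrite mulrC; apply: ler_pM => //.
    - exact: (rf_ge0 fB).
    - exact: sqr_ge0.
    apply: le_trans (vform_le _ _) _; apply: (@le_trans _ _ (rnr x ^+ 2)).
      by rewrite ler_piMr ?sqr_ge0.
    by rewrite lerDl.
  move: (lact a (lact a' x)) (lact (a - cmul a a') x) h1 h2 => p q h1 h2.
  have := rf_ge0 fB (p - q); rewrite (rf_sqrB fB) (rf_sqrD fB); lra.
move=> le; have := big Da pa a1 => ge; have := le_trans ge le.
rewrite -ler_sqr ?nnegrE ?(ltW e0) ?sqrtr_ge0// sqr_sqrtr; first by lra.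
by apply: ltW (mulr_gt0 (mulr_gt0 _ b0) s0).
Qed.

End Flat.

(** * From non-flatness to domination by a single vector *)

Section Dominate.
Variables (R : realType) (A : cstar_algebra R) (E : bimodule_data A).
Hypothesis pE : pre_bimodule E.
Variables (x : E) (D : set A) (e : R).
Hypothesis hD : hereditary_subalgebra D.
Hypothesis e0 : 0 < e.
Hypothesis big : forall a, D a -> cpositive a -> nr a = 1 -> e <= rnr (lact a (ract x a)).

Lemma cutoff_uio (u : A) n (V : lmodType R[i]) (B : V -> V -> R) (f : A -> V -> V) :
  cpositive u -> nr u <= 1 -> form_rep B f -> unit_interval_op B (f (cutoff u n)).
Proof.
move=> pu u1 rf; have rB := frep_form rf.
have uq := uio_compl rB (frep_uio rf pu u1).
pose q v := v - f u v.
have ui : unit_interval_op B (iter n q).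
  split=> [v w|v w|v]; first by elim: n => [//|n ih]; rewrite !iterS ih; exact: (uioD uq).
    exact: (uio_iterC uq).
  rewrite (momentD uq); elim: {2}n => [|m ih]; first by rewrite addn0.
  by apply: le_trans ih; rewrite addnS (moment_dec rB uq).
have := uio_compl rB ui; congr (unit_interval_op _ _); apply/funext => v.
by rewrite -(frep_cutoff _ _ _ rf) opprB addrC subrK.
Qed.

Lemma cutoff_mem (u : A) n : D u -> D (cutoff u n).
Proof.
move=> Du; have [[D0 Dlin] _ DM _ _] := hD; elim: n => [//|n ih] /=.
rewrite addrC -scaleN1r; apply: (Dlin); first exact: DM.
by rewrite -[cutoff u n]scale1r; exact: Dlin.
Qed.

Variables (pi : irrep A).
Local Notation op := (@irrep_op R A pi).

(** For [u = k / n] with [n >= |k|] the witness is [z = (1 - u)^n xi]. Convexity of the moments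
    gives [n <z, u z> <= <xi, z> - |z|^2], so the penalty is at least [<xi, z>]. In the form
    [vform xi], the cut-off [a' = 1 - (1 - u)^n] satisfies [<x, a' x> <= <x, k x> <= d / 2], so
    [not_flat] forces [<xi, z> >= d]. *)
Lemma penalty_witness : exists2 d : R, 0 < d & forall xi : pi, nr xi = 1 ->
  forall k : A, D k -> cpositive k -> vform xi x (lact k x) <= d / 2 ->
  exists z, d <= penalty xi op z k.
Proof.
have [d d0 flat] := not_flat pE hD e0 big; exists d => // xi xi1 k Dk pk kd.
have [n n0 kn] : exists2 n : nat, 0 < n%:R :> R & nr k <= n%:R.
  by exists (Num.truncn (nr k)).+1; [rewrite ltr0n|apply: ltW; exact: truncnS_gt].
pose u := ((n%:R : R)^-1)%:C%C *: k.
have nV : 0 <= (n%:R : R)^-1 by rewrite invr_ge0 ltW.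
have pu : cpositive u by exact: cpositiveZ.
have u1 : nr u <= 1 by rewrite nrZ cabs_real ger0_norm// mulrC ler_pdivrMr// mul1r.
have kE : k = (n%:R : R)%:C%C *: u by rewrite scalerA -rmorphM/= divff ?gt_eqF// rmorph1 scale1r.
have Du : D u.
  by have [[D0 Dlin] _ _ _ _] := hD; rewrite /u -[_ *: k]addr0; exact: Dlin.
pose a' := cutoff u n.
have rp := irrep_form_rep pi; have hB := hr_form pi.
have uq := uio_compl hB (frep_uio rp pu u1).
pose q v := v - op u v.
have flat' := flat a' (cutoff_mem n Du) (cutoff_sa n (cpositive_sa pu))
  (fun V B f rf => cutoff_uio n pu u1 rf) pi xi xi1.
have a'E : xi - op a' xi = iter n q xi by exact: (frep_cutoff _ _ _ rp).
pose m := moment (@hr R pi) q xi.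
have mn : hr xi (xi - op a' xi) = m n by rewrite a'E.
have x_small : vform xi (lact a' x) (lact a' x) < d.
  have rf := vform_rep pE xi; have rB := frep_form rf.
  have ux := uio_compl rB (frep_uio rf pu u1).
  apply: le_lt_trans (uio_le (cutoff_uio n pu u1 rf) x) _.
  have := convex_early (moment_cvx rB ux x) n.
  have -> : moment (vform xi) (fun y => y - lact u y) x 0 = vform xi x x by [].
  have -> : moment (vform xi) (fun y => y - lact u y) x 1 = vform xi x x - vform xi x (lact u x).
    by rewrite /moment /= (rfB rB).
  rewrite /moment -(frep_cutoff _ _ _ rf) (rfB rB).
  move: kd; rewrite {1}kE (frepZl rf) (rfZ rB) -/a'; lra.
have dm : d <= m n.
  by rewrite leNgt; apply/negP => lt; apply: flat' => //; rewrite mn.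
exists (iter n q xi); apply: le_trans dm _; rewrite /penalty kE opZl (rfZ hB).
have -> : nr (iter n q xi) ^+ 2 = m (n + n)%N by rewrite -hr_norm (momentD uq).
have -> : hr (iter n q xi) (op u (iter n q xi)) = m (n + n)%N - m (n + n).+1.
  by rewrite /m -addnS -!(momentD uq) /q /= (rfB hB) opprB addrC subrK.
have -> : hr xi (iter n q xi) = m n by [].
have := convex_late (moment_cvx hB uq xi) n n; rewrite -/m; lra.
Qed.

(** Minimax gives one [z] with [<z, k z> <= 2 <xi, z>] for all admissible [k]. It is applied to
    multiples of [d a^* a d^*], which belong to [D] by heredity, and [zeta = d^* z] turns [<z, k z>]
    into [|a zeta|^2]. As [xi = d h], the positive number [<xi, z>] equals [<h, zeta>], so [zeta]
    cannot vanish. *)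
Lemma dominated (d : A) (h xi : pi) : D d -> xi = op d h -> nr xi = 1 ->
  exists d' (zeta : pi) (C : R), [/\ D d', zeta <> 0, 0 <= C & forall a,
    nr (op a zeta) ^+ 2 <= C * vform xi (lact a (lact d' x)) (lact a (lact d' x))].
Proof.
move=> Dd xiE xi1; have [del del0 wit] := penalty_witness.
have hB := hr_form pi; have rp := irrep_form_rep pi.
have rf := vform_rep pE xi; have rB := frep_form rf.
have [[D0 Dlin] _ DM Dadj _] := hD.
have DZ (c : R[i]) a : D a -> D (c *: a) by move=> Da; rewrite -[_ *: a]addr0; exact: Dlin.
pose L k := [/\ D k, cpositive k & vform xi x (lact k x) <= del / 2].
pose mix (r : R) (s t : A) := (1 - r)%:C%C *: s + r%:C%C *: t.
have L0 : L 0.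
  split=> //; first by exists 0; rewrite cmul0r.
  by rewrite (lact0l pE) (rf0 rB) divr_ge0// ltW.
have [|||||||z zP] := @minimax R pi xi A L op mix _ _ _ _ _ _ del 0 L0 del0.
- by move=> a u v; exact: opD.
- by move=> k [_ pk _] u v; rewrite hr_op (cpositive_sa pk).
- by move=> k [_ pk _] u; exact: op_cpositive.
- by move=> k _; exists (nr k) => [|u]; [exact: nr_ge0|exact: op_norm].
- move=> r s t /andP[r0 r1] [Ds ps sd] [Dt pt td]; rewrite /L /mix; split.
  + by apply: Dlin => //; exact: DZ.
  + by apply: cpositiveD; apply: cpositiveZ; rewrite ?subr_ge0.
  + rewrite (frepDl rf) !(frepZl rf) (rfD rB) !(rfZ rB).
    have := ler_wpM2l r0 td; have := ler_wpM2l (_ : 0 <= 1 - r) sd.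
    by rewrite subr_ge0 => /(_ r1); lra.
- by move=> r s t u _ _ _; rewrite opDl !opZl.
- by move=> k [Dk pk kd]; exact: wit.
pose zeta := op (cadj d) z.
have zz : del <= 2 * hr xi z - nr z ^+ 2.
  by have := zP _ L0; rewrite /penalty op0l (rf0 hB) subr0.
have zeta0 : zeta <> 0.
  move=> e'; have e2 : hr xi z = 0 by rewrite xiE hr_op -/zeta e' (rf0 hB).
  by move: zz; rewrite e2; have := sqr_ge0 (nr z); lra.
pose K := 2 * hr xi z.
have K0 : 0 <= K by have := sqr_ge0 (nr z); rewrite /K; lra.
exists (cadj d), zeta, (2 * K / del); split=> //; first exact: Dadj.
  by apply: divr_ge0 (mulr_ge0 _ K0) (ltW del0).
move=> a; set y := lact (cadj d) x; set w := vform xi (lact a y) (lact a y).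
have w0 : 0 <= w by exact: (rf_ge0 rB).
set p := nr (op a zeta) ^+ 2; have p0 : 0 <= p by exact: sqr_ge0.
(* Scaling [k] up to the limit of admissibility makes the bound homogeneous; if [w = 0], arbitrarily
   large multiples are admissible. *)
have key t : 0 <= t -> t * w <= del / 2 -> t * p <= K.
  move=> t0 tw; pose k := t%:C%C *: cmul (cadj (cadj d)) (cmul (cmul (cadj a) a) (cadj d)).
  have k1 : vform xi x (lact k x) = t * w.
    by rewrite (frepZl rf) (rfZ rB) !(frepM rf) -!(frepC rf).
  have k2 : hr z (op k z) = t * p.
    by rewrite opZl (rfZ hB) !opM -!hr_op hr_norm.
  have Lk : L k.
    split; [apply: DZ; exact: hereditary_conj (Dadj _ Dd)| |by rewrite k1].
    apply: cpositiveZ => //; exists (cmul a (cadj d)).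
    by rewrite cadjM !cmulA.
  have := zP _ Lk; rewrite /penalty k2; have := sqr_ge0 (nr z).
  by rewrite /K; move: zz; lra.
have [w00|w00] := eqVneq w 0.
  rewrite w00 mulr0 leNgt; apply/negP => p_gt0.
  have := key ((K + 1) / p); rewrite w00 mulr0 divfK ?gt_eqF//.
  have : 0 <= (K + 1) / p by rewrite divr_ge0 // addr_ge0.
  have : 0 <= del / 2 by rewrite divr_ge0 // ltW.
  by move=> h1 h2 /(_ h2 h1); lra.
have wp : 0 < w by rewrite lt_neqAle eq_sym w00.
have := key (del / 2 / w); rewrite divfK ?gt_eqF//.
have : 0 <= del / 2 / w by rewrite !divr_ge0 // ltW.
move=> dw0 /(_ dw0 (lexx _)) le.
have dw : 0 < 2 * w / del by rewrite divr_gt0 ?mulr_gt0.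
have := ler_wpM2l (ltW dw) le.
have -> : 2 * w / del * (del / 2 / w * p) = p.
  by field; rewrite !gt_eqF.
by have -> : 2 * w / del * K = 2 * K / del * w by field; rewrite gt_eqF.
Qed.

End Dominate.

(** * Representations that induce themselves *)

Section SelfInduced.
Variables (R : realType) (A : cstar_algebra R) (E : bimodule_data A).
Hypothesis pE : pre_bimodule E.
Variable pi : irrep A.
Local Notation op := (@irrep_op R A pi).
Implicit Types (z w v : E) (a b : A) (h k : pi).

Section TensorMap.
Variable kappa : pi.
Hypothesis kappa0 : kappa <> 0.
Local Notation K := (hcompletion (vform_form pE kappa)).
Local Notation emb := (cemb (vform_form pE kappa)).

(** By cyclicity [h] is close to some [b kappa], and [z (x) b kappa = z b (x) kappa] has norm at
    most [|z| |b kappa|]. *)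
Lemma tensor_bound z h v :
  hr kappa (op (rip v z) h) <= rnr z * nr h * qn (vform kappa) v.
Proof.
have fB := vform_form pE kappa; have hB := hr_form pi.
apply: (@eps_le _ _ _ (nr kappa * nr (rip v z) + rnr z * qn (vform kappa) v)).
  by rewrite addr_ge0 ?mulr_ge0 ?nr_ge0 ?rnr_ge0 ?sqrtr_ge0.
move=> e e0; have [b bP] := op_cyclic kappa0 h e0.
have bh : nr (op b kappa) <= nr h + e.
  have -> : op b kappa = h - (h - op b kappa) by rewrite opprB addrC subrK.
  by apply: le_trans (nrB _ _) _; rewrite lerD2l ltW.
have h1 : hr kappa (op (rip v z) (h - op b kappa)) <= nr kappa * (nr (rip v z) * e).
  apply: le_trans (ler_norm _) _; apply: le_trans (hr_le _ _) _.
  rewrite ler_wpM2l ?nr_ge0//; apply: le_trans (op_norm _ _) _.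
  by rewrite ler_wpM2l ?nr_ge0// ltW.
have h2 : hr kappa (op (rip v z) (op b kappa)) <=
    qn (vform kappa) v * (rnr z * nr (op b kappa)).
  rewrite -opM -(pb_rip_ract pE); apply: le_trans (rf_le fB _ _) _.
  rewrite ler_wpM2l ?sqrtr_ge0//; apply: (qn_le fB); first by rewrite mulr_ge0 ?rnr_ge0 ?nr_ge0.
  by rewrite vform_ract// exprMn vform_le.
have -> : hr kappa (op (rip v z) h) =
    hr kappa (op (rip v z) (h - op b kappa)) + hr kappa (op (rip v z) (op b kappa)).
  by rewrite opB (rfB hB) subrK.
apply: le_trans (lerD h1 h2) _.
have q0 : 0 <= qn (vform kappa) v * rnr z by rewrite mulr_ge0 ?sqrtr_ge0 ?rnr_ge0.
have := ler_wpM2l q0 bh; rewrite -!mulrA; set q := qn _ _.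
by move: (rnr z) (nr kappa) (nr h) (nr (rip v z)) (nr (op b kappa)) => *; lra.
Qed.

(** The completion of [E] at the single vector [kappa] is a model of the whole tensor product:
    [z (x) h] is given by its inner products with all [v (x) kappa]. *)
Lemma tensor_map : exists T : E -> pi -> K,
  forall z h v, (T z h : completion _) v = hr kappa (op (rip v z) h).
Proof.
have hB := hr_form pi.
have ex (p : E * pi) : exists F : K, forall v, F v = hr kappa (op (rip v p.1) p.2).
  case: p => z h /=.
  apply: (@completion_riesz _ _ _ _ _ (rnr z * nr h)) => [u v|r u|u].
  - by rewrite (ripDl pE) opDl (rfD hB).
  - by rewrite (ripZl pE) opZl conjCr (rfZ hB).
  - exact: tensor_bound.
have [T TE] := choice ex; exists (fun z h => T (z, h)) => z h v.
by rewrite TE.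
Qed.

End TensorMap.

Variables (xi zeta : pi) (y : E) (C : R).
Hypothesis zeta0 : zeta <> 0.
Hypothesis C0 : 0 <= C.
Hypothesis dom : forall a, nr (op a zeta) ^+ 2 <= C * vform xi (lact a y) (lact a y).

Let kappa := op (rip y y) xi.
Let rW := vform_form pE kappa.
Local Notation K := (hcompletion rW).
Local Notation emb := (cemb rW).

(** This explains the choice [kappa = <y|y> xi]: since [<<z|y>> y = z <y|y>], [dom] at [a = <<z|y>>]
    compares with the norm of [z (x) kappa]. *)
Let lip_bound z : nr (op (lip z y) zeta) <= Num.sqrt C * qn (vform kappa) z.
Proof.
rewrite -ler_sqr ?nnegrE ?nr_ge0 ?mulr_ge0 ?sqrtr_ge0//.
rewrite exprMn sqr_sqrtr// (qn_sqr rW) -vform_ract// -(pb_imprim pE); exact: dom.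
Qed.

(* Otherwise [zeta] is killed by all [<<z|y>>]; as [<<z|y>> y = z <y|y>] can be
   taken close to [y], [dom] makes [op (a - a <<z|y>>) zeta] small. *)
Let lip_neq0 : exists z, op (lip z y) zeta <> 0.
Proof.
apply/not_existsP => h; apply: zeta0; apply: op_nondegenerate => a.
apply: nr0_eq0; apply/eqP; rewrite eq_le nr_ge0 andbT.
pose M := Num.sqrt C * (nr a * nr xi).
have M0 : 0 <= M by rewrite !mulr_ge0 ?sqrtr_ge0 ?nr_ge0.
apply: (@eps_le _ _ _ M) => // e e0; rewrite add0r.
have [z zP] := approx_unit pE y e0.
have <- : op (a - cmul a (lip z y)) zeta = op a zeta.
  rewrite opBl opM; have /contrapT -> := h z.
  by rewrite op0 subr0.
rewrite -ler_sqr ?nnegrE ?nr_ge0 ?(mulr_ge0 (ltW e0) M0)//.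
apply: le_trans (dom _) _.
have -> : lact (a - cmul a (lip z y)) y = lact a (y - ract z (rip y y)).
  have rf := vform_rep pE xi.
  rewrite (frepBl rf) (frepM rf) (pb_imprim pE).
  by apply/eqP; rewrite subr_eq -(lactD pE) subrK.
apply: le_trans (ler_wpM2l C0 (vform_le _ _)) _.
have -> : (e * M) ^+ 2 = C * ((nr a * e) ^+ 2 * nr xi ^+ 2).
  by rewrite /M !exprMn sqr_sqrtr//; ring.
rewrite ler_wpM2l// ler_wpM2r ?sqr_ge0// ler_sqr ?nnegrE ?rnr_ge0 ?mulr_ge0 ?nr_ge0 ?(ltW e0)//.
by apply: le_trans (rnr_lact pE _ _) _; rewrite ler_wpM2l ?nr_ge0// ltW.
Qed.

Let c0E z : (0 : completion rW) z = 0.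
Proof. exact: (rf0 rW). Qed.

(** [X] is the adjoint of the bounded map [z (x) kappa |-> <<z|y>> zeta]. It commutes with the
    actions of [A], so the inner product pulled back along [X] is invariant and Schur's lemma
    applies; [lip_neq0] makes the factor positive. *)
Let intertwiner : exists X : pi -> K, [/\ forall c h k, X (c *: h + k) = c *: X h + X k,
  forall h z, (X h : completion _) z = hr (op (lip z y) zeta) h
  & exists2 l : R, 0 < l & forall h k, hr (X h) (X k) = l * hr h k].
Proof.
have hB := hr_form pi.
have ex h : exists F : K, forall z, F z = hr (op (lip z y) zeta) h.
  apply: (@completion_riesz _ _ _ _ _ (Num.sqrt C * nr h)) => [u v|r u|u].
  - have -> : lip (u + v) y = lip u y + lip v y.
      by have := pb_lip_linear pE 1 u v y; rewrite !scale1r.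
    by rewrite opDl (rfDl hB).
  - have -> : lip (r%:C%C *: u) y = r%:C%C *: lip u y.
      have l0 : lip 0 y = 0.
        by have := pb_lip_linear pE (-1) u u y; rewrite !scaleN1r !addNr.
      by have := pb_lip_linear pE r%:C%C u 0 y; rewrite l0 !addr0.
    by rewrite opZl (rfZl hB).
  - apply: le_trans (ler_norm _) _; apply: le_trans (hr_le _ _) _.
    by rewrite mulrAC ler_wpM2r ?nr_ge0.
have [X XE] := choice ex; exists X.
have XD c h k : X (c *: h + k) = c *: X h + X k.
  apply: cext => z; rewrite caddE cscaleE !XE (rfD hB) (rfJ hB); congr (hr _ _ + _).
  have l0 : lip 0 y = 0.
    by have := pb_lip_linear pE (-1) z z y; rewrite !scaleN1r !addNr.
  by have := pb_lip_linear pE c^* z 0 y; rewrite l0 !addr0 => ->; rewrite opZl.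
have kB := hr_form K.
have Xop a h z : (X (op a h) : completion _) z = (X h : completion _) (lact (cadj a) z).
  by rewrite !XE (pb_lip_lact pE) opM [RHS]hr_op cadjK.
have Xnr h : nr (X h) <= Num.sqrt C * nr h.
  rewrite nr_completion; apply: qn_cfun_le => [|z]; first by rewrite mulr_ge0 ?sqrtr_ge0 ?nr_ge0.
  rewrite XE; apply: le_trans (hr_le _ _) _.
  by rewrite mulrAC ler_wpM2r ?nr_ge0.
have X0 : X 0 = 0 by apply: cext => z; rewrite XE (rf0 hB) c0E.
have XA h k : X (h + k) = X h + X k by rewrite -[h]scale1r XD !scale1r.
have XZ c h : X (c *: h) = c *: X h by rewrite -[c *: h]addr0 XD X0 addr0.
have rX : real_form (fun h k => hr (X h) (X k)).
  split=> [h k|h k l|r h k|h|c h k].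
  - exact: (rfC kB).
  - by rewrite XA (rfD kB).
  - by rewrite XZ (rfZ kB).
  - exact: (rf_ge0 kB).
  - by rewrite !XZ (rfJ kB).
have [|h k|a h k|l l0 lE] := schur_form rX (C := C).
- exact: C0.
- apply: le_trans (ler_norm _) _; apply: le_trans (hr_le _ _) _.
  rewrite -[C]sqr_sqrtr// expr2 mulrACA; apply: ler_pM; rewrite ?nr_ge0//.
(* The action on the completion is explicit on embedded vectors, so invariance is checked up to [e]
   on an approximant of [X k]. *)
- apply/eqP; rewrite -subr_eq0; apply/eqP.
  apply: (@eps_eq0 _ _ (nr (X (op a h)) + nr (X h) * nr a)).
    by rewrite addr_ge0 ?mulr_ge0 ?nr_ge0.
  move=> e e0; have [u uP] := cemb_dense (X k) e0.
  have e1 : hr (X (op a h)) (emb u : K) = hr (X h) (emb (lact (cadj a) u) : K).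
    by rewrite (rfC kB) hr_emb Xop -hr_emb (rfC kB).
  have e2 : nr (X (op (cadj a) k) - emb (lact (cadj a) u) : K) <= nr a * e.
    rewrite nr_completion; apply: qn_cfun_le => [|w]; first by rewrite mulr_ge0 ?nr_ge0 ?ltW.
    rewrite caddE coppE Xop cadjK.
    have -> : (emb (lact (cadj a) u) : completion _) w = (emb u : completion _) (lact a w).
      by rewrite /= (frepC (vform_rep pE kappa)).
    have -> : (X k : completion _) (lact a w) - (emb u : completion _) (lact a w)
        = (X k - emb u : completion _) (lact a w) by rewrite caddE coppE.
    apply: le_trans (cfun_le _ _) _.
    have -> : nr a * e * qn (vform kappa) w = e * (nr a * qn (vform kappa) w) by ring.
    apply: ler_pM; rewrite ?qn_ge0//.
    apply: (qn_le rW); first by rewrite mulr_ge0 ?nr_ge0 ?qn_ge0.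
    by rewrite exprMn (qn_sqr rW) (frep_norm (vform_rep pE kappa)).
  have -> : hr (X (op a h)) (X k) - hr (X h) (X (op (cadj a) k)) =
      hr (X (op a h)) (X k - emb u : K) - hr (X h) (X (op (cadj a) k) - emb (lact (cadj a) u) : K).
    by rewrite !(rfB kB) e1 opprB addrA subrK.
  apply: le_trans (ler_normB _ _) _; rewrite mulrDr lerD//.
    by apply: le_trans (hr_le _ _) _; rewrite mulrC ler_wpM2r ?nr_ge0.
  by apply: le_trans (hr_le _ _) _; rewrite mulrCA ler_wpM2l ?nr_ge0// mulrC.
split=> //; exists l => //; rewrite lt_neqAle l0 andbT; apply/eqP => l00.
have [z] := lip_neq0; apply.
have := lE (op (lip z y) zeta) (op (lip z y) zeta); rewrite -l00 mul0r hr_norm.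
move=> /eqP; rewrite sqrf_eq0 => /eqP/nr0_eq0 X00.
have := XE (op (lip z y) zeta) z; rewrite X00 hr_norm c0E.
by move=> /esym/eqP; rewrite sqrf_eq0 => /eqP/nr0_eq0.
Qed.

(** [X] is a multiple of an isometry from [pi] into the tensor product; what remains is
    surjectivity, that is, [X S = l] for the adjoint [S]. The [h] for which all [z (x) h] lie in the
    range of [X] form a closed invariant subspace [N] of [pi], so by irreducibility one non-zero
    element suffices. *)
Theorem self_induced : is_induced E pi pi.
Proof.
have hB := hr_form pi; have kB := hr_form K.
have kappa0 : kappa <> 0.
  move=> k0; have [z] := lip_neq0; apply; apply/nr0_eq0/eqP; rewrite eq_le nr_ge0 andbT.
  apply: le_trans (lip_bound z) _.
  have -> : qn (vform kappa) z = 0 by rewrite /qn /vform k0 op0 (rf0 hB) sqrtr0.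
  by rewrite mulr0.
have [T TE] := tensor_map kappa0; have [X [XL XE [l l0 lE]]] := intertwiner.
have X0 : X 0 = 0 by have := XL (-1) 0 0; rewrite scaler0 addr0 scaleN1r addNr.
have XZ c h : X (c *: h) = c *: X h by rewrite -[c *: h]addr0 XL X0 addr0.
have Xop a h z : (X (op a h) : completion _) z = (X h : completion _) (lact (cadj a) z).
  by rewrite !XE (pb_lip_lact pE) opM [RHS]hr_op cadjK.
have TL c z w h : T (c *: z + w) h = c *: T z h + T w h.
  apply: cext => v; rewrite caddE cscaleE !TE (pb_rip_linear pE) opDl (rfD hB).
  by rewrite (ripZl pE) conjCK.
have TLr c z h k : T z (c *: h + k) = c *: T z h + T z k.
  apply: cext => v; rewrite caddE cscaleE !TE irrep_op_linear (rfD hB).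
  by rewrite (ripZl pE) conjCK opZl.
have T0 z : T z 0 = 0 by have := TLr (-1) z 0 0; rewrite scaler0 addr0 scaleN1r addNr.
have TN z h : T z (- h) = - T z h.
  by have := TLr (-1) z h 0; rewrite T0 !addr0 !scaleN1r.
have TB z h k : T z (h - k) = T z h - T z k.
  by have := TLr 1 z h (- k); rewrite !scale1r TN.
have Tnr z h : nr (T z h) <= rnr z * nr h.
  have zh : 0 <= rnr z * nr h by rewrite mulr_ge0 ?rnr_ge0 ?nr_ge0.
  rewrite nr_completion; apply: qn_cfun_le => // v; rewrite ler_norml TE.
  rewrite tensor_bound// andbT lerNl -(rfN hB).
  have -> : - op (rip v z) h = op (rip v z) (- h) by rewrite -scaleN1r -opZ scaleN1r.
  by rewrite -(nrN h) tensor_bound.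
have Temb z b : T z (op b kappa) = emb (ract z b) :> K.
  by apply: cext => v; rewrite TE /= /vform (pb_rip_ract pE) opM.
have Tk z : T z kappa = emb z :> K by apply: cext => v; rewrite TE.
have Tip z h w k : hr (T z h) (T w k) = hr h (op (rip z w) k).
  apply/eqP; rewrite -subr_eq0; apply/eqP.
  apply: (@eps_eq0 _ _ (rnr z * nr (T w k) + nr (op (rip z w) k))).
    by rewrite addr_ge0 ?mulr_ge0 ?rnr_ge0 ?nr_ge0.
  move=> e e0; have [b bP] := op_cyclic kappa0 h e0.
  have eb : hr (T z (op b kappa)) (T w k) = hr (op b kappa) (op (rip z w) k).
    by rewrite Temb hr_emb TE (rip_ractl pE) opM -hr_op.
  have -> : hr (T z h) (T w k) - hr h (op (rip z w) k) =
      hr (T z (h - op b kappa)) (T w k) - hr (h - op b kappa) (op (rip z w) k).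
    by rewrite TB (rfBl kB) (rfBl hB) eb opprB addrA subrK.
  apply: le_trans (ler_normB _ _) _; rewrite mulrDr lerD//.
    apply: le_trans (hr_le _ _) _; rewrite mulrA ler_wpM2r ?nr_ge0//.
    by apply: le_trans (Tnr _ _) _; rewrite mulrC ler_wpM2r ?rnr_ge0// ltW.
  by apply: le_trans (hr_le _ _) _; rewrite ler_wpM2r ?nr_ge0// ltW.
pose sl := Num.sqrt l; have sl0 : 0 < sl by rewrite sqrtr_gt0.
have sll : sl * sl = l by rewrite -expr2 sqr_sqrtr// ltW.
have Xnr h : nr (X h) = sl * nr h.
  apply/eqP; rewrite -(@eqrXn2 _ 2) ?nr_ge0 ?(mulr_ge0 (ltW sl0) (nr_ge0 _))//.
  by rewrite -hr_norm lE hr_norm exprMn [sl ^+ 2]expr2 sll.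
have Sex F : exists u, forall h, hr F (X h) = hr h u.
  apply: (@riesz _ pi (fun h => hr F (X h)) (nr F * sl)) => [h k|r h|h].
  - by rewrite -[h]scale1r XL !scale1r (rfD kB).
  - by rewrite XZ (rfZ kB).
  - apply: le_trans (ler_norm _) _; apply: le_trans (hr_le _ _) _.
    by rewrite Xnr mulrA.
have [S SE] := choice Sex.
have SL c F G : S (c *: F + G) = c *: S F + S G.
  apply: hr_ext => h; rewrite -SE (rfDl kB) (rfD hB) (rfJ hB) -!SE XZ.
  by rewrite (rfJ kB) conjCK.
have S0 : S 0 = 0 by have := SL (-1) 0 0; rewrite scaler0 addr0 scaleN1r addNr.
have SX h : S (X h) = l%:C%C *: h.
  by apply: hr_ext => k; rewrite -SE lE (rfZ hB) (rfC hB).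
have Snr F : nr (S F) <= sl * nr F.
  have [->|SF0] := eqVneq (nr (S F)) 0; first by rewrite mulr_ge0 ?nr_ge0 ?(ltW sl0).
  have SF1 : 0 < nr (S F) by rewrite lt_neqAle eq_sym SF0 nr_ge0.
  rewrite -(ler_pM2l SF1) -expr2 -hr_norm -SE; apply: le_trans (ler_norm _) _.
  by apply: le_trans (hr_le _ _) _; rewrite Xnr; move: (nr F) (nr (S F)) => *; lra.
pose Z z h := X (S (T z h)) - l%:C%C *: T z h.
have ZL c z h k : Z z (c *: h + k) = c *: Z z h + Z z k.
  rewrite /Z TLr SL XL scalerBr [l%:C%C *: (_ + _)]scalerDr opprD addrACA.
  by rewrite !scalerA [l%:C%C * c]mulrC.
pose N : set pi := [set h | forall z, Z z h = 0].
have Xz0 : X zeta <> 0.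
  move=> e; have := lE zeta zeta; rewrite e (rf0 kB) => /esym/eqP.
  by rewrite mulf_eq0 gt_eqF//= hr_norm sqrf_eq0 => /eqP/nr0_eq0.
have [w0 wP] : exists w, (X zeta : completion _) w <> 0.
  apply/not_existsP => h; apply: Xz0; apply: cext => w.
  by have /contrapT -> := h w; rewrite c0E.
(* The adjoint of [k |-> w0 (x) k] sends [X zeta] to [h0], and imprimitivity shows
   [z (x) h0 = X (<<z|w0>> zeta)]. *)
have [h0 h0P] : exists u, forall k, hr (X zeta) (T w0 k) = hr k u.
  apply: (@riesz _ pi (fun h => hr (X zeta) (T w0 h)) (nr (X zeta) * rnr w0)) => [h k|r h|h].
  - by have := TLr 1 w0 h k; rewrite !scale1r => ->; rewrite (rfD kB).
  - by have := TLr r%:C%C w0 h 0; rewrite T0 !addr0 => ->; rewrite (rfZ kB).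
  - apply: le_trans (ler_norm _) _; apply: le_trans (hr_le _ _) _.
    by rewrite -mulrA ler_wpM2l ?nr_ge0.
have h00 : h0 <> 0.
  move=> e; have := h0P kappa; rewrite e (rf0 hB) Tk (rfC kB) hr_emb.
  exact: wP.
have Nh0 : N h0.
  move=> z; rewrite /Z.
  have -> : T z h0 = X (op (lip z w0) zeta) :> K.
    apply: cext => v; rewrite TE Xop (pb_lip_adj pE) (pb_imprim pE).
    by rewrite -(pb_rip_adj pE) -hr_op -h0P Temb (rfC kB) hr_emb.
  by rewrite SX XZ subrr.
have NT : N = setT.
  apply: irrep_invariant Nh0 h00.
  - split=> [z|c h k Nh Nk z]; first by rewrite /Z T0 S0 X0 scaler0 subrr.
    by rewrite ZL Nh Nk scaler0 addr0.
  - apply: nr_closed => h ap z; apply/nr0_eq0/eqP; rewrite eq_le nr_ge0 andbT.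
    apply: (@eps_le _ _ _ (2 * l * rnr z)); first by rewrite !mulr_ge0 ?rnr_ge0 ?(ltW l0).
    move=> e /ap[k Nk hk]; rewrite add0r.
    have -> : Z z h = Z z (h - k).
      by have := ZL (-1) z k h; rewrite !scaleN1r Nk oppr0 add0r addrC => ->.
    apply: le_trans (nrB _ _) _; rewrite Xnr nrZ cabs_real gtr0_norm//.
    have b1 := ler_wpM2l (ltW sl0) (Snr (T z (h - k))).
    have b2 := ler_wpM2l (ltW l0) (Tnr z (h - k)).
    have b3 := ler_wpM2l (mulr_ge0 (ltW l0) (rnr_ge0 z)) (ltW hk).
    by rewrite mulrA sll in b1; rewrite mulrA in b2; lra.
  - by move=> a h Nh z; have := Nh (ract z a); rewrite /Z;
      have -> : T z (op a h) = T (ract z a) h :> K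
        by apply: cext => v; rewrite !TE (pb_rip_ract pE) opM.
have XST z h : X (S (T z h)) = l%:C%C *: T z h.
  have Nh : N h by rewrite NT.
  by have /eqP := Nh z; rewrite subr_eq0 => /eqP.
pose s := sl^-1; have ssl : s * s * l = 1.
  by rewrite -sll /s mulrACA mulVf ?mulr1 ?gt_eqF.
pose T' z h := s%:C%C *: S (T z h).
have T'r z h w k : hr (T' z h) (T' w k) = hr h (op (rip z w) k).
  by rewrite (rfZ hB) (rfZl hB) -SE XST (rfZ kB) (rfC kB) Tip mulrA mulrA ssl mul1r.
(* A vector orthogonal to all [T' z kappa] is killed by [X], which is injective; this yields the
   density of the range of [T']. *)
have Xkill q : (forall z, hr (T' z kappa) q = 0) -> q = 0.
  move=> hq; have Xq : X q = 0.
    apply: cext => z; have := hq z; rewrite (rfZl hB) (rfC hB) -SE Tk hr_emb => /eqP.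
    rewrite mulf_eq0 gt_eqF ?invr_gt0//= => /eqP ->.
    by rewrite (rf0 rW).
  have := lE q q; rewrite Xq (rf0 kB) => /esym/eqP.
  by rewrite mulf_eq0 gt_eqF//= hr_norm sqrf_eq0 => /eqP/nr0_eq0.
have T'act a z h : op a (T' z h) = T' (lact a z) h.
  apply: hr_ext => p; rewrite opZ !(rfZ hB); congr (_ * _).
  rewrite -[a]cadjK -hr_op -!SE cadjK.
  apply/eqP; rewrite -subr_eq0; apply/eqP.
  apply: (@eps_eq0 _ _ (rnr z * nr (X (op (cadj a) p)) + rnr (lact a z) * nr (X p))).
    by rewrite addr_ge0 ?mulr_ge0 ?rnr_ge0 ?nr_ge0.
  move=> e e0; have [b bP] := op_cyclic kappa0 h e0.
  have eb : hr (T z (op b kappa)) (X (op (cadj a) p)) = hr (T (lact a z) (op b kappa)) (X p).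
    by rewrite !Temb !hr_emb Xop cadjK (lact_ract pE).
  have -> : hr (T z h) (X (op (cadj a) p)) - hr (T (lact a z) h) (X p) =
      hr (T z (h - op b kappa)) (X (op (cadj a) p)) -
      hr (T (lact a z) (h - op b kappa)) (X p).
    by rewrite !TB !(rfBl kB) eb opprB addrA subrK.
  have le w F : `|hr (T w (h - op b kappa)) F| <= e * (rnr w * nr F).
    apply: le_trans (hr_le _ _) _; rewrite mulrA ler_wpM2r ?nr_ge0//.
    by apply: le_trans (Tnr _ _) _; rewrite mulrC ler_wpM2r ?rnr_ge0// ltW.
  by apply: le_trans (ler_normB _ _) _; rewrite mulrDr lerD.
exists T'; split.
- by move=> c z w h; rewrite /T' TL SL scalerDr !scalerA [s%:C%C * c]mulrC.
- by move=> c z h k; rewrite /T' TLr SL scalerDr !scalerA [s%:C%C * c]mulrC.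
- move=> z h w k; apply: hip_eq; first exact: T'r.
  have -> : 'i%C *: T' w k = T' w ('i%C *: k).
    have := TLr 'i%C w k 0; rewrite T0 !addr0 /T' => ->.
    have := SL 'i%C (T w k) 0; rewrite S0 !addr0 => ->.
    by rewrite !scalerA mulrC.
  by rewrite T'r opZ.
- apply/seteqP; split=> // p _ M [[lM cM] TM].
  have clM : closed M.
    apply: nr_closed => u ap; apply: cM => e /gt0_re[r r0 ->].
    by have [v Mv uv] := ap r r0; exists v; rewrite // normE ltcR.
  have [||h Mh|u Mu uP] := @riesz_on _ pi M (hr p) (nr p) lM clM.
  - by move=> h k; rewrite (rfD hB).
  - by move=> r h; rewrite (rfZ hB).
  - by apply: le_trans (ler_norm _) _; exact: hr_le.
  suff : p - u = 0 by move=> /eqP; rewrite subr_eq0 => /eqP ->.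
  apply: Xkill => z; have Mz : M (T' z kappa) by apply: TM; exists z, kappa.
  by rewrite (rfB hB) -uP// (rfC hB) subrr.
- by move=> a z h; exact: T'act.
Qed.

End SelfInduced.

(** * Topological freeness and aperiodicity *)

Section Ideals.
Variables (R : realType) (A : cstar_algebra R).
Implicit Types (J : set A) (a b c : A).

Lemma closed_ideal_gen (X : set A) : closed_ideal (ideal_gen X).
Proof.
split; first split.
- by move=> M [[[M0 _] _ _] _].
- move=> c x y hx hy M hM; have [[[_ lin] _ _] _] := hM.
  by apply: lin; [exact: hx|exact: hy].
- apply: nr_closed => x ap M hM; have [[_ cM _] _] := hM.
  by apply: closed_nr cM _ => e /ap[y hy xy]; exists y => //; exact: hy.
- move=> a x hx; split=> M hM; have [[_ _ iM] _] := hM.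
    by have [] := iM a x (hx M hM).
  by have [] := iM a x (hx M hM).
Qed.

Lemma sub_ideal_gen (X : set A) : X `<=` ideal_gen X.
Proof. by move=> x Xx M [_]; exact. Qed.

Lemma ideal_gen_sub (X J : set A) : closed_ideal J -> X `<=` J -> ideal_gen X `<=` J.
Proof. by move=> hJ XJ x; apply. Qed.

Lemma left_annihilator_ideal J : (forall a x, J x -> J (cmul a x)) ->
  closed_ideal [set a : A | forall x, J x -> cmul a x = 0].
Proof.
move=> iJ; split; first split.
- by move=> x _; rewrite cmul0l.
- by move=> c a b ha hb x Jx; rewrite cmulDl cmulZl ha// hb// scaler0 addr0.
- apply: nr_closed => a ap x Jx; apply/nr0_eq0/eqP; rewrite eq_le nr_ge0 andbT.
  apply: (@eps_le _ _ _ (nr x)) => [|e /ap[b hb ab]]; first exact: nr_ge0.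
  have -> : cmul a x = cmul (a - b) x by rewrite cmulBl hb// subr0.
  by rewrite add0r; apply: le_trans (nrM _ _) _; rewrite ler_wpM2r ?nr_ge0// ltW.
- move=> a b hb; split=> x Jx; first by rewrite -cmulA hb// cmul0r.
  by rewrite -cmulA hb//; exact: iJ.
Qed.

Lemma op_kernel_ideal (pi : irrep A) :
  closed_ideal [set a : A | forall h : pi, irrep_op a h = 0].
Proof.
split; first split.
- by move=> h; rewrite op0l.
- by move=> c a b ha hb h; rewrite opDl opZl ha hb scaler0 addr0.
- apply: nr_closed => a ap h; apply/nr0_eq0/eqP; rewrite eq_le nr_ge0 andbT.
  apply: (@eps_le _ _ _ (nr h)) => [|e /ap[b hb ab]]; first exact: nr_ge0.
  have -> : irrep_op a h = irrep_op (a - b) h by rewrite opBl hb subr0.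
  by rewrite add0r; apply: le_trans (op_norm _ _) _; rewrite ler_wpM2r ?nr_ge0// ltW.
- by move=> a b hb; split=> h; rewrite opM hb ?op0.
Qed.

(** The vectors killed by [J] form a closed invariant subspace, which contains the non-zero vector
    [b k]; by irreducibility it is everything. *)
Lemma op_prime (pi : irrep A) (I J : set A) : closed_ideal J ->
  (forall a b (h : pi), J a -> I b -> irrep_op a (irrep_op b h) = 0) ->
  (exists a (h : pi), I a /\ irrep_op a h != 0) ->
  forall a (h : pi), J a -> irrep_op a h = 0.
Proof.
move=> [_ _ iJ] JI [b [k [Ib bk]]].
pose M : set pi := [set h | forall a, J a -> irrep_op a h = 0].
suff MT : M = setT by move=> a h Ja; have Mh : M h; [rewrite MT|exact: Mh].
apply: (@irrep_invariant _ _ _ _ (irrep_op b k)).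
- split=> [a _|c h l hM lM a Ja]; first by rewrite op0.
  by rewrite irrep_op_linear hM// lM// scaler0 addr0.
- apply: nr_closed => h ap a Ja; apply/nr0_eq0/eqP; rewrite eq_le nr_ge0 andbT.
  apply: (@eps_le _ _ _ (nr a)) => [|e /ap[l lM hl]]; first exact: nr_ge0.
  have -> : irrep_op a h = irrep_op a (h - l) by rewrite opB lM// subr0.
  by rewrite add0r mulrC; apply: le_trans (op_norm _ _) _; rewrite ler_wpM2l ?nr_ge0// ltW.
- by move=> a h hM c Jc; rewrite -opM hM//; have [] := iJ a c Jc.
- by move=> a Ja; exact: JI.
- by apply/eqP.
Qed.

Lemma unitarily_equivalent_refl (pi : irrep A) : unitarily_equivalent pi pi.
Proof. by exists id; split=> // k; exists k. Qed.

Definition spectrum_of (pi : irrep A) : spectrum A :=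
  Spectrum (ex_intro _ pi erefl).

Lemma spectrum_ideal_rep J p (rho : irrep A) : spectrum_ideal J p -> spectrum_class p rho ->
  exists a (h : rho), J a /\ irrep_op a h != 0.
Proof.
move=> [sg]; have [rho0 ->] := spectrum_classP p.
move=> [U [Ul Uip Us Uop]] [a [k [Ja ak]]] [W [Wl Wip Ws Wop]].
have [h hk] := Us k; exists a, (W h); split=> //.
rewrite -Wop; apply: contra ak => /eqP e.
have e2 : irrep_op a h = 0.
  apply/nr0_eq0/eqP; rewrite -sqrf_eq0 -hr_norm /hr -Wip e -/(hr _ _).
  by rewrite (rf0 (hr_form rho)).
have U0 : U 0 = 0 by have := Ul (-1) 0 0; rewrite scaler0 addr0 scaleN1r addNr.
by rewrite -hk -Uop e2 U0.
Qed.

Lemma spectrum_ideal_sub I J p : I `<=` J -> spectrum_ideal I p -> spectrum_ideal J p.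
Proof. by move=> IJ [rho hr' [a [h [Ia ah]]]]; exists rho => //; exists a, h; split=> //; exact: IJ. Qed.

End Ideals.

Section Aperiodic.
Variables (R : realType) (A : cstar_algebra R) (E : action_data A).
Local Notation S := (action_semigroup E).
Hypothesis pE : forall t : S, pre_bimodule (E t).
Hypothesis le_refl : forall t : S, natural_le t t.
Hypothesis germ_trans : forall p (t u v : S), germ_equiv p t u -> germ_equiv p t v ->
  germ_equiv p u v.

Let self_map (t : S) (x : E t) (D : set A) (e : R) (rho : irrep A) (d : A) :
  hereditary_subalgebra D -> 0 < e ->
  (forall a, D a -> cpositive a -> nr a = 1 -> e <= rnr (lact a (ract x a))) ->
  D d -> (exists h : rho, irrep_op d h <> 0) -> is_induced (E t) rho rho.
Proof.
move=> hD e0 big Dd [h dh].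
have n0 : 0 < nr (irrep_op d h).
  by rewrite lt_neqAle nr_ge0 andbT eq_sym; apply/eqP => /nr0_eq0.
pose xi := irrep_op d (((nr (irrep_op d h))^-1)%:C%C *: h).
have xi1 : nr xi = 1.
  by rewrite /xi opZ nrZ cabs_real ger0_norm ?invr_ge0 ?nr_ge0// mulVf ?gt_eqF.
have [d' [zeta [C [_ z0 C0 dom]]]] := dominated (pE t) hD e0 big Dd erefl xi1.
exact: self_induced z0 C0 dom.
Qed.

Theorem topologically_free_aperiodic : topologically_free E -> aperiodic E.
Proof.
move=> free t x xX D hD Dn0 eps /gt0_re[e e0 ->].
have [//|no] := pselect (exists a, [/\ D a, cpositive a, `|a| = 1
  & rnorm (lact a (ract x a)) < e%:C%C]).
case: free.
have [[D0 Dlin] _ DM Dadj _] := hD.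
have big a : D a -> cpositive a -> nr a = 1 -> e <= rnr (lact a (ract x a)).
  move=> Da pa a1; rewrite leNgt; apply/negP => lt; apply: no; exists a; split=> //.
    by rewrite normE a1.
  by rewrite (rnormE (lact a (ract x a))) ltcR.
(* If [x d = 0] for all [d] in [D], then [axa = 0] for the normalised [a] of a non-zero [d^* d],
   against [big]. *)
have [d Dd xd] : exists2 d, D d & ract x d <> 0.
  have [//|all0] := pselect (exists2 d, D d & ract x d <> 0).
  have [d Dd d0] : exists2 d, D d & d <> 0.
    have [//|D1] := pselect (exists2 d, D d & d <> 0).
    case/eqP: Dn0; apply/seteqP; split=> [d Dd /=|_ -> //].
    by apply: contrapT => d0; apply: D1; exists d.
  have dd0 : 0 < nr (cmul (cadj d) d).
    by rewrite nr_cstar exprn_gt0// lt_neqAle nr_ge0 andbT eq_sym; apply/eqP => /nr0_eq0.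
  pose a := ((nr (cmul (cadj d) d))^-1)%:C%C *: cmul (cadj d) d.
  have aV : 0 <= (nr (cmul (cadj d) d))^-1 by rewrite invr_ge0 ltW.
  have Da : D a by rewrite /a -[_ *: _]addr0; apply: Dlin => //; apply: DM => //; exact: Dadj.
  have pa : cpositive a by apply: cpositiveZ => //; exists d.
  have := big a Da pa; rewrite nrZ cabs_real ger0_norm// mulVf ?gt_eqF// => /(_ erefl).
  have -> : ract x a = 0 by apply: contrapT => xa; apply: all0; exists a.
  have -> : lact a (0 : E t) = 0.
    by apply: (addIr (lact a (0 : E t))); rewrite -(lactD (pE t)) !add0r.
  by rewrite /rnr (rip0 (pE t)) nr0 sqrtr0; lra.
pose c := rip (ract x d) (ract x d); pose J := ideal_gen [set c].
have c0 : c <> 0 by move=> /(pb_rip_eq0 (pE t)).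
have hJ : closed_ideal J by exact: closed_ideal_gen.
have JE : J `<=` source_ideal (E t).
  apply: ideal_gen_sub; first exact: closed_ideal_gen.
  by move=> _ ->; apply: sub_ideal_gen; exists (ract x d), (ract x d).
have Vdom p : spectrum_ideal J p -> germ_domain t p by exact: spectrum_ideal_sub.
exists (basic_open t (spectrum_ideal J)); split.
- have [|pi [v [v1 cv]]] := @irrep_norm R A c; first exact/eqP.
  have Vp : spectrum_ideal J (spectrum_of pi).
    exists pi; first exact: unitarily_equivalent_refl.
    exists c, v; split; first exact: sub_ideal_gen.
    apply/eqP => e1; apply: c0; apply: nr0_eq0.
    by rewrite -cv e1 nr0.
  exists (DualArrow (ex_intro2 _ _ t (Vdom _ Vp) erefl)); split=> //=.
  split; [exact: Vdom|exact: Vdom|exists t; split=> //; exact: Vdom].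
- by move=> g Wg; exists t, (spectrum_ideal J); split=> //; exists J.
- move=> g [gt Vg]; rewrite /arrow_unit; have [t0 _ gE] := arrow_germP g.
  rewrite gE in gt * => g1; have [_ _ [v [vt v1 [rho pr hv]]]] := germ_trans gt g1.
  have [_ _ iv] := closed_ideal_gen [set a | exists y z : E v, a = rip y z].
  pose I := source_ideal (E v).
  have [b [k [Jb bk]]] := spectrum_ideal_rep Vg pr.
  (* [x] is a limit of sums of products [y a] with [a] annihilating the overlap ideal, and [I] is
     contained in that ideal. *)
  have xI z : I z -> ract x z = 0.
    have M := xX [set y | forall z, I z -> ract y z = 0]; apply: M.
    split; first split; first split.
    + by move=> z' _; rewrite (ract0l (pE t)).
    + by move=> s y y' hy hy' z' Iz; rewrite (ractD (pE t)) (ractZ (pE t)) hy// hy'// scaler0 addr0.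
    + move=> y ap z' Iz; apply/(rnr0_eq0 (pE t))/eqP; rewrite eq_le rnr_ge0 andbT.
      apply: (@eps_le _ _ _ (nr z')) => [|r r0]; first exact: nr_ge0.
      have [|y' hy' yy] := ap r%:C%C; first by rewrite ltcR.
      have -> : ract y z' = ract (y - y') z' by rewrite (ractBl (pE t)) hy'// subr0.
      rewrite add0r; apply: le_trans (rnr_ract (pE t) _ _) _; rewrite ler_wpM2r ?nr_ge0//.
      by move: yy; rewrite (rnormE (y - y')) ltcR => /ltW.
    + move=> _ [y [a [Ia ->]]] z' Iz; rewrite -(ractM (pE t)) Ia ?rip0.
        by apply: (rip_ext (pE t)) => w; rewrite (pb_rip_ract (pE t)) cmul0r (rip0 (pE t)).
      by move=> M [_ sub]; apply: sub; exists v.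
  (* [<xd|xd> z = <xd|x (d z)>], and [d z] lies in [I]. *)
  have cI : J `<=` [set a : A | forall z, I z -> cmul a z = 0].
    apply: ideal_gen_sub.
      by apply: left_annihilator_ideal => a z Iz; have [] := iv a z Iz.
    move=> _ -> z Iz; have [Idz _] := iv d z Iz.
    by rewrite -(pb_rip_ract (pE t)) -(ractM (pE t)) (xI _ Idz) (rip0 (pE t)).
  case/eqP: bk; apply: (@op_prime _ _ rho I J hJ _ hv b k Jb) => a z h Ja Iz.
  by rewrite -opM cI// op0l.
- move=> g [gt Vg]; exists t => //; split; first exact: Vdom.
  have [rho pr _] := Vg.
  have [b [k [Jb bk]]] := spectrum_ideal_rep Vg pr.
  exists rho, rho; split=> //; apply: self_map hD e0 big Dd _.
  apply: contrapT => kill; case/eqP: bk; move: b Jb k.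
  apply: (ideal_gen_sub (op_kernel_ideal rho)) => _ -> h.
  rewrite /c rip_ractl// (pb_rip_ract (pE t)) !opM.
  have -> : irrep_op d h = 0 by apply: contrapT => dh; apply: kill; exists h.
  by rewrite !op0.
Qed.

End Aperiodic.

(** * Germs *)

Section InverseSemigroup.
Variable S : semigroup_data.
Hypothesis hS : unital_inverse_semigroup S.
Implicit Types e f t : S.
Local Notation "x ** y" := (@smul S x y) (at level 40, left associativity).

Let mulA t u v : t ** (u ** v) = t ** u ** v.
Proof. by case: hS. Qed.

Let inverse_unique t u v : t ** u ** t = t -> u ** t ** u = u ->
  t ** v ** t = t -> v ** t ** v = v -> u = v.
Proof.
move=> u1 u2 v1 v2; have [_ _ _ /(_ t)[w [_ wP]]] := hS.
by rewrite -(wP u) // -(wP v).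
Qed.

(** The inverse [x] of [ef] equals [f x e] by uniqueness, which makes [x] idempotent and hence its
    own inverse; so [ef = x]. *)
Lemma idempotentM e f : e ** e = e -> f ** f = f -> e ** f ** (e ** f) = e ** f.
Proof.
move=> ee ff; have [_ _ _ /(_ (e ** f))[x [[x1 x2] xP]]] := hS.
have xE : x = f ** x ** e.
  apply: xP; split.
    have -> : e ** f ** (f ** x ** e) ** (e ** f) = e ** (f ** f) ** x ** (e ** e) ** f.
      by rewrite !mulA.
    by rewrite ff ee -[e ** f ** x ** e ** f]mulA x1.
  have -> : f ** x ** e ** (e ** f) ** (f ** x ** e) =
      f ** (x ** (e ** e) ** (f ** f) ** x) ** e by rewrite !mulA.
  by rewrite ff ee -[x ** e ** f]mulA x2.
have xx : x ** x = x.
  have -> : x ** x = f ** (x ** (e ** f) ** x) ** e by rewrite {1 2}xE !mulA.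
  by rewrite x2 -xE.
have -> : e ** f = x by apply: (@inverse_unique x) => //; rewrite !xx.
exact: xx.
Qed.

(** [fe] is an inverse of [ef], and so is the idempotent [ef] itself. *)
Lemma idempotentC e f : e ** e = e -> f ** f = f -> e ** f = f ** e.
Proof.
move=> ee ff; have ef := idempotentM ee ff; have fe := idempotentM ff ee.
apply: (@inverse_unique (e ** f)); rewrite ?ef//.
- have -> : e ** f ** (f ** e) ** (e ** f) = e ** (f ** f) ** (e ** e) ** f by rewrite !mulA.
  by rewrite ee ff -[e ** f ** e ** f]mulA ef.
- have -> : f ** e ** (e ** f) ** (f ** e) = f ** (e ** e) ** (f ** f) ** e by rewrite !mulA.
  by rewrite ee ff -[f ** e ** f ** e]mulA fe.
Qed.

End InverseSemigroup.

Section InnerProductBound.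
Variables (R : realType) (A : cstar_algebra R) (E : bimodule_data A).
Hypothesis pE : pre_bimodule E.

(** In an irreducible representation where [b = <y|z>] attains its norm at a unit vector [v], one
    has [|b|^2 = <z (x) v, y b (x) v> <= |z| |y| |b|]. *)
Lemma nr_rip (y z : E) : nr (rip y z) <= rnr y * rnr z.
Proof.
set b := rip y z.
have [->|b0] := eqVneq b 0; first by rewrite nr0 mulr_ge0 ?rnr_ge0.
have b1 : 0 < nr b by rewrite lt_neqAle nr_ge0 andbT eq_sym; apply: contra b0 => /eqP/nr0_eq0/eqP.
have [pi [v [v1 bv]]] := irrep_norm b0.
have rB := vform_form pE v; rewrite -(ler_pM2r b1).
have -> : nr b * nr b = vform v z (ract y b).
  by rewrite -expr2 -bv -hr_op_star /vform (pb_rip_ract pE) -(pb_rip_adj pE).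
apply: le_trans (rf_le rB _ _) _.
have q (w : E) : qn (vform v) w <= rnr w by apply: (qn_le rB); [exact: rnr_ge0|exact: vform_unit].
rewrite [X in _ <= X]mulrAC mulrC; apply: ler_pM; rewrite ?qn_ge0//.
exact: le_trans (q _) (rnr_ract pE _ _).
Qed.

(** One argument at a time: membership in [J] passes to linear combinations and, by [nr_rip], to
    limits. *)
Lemma rip_closed_span (J : set A) (Y Z : set E) : closed_ideal J ->
  (forall y z : E, Y y -> Z z -> J (rip y z)) ->
  closed_span (@rnorm _ _ E) Y = setT -> closed_span (@rnorm _ _ E) Z = setT ->
  forall y z : E, J (rip y z).
Proof.
move=> [[J0 Jlin] cJ _] YZ hY hZ.
have lim (f : E -> A) (K : R) (y : E) : (forall x x', f (x - x') = f x - f x') ->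
    (forall x, nr (f x) <= K * rnr x) ->
    (forall e : R[i], 0 < e -> exists2 y', J (f y') & rnorm (y - y') < e) -> J (f y).
  move=> fB fK ap; apply: closed_nr cJ _ => e e0.
  have K1 : 0 < `|K| + 1 by rewrite ltr_wpDl.
  have [|y' Jy' yy] := ap (e / (`|K| + 1))%:C%C; first by rewrite ltcR divr_gt0.
  exists (f y') => //; rewrite -fB; apply: le_lt_trans (fK _) _.
  move: yy; rewrite (rnormE (y - y')) ltcR ltr_pdivlMr// => yy; apply: le_lt_trans yy.
  rewrite mulrC ler_wpM2l ?rnr_ge0//; apply: le_trans (ler_norm K) _.
  by rewrite lerDl.
have step (y z : E) : Z z -> J (rip y z).
  move=> Zz; have : (closed_span (@rnorm _ _ E) Y) y by rewrite hY.
  move=> /(_ [set y : E | J (rip y z)]); apply; split; last by move=> x Yx; exact: YZ.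
  split; first split.
  - by rewrite /= (rip0l pE).
  - by move=> c x x' hx hx'; rewrite /= (ripDl pE) (ripZl pE); exact: Jlin.
  - move=> x ap; apply: (lim (fun y : E => rip y z) (rnr z)) ap => [x' x''|x'].
      by rewrite (ripBl pE).
    by rewrite mulrC nr_rip.
move=> y z; have : (closed_span (@rnorm _ _ E) Z) z by rewrite hZ.
move=> /(_ [set z : E | J (rip y z)]); apply; split; last by move=> x; exact: step.
split; first split.
- by rewrite /= (rip0 pE).
- by move=> c x x' hx hx'; rewrite /= (ripD pE) (ripZ pE); exact: Jlin.
- move=> x ap; apply: (lim (fun z : E => rip y z) (rnr y)) ap => [x' x''|x'].
    by rewrite (ripB pE).
  by rewrite nr_rip.
Qed.

End InnerProductBound.

Section GermTransitivity.
Variables (R : realType) (A : cstar_algebra R) (E : action_data A).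
Local Notation S := (action_semigroup E).
Hypothesis pE : forall t : S, pre_bimodule (E t).
Hypothesis mu_ripE : forall (t u : S) (x x' : E t) (y y' : E u),
  rip (mu x y) (mu x' y') = rip y (lact (rip x x') y').
Hypothesis mu_lactE : forall (t u : S) a (x : E t) (y : E u),
  mu (lact a x) y = lact a (mu x y).
Hypothesis mu_denseE : forall t u : S, closed_span (@rnorm _ _ (E (smul t u)))
  [set z | exists (x : E t) (y : E u), z = mu x y] = setT.
(** Associativity in the form that is checked for spaces of sections, where idempotents are ideals
    of [A]. *)
Hypothesis idemA : forall t e f : S, smul e e = e -> smul f f = f ->
  smul t (smul e f) = smul (smul t e) f.
Hypothesis idemM : forall e f : S, smul e e = e -> smul f f = f ->
  smul (smul e f) (smul e f) = smul e f.
Hypothesis idemC : forall e f : S, smul e e = e -> smul f f = f -> smul e f = smul f e.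

Let cE t : closed_ideal (source_ideal (E t)).
Proof. exact: closed_ideal_gen. Qed.

Let ripE t (x y : E t) : source_ideal (E t) (rip x y).
Proof. by apply: sub_ideal_gen; exists x, y. Qed.

Lemma source_ideal_mul (t u : S) : source_ideal (E (smul t u)) `<=` source_ideal (E u).
Proof.
apply: ideal_gen_sub => // _ [z [z' ->]].
apply: (rip_closed_span (pE _) _ _ (mu_denseE t u) (mu_denseE t u)) => //.
by move=> _ _ [x [y ->]] [x' [y' ->]]; rewrite mu_ripE.
Qed.

(** [E (smul e e)] and [E e] agree only along a proof of [smul e e = e]; the left inner products are
    what has to be carried across. *)
Let cast_lip (t u : S) (z : E t) : t = u ->
  exists z' : E u, forall k, lip (ract z' k) z' = lip (ract z k) z.
Proof. by move=> e; subst u; exists z. Qed.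

(** If [rho] kills the source ideal of [t e], it kills [k b] for [k] in the source ideal of [t] and
    [b] in that of [e]; as [e e = e], the latter comes from inner products of elements [mu x y].
    Kernels of irreducible representations are prime, so one of the two ideals would be killed. *)
Lemma germ_domain_mul p (t e : S) : smul e e = e -> germ_domain t p -> germ_domain e p ->
  germ_domain (smul t e) p.
Proof.
move=> ee tp ep; apply: contrapT => no.
have [rho pr _] := tp.
have kill a (h : rho) : source_ideal (E (smul t e)) a -> irrep_op a h = 0.
  by move=> Ja; apply/eqP/negP => /negP ah; apply: no; exists rho => //; exists a, h.
have kill2 a (y y' : E e) (h : rho) : source_ideal (E t) a -> irrep_op (rip y (lact a y')) h = 0.
  move=> Ja; move: a Ja y y' h.
  apply: ideal_gen_sub => [|_ [x [x' ->]] y y' h]; last first.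
    by rewrite -mu_ripE kill.
  split; first split.
  - by move=> y y' h; rewrite (lact0l (pE e)) (rip0 (pE e)) op0l.
  - move=> c a b ha hb y y' h.
    by rewrite (pb_lactDl (pE e)) (pb_rip_linear (pE e)) opDl opZl ha hb scaler0 addr0.
  - apply: nr_closed => a ap y y' h; apply/nr0_eq0/eqP; rewrite eq_le nr_ge0 andbT.
    apply: (@eps_le _ _ _ (rnr y * rnr y' * nr h)).
      by rewrite !mulr_ge0 ?rnr_ge0 ?nr_ge0.
    move=> r /ap[b hb ab]; rewrite add0r.
    have -> : irrep_op (rip y (lact a y')) h = irrep_op (rip y (lact (a - b) y')) h.
      rewrite (_ : lact (a - b) y' = lact a y' - lact b y').
        by rewrite (ripB (pE e)) opBl hb subr0.
      by apply/eqP; rewrite eq_sym subr_eq -(lactDl1 (pE e)) subrK.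
    apply: le_trans (op_norm _ _) _; rewrite mulrA ler_wpM2r ?nr_ge0//.
    apply: le_trans (nr_rip (pE e) _ _) _; rewrite mulrCA ler_wpM2l ?rnr_ge0//.
    by apply: le_trans (rnr_lact (pE e) _ _) _; rewrite ler_wpM2r ?rnr_ge0// ltW.
  - move=> c a ha; split=> y y' h; first by rewrite (pb_lactA (pE e)) -[c]cadjK -(rip_lact (pE e)) ha.
    by rewrite (pb_lactA (pE e)) ha.
(* [b^* k b = <y | <x|<<zk|z>>x> y>] for [b = <z|mu x y>], and
   [<x|<<zk|z>>x> = <x|z> k <z|x>] belongs to the ideal of [k]. *)
have kill3 k (z : E (smul e e)) (x y : E e) (h : rho) : source_ideal (E t) k ->
    irrep_op k (irrep_op (rip z (mu x y)) h) = 0.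
  move=> Jk; have [_ _ iJ] := cE t.
  have [z' z'E] := cast_lip z ee; set b := rip z (mu x y).
  pose k2 := cmul (cadj k) k.
  have e1 : cmul (cadj b) (cmul k2 b) =
      rip y (lact (rip x (lact (lip (ract z k2) z) x)) y).
    rewrite -mu_ripE mu_lactE (pb_imprim (pE _)) -(ractM (pE _)).
    by rewrite (pb_rip_ract (pE _)) (pb_rip_adj (pE _)).
  have e2 : rip x (lact (lip (ract z k2) z) x) = cmul (rip x z') (cmul k2 (rip z' x)).
    by rewrite -z'E (pb_imprim (pE _)) -(ractM (pE _)) (pb_rip_ract (pE _)).
  apply/nr0_eq0/eqP; rewrite -sqrf_eq0 -hr_op_star -/k2.
  have -> : hr (irrep_op b h) (irrep_op k2 (irrep_op b h)) =
      hr h (irrep_op (cmul (cadj b) (cmul k2 b)) h) by rewrite hr_op !opM.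
  rewrite e1 kill2 ?(rf0 (hr_form rho))// e2.
  apply: (iJ _ _ _).1; apply: (iJ _ _ _).2; exact: (iJ _ _ Jk).1.
pose K := [set a : A | forall k (h : rho), source_ideal (E t) k ->
  irrep_op k (irrep_op a h) = 0].
have cK : closed_ideal K.
  have [_ _ iJ] := cE t; split; first split.
  - by move=> k h _; rewrite op0l op0.
  - by move=> c a b ha hb k h Jk; rewrite opDl opZl opD opZ ha// hb// scaler0 addr0.
  - apply: nr_closed => a ap k h Jk; apply/nr0_eq0/eqP; rewrite eq_le nr_ge0 andbT.
    apply: (@eps_le _ _ _ (nr k * nr h)); first by rewrite mulr_ge0 ?nr_ge0.
    move=> r /ap[b hb ab]; rewrite add0r.
    have -> : irrep_op k (irrep_op a h) = irrep_op k (irrep_op (a - b) h).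
      by rewrite opBl opB hb// subr0.
    apply: le_trans (op_norm _ _) _; rewrite mulrCA ler_wpM2l ?nr_ge0//.
    by apply: le_trans (op_norm _ _) _; rewrite ler_wpM2r ?nr_ge0// ltW.
  - move=> c a ha; split=> k h Jk; rewrite opM; last exact: ha.
    by rewrite -(opM k) ha//; have [] := iJ c k Jk.
have JK : source_ideal (E e) `<=` K.
  rewrite -ee; apply: ideal_gen_sub => // _ [z [z' ->]].
  apply: (rip_closed_span (pE _) cK _ (mu_denseE e e) (mu_denseE e e)) => y _ _ [x' [y' ->]] k h Jk.
  exact: kill3.
have [a [h [Ja ah]]] := spectrum_ideal_rep tp pr.
case/eqP: ah.
apply: (op_prime (cE t) _ (spectrum_ideal_rep ep pr) h Ja) => k b k' Jk Jb.
exact: JK.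
Qed.

(** From [t e = u e'] and [t f = v f'] one gets the common lower bound [t e f = u e' f = v f' e], as
    idempotents commute. *)
Lemma germ_equiv_trans p (t u v : S) : germ_equiv p t u -> germ_equiv p t v ->
  germ_equiv p u v.
Proof.
move=> [_ up [_ [[e [ee ->]] [e' [e'e' we]] wp]]] [_ vp [_ [[f [ff ->]] [f' [f'f' wf]] wfp]]].
have fp : germ_domain f p by exact: spectrum_ideal_sub (@source_ideal_mul t f) wfp.
split=> //; exists (smul (smul t e) f); split.
- exists (smul e' f); split; first exact: idemM.
  by rewrite we idemA.
- exists (smul f' e); split; first exact: idemM.
  by rewrite -idemA// [smul e f]idemC// idemA// wf idemA.
- exact: germ_domain_mul.
Qed.

End GermTransitivity.

Theorem bimodule_action_aperiodic (R : realType) (A : cstar_algebra R) (E : action_data A) :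
  bimodule_action E -> topologically_free E -> aperiodic E.
Proof.
move=> act; apply: topologically_free_aperiodic.
- by move=> t; exact: hilbert_pre_bimodule (action_bimodule act t).
- move=> t; have [_ u1 u2 _] := action_invsemigroup act.
  by exists sone; split; rewrite ?u1 ?u2.
- have hS := action_invsemigroup act; have [mulA _ _ _] := hS.
  move=> p t u v; apply: germ_equiv_trans.
  + by move=> s; exact: hilbert_pre_bimodule (action_bimodule act s).
  + by move=> s s'; exact: mu_rip (action_mu act s s').
  + by move=> s s'; exact: mu_lact (action_mu act s s').
  + by move=> s s'; exact: mu_dense (action_mu act s s').
  + by move=> s e f _ _; exact: mulA.
  + by move=> e f; exact: idempotentM.
  + by move=> e f; exact: idempotentC.
Qed.

(** * Fell bundles *)

Section FibreAlgebra.
Variables (R : realType) (G : etale_groupoid) (B : fell_bundle R G).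
Variables (x : G) (xu : units x).

Let sr : gsrc x = grng x. Proof. by rewrite rng_unit. Qed.
Let mul (v w : ffib B x) : ffib B x := transport x (fmul v w).
Let star (v : ffib B x) : ffib B x := transport x (fadj v).

Let felt_mul v w : felt (mul v w) = felt (fmul v w).
Proof. by rewrite felt_transport// gmul_unit. Qed.

Let felt_star v : felt (star v) = felt (fadj v).
Proof. by rewrite felt_transport// ginv_unit. Qed.

Let mulA u v w : mul u (mul v w) = mul (mul u v) w.
Proof.
apply: (@felt_inj _ _ B); rewrite !felt_mul.
rewrite (fmul_congr (erefl (felt u)) (felt_mul v w)).
by rewrite (fmul_congr (felt_mul u v) (erefl (felt w))) fmulA.
Qed.

Let mul_linear_l c u v w : mul (c *: u + v) w = c *: mul u w + mul v w.
Proof. by rewrite /mul fmul_linear_l// transport_linear. Qed.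

Let mul_linear_r c u v w : mul u (c *: v + w) = c *: mul u v + mul u w.
Proof. by rewrite /mul fmul_linear_r// transport_linear. Qed.

Let mul0l w : mul 0 w = 0. Proof. by rewrite /mul fmul0l// transport0. Qed.
Let mul0r w : mul w 0 = 0. Proof. by rewrite /mul fmul0r// transport0. Qed.

Let mulDl u v w : mul (u + v) w = mul u w + mul v w.
Proof. by have := mul_linear_l 1 u v w; rewrite !scale1r. Qed.

Let mulDr u v w : mul u (v + w) = mul u v + mul u w.
Proof. by have := mul_linear_r 1 u v w; rewrite !scale1r. Qed.

Let mulZl c u v : mul (c *: u) v = c *: mul u v.
Proof. by have := mul_linear_l c u 0 v; rewrite mul0l !addr0. Qed.

Let mulZr c u v : mul u (c *: v) = c *: mul u v.
Proof. by have := mul_linear_r c u v 0; rewrite mul0r !addr0. Qed.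

Let starK v : star (star v) = v.
Proof. by apply: (@felt_inj _ _ B); rewrite felt_star (fadj_congr (felt_star v)) fadjK. Qed.

Let star_linear c v w : star (c *: v + w) = c^* *: star v + star w.
Proof. by rewrite /star fadj_linear transport_linear. Qed.

Let starD v w : star (v + w) = star v + star w.
Proof. by have := star_linear 1 v w; rewrite rmorph1 !scale1r. Qed.

Let starZ c v : star (c *: v) = c^* *: star v.
Proof.
have := star_linear c v 0; rewrite !addr0 => ->.
by rewrite /star fadj0 transport0 addr0.
Qed.

Let starM v w : star (mul v w) = mul (star w) (star v).
Proof.
apply: (@felt_inj _ _ B); rewrite felt_star felt_mul (fadj_congr (felt_mul v w)) fadjM//.
exact: fmul_congr (esym (felt_star w)) (esym (felt_star v)).
Qed.

Let normM v w : `|mul v w| <= `|v| * `|w|.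
Proof. by apply: le_trans (norm_transport _ _) _; exact: fnormM. Qed.

Let norm_star v : `|mul (star v) v| = `|v| ^+ 2.
Proof.
rewrite (felt_norm (felt_mul _ _)) -fnorm_adj; apply: felt_norm.
exact: fmul_congr (felt_star v) erefl.
Qed.

(** Makes the results on positive elements available pointwise; [transport] identifies the fibres
    over [gmul x x] and [ginv x] with the one over [x]. *)
Definition fibre_cstar : cstar_algebra R :=
  @CStarAlgebra R (ffib B x) mul star mulA mulDl mulDr mulZl mulZr starK
    starD starZ starM normM norm_star.

Lemma felt_fibre_mul (v w : fibre_cstar) : felt (cmul v w) = felt (fmul v w).
Proof. exact: felt_mul. Qed.

Lemma felt_fibre_star (v : fibre_cstar) : felt (cadj v) = felt (fadj v).
Proof. exact: felt_star. Qed.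

End FibreAlgebra.

Section FellBimodule.
Variables (R : realType) (G : etale_groupoid) (B : fell_bundle R G).
Local Notation X := (units : set G).
Local Notation A := (C0_cstar B).
Implicit Types t u j e f : bisection_bimodule B.

Let bX : bisection X := bisection_units G.

Let suppX (a : A) : supported X (lval a).
Proof. by have [] := C0_eltP a. Qed.

Lemma lval_cmul (a b : A) : lval (cmul a b) = conv (lval a) (lval b).
Proof. by []. Qed.

Lemma felt_C0_mul (a b : A) x (xu : X x) :
  felt (lval (cmul a b) x) = felt (fmul (lval a x) (lval b x)).
Proof.
rewrite lval_cmul -(felt_sec _ (gmul_unit xu)).
by apply: (conv_comp _ bX); rewrite ?rng_unit.
Qed.

Lemma felt_source (y : fsec B) (U : set G) a : bisection U -> supported U y -> U a ->
  felt (conv (adj y) y (gsrc a)) = felt (fmul (fadj (y a)) (y a)).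
Proof.
move=> bU sy Ua; have bU' := bisection_inv bU.
rewrite -(felt_sec _ (gmulVg a)) (conv_comp _ bU' (adj_supported sy)) ?gsrc_inv//; last first.
  by rewrite /= ginvK.
apply: fmul_congr => //; rewrite felt_adj; apply: fadj_congr; apply: felt_sec.
exact: ginvK.
Qed.

Lemma norm_source (y : fsec B) (U : set G) a : bisection U -> supported U y -> U a ->
  `|y a| ^+ 2 = `|conv (adj y) y (gsrc a)|.
Proof. by move=> bU sy Ua; rewrite -fnorm_adj (felt_norm (felt_source bU sy Ua)). Qed.

Lemma C0_nrE (a : A) (K : R) : 0 <= K -> (forall x, `|lval a x| <= K%:C%C) -> nr a <= K.
Proof.
by move=> K0 h; have := supnorm_lub (M := K%:C%C) _ h; rewrite lecR => /(_ K0);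
  rewrite -lecR -normE.
Qed.

Lemma C0_nr_ge (a : A) x : `|lval a x| <= (nr a)%:C%C.
Proof. by rewrite -normE; exact: supnorm_le. Qed.

(* Positivity in [C0_cstar] is checked fibrewise, through the norm
   characterisation of positive elements. *)
Lemma source_cpositive t (y : bb_bimodule t) : cpositive (rip y y).
Proof.
have [U bU tU] := bb_bisection t; have [sy _ _] := tU _ (lvalP y).
set c := rip y y.
apply: (@norm_cpositive _ A c (nr c)); first last.
- move=> b; apply: C0_nrE => [|x]; first by rewrite mulr_ge0 ?nr_ge0.
  have [xu|nx] := pselect (X x); last first.
    by rewrite suppX// normr0 lecR mulr_ge0 ?nr_ge0.
  pose F := fibre_cstar B xu.
  (* At the source of an arrow [a] of [U] the value is [y(a)^* y(a)], positive by [fpositive]; at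
     all other units it is zero. *)
  have pc : cpositive (lval c x : F).
    have [[a [Ua ax]]|no] := pselect (exists a, U a /\ gsrc a = x).
      have e0 := felt_source bU sy Ua.
      have [w we] := fpositive (lval y a); subst x; exists (w : F).
      apply: (@felt_inj _ _ B); rewrite e0 we (felt_fibre_mul _ _).
      exact: (fmul_congr (esym (@felt_fibre_star _ _ _ _ xu w)) (erefl (felt w))).
    have -> : lval c x = 0.
      have [[a [b' [Ua ab xE]]]|zero] := conv_cases x (bisection_inv bU) (adj_supported sy).
        subst x; apply: (felt_eq0 (esym (conv_comp _ (bisection_inv bU) (adj_supported sy) Ua ab))).
        rewrite sy ?fmul0r// => Ub; apply: no; exists b'; split=> //.
        by rewrite -(gsrc_mul ab); exact: xu.
      exact: zero.
    by exists 0; rewrite cmul0r.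
  have cx : nr (lval c x : F) <= nr c.
    by rewrite -lecR -normE; exact: C0_nr_ge.
  have := cpositive_norm (lval b x : F) pc cx; rewrite -lecR => le.
  have -> : lval ((nr c)%:C%C *: b - cmul c b) x =
      (nr c)%:C%C *: (lval b x : F) - cmul (lval c x : F) (lval b x).
    rewrite lvalD lvalN lvalZ fsecDE fsecNE fsecZE; congr (_ - _).
    by apply: (@felt_inj _ _ B); rewrite felt_C0_mul// felt_fibre_mul.
  rewrite (@normE _ F); apply: le_trans le _; rewrite lecR ler_wpM2l ?nr_ge0//.
  by rewrite -lecR -normE; exact: C0_nr_ge.
- exact: nr_ge0.
- apply: lval_inj; rewrite /=.
  by rewrite (adj_conv (bisection_inv bU) bU (adj_supported sy) sy) adjK.
Qed.

Lemma fell_pre_bimodule t : pre_bimodule (bb_bimodule t).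
Proof.
have [U bU tU] := bb_bisection t; have bU' := bisection_inv bU.
have sp (y : bb_bimodule t) : supported U (lval y) by have [] := tU _ (lvalP y).
have sp' (y : bb_bimodule t) : supported (ginv @^-1` U) (adj (lval y)) by apply: adj_supported.
split.
- by move=> c x y z; apply: lval_inj; apply: (conv_linear_r _ _ _ bU').
- by move=> x y a; apply: lval_inj; apply: (convA _ bU' bU).
- by move=> x y; apply: lval_inj; rewrite /= (adj_conv bU' bU)// adjK.
- exact: source_cpositive.
- move=> x x0; apply: lval_inj; apply: fsecP => a.
  have [Ua|nU] := pselect (U a); last by rewrite sp.
  apply/normr0_eq0/eqP; rewrite -sqrf_eq0 (norm_source bU (sp x) Ua).
  have -> : conv (adj (lval x)) (lval x) = lval (rip x x) by [].
  by rewrite x0 normr0.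
- by move=> c a b x; apply: lval_inj; apply: (conv_linear_l _ _ bX); exact: suppX.
- by move=> a b x; apply: lval_inj; apply/esym/(convA _ bX bX); exact: suppX.
- by move=> c x y z; apply: lval_inj; apply: (conv_linear_l _ _ bU).
- by move=> a x y; apply: lval_inj; apply/esym/(convA _ bX bU) => //; exact: suppX.
- by move=> x y; apply: lval_inj; rewrite /= (adj_conv bU bU')// adjK.
- by move=> x y z; apply: lval_inj; apply/esym/(convA _ bU bU').
Qed.

Lemma val_le_rnr t (y : bb_bimodule t) x : `|lval y x| <= (rnr y)%:C%C.
Proof.
have [U bU tU] := bb_bisection t; have [sy _ _] := tU _ (lvalP y).
have [Ux|nU] := pselect (U x); last by rewrite sy// normr0 lecR rnr_ge0.
rewrite -ler_sqr ?nnegrE ?lecR ?rnr_ge0// (norm_source bU sy Ux) -rmorphXn /= rnr_sqr.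
exact: (C0_nr_ge (rip y y)).
Qed.

Lemma rnr_le_val t (y : bb_bimodule t) (K : R) : 0 <= K ->
  (forall x, `|lval y x| <= K%:C%C) -> rnr y <= K.
Proof.
move=> K0 yK; have [U bU tU] := bb_bisection t; have [sy _ _] := tU _ (lvalP y).
rewrite -ler_sqr ?nnegrE ?rnr_ge0// rnr_sqr; apply: C0_nrE => [|x]; first exact: sqr_ge0.
rewrite rmorphXn expr2; apply: (norm_conv _ (bisection_inv bU) (adj_supported sy)) => //.
- by rewrite lecR.
- by rewrite lecR.
- by move=> z; rewrite norm_adj.
Qed.

(** The product bimodule is a uniform closure, and [rnr_le_val] turns uniform approximation into
    approximation in the Hilbert module norm. *)
Lemma fell_mu_dense t u : closed_span (@rnorm _ _ (bb_bimodule (bb_mul t u)))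
  [set z | exists (x : bb_bimodule t) (y : bb_bimodule u),
     z = @mu _ _ (fell_action B) t u x y] = setT.
Proof.
apply/seteqP; split=> // z _ M [[[M0 Mlin] cM] sub].
have : uniform_span (bb_products t u) (lval z) by exact: (lvalP z).
move=> /(_ [set f | exists2 z', M z' & lval z' = f]) h.
have [|z' Mz' /lval_inj <- //] := h _; split; first split; first split.
- by exists 0.
- by move=> c _ _ [z1 M1 <-] [z2 M2 <-]; exists (c *: z1 + z2) => //; exact: Mlin.
- move=> f ap; have tuf : linsub_set (bbset (bb_mul t u)) f.
    apply: bb_closed => e /ap[_ [z1 M1 <-] fz]; exists (lval z1) => //; exact: lvalP.
  exists (LinSubElt tuf) => //; apply: cM => e /gt0_re[r r0 ->].
  have r2 : 0 < r / 2 by rewrite divr_gt0.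
  have [|_ [z1 M1 <-] fz] := ap (r / 2)%:C%C; first by rewrite ltcR.
  exists z1 => //; rewrite (rnormE (_ - _)) ltcR.
  apply: (@le_lt_trans _ _ (r / 2)); last by lra.
  by apply: rnr_le_val => [|x]; [exact: ltW|exact: ltW].
- move=> _ [f [g [tf ug ->]]].
  by exists (@mu _ _ (fell_action B) t u (LinSubElt tf) (LinSubElt ug)) => //; apply: sub; exists (LinSubElt tf), (LinSubElt ug).
Qed.

End FellBimodule.

Section FellSemigroup.
Variables (R : realType) (G : etale_groupoid) (B : fell_bundle R G).
Local Notation X := (units : set G).
Local Notation A := (C0_cstar B).
Implicit Types t u j e f : bisection_bimodule B.
Local Notation mem t := (linsub_set (bbset t)).

Let bX : bisection X := bisection_units G.

Lemma bb_ext t u : (forall h, mem t h <-> mem u h) -> t = u.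
Proof.
move=> tu; have : mem t = mem u by apply/funext => h; exact/propext.
case: t u {tu} => [[s sP] b c l r] [[s' sP'] b' c' l' r'] /= e; subst s'.
have e := Prop_irrelevance sP' sP; subst sP'.
by congr BisectionBimodule; exact: Prop_irrelevance.
Qed.

Lemma coefficient_ideal j : closed_ideal [set a : A | mem j (lval a)].
Proof.
split.
- split=> [|c a b ja jb]; first exact: (linsubP (bbset j)).1.
  exact: (linsubP (bbset j)).2.
- apply: nr_closed => a ap; apply: bb_closed => r /gt0_re[e e0 ->].
  have [b jb ab] := ap e e0; exists (lval b) => // x.
  apply: le_lt_trans (C0_nr_ge (a - b) x) _.
  by rewrite ltcR.
- move=> a b jb; split; first exact: bb_lact (C0_eltP a) jb.
  exact: bb_ract jb (C0_eltP a).
Qed.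

Let sA (a : A) : supported X (lval a).
Proof. by have [] := C0_eltP a. Qed.

Lemma fell_mu_lact t u a (x : bb_bimodule t) (y : bb_bimodule u) :
  @mu _ _ (fell_action B) t u (lact a x) y = lact a (@mu _ _ (fell_action B) t u x y).
Proof.
have [U bU tU] := bb_bisection t; have [sx _ _] := tU _ (lvalP x).
by apply: lval_inj; apply/esym/(convA _ bX bU (sA a) sx).
Qed.

Lemma fell_mu_rip t u (x x' : bb_bimodule t) (y y' : bb_bimodule u) :
  rip (@mu _ _ (fell_action B) t u x y) (@mu _ _ (fell_action B) t u x' y') =
  rip y (lact (rip x x') y').
Proof.
have [U bU tU] := bb_bisection t; have [V bV uV] := bb_bisection u.
have bU' := bisection_inv bU; have bV' := bisection_inv bV.
have [sx _ _] := tU _ (lvalP x); have [sy _ _] := uV _ (lvalP y).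
have [sx' _ _] := tU _ (lvalP x').
have sx1 := adj_supported sx; have sy1 := adj_supported sy.
apply: lval_inj; rewrite /= (adj_conv bU bV sx sy).
rewrite -(convA _ bV' bU' sy1 sx1); congr conv.
exact: (convA _ bU' bU sx1 sx').
Qed.

(* By an approximate unit, [h] is close to products [z <h|h>]. *)
Lemma mem_mul_ideal t j h : mem j `<=` C0 X ->
  mem (bb_mul t j) h <-> mem t h /\ mem j (conv (adj h) h).
Proof.
move=> jX; split=> [tjh|[th jh]].
  split.
    move: tjh => /(_ (mem t)); apply; split.
      by split; [exact: linsubP|exact: bb_closed].
    by move=> _ [k [l [tk jl ->]]]; apply: bb_ract => //; exact: jX.
  have dense := fell_mu_dense t j.
  have pE := fell_pre_bimodule (bb_mul t j).
  apply: (rip_closed_span pE (coefficient_ideal j) _ dense dense (LinSubElt tjh) (LinSubElt tjh)).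
  move=> _ _ [x [y ->]] [x' [y' ->]].
  rewrite fell_mu_rip; apply: bb_lact; last exact: (lvalP (lact (rip x x') y')).
  exact/C0_units_adj/jX/(lvalP y).
have pE := fell_pre_bimodule t; pose y : bb_bimodule t := LinSubElt th.
apply: bb_closed => r /gt0_re[e e0 ->].
have [z zP] := approx_unit pE y e0.
exists (conv (lval z) (conv (adj h) h)).
  by apply: sub_uniform_span; exists (lval z), (conv (adj h) h); split=> //; exact: lvalP.
move=> x; apply: le_lt_trans (val_le_rnr (y - ract z (rip y y)) x) _.
by rewrite ltcR.
Qed.

Lemma mem_mulI e f h : mem e `<=` C0 X -> mem f `<=` C0 X ->
  mem (bb_mul e f) h <-> mem e h /\ mem f h.
Proof.
move=> eX fX; rewrite mem_mul_ideal//; split=> -[eh fh]; split=> //.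
  have : mem (bb_mul e f) h by apply/mem_mul_ideal.
  move=> /(_ (mem f)); apply; split.
    by split; [exact: linsubP|exact: bb_closed].
  by move=> _ [k [l [ek fl ->]]]; apply: bb_lact => //; exact: eX.
by apply: bb_lact => //; exact/C0_units_adj/eX.
Qed.

(** An arrow [g] at which some element of [e] is non-zero factors as [b c] into arrows of the same
    kind. All of them lie in one bisection, so equal ranges give [g = b] and equal sources [g = c];
    thus [c], and with it [g], is a unit. *)
Lemma idempotent_supported e h : bb_mul e e = e -> mem e h -> supported X h.
Proof.
move=> ee eh g nX; have [U bU eU] := bb_bisection e.
apply: contrapT => hg.
pose W g := exists2 k, mem e k & k g <> 0.
have WU a : W a -> U a.
  by move=> [k ek ka]; apply: contrapT => nU; apply: ka; have [sk _ _] := eU _ ek; exact: sk.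
have split_W a : W a -> exists b c, [/\ W b, W c, gsrc b = grng c & a = gmul b c].
  move=> [k ek ka]; apply: contrapT => no; apply: ka.
  move: ek; rewrite -{1}ee => /(_ [set k | k a = 0]); apply; split; first split; first split.
  - by [].
  - by move=> c k1 k2 h1 h2; rewrite /= fsecDE fsecZE h1 h2 scaler0 addr0.
  - move=> k1 ap; apply: contrapT => k10.
    have [|k2 k20 /(_ a)] := ap `|k1 a|; first by rewrite normr_gt0; apply/eqP.
    by rewrite k20 subr0 ltxx.
  - move=> _ [k1 [k2 [e1 e2 ->]]]; have [s1 _ _] := eU _ e1.
    have [[b [c [Ub bc aE]]]|] := conv_cases a bU s1; last exact.
    subst a; apply: (felt_eq0 (esym (conv_comp k2 bU s1 Ub bc))).
    have [->|b0] := pselect (k1 b = 0); first by rewrite fmul0l.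
    have [->|c0] := pselect (k2 c = 0); first by rewrite fmul0r.
    by case: no; exists b, c; split=> //; [exists k1|exists k2].
have Wg : W g by exists h.
have [b [c [Wb Wc bc gE]]] := split_W g Wg.
have [_ Us Ur] := bU.
have gb : g = b by apply: Ur; [exact: WU|exact: WU|rewrite gE grng_mul].
have cE : c = gsrc c.
  by rewrite -(gmulVKg bc) -gE gb gmulVg gsrc_src.
apply: nX; have -> : g = c by apply: Us; [exact: WU|exact: WU|rewrite gE gsrc_mul].
exact: esym cE.
Qed.

Lemma idempotent_C0 e : bb_mul e e = e -> mem e `<=` C0 X.
Proof.
move=> ee h eh; have [U bU eU] := bb_bisection e; have [Uo _ _] := bU.
have sX := idempotent_supported ee eh; have [sh ch vh] := eU _ eh.
have UXo : open (U `&` X) by apply: openI => //; exact: units_open.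
apply: (C0_ext (U := U `&` X)) => //; split.
- move=> x nx; have [Ux|] := pselect (U x); last exact: sh.
  by apply: sX => xX; apply: nx.
- by move=> x [Ux _]; exact: ch.
move=> r r0; have [K [cK KU Kh]] := vh r r0.
(* [K] may leave the unit space, which need not be closed in [G]; removing the open set where [h] is
   small keeps compactness and leaves only units. *)
pose O := [set y | U y /\ `|h y| < r].
have Oo : open O.
  rewrite openE => y [Uy hy].
  have nW : nbhs (felt (h y)) [set v | exists z (w : ffib B z), v = felt w /\ `|w| < r].
    have [s s0 rE] := gt0_re r0.
    by apply: open_nbhs_nbhs; split; [exact: fnorm_usc|exists y, (h y)].
  have cy : cont_at h y := ch y Uy.
  apply: filterS2 (cy _ nW) (open_nbhs_nbhs (conj Uo Uy)) => z [w [v [e1 vr]]] Uz.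
  by split=> //; rewrite (felt_norm e1).
exists (K `&` ~` O); split.
- by apply: compact_closedI => //; exact: open_closedC.
- move=> x [Kx nO]; split; first exact: KU.
  apply: contrapT => nX; apply: nO; split; first exact: KU.
  by rewrite sX// normr0.
- move=> x nKO; have [Kx|] := pselect (K x); last exact: Kh.
  have [[]//|nO] := pselect (O x).
  by case: nKO.
Qed.

Lemma bb_one_idem : bb_mul (bb_one B) (bb_one B) = bb_one B.
Proof. by apply: bb_ext => h; rewrite mem_mulI//; split=> [[]|]. Qed.

Lemma bb_mulg1 t : bb_mul t (bb_one B) = t.
Proof.
apply: bb_ext => h; rewrite mem_mul_ideal//; split=> [[]//|th]; split=> //.
exact: (bb_rip_C0 (LinSubElt th : linsub_elt (bbset t)) (LinSubElt th)).
Qed.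

Lemma bb_idemC e f : bb_mul e e = e -> bb_mul f f = f -> bb_mul e f = bb_mul f e.
Proof.
move=> /idempotent_C0 eX /idempotent_C0 fX; apply: bb_ext => h.
by rewrite !mem_mulI//; split=> -[].
Qed.

Lemma bb_mul_sub e f : mem e `<=` C0 X -> mem f `<=` C0 X -> mem (bb_mul e f) `<=` C0 X.
Proof. by move=> eX fX h /mem_mulI-/(_ eX fX)[/eX]. Qed.

Lemma bb_idemM e f : bb_mul e e = e -> bb_mul f f = f ->
  bb_mul (bb_mul e f) (bb_mul e f) = bb_mul e f.
Proof.
move=> /idempotent_C0 eX /idempotent_C0 fX; have efX := bb_mul_sub eX fX.
by apply: bb_ext => h; rewrite mem_mulI//; split=> [[]|].
Qed.

(** Both sides consist of the [h] in [t] for which [h^* h] lies in [e] and in [f]. *)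
Lemma bb_idemA t e f : bb_mul e e = e -> bb_mul f f = f ->
  bb_mul t (bb_mul e f) = bb_mul (bb_mul t e) f.
Proof.
move=> /idempotent_C0 eX /idempotent_C0 fX; have efX := bb_mul_sub eX fX.
apply: bb_ext => h; rewrite (@mem_mul_ideal t _ h efX) mem_mulI//.
rewrite (@mem_mul_ideal _ _ h fX) (@mem_mul_ideal t _ h eX).
by split=> [[? []]|[[]]].
Qed.

Theorem fell_action_aperiodic :
  topologically_free (fell_action B) -> aperiodic (fell_action B).
Proof.
apply: topologically_free_aperiodic.
- exact: fell_pre_bimodule.
- by move=> t; exists (bb_one B); split; [exact: bb_one_idem|exact/esym/bb_mulg1].
- move=> p t u v; apply: germ_equiv_trans.
  + exact: fell_pre_bimodule.
  + exact: fell_mu_rip.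
  + exact: fell_mu_lact.
  + exact: fell_mu_dense.
  + exact: bb_idemA.
  + exact: bb_idemM.
  + exact: bb_idemC.
Qed.

End FellSemigroup.

Theorem corollary4p8 (R : realType) :
  (forall (A : cstar_algebra R) (E : action_data A),
    bimodule_action E -> topologically_free E -> aperiodic E) /\
  (forall (G : etale_groupoid) (B : fell_bundle R G),
    topologically_free (fell_action B) -> aperiodic (fell_action B)).
Proof.
by split=> [A E|G B]; [exact: bimodule_action_aperiodic|exact: fell_action_aperiodic].
Qed.
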